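(* Let $(M,\omega)$ be a compact connected Kähler manifold of complex dimension $n\ge 2$ with $\mathrm{Ric}(\omega)\ge\omega$, let $1<q<\frac{n+1}{n-1}$, and let $\lambda_1>0$ be the first nonzero eigenvalue of the complex Laplacian $\Box$ on $M$ (so $-\Box f=\lambda_1 f$ for some nonzero $f$). Let $k$ be any number in the interval $$\left[\frac{2(n+1)}{q(n-1)}-\frac{2(n+1)}{q(n-1)}\sqrt{1-\frac{(n-1)q}{n+1}}-1,\ \frac{2(n+1)}{q(n-1)}+\frac{2(n+1)}{q(n-1)}\sqrt{1-\frac{(n-1)q}{n+1}}-1\right],$$ and define the constant $C_{S,\lambda_1,k}$ by $$\frac{1}{C_{S,\lambda_1,k}}=\frac{2}{q-1}\left(\left(1-\frac{(n+(n-1)k)(kn+n-1)q}{(4n^2+4n+q)k}\right)\lambda_1+\frac{qn(kn+n-1)}{(4n^2+4n+q)k}\right).$$ If $0<\lambda<\frac{1}{2C_{S,\lambda_1,k}}$, then the only positive solutions $u\in C^\infty(M)$ of $$-\Box u+\lambda u=u^q$$ on $M$ are positive constant functions.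
   Context: For a Kähler manifold $(M,\omega)$ of complex dimension $n$ with complex structure $J$ and Riemannian metric $g$, take a local orthonormal frame $\{e_k\}_{k=1}^{2n}$ with $e_{2i}=J(e_{2i-1})$ and set $X_i=\frac{1}{\sqrt2}(e_{2i-1}-\sqrt{-1}e_{2i})$, $X_{\bar i}=\frac{1}{\sqrt2}(e_{2i-1}+\sqrt{-1}e_{2i})$, $1\le i\le n$. Subscripts $i,\bar j$ on a function denote covariant derivatives in this unitary frame. The complex Laplacian is $\Box u=\sum_{i=1}^n u_{i\bar i}=\frac12\Delta u$, where $\Delta$ is the Riemannian Laplacian (trace of the Hessian). The condition $\mathrm{Ric}(\omega)\ge\omega$ means $R_{i\bar j}\ge\delta_{i\bar j}$, equivalently the Riemannian Ricci tensor satisfies $\mathrm{Ric}(g)\ge g$. *)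

(* Defs.v *)
From HB Require Import structures.
From mathcomp Require Import all_boot all_order all_algebra.
From mathcomp Require Import all_classical all_reals all_analysis.
From mathcomp Require Import complex.

Set Implicit Arguments.
Unset Strict Implicit.
Unset Printing Implicit Defensive.

Import Order.TTheory GRing.Theory Num.Theory.
Import numFieldNormedType.Exports.

Local Open Scope classical_set_scope.
Local Open Scope ring_scope.

Section Coordinates.
Context {R : realType}.

Definition partial m (a : 'I_m) (f : 'rV[R]_m -> R) : 'rV[R]_m -> R :=
  fun x => derive f x (delta_mx 0 a : 'rV[R]_m).

(* Meant for open U: class C^k on U through iterated partial derivatives. *)
Fixpoint Ck_on m (k : nat) (U : set 'rV[R]_m) (f : 'rV[R]_m -> R) : Prop :=
  (forall x, U x -> {for x, continuous f}) /\
  (if k is k'.+1 then forall a : 'I_m,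
     (forall x, U x -> derivable f x (delta_mx 0 a : 'rV[R]_m)) /\
     Ck_on k' U (partial a f)
   else True).

Definition smooth_on m (U : set 'rV[R]_m) (f : 'rV[R]_m -> R) : Prop :=
  forall k, Ck_on k U f.

(* Vectors are rows, so v *m jacobian f x is the differential of f at x applied
   to v. *)
Definition jacobian m (f : 'rV[R]_m -> 'rV[R]_m) (x : 'rV[R]_m) : 'M[R]_m :=
  \matrix_(a, b) partial a (fun y => f y 0 b) x.

(* C^n is identified with R^(n+n), z = x + i y being the row (x, y);
   v *m Jmx is J v, i.e. (x, y) is sent to (- y, x). *)
Definition Jmx n : 'M[R]_(n + n) := block_mx 0 1%:M (- 1%:M) 0.

Section Metric.
Variables (m : nat) (g : 'rV[R]_m -> 'M[R]_m).

(* christoffel c a b = Gamma^c_(ab) *)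
Definition christoffel (c a b : 'I_m) (x : 'rV[R]_m) : R :=
  2^-1 * \sum_d invmx (g x) c d *
    (partial a (fun y => g y b d) x + partial b (fun y => g y a d) x
     - partial d (fun y => g y a b) x).

(* The d-th component of Rm(d_a, d_b) d_c, where
   Rm(X, Y) = [nabla_X, nabla_Y] - nabla_[X, Y]. *)
Definition riemann (a b c d : 'I_m) (x : 'rV[R]_m) : R :=
  partial a (christoffel d b c) x - partial b (christoffel d a c) x
  + \sum_e (christoffel d a e x * christoffel e b c x
            - christoffel d b e x * christoffel e a c x).

(* Ric(Y, Z) is the trace of X |-> Rm(X, Y) Z (positive on round spheres). *)
Definition ricci (x : 'rV[R]_m) : 'M[R]_m :=
  \matrix_(b, c) \sum_a riemann a b c a x.

Definition hessian (f : 'rV[R]_m -> R) (x : 'rV[R]_m) : 'M[R]_m :=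
  \matrix_(a, b) (partial a (partial b f) x
                  - \sum_c christoffel c a b x * partial c f x).

Definition laplacian (f : 'rV[R]_m -> R) (x : 'rV[R]_m) : R :=
  \tr (invmx (g x) *m hessian f x).

End Metric.

(* The rows of E are e_1, e_3, ..., e_(2n-1); those of E *m Jmx n are
   e_2, e_4, ..., e_(2n); together they are orthonormal for g. *)
Definition unitary_frame n (g : 'M[R]_(n + n)) (E : 'M[R]_(n, n + n)) : Prop :=
  let F := col_mx E (E *m Jmx n) in F *m g *m F^T = 1%:M.

(* The i-th row is X_i = (e_(2i-1) - sqrt(-1) e_(2i)) / sqrt 2. *)
Definition frame10 n (E : 'M[R]_(n, n + n)) : 'M[R[i]]_(n, n + n) :=
  ((Num.sqrt 2)^-1)%:C%C *:
    (map_mx (real_complex R) E - 'i%C *: map_mx (real_complex R) (E *m Jmx n)).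

(* The matrix of components B_(i \bar j) = B(X_i, X_(\bar j)), for the complex
   bilinear extension of a real bilinear form B. *)
Definition mixed n (B : 'M[R]_(n + n)) (E : 'M[R]_(n, n + n)) : 'M[R[i]]_n :=
  frame10 E *m map_mx (real_complex R) B *m (map_mx (@conjc R) (frame10 E))^T.

(* A >= B as Hermitian forms; 0 <= z in R[i] means that z is real and
   nonnegative. *)
Definition herm_ge n (A B : 'M[R[i]]_n) : Prop :=
  forall xi : 'rV[R[i]]_n,
    0 <= (xi *m (A - B) *m (map_mx (@conjc R) xi)^T) 0 0.

Lemma mxtrace_comb (K : comNzRingType) n (A B C D : 'M[K]_n) (z : K) :
  \tr (A - z *: B + (z *: C - (z * z) *: D))
    = \tr A - z * \tr B + (z * \tr C - z * z * \tr D).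
Proof. by rewrite !linearD !linearN !linearZ. Qed.

Lemma mixed_trace_aux n (P Q S T : 'M[R]_n) : \tr Q = \tr S ->
  let c := map_mx (real_complex R) in
  \tr (c P - 'i%C *: c S + ('i%C *: c Q - ('i%C * 'i%C) *: c T))
    = (\tr P + \tr T)%:C%C.
Proof.
move=> hQS c; have trc (A : 'M[R]_n) : \tr (c A) = (\tr A)%:C%C.
  exact: trace_map_mx.
rewrite mxtrace_comb !trc hQS addrA subrK rmorphD; congr (_ + _).
by rewrite -mulNr -expr2 sqr_i opprK mul1r.
Qed.

Lemma mixed_trace n (g H : 'M[R]_(n + n)) (E : 'M[R]_(n, n + n)) :
  H^T = H -> unitary_frame g E ->
  \tr (mixed H E) = (2^-1 * \tr (invmx g *m H))%:C%C.
Proof.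
move=> Hsym /= hE; set J := Jmx n in hE *; set F := col_mx E (E *m J) in hE *.
have gFF : g *m (F^T *m F) = 1%:M by rewrite mulmxA mulmx1C // mulmxA.
have ginv : invmx g = F^T *m F.
  by have [gu _] := mulmx1_unit gFF; rewrite -[RHS](mulKmx gu) gFF mulmx1.
have -> : \tr (invmx g *m H)
    = \tr (E *m H *m E^T) + \tr (E *m J *m H *m (E *m J)^T).
  rewrite ginv -[_ *m F *m H]mulmxA mxtrace_mulC /F mul_col_mx tr_col_mx mul_col_row.
  by rewrite mxtrace_block.
have conjX : map_mx (@conjc R) (frame10 E) =
    ((Num.sqrt 2)^-1)%:C%C *: (map_mx (real_complex R) E
      + 'i%C *: map_mx (real_complex R) (E *m J)).
  by apply/matrixP => i j; rewrite !mxE /=; simpc.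
rewrite /mixed conjX /frame10 -/J.
set c := (X in X *: _); set e := map_mx _ E; set e' := map_mx _ (E *m J).
set h := map_mx _ H.
have -> : (c *: (e + 'i%C *: e'))^T = c *: (e^T + 'i%C *: e'^T).
  by rewrite linearZ linearD linearZ.
rewrite -!scalemxAl -!scalemxAr scalerA mxtraceZ mulmxBl mulmxDr !mulmxBl.
rewrite -!scalemxAl -!scalemxAr scalerA.
rewrite /e /e' /h !map_trmx -!map_mxM mixed_trace_aux; last first.
  by rewrite -[LHS]mxtrace_tr !trmx_mul !trmxK Hsym !mulmxA.
by rewrite /c -rmorphM -invfM -expr2 sqr_sqrtr // -rmorphM.
Qed.

End Coordinates.

Record chart (R : realType) (m : nat) (M : topologicalType) := Chart {
  dom : set M;
  coord : M -> 'rV[R]_m;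
  coordV : 'rV[R]_m -> M;
  dom_open : open dom;
  img_open : open (coord @` dom);
  coordK : forall p, dom p -> coordV (coord p) = p;
  coord_cont : forall p, dom p -> {for p, continuous coord};
  coordV_cont : forall x, (coord @` dom) x -> {for x, continuous coordV} }.

Definition img (R : realType) m (M : topologicalType) (c : chart R m M) :
  set 'rV[R]_m := coord c @` dom c.

Definition overlap (R : realType) m (M : topologicalType) (c d : chart R m M) :
  set 'rV[R]_m := coord c @` (dom c `&` dom d).

Definition transition (R : realType) m (M : topologicalType)
  (c d : chart R m M) (x : 'rV[R]_m) : 'rV[R]_m := coord d (coordV c x).

(* A Kaehler structure of complex dimension n on M: a holomorphic atlas, given
   as a family chart_at indexed by points with p in the domain of chart_at p
   (every atlas contains such a family), and a Hermitian metric with closed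
   fundamental form, gmx p being the matrix of g in chart_at p. *)
Record kahler (R : realType) (n : nat) (M : topologicalType) := Kahler {
  chart_at : M -> chart R (n + n) M;
  gmx : M -> 'rV[R]_(n + n) -> 'M[R]_(n + n);
  chart_at_dom : forall p, dom (chart_at p) p;
  transition_smooth : forall p q (b : 'I_(n + n)),
    smooth_on (overlap (chart_at p) (chart_at q))
      (fun x => transition (chart_at p) (chart_at q) x 0 b);
  transition_holo : forall p q x, overlap (chart_at p) (chart_at q) x ->
    let D := jacobian (transition (chart_at p) (chart_at q)) x in
    Jmx n *m D = D *m Jmx n;
  gmx_smooth : forall p (a b : 'I_(n + n)),
    smooth_on (img (chart_at p)) (fun x => gmx p x a b);
  gmx_sym : forall p x, img (chart_at p) x -> (gmx p x)^T = gmx p x;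
  gmx_pos : forall p x (v : 'rV[R]_(n + n)), img (chart_at p) x -> v != 0 ->
    0 < (v *m gmx p x *m v^T) 0 0;
  gmx_change : forall p q x, overlap (chart_at p) (chart_at q) x ->
    let D := jacobian (transition (chart_at p) (chart_at q)) x in
    gmx p x = D *m gmx q (transition (chart_at p) (chart_at q) x) *m D^T;
  gmx_hermitian : forall p x, img (chart_at p) x ->
    Jmx n *m gmx p x *m (Jmx n)^T = gmx p x;
  (* omega(v, w) = g(J v, w) has matrix Jmx n *m gmx p x *)
  omega_closed : forall p x (a b c : 'I_(n + n)), img (chart_at p) x ->
    let w (i j : 'I_(n + n)) y := (Jmx n *m gmx p y) i j in
    partial a (w b c) x + partial b (w c a) x + partial c (w a b) x = 0 }.

Section KahlerManifold.
Context {R : realType} {n : nat} {M : topologicalType}.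
Variable K : kahler R n M.

Definition smooth (u : M -> R) : Prop :=
  forall p, smooth_on (img (chart_at K p)) (u \o coordV (chart_at K p)).

(* Half the Riemannian Laplacian; by mixed_trace, applied to the Hessian (a
   symmetric matrix for smooth u), this is the sum of the u_(i \bar i) in any
   unitary frame. *)
Definition box (u : M -> R) (p : M) : R :=
  2^-1 * laplacian (gmx K p) (u \o coordV (chart_at K p))
           (coord (chart_at K p) p).

(* Ric(omega) >= omega: R_(i \bar j) >= delta_(i j) in every unitary frame at
   every point. *)
Definition ricci_ge_omega : Prop :=
  forall (p : M) (E : 'M[R]_(n, n + n)),
    let x := coord (chart_at K p) p in
    unitary_frame (gmx K p x) E ->
    herm_ge (mixed (ricci (gmx K p) x) E) 1%:M.

Definition eigenvalue_box (mu : R) : Prop :=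
  exists f : M -> R, [/\ smooth f, exists p, f p != 0 &
    forall p, - box f p = mu * f p].

Definition first_eigenvalue (mu : R) : Prop :=
  [/\ 0 < mu, eigenvalue_box mu &
      forall nu, eigenvalue_box nu -> nu != 0 -> mu <= nu].

End KahlerManifold.

Section Constants.
Context {R : realType}.
Variables (n : nat) (q : R).
Let N : R := n%:R.

Definition k_lower : R :=
  2 * (N + 1) / (q * (N - 1))
  - 2 * (N + 1) / (q * (N - 1)) * Num.sqrt (1 - (N - 1) * q / (N + 1)) - 1.

Definition k_upper : R :=
  2 * (N + 1) / (q * (N - 1))
  + 2 * (N + 1) / (q * (N - 1)) * Num.sqrt (1 - (N - 1) * q / (N + 1)) - 1.

(* 1 / C_(S, lambda_1, k) *)
Definition invCS (lambda1 k : R) : R :=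
  2 / (q - 1) *
  ((1 - (N + (N - 1) * k) * (k * N + N - 1) * q
        / ((4 * N ^+ 2 + 4 * N + q) * k)) * lambda1
   + q * N * (k * N + N - 1) / ((4 * N ^+ 2 + 4 * N + q) * k)).

End Constants.

(* Main.v *)
(* Put f = u^(1/b) with 1/b = 1 - q/(2(n+1)). Integrating the equation for f, the
   Bochner formula split into the J-invariant and J-anti-invariant parts P and H - P of
   the Hessian H of f, the identity int |P|^2 = (1/2) int (Lap f)^2, and the spectral gap
   int (Lap f)^2 >= 2 lambda_1 int |df|^2 are added with weights x + y + z = 1 for which
   everything but int |df|^2 cancels; what is left is
   (x lambda_1 + y - (q - 1) lambda) int |df|^2 <= 0, so df = 0.

   The integral is a positive normalized linear functional vanishing on all Laplacians,
   given by Hahn-Banach and the maximum principle. By Weyl's lemma (Fourier series on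
   cubes) it has a smooth density in every chart, positive by Hopf's lemma. If theta is
   the logarithmic differential of its density with respect to the Riemannian volume, the
   Bochner formula at a maximum of |theta|^2 and Ric > 0 give theta = 0, hence Green's
   formula. The gap follows by minimizing the Rayleigh quotient: an ultralimit of a
   minimizing sequence is a nonzero weak eigenfunction by Rellich's lemma, and it is
   smooth by Weyl's lemma. *)
Require Import Defs.
From HB Require Import structures.
From mathcomp Require Import all_boot all_order all_algebra.
From mathcomp Require Import all_classical all_reals all_analysis.
From mathcomp Require Import complex ring lra zify.
Set Implicit Arguments.
Unset Strict Implicit.
Unset Printing Implicit Defensive.
Import Order.TTheory GRing.Theory Num.Theory.
Import numFieldNormedType.Exports.
Local Open Scope classical_set_scope.
Local Open Scope ring_scope.

(** * Smooth functions on R^m *)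

Section Calculus.
Context {R : realType}.

Section Lines.
Context {V : normedModType R}.
Implicit Types (f : V -> R) (x v : V).

(** No integration theory on the manifold is built: every later step uses the mean only as a
    positive faithful functional. Being global, it yields chart independence for free, where a
    change of variables would otherwise be required. The Kaehler condition keeps Weyl's lemma short:
    in holomorphic coordinates the Christoffel part of a Hessian is J-anti-invariant, so the
    Laplacian is $g^{ab}\partial_a\partial_b$ without first-order terms, and the J-invariant part of
    a Hessian is a tensor that needs no connection. The same splitting drives the estimate. The one
    uncontrolled integrand is $P(\nabla f,\nabla f)/f$; it enters the lower bounds for $|P|^2$ and
    $|H-P|^2$ with opposite signs, and the weights are balanced so that it disappears. The exponent
    of $f$ is the one for which the integral of $|df|^4/f^2$ then cancels as well. The number $k$ is
    the free ratio of the two Hessian weights, $z/y=(n-1)k/n$, and its interval is exactly the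
    condition $x\ge0$. *)

Lemma is_derive_lineE f x v t d :
 is_derive (x + t *: v) v f d <-> is_derive t 1 (fun s => f (x + s *: v)) d.
Proof.
have E : (fun h : R => h^-1 *: ((f \o shift (x + t *: v)) (h *: v) - f (x + t *: v)))
 = (fun h : R => h^-1 *: (((fun s => f (x + s *: v)) \o shift t) (h *: 1) - f (x + t *: v))).
 by apply/funext => h /=; rewrite [h *: 1]mulr1 scalerDl addrCA.
by split=> -[dv e]; split; rewrite ?/derivable ?/derive in dv e *; rewrite ?E // -?E.
Qed.

Lemma is_derive_line0 f x v d :
 is_derive x v f d <-> is_derive (0 : R) 1 (fun s : R => f (x + s *: v)) d.
Proof. by rewrite -is_derive_lineE scale0r addr0. Qed.

Lemma is_derive_comp1 (h : R -> R) f x v dh df :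
 is_derive (f x) 1 h dh -> is_derive x v f df -> is_derive x v (h \o f) (dh * df).
Proof.
move=> Dh /is_derive_line0 Df; apply/is_derive_line0.
apply: (@is_derive1_comp _ h (fun s : R => f (x + s *: v))) => //.
by rewrite scale0r addr0.
Qed.

Lemma is_derive_mulc (c t : R) : is_derive t 1 (fun s : R => s * c) c.
Proof.
have H := @is_deriveZ R R R id c t 1 1 (@is_derive_id R R t 1).
rewrite -[X in is_derive _ _ _ X]mulr1.
have -> : (fun s : R => s * c) = c \*: id by apply/funext => s /=; rewrite mulrC.
exact: H.
Qed.

Lemma is_deriveZdir f x v d (c : R) : is_derive x v f d -> is_derive x (c *: v) f (c * d).
Proof.
move=> /is_derive_line0 Df; apply/is_derive_line0.
have -> : (fun s : R => f (x + s *: (c *: v))) = (fun s => f (x + s *: v)) \o ( *%R^~ c).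
 by apply/funext => s /=; rewrite scalerA.
rewrite mulrC; apply: is_derive1_comp; first by rewrite mul0r.
exact: is_derive_mulc.
Qed.

Lemma is_derive_ext f g x v d :
 (\forall y \near x, f y = g y) -> is_derive x v f d -> is_derive x v g d.
Proof. exact: near_eq_is_derive. Qed.

Lemma is_derive_cont1 (f : R -> R) (x d : R) : is_derive x 1 f d -> {for x, continuous f}.
Proof. by move=> [/derivable1_diffP + _]; exact: differentiable_continuous. Qed.

Lemma MVT_line f x v (df : V -> R) :
 (forall t, 0 <= t <= 1 -> is_derive (x + t *: v) v f (df (x + t *: v))) ->
 exists2 t, 0 <= t <= 1 & f (x + v) - f x = df (x + t *: v).
Proof.
move=> H.
have [] := @MVT_segment R (fun s => f (x + s *: v)) (fun s => df (x + s *: v)) 0 1 ler01.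
- by move=> t; rewrite in_itv /= => /andP[t0 t1]; apply/is_derive_lineE/H; rewrite !ltW.
- apply: derivable_within_continuous => t; rewrite in_itv /= => t01.
 by have /is_derive_lineE[] := H _ t01.
- move=> c; rewrite in_itv /= => c01; rewrite scale1r scale0r addr0 subr0 mulr1 => E.
 by exists c.
Qed.

End Lines.

Section Partial.
Context {m : nat}.
Implicit Types (f g : 'rV[R]_m -> R) (U : set 'rV[R]_m) (a b : 'I_m).

Definition dl a : 'rV[R]_m := delta_mx 0 a.

Lemma dlE a b : dl a 0 b = (b == a)%:R.
Proof. by rewrite mxE eqxx. Qed.

Lemma derivable_partial f a x : derivable f x (dl a) -> is_derive x (dl a) f (partial a f x).
Proof. exact: derivableP. Qed.

Lemma is_derive_partial f a x d : is_derive x (dl a) f d -> partial a f x = d.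
Proof. by move=> [_ <-]. Qed.

Lemma open_near U x : open U -> U x -> \forall y \near x, U y.
Proof. by move=> oU Ux; exact: open_nbhs_nbhs. Qed.

Lemma partial_ext U f g a x : open U -> U x -> (forall y, U y -> f y = g y) ->
 partial a f x = partial a g x.
Proof.
move=> oU Ux fg; apply: near_eq_derive.
by apply: filterS (open_near oU Ux) => y; exact: fg.
Qed.

Lemma derivable_ext U f g v x : open U -> U x -> (forall y, U y -> f y = g y) ->
 derivable f x v -> derivable g x v.
Proof.
move=> oU Ux fg; apply: near_eq_derivable.
by apply: filterS (open_near oU Ux) => y; exact: fg.
Qed.

Lemma cont_ext U f g x : open U -> U x -> (forall y, U y -> f y = g y) ->
 {for x, continuous f} -> {for x, continuous g}.
Proof.
move=> oU Ux fg cf; rewrite /prop_for /continuous_at -(fg x Ux).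
have H : \forall y \near x, f y = g y.
 by apply: filterS (open_near oU Ux) => y /fg.
exact: cvg_trans (near_eq_cvg H) cf.
Qed.

Lemma Ck_on0 U f : Ck_on 0 U f <-> (forall x, U x -> {for x, continuous f}).
Proof. by split => [[]|]. Qed.

Lemma Ck_onS k U f : Ck_on k.+1 U f <->
 (forall x, U x -> {for x, continuous f}) /\
 (forall a, (forall x, U x -> derivable f x (dl a)) /\ Ck_on k U (partial a f)).
Proof. by []. Qed.

Lemma Ck_onW k U f : Ck_on k.+1 U f -> Ck_on k U f.
Proof.
elim: k f => [|k IH] f; first by case.
move=> /Ck_onS[cf df]; apply/Ck_onS; split=> // a; have [d1 d2] := df a.
by split=> //; exact: IH.
Qed.

Lemma Ck_on_ext k U f g : open U -> (forall y, U y -> f y = g y) ->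
 Ck_on k U f -> Ck_on k U g.
Proof.
move=> oU; elim: k f g => [|k IH] f g fg.
 by move=> /Ck_on0 cf; apply/Ck_on0 => x Ux; exact: cont_ext oU Ux fg (cf _ Ux).
move=> /Ck_onS[cf df]; apply/Ck_onS; split=> [x Ux|a].
 exact: cont_ext oU Ux fg (cf _ Ux).
have [d1 d2] := df a; split=> [x Ux|]; first exact: derivable_ext oU Ux fg (d1 _ Ux).
by apply: IH d2 => y Uy; exact: partial_ext oU Uy fg.
Qed.

Lemma Ck_on_sub k U (W : set 'rV[R]_m) f : W `<=` U -> Ck_on k U f -> Ck_on k W f.
Proof.
move=> WU; elim: k f => [|k IH] f.
 by move=> /Ck_on0 cf; apply/Ck_on0 => x /WU; exact: cf.
move=> /Ck_onS[cf df]; apply/Ck_onS; split=> [x /WU|a]; first exact: cf.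
by have [d1 d2] := df a; split=> [x /WU|]; [exact: d1|exact: IH].
Qed.

Lemma Ck_on_loc k U f :
 (forall x, U x -> exists W, [/\ open W, W x & Ck_on k W f]) -> Ck_on k U f.
Proof.
elim: k f => [|k IH] f H.
 apply/Ck_on0 => x Ux; have [W [oW Wx /Ck_on0]] := H x Ux; exact.
apply/Ck_onS; split=> [x Ux|a].
 by have [W [oW Wx /Ck_onS[+ _]]] := H x Ux; exact.
split=> [x Ux|].
 by have [W [oW Wx /Ck_onS[_ /(_ a)[+ _]]]] := H x Ux; exact.
apply: IH => x Ux; have [W [oW Wx /Ck_onS[_ /(_ a)[_ h]]]] := H x Ux.
by exists W.
Qed.

Lemma Ck_cst k U (c : R) : Ck_on k U (fun=> c).
Proof.
elim: k c => [|k IH] c; first by apply/Ck_on0 => x _; exact: cst_continuous.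
apply/Ck_onS; split=> [x _|a]; first exact: cst_continuous.
split=> [x _|]; first exact: derivable_cst.
have -> : partial a (fun=> c) = (fun=> 0); last exact: IH.
by apply/funext => x; exact: derive_cst.
Qed.

Lemma partial_cst a (c : R) x : partial a (fun=> c) x = 0.
Proof. exact: derive_cst. Qed.

Lemma is_derive_coord a b x : is_derive x (dl a) (fun y : 'rV[R]_m => y 0 b) (b == a)%:R.
Proof.
apply/is_derive_line0.
have -> : (fun s : R => (x + s *: dl a) 0 b) = (fun s => x 0 b + s * (b == a)%:R).
 by apply/funext => s; rewrite !mxE eqxx.
rewrite -[X in is_derive _ _ _ X]add0r.
apply: (@is_deriveD R R R (cst (x 0 b)) (fun s => s * (b == a)%:R)).
exact: is_derive_mulc.
Qed.

Lemma partial_coord a b x : partial a (fun y : 'rV[R]_m => y 0 b) x = (b == a)%:R.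
Proof. exact/is_derive_partial/is_derive_coord. Qed.

Lemma Ck_coord k U b : Ck_on k U (fun y => y 0 b).
Proof.
case: k => [|k]; first by apply/Ck_on0 => x _; exact: coord_continuous.
apply/Ck_onS; split=> [x _|a]; first exact: coord_continuous.
split=> [x _|]; first by have [] := is_derive_coord a b x.
have -> : partial a (fun y : 'rV[R]_m => y 0 b) = (fun=> (b == a)%:R); last exact: Ck_cst.
by apply/funext => x; exact: partial_coord.
Qed.

Lemma partialD f g a x : derivable f x (dl a) -> derivable g x (dl a) ->
 partial a (fun y => f y + g y) x = partial a f x + partial a g x.
Proof. by move=> df dg; apply: etrans (deriveD df dg) _. Qed.

Lemma partialM f g a x : derivable f x (dl a) -> derivable g x (dl a) ->
 partial a (fun y => f y * g y) x = partial a f x * g x + f x * partial a g x.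
Proof.
move=> df dg; apply: etrans (deriveM df dg) _.
by rewrite addrC -[g x *: _]/(g x * _) [g x * _]mulrC.
Qed.

Lemma derivableM' f g x v : derivable f x v -> derivable g x v ->
 derivable (fun y => f y * g y) x v.
Proof. exact: derivableM. Qed.

Lemma derivableD' f g x v : derivable f x v -> derivable g x v ->
 derivable (fun y => f y + g y) x v.
Proof. exact: derivableD. Qed.

Lemma Ck_add k U f g : open U -> Ck_on k U f -> Ck_on k U g ->
 Ck_on k U (fun y => f y + g y).
Proof.
move=> oU; elim: k f g => [|k IH] f g.
 move=> /Ck_on0 cf /Ck_on0 cg; apply/Ck_on0 => x Ux.
 by apply: continuousD; [exact: cf|exact: cg].
move=> /Ck_onS[cf df] /Ck_onS[cg dg]; apply/Ck_onS; split=> [x Ux|a].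
 by apply: continuousD; [exact: cf|exact: cg].
have [df1 df2] := df a; have [dg1 dg2] := dg a.
split=> [x Ux|]; first by apply: derivableD'; [exact: df1|exact: dg1].
apply: Ck_on_ext (IH _ _ df2 dg2) => // y Uy.
by rewrite partialD //; [exact: df1|exact: dg1].
Qed.

Lemma Ck_mul k U f g : open U -> Ck_on k U f -> Ck_on k U g ->
 Ck_on k U (fun y => f y * g y).
Proof.
move=> oU; elim: k f g => [|k IH] f g.
 move=> /Ck_on0 cf /Ck_on0 cg; apply/Ck_on0 => x Ux.
 by apply: continuousM; [exact: cf|exact: cg].
move=> Cf Cg; move: (Cf) (Cg).
move=> /Ck_onS[cf df] /Ck_onS[cg dg]; apply/Ck_onS; split=> [x Ux|a].
 by apply: continuousM; [exact: cf|exact: cg].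
have [df1 df2] := df a; have [dg1 dg2] := dg a.
split=> [x Ux|]; first by apply: derivableM'; [exact: df1|exact: dg1].
have := Ck_add oU (IH _ _ df2 (Ck_onW Cg)) (IH _ _ (Ck_onW Cf) dg2).
apply: Ck_on_ext => // y Uy.
by rewrite partialM //; [exact: df1|exact: dg1].
Qed.

(** The chain rule turns [h] into its derivative, so the induction on the order of smoothness in
    [Ck_comp1] needs a whole family closed under differentiation. One such family is exhibited for
    each outer function used: exponential, sine and cosine, negative powers, real powers, and the
    bump. *)
Definition deriv_stable (V : set R) (F : (R -> R) -> Prop) :=
 forall h, F h -> exists2 h', F h' & forall t, V t -> is_derive t 1 h (h' t).

Lemma Ck_comp1 k U V F (h : R -> R) f : open U -> deriv_stable V F -> F h ->
 (forall x, U x -> V (f x)) -> Ck_on k U f -> Ck_on k U (fun y => h (f y)).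
Proof.
move=> oU sF + UV; elim: k h f UV => [|k IH] h f UV Fh.
 move=> /Ck_on0 cf; apply/Ck_on0 => x Ux.
 apply: (@continuous_comp _ _ _ f h); first exact: cf.
 by have [h' _ /(_ _ (UV x Ux))] := sF _ Fh; exact: is_derive_cont1.
move=> Cf; have /Ck_onS[cf df] := Cf; have [h' Fh' Hh'] := sF _ Fh.
apply/Ck_onS; split=> [x Ux|a].
 apply: (@continuous_comp _ _ _ f h); first exact: cf.
 by have := Hh' _ (UV x Ux); exact: is_derive_cont1.
have [d1 d2] := df a.
have D x : U x -> is_derive x (dl a) (h \o f) (h' (f x) * partial a f x).
 by move=> Ux; apply: is_derive_comp1; [exact/Hh'/UV|exact/derivable_partial/d1].
split=> [x Ux|]; first by have [] := D x Ux.
apply: Ck_on_ext (Ck_mul oU (IH _ _ UV Fh' (Ck_onW Cf)) d2) => // y Uy.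
by rewrite (is_derive_partial (D y Uy)).
Qed.

Lemma smooth_cont U f x : smooth_on U f -> U x -> {for x, continuous f}.
Proof. by move=> /(_ 0%N)/Ck_on0; exact. Qed.

Lemma smooth_derivable U f a x : smooth_on U f -> U x -> derivable f x (dl a).
Proof. by move=> /(_ 1%N)/Ck_onS[_ /(_ a)[+ _]]; exact. Qed.

Lemma smooth_partial U f a : smooth_on U f -> smooth_on U (partial a f).
Proof. by move=> sf k; have /Ck_onS[_ /(_ a)[]] := sf k.+1. Qed.

Lemma smooth_ext U f g : open U -> (forall y, U y -> f y = g y) ->
 smooth_on U f -> smooth_on U g.
Proof. by move=> oU fg sf k; exact: Ck_on_ext oU fg (sf k). Qed.

Lemma smooth_sub U (W : set 'rV[R]_m) f : W `<=` U -> smooth_on U f -> smooth_on W f.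
Proof. by move=> WU sf k; exact: Ck_on_sub WU (sf k). Qed.

Lemma smooth_loc U f :
 (forall x, U x -> exists W, [/\ open W, W x & smooth_on W f]) -> smooth_on U f.
Proof.
move=> H k; apply: Ck_on_loc => x Ux; have [W [oW Wx sf]] := H x Ux.
by exists W; split.
Qed.

Lemma smooth_cst U (c : R) : smooth_on U (fun=> c).
Proof. by move=> k; exact: Ck_cst. Qed.

Lemma smooth_coord U b : smooth_on U (fun y => y 0 b).
Proof. by move=> k; exact: Ck_coord. Qed.

Lemma smooth_add U f g : open U -> smooth_on U f -> smooth_on U g ->
 smooth_on U (fun y => f y + g y).
Proof. by move=> oU sf sg k; exact: Ck_add. Qed.

Lemma smooth_mul U f g : open U -> smooth_on U f -> smooth_on U g ->
 smooth_on U (fun y => f y * g y).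
Proof. by move=> oU sf sg k; exact: Ck_mul. Qed.

Lemma smooth_scale U (c : R) f : open U -> smooth_on U f -> smooth_on U (fun y => c * f y).
Proof. by move=> oU sf; apply: smooth_mul => //; exact: smooth_cst. Qed.

Lemma smooth_opp U f : open U -> smooth_on U f -> smooth_on U (fun y => - f y).
Proof.
move=> oU sf; apply: smooth_ext (smooth_scale (-1) oU sf) => // y _.
by rewrite mulN1r.
Qed.

Lemma smooth_subr U f g : open U -> smooth_on U f -> smooth_on U g ->
 smooth_on U (fun y => f y - g y).
Proof. by move=> oU sf sg; apply: smooth_add => //; exact: smooth_opp. Qed.

Lemma smooth_sum U (I : Type) (r : seq I) (P : pred I) (F : I -> 'rV[R]_m -> R) : open U ->
 (forall i, P i -> smooth_on U (F i)) -> smooth_on U (fun y => \sum_(i <- r | P i) F i y).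
Proof.
move=> oU sF; elim: r => [|i r IH].
 by apply: smooth_ext (smooth_cst U 0) => // y _; rewrite big_nil.
have [Pi|nPi] := boolP (P i).
 apply: smooth_ext (smooth_add oU (sF i Pi) IH) => // y _.
 by rewrite big_cons Pi.
by apply: smooth_ext IH => // y _; rewrite big_cons (negbTE nPi).
Qed.

Lemma smooth_prod U (I : Type) (r : seq I) (P : pred I) (F : I -> 'rV[R]_m -> R) : open U ->
 (forall i, P i -> smooth_on U (F i)) -> smooth_on U (fun y => \prod_(i <- r | P i) F i y).
Proof.
move=> oU sF; elim: r => [|i r IH].
 by apply: smooth_ext (smooth_cst U 1) => // y _; rewrite big_nil.
have [Pi|nPi] := boolP (P i).
 apply: smooth_ext (smooth_mul oU (sF i Pi) IH) => // y _.
 by rewrite big_cons Pi.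
by apply: smooth_ext IH => // y _; rewrite big_cons (negbTE nPi).
Qed.

Lemma smooth_comp1 U V F (h : R -> R) f : open U -> deriv_stable V F -> F h ->
 (forall x, U x -> V (f x)) -> smooth_on U f -> smooth_on U (fun y => h (f y)).
Proof. by move=> oU sF Fh UV sf k; exact: Ck_comp1 sF Fh UV (sf k). Qed.

Lemma smooth_partialM U f g a x : smooth_on U f -> smooth_on U g -> U x ->
 partial a (fun y => f y * g y) x = partial a f x * g x + f x * partial a g x.
Proof. by move=> sf sg Ux; apply: partialM; exact: smooth_derivable Ux. Qed.

Lemma smooth_partialD U f g a x : smooth_on U f -> smooth_on U g -> U x ->
 partial a (fun y => f y + g y) x = partial a f x + partial a g x.
Proof. by move=> sf sg Ux; apply: partialD; exact: smooth_derivable Ux. Qed.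

Lemma partialZ (c : R) f a x : derivable f x (dl a) ->
 partial a (fun y => c * f y) x = c * partial a f x.
Proof.
move=> df; have dc : derivable (fun=> c) x (dl a) := @derivable_cst R 'rV[R]_m R c x (dl a).
by rewrite (partialM dc df) partial_cst mul0r add0r.
Qed.

Lemma smooth_partialB U f g a x : smooth_on U f -> smooth_on U g -> U x ->
 partial a (fun y => f y - g y) x = partial a f x - partial a g x.
Proof.
move=> sf sg Ux.
have -> : (fun y => f y - g y) = (fun y => f y + (-1) * g y).
 by apply/funext => y; rewrite mulN1r.
have dg := @smooth_derivable _ _ a _ sg Ux; have df := @smooth_derivable _ _ a _ sf Ux.
have dmg : derivable (fun y => -1 * g y) x (dl a).
 exact: derivableM' (@derivable_cst R 'rV[R]_m R (-1) x (dl a)) dg.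
by rewrite (partialD df dmg) (partialZ _ dg) mulN1r.
Qed.

Lemma derivable_sumI (I : Type) (r : seq I) (P : pred I) (F : I -> 'rV[R]_m -> R) v x :
 (forall i, P i -> derivable (F i) x v) ->
 derivable (fun y => \sum_(i <- r | P i) F i y) x v.
Proof.
move=> dF; elim: r => [|i r IH].
 have -> : (fun y => \sum_(i <- [::] | P i) F i y) = cst 0.
  by apply/funext => y; rewrite big_nil.
 exact: (@derivable_cst R 'rV[R]_m R).
have [Pi|nPi] := boolP (P i).
 have -> : (fun y => \sum_(j <- i :: r | P j) F j y)
  = (fun y => F i y + \sum_(j <- r | P j) F j y).
  by apply/funext => y; rewrite big_cons Pi.
 exact: derivableD' (dF i Pi) IH.
have -> // : (fun y => \sum_(j <- i :: r | P j) F j y) = (fun y => \sum_(j <- r | P j) F j y).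
by apply/funext => y; rewrite big_cons (negbTE nPi).
Qed.

Lemma partial_sum (I : Type) (r : seq I) (P : pred I) (F : I -> 'rV[R]_m -> R) a x :
 (forall i, P i -> derivable (F i) x (dl a)) ->
 partial a (fun y => \sum_(i <- r | P i) F i y) x = \sum_(i <- r | P i) partial a (F i) x.
Proof.
move=> dF; elim: r => [|i r IH].
 have -> : (fun y => \sum_(i <- [::] | P i) F i y) = (fun=> 0).
  by apply/funext => y; rewrite big_nil.
 by rewrite partial_cst big_nil.
have [Pi|nPi] := boolP (P i).
 have -> : (fun y => \sum_(j <- i :: r | P j) F j y)
  = (fun y => F i y + \sum_(j <- r | P j) F j y).
  by apply/funext => y; rewrite big_cons Pi.
 by rewrite big_cons Pi (partialD (dF i Pi) (@derivable_sumI _ r _ _ _ _ dF)) IH.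
have -> : (fun y => \sum_(j <- i :: r | P j) F j y) = (fun y => \sum_(j <- r | P j) F j y).
 by apply/funext => y; rewrite big_cons (negbTE nPi).
by rewrite IH big_cons (negbTE nPi).
Qed.

Lemma partial_comp1 (h : R -> R) f a x dh : is_derive (f x) 1 h dh ->
 derivable f x (dl a) -> partial a (fun y => h (f y)) x = dh * partial a f x.
Proof.
by move=> Dh df; apply: is_derive_partial; apply: is_derive_comp1 => //; exact: derivable_partial.
Qed.

Lemma smooth_exp U f : open U -> smooth_on U f -> smooth_on U (fun y => expR (f y)).
Proof.
move=> oU; apply: (@smooth_comp1 U setT (fun h => h = expR)) => // h ->.
by exists expR => // t _; exact: is_derive_expR.
Qed.

Let trig (h : R -> R) := exists a b : R, h = fun t => a * cos t + b * sin t.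

Lemma trig_stable : deriv_stable setT trig.
Proof.
move=> h [a [b ->]]; exists (fun t => b * cos t + (- a) * sin t); first by exists b, (- a).
move=> t _; rewrite mulNr -mulrN addrC.
have -> : (fun t => a * cos t + b * sin t) = (a \*: (@cos R)) + (b \*: (@sin R)) by [].
exact: is_deriveD.
Qed.

Lemma smooth_cos U f : open U -> smooth_on U f -> smooth_on U (fun y => cos (f y)).
Proof.
move=> oU; apply: (smooth_comp1 oU trig_stable) => //.
by exists 1, 0; apply/funext => t; rewrite mul1r mul0r addr0.
Qed.

Lemma smooth_sin U f : open U -> smooth_on U f -> smooth_on U (fun y => sin (f y)).
Proof.
move=> oU; apply: (smooth_comp1 oU trig_stable) => //.
by exists 0, 1; apply/funext => t; rewrite mul1r mul0r add0r.
Qed.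

Let rpow (h : R -> R) := exists (c : R) n, h = fun t => c * t^-1 ^+ n.

Lemma is_derive_invr (t : R) : t != 0 -> is_derive t 1 (fun s : R => s^-1) (- t^-1 ^+ 2).
Proof.
move=> t0; have := @is_deriveV R id t 1 1 t0 (@is_derive_id R R t 1).
by rewrite [_ *: 1]mulr1 exprVn.
Qed.

Lemma rpow_stable : deriv_stable [set t | t != 0] rpow.
Proof.
move=> h [c [n ->]]; exists (fun t => (- (c * n%:R)) * t^-1 ^+ n.+1).
 by exists (- (c * n%:R)), n.+1.
move=> t t0; have D := is_deriveZ c (is_deriveX n (is_derive_invr t0)).
have -> : (fun t : R => c * t^-1 ^+ n) = c \*: (fun s : R => s^-1) ^+ n.
 by apply/funext => s /=; rewrite fctE.
apply: is_derive_eq D _; rewrite /GRing.scale /=.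
case: n => [|n]; first by rewrite mul0r !(mulr0, mul0r) oppr0 mul0r.
by rewrite /= -(addn2 n) exprD; ring.
Qed.

Lemma smooth_inv U f : open U -> (forall x, U x -> f x != 0) -> smooth_on U f ->
 smooth_on U (fun y => (f y)^-1).
Proof.
move=> oU; apply: (smooth_comp1 oU rpow_stable) => //.
by exists 1, 1%N; apply/funext => t; rewrite mul1r.
Qed.

Let ppow (h : R -> R) := exists c p : R, h = fun t => c * t `^ p.

Lemma is_derive_powR (p t : R) : 0 < t -> is_derive t 1 (fun s => s `^ p) (p * t `^ (p - 1)).
Proof.
move=> t0; split; first by apply: derivable_powR; rewrite in_itv /= t0.
by rewrite -derive1E powR_derive1 // in_itv /= t0.
Qed.

Lemma ppow_stable : deriv_stable [set t | 0 < t] ppow.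
Proof.
move=> h [c [p ->]]; exists (fun t => (c * p) * t `^ (p - 1)).
 by exists (c * p), (p - 1).
move=> t t0; rewrite -mulrA.
exact: (is_deriveZ c (is_derive_powR p t0)).
Qed.

Lemma smooth_powR U f p : open U -> (forall x, U x -> 0 < f x) -> smooth_on U f ->
 smooth_on U (fun y => f y `^ p).
Proof.
move=> oU; apply: (@smooth_comp1 U _ _ (fun t => t `^ p) f oU ppow_stable) => //.
by exists 1, p; apply/funext => t; rewrite mul1r.
Qed.

End Partial.

(** * Bump functions *)

Section Bump.

(** The functions $p(1/t)e^{-1/t}$, extended by zero, are closed under differentiation: $p$ becomes
    $X^2(p-p')$. This is how $e^{-1/t}$ is seen to be smooth at 0. *)
Definition flat (p : {poly R}) (t : R) : R := if 0 < t then p.[t^-1] * expR (- t^-1) else 0.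

(** Coefficient by coefficient, $s^i\le i!\,e^s$ by the exponential series. *)
Lemma poly_expN_bounded (p : {poly R}) :
 exists2 C : R, 0 <= C & forall s : R, 0 < s -> `|p.[s]| * expR (- s) <= C.
Proof.
exists (\sum_(i < size p) `|p`_i| * i`!%:R).
 by apply: sumr_ge0 => i _; rewrite mulr_ge0.
move=> s s0; rewrite expRN ler_pdivrMr ?expR_gt0 // horner_coef.
apply: le_trans (ler_norm_sum _ _ _) _; rewrite mulr_suml; apply: ler_sum => i _.
rewrite normrM -mulrA ler_wpM2l // normrX gtr0_norm //.
case: (i : nat) => [|j].
 by rewrite expr0 fact0 mul1r -(expR0 R) ler_expR ltW.
have := expR_ge1Dxn j (ltW s0); rewrite mulrC => H.
rewrite -ler_pdivrMl ?ltr0n ?fact_gt0 //; apply: le_trans H; rewrite lerDr.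
exact: ler01.
Qed.

(** A quadratic error bound with a fixed constant is the form in which differentiability survives a
    limit of functions; it is used so in [tlim_smooth], and for [flat] at the origin. *)
Lemma is_derive_quad (f : R -> R) (t d C e : R) : 0 < e ->
 (forall h, `|h| < e -> `|f (t + h) - f t - h * d| <= C * h ^+ 2) -> is_derive t 1 f d.
Proof.
move=> e0 H; pose D := `|C| + 1; have D0 : 0 < D by rewrite /D ltr_wpDl.
have L : h^-1 *: ((f \o shift t) (h *: (1 : R)) - f t) @[h --> 0^'] --> d.
 apply/cvgrPdist_le => eps eps0; near=> h.
 have h0 : h != 0 by near: h; exact: nbhs_dnbhs_neq.
 have he : `|h| < e by near: h; apply: dnbhs0_lt.
 have hD : `|h| <= eps / D by near: h; apply: dnbhs0_le; rewrite divr_gt0.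
 rewrite /= [h *: 1]mulr1 [h + t]addrC -[h^-1 *: _]/(h^-1 * _).
 have -> : d - h^-1 * (f (t + h) - f t) = - (h^-1 * (f (t + h) - f t - h * d)).
  by field.
 rewrite normrN normrM normfV ler_pdivrMl ?normr_gt0 //.
 apply: le_trans (H h he) _; rewrite -normr_id -real_normK ?num_real // normr_id expr2 mulrA.
 rewrite [C * _]mulrC -mulrA ler_wpM2l //.
 have : `|h| * D <= eps by rewrite -ler_pdivlMr.
 apply: le_trans; rewrite mulrC ler_wpM2l // /D.
 by apply: le_trans (ler_norm C) _; rewrite lerDl.
by split; [apply/cvg_ex; exists d|exact: cvg_lim].
Unshelve. all: by end_near. Qed.

Lemma flat_stable : deriv_stable setT (fun h => exists p, h = flat p).
Proof.
move=> h [p ->]; exists (flat ('X^2 * (p - p^`()))); first by exists ('X^2 * (p - p^`())).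
move=> t _; have [t0|t0|t0] := ltgtP t 0.
- rewrite [X in is_derive _ _ _ X](_ : _ = 0) ?/flat ?(ltNge 0 t) ?(ltW t0) //.
 have H0 : is_derive t 1 (fun=> 0 : R) 0 := @is_derive_cst R R R 0 t 1.
 apply: is_derive_ext H0.
 near=> y; rewrite /flat ltNge (_ : y <= 0) //.
 by apply/ltW; near: y; exact: lt_nbhsl.
- have [C C0 HC] := poly_expN_bounded ('X^2 * p).
 rewrite {2}/flat t0.
 apply: (@is_derive_ext R (fun s : R => p.[s^-1] * expR (- s^-1))).
  by near=> y; rewrite /flat (_ : 0 < y) //; near: y; exact: lt_nbhsr.
 have Di := is_derive_invr (lt0r_neq0 t0).
 have Dp : is_derive t 1 (horner p \o (fun s : R => s^-1)) (p^`().[t^-1] * - t^-1 ^+ 2).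
  have Dh : is_derive t^-1 1 (horner p) p^`().[t^-1].
   by split; [exact: derivable_horner|rewrite -derive1E -derivE].
  exact: is_derive1_comp Dh Di.
 have De : is_derive t 1 (expR \o (fun s : R => - s^-1)) (expR (- t^-1) * (t^-1 ^+ 2)).
  have Dn : is_derive t 1 (fun s : R => - s^-1) (t^-1 ^+ 2).
   by rewrite -[X in is_derive _ _ _ X]opprK; exact: (is_deriveN Di).
  exact: is_derive1_comp (is_derive_expR _) Dn.
 apply: is_derive_eq (is_deriveM Dp De) _.
 by rewrite /= !hornerE /GRing.scale /=; ring.
(* At the origin: the bound for $s^2|p(s)|e^{-s}$ with $s=1/y$ says that the value of [flat p] at
   $y$ is at most $Cy^2$, so the derivative is 0. *)
- have [C C0 HC] := poly_expN_bounded ('X^2 * p).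
 subst t; rewrite {2}/flat ltxx.
 apply: (@is_derive_quad _ _ _ C 1) => // y _.
 rewrite add0r mulr0 subr0 {2}/flat ltxx subr0 /flat; case: ifPn => y0; last first.
  by rewrite normr0 mulr_ge0 ?sqr_ge0.
 have := HC y^-1; rewrite invr_gt0 => /(_ y0).
 rewrite normrM (gtr0_norm (expR_gt0 _)) hornerM hornerXn normrM.
 rewrite (ger0_norm (sqr_ge0 _)) -mulrA exprVn ler_pdivrMl ?exprn_gt0 //.
 by rewrite [_ * C]mulrC.
Unshelve. all: by end_near. Qed.

Definition bump (t : R) : R := flat 1 t.

Lemma bumpE t : 0 < t -> bump t = expR (- t^-1).
Proof. by move=> t0; rewrite /bump /flat t0 hornerC mul1r. Qed.

Lemma bump_gt0 t : 0 < t -> 0 < bump t.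
Proof. by move=> t0; rewrite bumpE ?expR_gt0. Qed.

Lemma bump_eq0 t : t <= 0 -> bump t = 0.
Proof. by move=> t0; rewrite /bump /flat ltNge t0. Qed.

Lemma bump_ge0 t : 0 <= bump t.
Proof. by have [/bump_eq0->|/bump_gt0/ltW] := leP t 0. Qed.

Lemma bump_le s t : s <= t -> bump s <= bump t.
Proof.
move=> st; have [/bump_eq0->|s0] := leP s 0; first exact: bump_ge0.
have t0 := lt_le_trans s0 st.
by rewrite !bumpE // ler_expR lerN2 lef_pV2.
Qed.

Lemma bump_le1 t : bump t <= 1.
Proof.
have [/bump_eq0->|t0] := leP t 0; first exact: ler01.
by rewrite bumpE // -(expR0 R) ler_expR oppr_le0 invr_ge0 ltW.
Qed.

Lemma smooth_bump m (U : set 'rV[R]_m) f : open U -> smooth_on U f ->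
 smooth_on U (fun y => bump (f y)).
Proof. by move=> oU; apply: (@smooth_comp1 m U _ _ bump f oU flat_stable) => //; exists 1. Qed.

End Bump.
End Calculus.

Opaque partial.
Section Calculus2.
Context {R : realType}.

Lemma rV_coord_le m (v : 'rV[R]_m) a : `|v 0 a| <= `|v|.
Proof.
by rewrite {2}/Num.norm /= mx_normrE; apply: (le_bigmax _ _ (0, a)).
Qed.

Lemma rV_norm_le m (v : 'rV[R]_m) (c : R) : 0 <= c -> (forall a, `|v 0 a| <= c) -> `|v| <= c.
Proof.
move=> c0 H; rewrite {1}/Num.norm /= mx_normrE; apply/bigmax_leP; split=> // -[i a] _ /=.
by rewrite (ord1 i).
Qed.

Lemma norm_dl m (a : 'I_m) : `|dl a : 'rV[R]_m| <= 1.
Proof. by apply: rV_norm_le => // b; rewrite dlE; case: eqP; rewrite ?normr1 ?normr0. Qed.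

Lemma cont_dist (T : topologicalType) (f : T -> R) (x : T) (e : R) :
 {for x, continuous f} -> 0 < e -> \forall y \near x, `|f x - f y| <= e.
Proof. by move=> /cvgrPdist_le cf e0; exact: cf. Qed.

Lemma near_all (T : Type) (F : set_system T) {FF : Filter F} (I : finType) (P : I -> T -> Prop) :
 (forall i, \forall y \near F, P i y) -> \forall y \near F, forall i, P i y.
Proof. exact: filter_forall. Qed.

Lemma rV_cont (T : topologicalType) m (f : T -> 'rV[R]_m) x :
 (forall b, {for x, continuous (fun y => f y 0 b)}) -> {for x, continuous f}.
Proof.
move=> cf; apply/cvgrPdist_le => e e0.
have H b : \forall y \near x, `|f x 0 b - f y 0 b| <= e.
 by have /cvgrPdist_le := cf b; exact.
apply: (@filterS T (nbhs x) _ _ _ _ (near_all H)) => y Hy.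
by apply: rV_norm_le => [|b]; [exact: ltW|rewrite !mxE].
Qed.

(** * First-order expansions and the chain rule *)

Section Differentiable.
Context {m : nat}.
Implicit Types (f : 'rV[R]_m -> R) (U : set 'rV[R]_m) (x h : 'rV[R]_m).

Lemma is_derive_scaled f a x (c : R) : derivable f x (dl a) ->
 is_derive x (c *: dl a) f (c * partial a f x).
Proof. by move=> df; apply: is_deriveZdir; exact: derivable_partial. Qed.

(** The increment is split along the broken line [z], which changes one coordinate at a time; on
    each edge the mean value theorem compares it with the partial derivative at [x]. *)
Lemma C1_approx U f x (e : R) : open U -> U x -> (forall a y, U y -> derivable f y (dl a)) ->
 (forall a, {for x, continuous (partial a f)}) -> 0 < e ->
 \forall h \near (0 : 'rV[R]_m),
  `|f (x + h) - f x - \sum_a h 0 a * partial a f x| <= e * `|h|.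
Proof.
(* Dividing by [m.+1] instead of [m] covers dimension 0. *)
move=> oU Ux df cf e0; pose d := e / m.+1%:R.
have d0 : 0 < d by rewrite divr_gt0.
have nU : \forall y \near x, U y /\ forall a, `|partial a f x - partial a f y| <= d.
 apply: filterI; first exact: open_near.
 have H a : \forall y \near x, `|partial a f x - partial a f y| <= d.
  by have /cvgrPdist_le := cf a; exact.
 exact: near_all H.
have [r /= r0 Hr] := (nbhs_ballP _ _).1 nU.
have : \forall h \near (0 : 'rV[R]_m), `|h| < r.
 by apply/nbhs_ballP; exists r => //= y; rewrite -ball_normE /= sub0r normrN.
apply: filterS => h hr.
pose z (i : nat) : 'rV[R]_m := \row_a (if (a < i)%N then h 0 a else 0).
have zle i : `|z i| <= `|h|.
 by apply: rV_norm_le => // a; rewrite mxE; case: ifP => _; rewrite ?normr0 // rV_coord_le.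
have zS (i : 'I_m) : z i.+1 = z i + h 0 i *: dl i.
 apply/rowP => a; rewrite !mxE eqxx ltnS leq_eqVlt eq_sym /=.
 rewrite (inj_eq val_inj) [a == i]eq_sym.
 by case: (eqVneq i a) => [->|ai]; rewrite ?ltnn ?mulr1 ?add0r // mulr0 addr0.
have step (i : 'I_m) : `|f (x + z i.+1) - f (x + z i) - h 0 i * partial i f x| <= d * `|h|.
 pose df' y := h 0 i * partial i f y.
 have inb t : 0 <= t <= 1 -> ball x r (x + z i + t *: (h 0 i *: dl i)).
  move=> /andP[t0 t1]; rewrite -ball_normE /= -addrA opprD addNKr normrN.
  apply: le_lt_trans hr; apply: rV_norm_le => // a; rewrite !mxE eqxx /=.
  have [->|ai] := eqVneq a i.
   rewrite ltnn add0r mulr1 normrM ger0_norm //.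
   by apply: le_trans (rV_coord_le h i); rewrite ler_piMl.
  by rewrite !mulr0 addr0; case: ifP => _; rewrite ?normr0 // rV_coord_le.
 have [|t t01 E] := @MVT_line _ _ f (x + z i) (h 0 i *: dl i) df'.
  by move=> t /inb /Hr [Uy _]; apply: is_derive_scaled; exact: df.
 rewrite zS addrA E -mulrBr normrM mulrC distrC.
 have [_ /(_ i) H] := Hr _ (inb t t01).
 by apply: ler_pM => //; exact: rV_coord_le.
have -> : f (x + h) - f x = \sum_(i < m) (f (x + z i.+1) - f (x + z i)).
 rewrite -(big_mkord xpredT (fun i => f (x + z i.+1) - f (x + z i))).
 rewrite (telescope_sumr (fun i => f (x + z i))) //.
 congr (f _ - f _); first by congr (_ + _); apply/rowP => a; rewrite mxE ltn_ord.
 by rewrite -[LHS]addr0; congr (_ + _); apply/rowP => a; rewrite !mxE.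
rewrite -sumrB; apply: le_trans (ler_norm_sum _ _ _) _.
apply: le_trans (ler_sum _ (fun i _ => step i)) _.
rewrite sumr_const card_ord -mulr_natl mulrA ler_wpM2r // /d mulrCA -mulr_natl.
rewrite ler_piMr ?(ltW e0) // mulr1 ler_pdivrMr ?ltr0n // mul1r ler_nat; exact: leqnSn.
Qed.

(** Of [f] only the first-order expansion at the single point [gam t] is assumed, so the lemma
    serves for compositions with smooth maps as well as for restrictions to straight lines. *)
Lemma is_derive_chain f (gam : R -> 'rV[R]_m) (t : R) (gam' c : 'I_m -> R) :
 (forall e, 0 < e -> \forall h \near (0 : 'rV[R]_m),
  `|f (gam t + h) - f (gam t) - \sum_a h 0 a * c a| <= e * `|h|) ->
 (forall a, is_derive t 1 (fun s => gam s 0 a) (gam' a)) ->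
 is_derive t 1 (f \o gam) (\sum_a gam' a * c a).
Proof.
move=> Hf Dg; pose del (h : R) := gam (h + t) - gam t.
have Lg a : (h^-1 * del h 0 a) @[h --> 0^'] --> gam' a.
 have [/cvg_ex[l Hl] E] := Dg a.
 have -> : gam' a = l by rewrite -E; exact: cvg_lim.
 apply: cvg_trans Hl; apply: near_eq_cvg; near=> h.
 by rewrite /del !mxE /= [h *: _]mulr1.
pose K := 1 + \sum_a `|gam' a|.
have K0 : 0 < K by rewrite ltr_pwDl // sumr_ge0.
have Hdel : \forall h \near (0 : R)^', `|del h| <= K * `|h|.
 have : \forall h \near (0 : R)^', forall a, `|gam' a - h^-1 * del h 0 a| <= 1.
  by apply: filter_forall => a; have /cvgrPdist_le := Lg a; exact.
 apply: filter_app; near=> h => Hh.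
 have h0 : h != 0 by near: h; exact: nbhs_dnbhs_neq.
 apply: rV_norm_le => [|a]; first by rewrite mulr_ge0 // ltW.
 have : `|h^-1 * del h 0 a| <= K.
  have -> : h^-1 * del h 0 a = gam' a - (gam' a - h^-1 * del h 0 a) by ring.
  apply: le_trans (ler_normB _ _) _; rewrite addrC /K lerD //.
  by rewrite (bigD1 a) //= lerDl sumr_ge0.
 by rewrite normrM normfV ler_pdivrMl ?normr_gt0 // mulrC.
have Ldel : del h @[h --> (0 : R)^'] --> (0 : 'rV[R]_m).
 apply/cvgrPdist_le => e e0; move: Hdel; apply: filter_app; near=> h => Hh.
 rewrite sub0r normrN; apply: le_trans Hh _; rewrite mulrC -ler_pdivlMr //.
 by near: h; apply: dnbhs0_le; rewrite divr_gt0.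
have L1 : (\sum_a (h^-1 * del h 0 a) * c a) @[h --> 0^'] --> \sum_a gam' a * c a.
 apply: cvg_big => [|a _]; first exact: add_continuous.
 by apply: cvgM; [exact: Lg|exact: cvg_cst].
have L : h^-1 *: ((f \o gam \o shift t) (h *: (1 : R)) - (f \o gam) t) @[h --> 0^']
  --> \sum_a gam' a * c a.
 apply/cvgrPdist_le => e e0.
 have e20 : 0 < e / 2 by rewrite divr_gt0.
 have /cvgrPdist_le /(_ _ e20) H1 := L1.
 have H2 := Ldel _ (Hf _ (divr_gt0 e20 K0)).
 move: H1 H2 Hdel; rewrite !near_simpl; apply: filter_app3; near=> h => H1 H2 H3.
 have h0 : h != 0 by near: h; exact: nbhs_dnbhs_neq.
 move: H2; rewrite /= {1}/del addrCA subrr addr0 [h *: _]mulr1 => H2.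
 rewrite -[h^-1 *: _]/(h^-1 * _).
 set A := \sum_a gam' a * c a in H1 *.
 set B := \sum_a h^-1 * del h 0 a * c a in H1 *.
 set D := \sum_a del h 0 a * c a in H2 *.
 have EB : B = h^-1 * D by rewrite /B /D mulr_sumr; apply: eq_bigr => a _; rewrite mulrA.
 have -> : A - h^-1 * (f (gam (h + t)) - f (gam t)) =
  (A - B) - h^-1 * (f (gam (h + t)) - f (gam t) - D) by rewrite EB; ring.
 apply: le_trans (ler_normB _ _) _; rewrite [leRHS]splitr lerD //.
 rewrite normrM normfV ler_pdivrMl ?normr_gt0 //; apply: le_trans H2 _.
 rewrite mulrC -[e / 2 / K]/(e / 2 * K^-1) [leRHS]mulrC.
 apply: le_trans (ler_wpM2r _ H3) _; first by rewrite ltW // divr_gt0.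
 by rewrite le_eqVlt; apply/orP; left; apply/eqP; field; rewrite gt_eqF.
by split; [apply/cvg_ex; eexists; exact: L|exact: cvg_lim].
Unshelve. all: by end_near. Qed.

Lemma smooth_approx U f x (e : R) : open U -> U x -> smooth_on U f -> 0 < e ->
 \forall h \near (0 : 'rV[R]_m),
  `|f (x + h) - f x - \sum_a h 0 a * partial a f x| <= e * `|h|.
Proof.
move=> oU Ux sf; apply: (C1_approx oU Ux) => [a y Uy|a].
 exact: smooth_derivable sf Uy.
exact: smooth_cont (smooth_partial a sf) Ux.
Qed.

End Differentiable.

Section Chain.
Context {m l : nat}.
Variables (U : set 'rV[R]_m) (W : set 'rV[R]_l) (tau : 'rV[R]_m -> 'rV[R]_l).
Hypotheses (oU : open U) (oW : open W) (UW : forall x, U x -> W (tau x)).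
Hypothesis st : forall b, smooth_on U (fun x => tau x 0 b).

Lemma is_derive_map f a x : U x -> smooth_on W f ->
 is_derive x (dl a) (f \o tau) (\sum_b partial a (fun y => tau y 0 b) x * partial b f (tau x)).
Proof.
move=> Ux sf; apply/is_derive_line0.
apply: (@is_derive_chain l f (fun s : R => tau (x + s *: dl a)) 0
 (fun b => partial a (fun y => tau y 0 b) x) (fun b => partial b f (tau x))).
 by rewrite scale0r addr0 => e e0; apply: smooth_approx oW _ sf e0; exact: UW.
move=> b; apply/(is_derive_line0 (fun y => tau y 0 b)).
by apply: derivable_partial; exact: smooth_derivable (st b) Ux.
Qed.

Lemma partial_map f a x : U x -> smooth_on W f ->
 partial a (f \o tau) x = \sum_b partial a (fun y => tau y 0 b) x * partial b f (tau x).
Proof. by move=> Ux sf; exact/is_derive_partial/is_derive_map. Qed.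

Lemma cont_map x : U x -> {for x, continuous tau}.
Proof. by move=> Ux; apply: rV_cont => b; exact: smooth_cont (st b) Ux. Qed.

Lemma smooth_map f : smooth_on W f -> smooth_on U (f \o tau).
Proof.
move=> sf k; elim: k f sf => [|k IH] f sf.
 apply/Ck_on0 => x Ux; apply: (@continuous_comp _ _ _ tau f); first exact: cont_map.
 by apply: smooth_cont sf _; exact: UW.
apply/Ck_onS; split=> [x Ux|a].
 apply: (@continuous_comp _ _ _ tau f); first exact: cont_map.
 by apply: smooth_cont sf _; exact: UW.
split=> [x Ux|]; first by have [] := is_derive_map a Ux sf.
pose F b x := partial a (fun y => tau y 0 b) x * partial b f (tau x).
have : Ck_on k U (fun x => \sum_b F b x).
 elim: (index_enum _) => [|b r IHr].
  by apply: Ck_on_ext (Ck_cst k U 0) => // y _; rewrite big_nil.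
 have Cb : Ck_on k U (F b).
  apply: Ck_mul => //; first exact: (smooth_partial a (st b)).
  exact: IH (smooth_partial b sf).
 by apply: Ck_on_ext (Ck_add oU Cb IHr) => // y _; rewrite big_cons.
by apply: Ck_on_ext => // y Uy; rewrite -partial_map.
Qed.

End Chain.

Section Schwarz.
Context {m : nat}.
Implicit Types (f : 'rV[R]_m -> R) (U : set 'rV[R]_m) (x : 'rV[R]_m).

Lemma is_derive_shift_arg f (w x v : 'rV[R]_m) d :
 is_derive (x + w) v f d -> is_derive x v (fun y => f (y + w)) d.
Proof.
move=> /is_derive_line0 D; apply/is_derive_line0.
have -> // : (fun s : R => f (x + s *: v + w)) = (fun s => f (x + w + s *: v)).
by apply/funext => s; rewrite addrAC.
Qed.

Lemma mixed_difference U f a b x (r h : R) : smooth_on U f -> ball x r `<=` U ->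
 0 < h -> 2 * h < r ->
 exists2 xi, `|xi - x| <= 2 * h &
  f (x + h *: dl a + h *: dl b) - f (x + h *: dl a) - (f (x + h *: dl b) - f x)
   = h * (h * partial b (partial a f) xi).
Proof.
move=> sf HU h0 hr; have h1 : h <= 2 * h by lra.
have step (s t : R) : 0 <= s <= 1 -> 0 <= t <= 1 ->
  `|s *: (h *: dl a) + t *: (h *: dl b) : 'rV[R]_m| <= 2 * h.
 have H (c : R) (e : 'I_m) : 0 <= c <= 1 -> `|c *: (h *: dl e) : 'rV[R]_m| <= h.
  move=> /andP[c0 c1]; rewrite !normrZ ger0_norm // (gtr0_norm h0).
  have N := norm_dl e; rewrite -[leRHS]mul1r; apply: ler_pM => //.
   by rewrite mulr_ge0 // ltW.
  by rewrite -[leRHS]mulr1 ler_wpM2l // ltW.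
 by move=> s01 t01; apply: le_trans (ler_normD _ _) _; rewrite mulr2n mulrDl mul1r lerD ?H.
have inU (s t : R) : 0 <= s <= 1 -> 0 <= t <= 1 ->
  U (x + s *: (h *: dl a) + t *: (h *: dl b)).
 move=> s01 t01; apply: HU; rewrite -ball_normE /= -addrA opprD addNKr normrN.
 exact: le_lt_trans (step s t s01 t01) hr.
have i0 : 0 <= (0 : R) <= 1 by rewrite lexx ler01.
have i1 : 0 <= (1 : R) <= 1 by rewrite lexx ler01.
pose phi y := f (y + h *: dl b) - f y.
pose dphi y := h * (partial a f (y + h *: dl b) - partial a f y).
have [|t t01 E] := @MVT_line _ _ phi x (h *: dl a) dphi.
 move=> t t01; rewrite /dphi mulrBr; apply: is_deriveB.
  apply: is_derive_shift_arg; apply: is_derive_scaled.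
  by have := inU t 1 t01 i1; rewrite scale1r; exact: smooth_derivable.
 apply: is_derive_scaled.
 by have := inU t 0 t01 i0; rewrite scale0r addr0; exact: smooth_derivable.
have [|s s01 E'] := @MVT_line _ _ (partial a f) (x + t *: (h *: dl a)) (h *: dl b)
  (fun y => h * partial b (partial a f) y).
 move=> s s01; apply: is_derive_scaled.
 exact: smooth_derivable (smooth_partial a sf) (inU t s t01 s01).
exists (x + t *: (h *: dl a) + s *: (h *: dl b)).
 by rewrite -(addrA x) addrAC subrr add0r; exact: step.
by move: E; rewrite /phi => ->; rewrite /dphi E'.
Qed.

(** Both mixed derivatives, each taken at some point close to [x], equal the same second difference
    divided by $h^2$, which is symmetric in [a] and [b]; continuity brings them back to [x]. *)
Lemma partialC U f a b x : open U -> U x -> smooth_on U f  ->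
 partial a (partial b f) x = partial b (partial a f) x.
Proof.
move=> oU Ux sf; apply/eqP; rewrite -subr_eq0 -normr_le0; apply/ler_addgt0Pl => e e0.
rewrite addr0; have e20 : 0 < e / 2 by rewrite divr_gt0.
have sab := smooth_partial a (smooth_partial b sf).
have sba := smooth_partial b (smooth_partial a sf).
have : \forall y \near x, [/\ U y, `|partial a (partial b f) x - partial a (partial b f) y| <= e / 2
  & `|partial b (partial a f) x - partial b (partial a f) y| <= e / 2].
 apply: filterS3 (open_near oU Ux) (cont_dist (smooth_cont sab Ux) e20)
  (cont_dist (smooth_cont sba Ux) e20) => y h1 h2 h3; exact: And3.
move=> /nbhs_ballP[r /= r0 Hr].
pose h := r / 4; have h0 : 0 < h by rewrite divr_gt0.
have hr : 2 * h < r by rewrite /h; lra.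
have rU : ball x r `<=` U by move=> y /Hr[].
have [y1 By1 E1] := mixed_difference a b sf rU h0 hr.
have [y2 By2 E2] := mixed_difference b a sf rU h0 hr.
have inb y : `|y - x| <= 2 * h -> ball x r y.
 by move=> H; rewrite -ball_normE /= distrC; exact: le_lt_trans H hr.
have [_ _ H1] := Hr _ (inb _ By1); have [_ H2 _] := Hr _ (inb _ By2).
have E : partial b (partial a f) y1 = partial a (partial b f) y2.
 move: E1 E2; move: (partial b (partial a f) y1) (partial a (partial b f) y2) => P1 P2.
 rewrite (addrAC x (h *: dl a) (h *: dl b)).
 move: (f (x + h *: dl b + h *: dl a)) (f (x + h *: dl b)) (f (x + h *: dl a)) (f x).
 move=> A B C D E1 E2; apply: (mulfI (lt0r_neq0 h0)); apply: (mulfI (lt0r_neq0 h0)).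
 by rewrite -E1 -E2; ring.
rewrite E in H1; set A := partial a _ x in H2 *; set B := partial b _ x in H1 *.
set D := partial a _ y2 in H1 H2.
clearbody A B D; clear -H1 H2; have -> : A - B = (A - D) - (B - D) by ring.
by apply: le_trans (ler_normB _ _) _; rewrite [leRHS]splitr lerD.
Qed.

End Schwarz.
End Calculus2.

(** * Averages over cubes *)

Section UltraLimit.
Context {R : realType}.

(** Along an ultrafilter that contains the cofinite sets every bounded sequence has a limit,
    compatible with sums, products and inequalities. The limit [ulim] is used for Riemann sums, for
    trigonometric series and for minimizing sequences. *)
Definition uf : set_system nat := projT1 (cid (ultraFilterLemma (eventually_filter : ProperFilter \oo))).

#[global] Instance uf_ultra : UltraFilter uf.
Proof. by rewrite /uf; case: cid => F /= []. Qed.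

#[global] Instance uf_proper : ProperFilter uf.
Proof. exact: ultra_proper. Qed.

Lemma uf_eventually (P : set nat) : (\forall n \near \oo, P n) -> uf P.
Proof. by move=> H; rewrite /uf; case: cid => F /= [_ sF]; exact: sF. Qed.

Definition ulim (u : nat -> R) : R := lim (u @ uf).

Lemma ulim_cvg (u : nat -> R) (C : R) : (forall n, `|u n| <= C) -> u @ uf --> ulim u.
Proof.
move=> uC.
have [p [_ cp]] : `[- C, C]%classic `&` cluster (u @ uf) !=set0.
 apply: (@segment_compact R (- C) C); apply: filterS (filterT : uf setT) => n _ /=.
 by rewrite in_itv /= -ler_norml.
suff H : u @ uf --> p by apply: cvgP H.
move=> B pB.
have [//|nB] := in_ultra_setVsetC (u @^-1` B) uf_ultra.
by have [y [/= By nBy]] := cp (~` B) B nB pB.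
Qed.

Lemma cvg_ulim (u : nat -> R) l : u @ uf --> l -> ulim u = l.
Proof. by move=> H; apply: cvg_lim. Qed.

Lemma ulim_oo (u : nat -> R) l : u @ \oo --> l -> ulim u = l.
Proof. by move=> H; apply: cvg_ulim; apply: cvg_trans H => A; exact: uf_eventually. Qed.

Definition bds (u : nat -> R) := exists C : R, forall n, `|u n| <= C.

Lemma bds_cvg u : bds u -> u @ uf --> ulim u.
Proof. by move=> [C]; exact: ulim_cvg. Qed.

Lemma ulim_near u (e : R) : bds u -> 0 < e -> uf [set n | `|ulim u - u n| <= e].
Proof. by move=> /bds_cvg/cvgrPdist_le H e0; exact: H. Qed.

Lemma ulimD u v : bds u -> bds v -> ulim (fun n => u n + v n) = ulim u + ulim v.
Proof. by move=> /bds_cvg cu /bds_cvg cv; apply: cvg_ulim; exact: cvgD. Qed.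

Lemma ulimM u v : bds u -> bds v -> ulim (fun n => u n * v n) = ulim u * ulim v.
Proof. by move=> /bds_cvg cu /bds_cvg cv; apply: cvg_ulim; exact: cvgM. Qed.

Lemma ulim_cst (c : R) : ulim (fun=> c) = c.
Proof. by apply: cvg_ulim; exact: cvg_cst. Qed.

Lemma bds_cst (c : R) : bds (fun=> c).
Proof. by exists `|c|. Qed.

Lemma ulimZ (c : R) u : bds u -> ulim (fun n => c * u n) = c * ulim u.
Proof. by move=> bu; rewrite ulimM ?ulim_cst //; exact: bds_cst. Qed.

Lemma ulim_le_near u v : bds u -> bds v -> uf [set n | u n <= v n] -> ulim u <= ulim v.
Proof. by move=> /bds_cvg cu /bds_cvg cv H; apply: ler_cvg_to cu cv H. Qed.

Lemma ulim_le u v : bds u -> bds v -> (forall n, u n <= v n) -> ulim u <= ulim v.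
Proof. move=> bu bv H; apply: ulim_le_near => //.
by apply: (filterS _ (filterT : uf setT)) => n _; exact: H. Qed.

Lemma ulim_norm_le u (C : R) : (forall n, `|u n| <= C) -> `|ulim u| <= C.
Proof.
move=> uC; have bu : bds u by exists C.
have H n : - C <= u n <= C by rewrite -ler_norml.
rewrite ler_norml; apply/andP; split.
 rewrite -(ulim_cst (- C)); apply: ulim_le => //; [exact: bds_cst|by move=> n; have /andP[] := H n].
rewrite -[leRHS]ulim_cst; apply: ulim_le => //; [exact: bds_cst|by move=> n; have /andP[] := H n].
Qed.

Lemma bdsD u v : bds u -> bds v -> bds (fun n => u n + v n).
Proof.
move=> [C HC] [D HD]; exists (C + D) => n; apply: le_trans (ler_normD _ _) _.
by rewrite lerD.
Qed.

Lemma bdsM u v : bds u -> bds v -> bds (fun n => u n * v n).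
Proof. by move=> [C HC] [D HD]; exists (C * D) => n; rewrite normrM ler_pM. Qed.

Lemma ulim_sum (I : Type) (r : seq I) (u : I -> nat -> R) : (forall i, bds (u i)) ->
 bds (fun n => \sum_(i <- r) u i n) /\
 ulim (fun n => \sum_(i <- r) u i n) = \sum_(i <- r) ulim (u i).
Proof.
move=> bu; elim: r => [|i r [b E]].
 have -> : (fun n => \sum_(i <- [::]) u i n) = (fun=> 0) by apply/funext => n; rewrite big_nil.
 by rewrite big_nil ulim_cst; split=> //; exact: bds_cst.
have -> : (fun n => \sum_(j <- i :: r) u j n) = (fun n => u i n + \sum_(j <- r) u j n).
 by apply/funext => n; rewrite big_cons.
by rewrite big_cons ulimD // E; split=> //; exact: bdsD.
Qed.

End UltraLimit.

Section CompactBounds.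
Context {R : realType}.

Lemma continuous_bounded_on (T : topologicalType) (A : set T) (f : T -> R) : compact A ->
 (forall x, A x -> {for x, continuous f}) -> exists2 C : R, 0 <= C & forall x, A x -> `|f x| <= C.
Proof.
move=> cA cf; have wf : {within A, continuous f}.
 by apply: continuous_in_subspaceT => x; rewrite inE; exact: cf.
have [M [_ HM]] := compact_bounded (continuous_compact wf cA).
exists (`|M| + 1); first by rewrite addr_ge0.
move=> x Ax; apply: HM; first by rewrite (le_lt_trans (ler_norm M)) // ltrDl.
by exists x.
Qed.

End CompactBounds.

Section Cube.
Context {R : realType} {m : nat}.
Variables (x0 : 'rV[R]_m) (L : R).
Hypothesis L0 : 0 < L.
Implicit Types (f g : 'rV[R]_m -> R) (x y : 'rV[R]_m) (a : 'I_m).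

Definition cube : set 'rV[R]_m := [set x | forall a, x0 0 a <= x 0 a <= x0 0 a + L].

Lemma cube_compact : compact cube.
Proof.
have -> : cube = [set v : 'rV[R]_m | forall i, v ord0 i \in `[x0 0 i, x0 0 i + L]].
 by apply/seteqP; split=> x H i; have := H i; rewrite in_itv.
by apply: (@rV_compact _ _ (fun i => `[x0 0 i, x0 0 i + L]%classic)) => i; exact: segment_compact.
Qed.

Definition bdq f := exists C : R, forall x, cube x -> `|f x| <= C.

Lemma cont_bdq f : (forall x, cube x -> {for x, continuous f}) -> bdq f.
Proof. by move=> cf; have [C _ HC] := continuous_bounded_on cube_compact cf; exists C. Qed.

Lemma bdq_cst (c : R) : bdq (fun=> c).
Proof. by exists `|c|. Qed.

Lemma bdqD f g : bdq f -> bdq g -> bdq (fun x => f x + g x).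
Proof.
move=> [C HC] [D HD]; exists (C + D) => x Qx; apply: le_trans (ler_normD _ _) _.
by rewrite lerD ?HC ?HD.
Qed.

Lemma bdqM f g : bdq f -> bdq g -> bdq (fun x => f x * g x).
Proof.
by move=> [C HC] [D HD]; exists (C * D) => x Qx; rewrite normrM ler_pM ?HC ?HD.
Qed.

Lemma bdqN f : bdq f -> bdq (fun x => - f x).
Proof. by move=> [C HC]; exists C => x Qx; rewrite normrN HC. Qed.

Lemma bdq_sum (I : Type) (r : seq I) (F : I -> 'rV[R]_m -> R) : (forall i, bdq (F i)) ->
 bdq (fun x => \sum_(i <- r) F i x).
Proof.
move=> bF; elim: r => [|i r IH].
 by exists 0 => x _; rewrite big_nil normr0.
have [C HC] := bdqD (bF i) IH; exists C => x Qx; rewrite big_cons; exact: HC.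
Qed.

Lemma bdq_abs f : bdq f -> bdq (fun x => `|f x|).
Proof. by move=> [C HC]; exists C => x Qx; rewrite normr_id HC. Qed.

(** The grid has [M.+1] points in each direction and contains the lower faces but not the upper
    ones. A shift by one step therefore permutes it modulo the period [L], which is what
    [avg_partial] rests on. *)
Definition gpt (M : nat) (i : {ffun 'I_m -> 'I_M.+1}) : 'rV[R]_m :=
 \row_a (x0 0 a + L * (i a)%:R / M.+1%:R).

Definition rsum (M : nat) f : R :=
 (#|{ffun 'I_m -> 'I_M.+1}|%:R)^-1 * \sum_(i : {ffun 'I_m -> 'I_M.+1}) f (gpt i).

(* Replaces the integral over the cube: linearity, positivity and [avg_partial] are all that is
needed, so the convergence of the Riemann sums never has to be proved. *)
Definition avg f : R := ulim (fun M => rsum M f).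

Lemma card_grid_gt0 M : 0 < #|{ffun 'I_m -> 'I_M.+1}|%:R :> R.
Proof. by rewrite ltr0n card_ffun !card_ord expn_gt0. Qed.

Lemma gpt_cube M (i : {ffun 'I_m -> 'I_M.+1}) : cube (gpt i).
Proof.
move=> a; rewrite mxE lerDl lerD2l; apply/andP; split.
 by rewrite divr_ge0 // mulr_ge0 // ltW.
rewrite ler_pdivrMr ?ltr0n // ler_wpM2l ?(ltW L0) // ler_nat.
exact/ltnW/ltn_ord.
Qed.

Lemma rsum_norm M f (C : R) : (forall x, cube x -> `|f x| <= C) -> `|rsum M f| <= C.
Proof.
move=> HC; rewrite /rsum normrM gtr0_norm ?invr_gt0 ?card_grid_gt0 //.
rewrite ler_pdivrMl ?card_grid_gt0 //; apply: le_trans (ler_norm_sum _ _ _) _.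
apply: le_trans (ler_sum _ (fun i _ => HC _ (gpt_cube i))) _.
by rewrite sumr_const mulr_natl.
Qed.

Lemma rsum_bds f : bdq f -> bds (fun M => rsum M f).
Proof. by move=> [C HC]; exists C => M; exact: rsum_norm. Qed.

Lemma avgD f g : bdq f -> bdq g -> avg (fun x => f x + g x) = avg f + avg g.
Proof.
move=> bf bg; rewrite /avg -ulimD; [|exact: rsum_bds|exact: rsum_bds].
by congr ulim; apply/funext => M; rewrite /rsum big_split mulrDr.
Qed.

Lemma avgZ (c : R) f : bdq f -> avg (fun x => c * f x) = c * avg f.
Proof.
move=> bf; rewrite /avg -ulimZ; last exact: rsum_bds.
by congr ulim; apply/funext => M; rewrite /rsum -mulr_sumr mulrCA.
Qed.

Lemma avg_ext f g : (forall x, cube x -> f x = g x) -> avg f = avg g.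
Proof.
move=> fg; congr ulim; apply/funext => M; congr (_ * _); apply: eq_bigr => i _.
exact/fg/gpt_cube.
Qed.

Lemma avg_cst (c : R) : avg (fun=> c) = c.
Proof.
rewrite /avg -[RHS]ulim_cst; congr ulim; apply/funext => M.
by rewrite /rsum sumr_const -(mulr_natl c) mulrA mulVf ?mul1r // gt_eqF // card_grid_gt0.
Qed.

Lemma avg_le f g : bdq f -> bdq g -> (forall x, cube x -> f x <= g x) -> avg f <= avg g.
Proof.
move=> bf bg fg; apply: ulim_le; [exact: rsum_bds|exact: rsum_bds|move=> M].
rewrite ler_wpM2l ?invr_ge0 ?(ltW (card_grid_gt0 M)) //; apply: ler_sum => i _.
exact/fg/gpt_cube.
Qed.

Lemma avg_norm_le f (C : R) : (forall x, cube x -> `|f x| <= C) -> `|avg f| <= C.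
Proof. by move=> HC; apply: ulim_norm_le => M; exact: rsum_norm. Qed.

Lemma avg_ge0 f : bdq f -> (forall x, cube x -> 0 <= f x) -> 0 <= avg f.
Proof. by move=> bf f0; rewrite -(avg_cst 0); apply: avg_le => //; exact: bdq_cst. Qed.

Lemma avgN f : bdq f -> avg (fun x => - f x) = - avg f.
Proof.
by move=> bf; rewrite -mulN1r -avgZ //; apply: avg_ext => x _; rewrite mulN1r.
Qed.

Lemma avgB f g : bdq f -> bdq g -> avg (fun x => f x - g x) = avg f - avg g.
Proof. by move=> bf bg; rewrite avgD ?avgN //; exact: bdqN. Qed.

Lemma avg_sum (I : Type) (r : seq I) (F : I -> 'rV[R]_m -> R) : (forall i, bdq (F i)) ->
 avg (fun x => \sum_(i <- r) F i x) = \sum_(i <- r) avg (F i).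
Proof.
move=> bF; elim: r => [|i r IH].
 by rewrite big_nil; apply: etrans (avg_cst 0); apply: avg_ext => x _; rewrite big_nil.
rewrite big_cons -IH -avgD //; last exact: bdq_sum.
by apply: avg_ext => x _; rewrite big_cons.
Qed.

Lemma avg_abs_le f : bdq f -> `|avg f| <= avg (fun x => `|f x|).
Proof.
move=> bf; have ba := bdq_abs bf; rewrite ler_norml -avgN //; apply/andP; split.
 by apply: avg_le => //; [exact: bdqN|move=> x _; rewrite lerNl -normrN ler_norm].
by apply: avg_le => // x _; exact: ler_norm.
Qed.

(** With equal values on opposite faces the forward differences of [f] add up to zero over the grid,
    and each differs from $h\,\partial_af$ by $O(h^2)$. The Riemann sum is thus $O(h)$. *)
Lemma avg_partial U f a : open U -> cube `<=` U -> smooth_on U f ->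
 (forall x, cube x -> x 0 a = x0 0 a -> f (x + L *: dl a) = f x) ->
 avg (partial a f) = 0.
Proof.
move=> oU QU sf per.
have [C C0 HC] : exists2 C : R, 0 <= C & forall x, cube x -> `|partial a (partial a f) x| <= C.
 apply: continuous_bounded_on cube_compact _ => x /QU Ux.
 exact: smooth_cont (smooth_partial a (smooth_partial a sf)) Ux.
apply: ulim_oo; apply/cvgrPdist_le => e e0.
suff key M : `|rsum M (partial a f)| <= C * L / M.+1%:R.
 near=> M; rewrite sub0r normrN; apply: le_trans (key M) _.
 rewrite ler_pdivrMr ?ltr0n // -ler_pdivrMl //.
 apply: (@le_trans _ _ M%:R); last by rewrite ler_nat.
 by near: M; exact: nbhs_infty_ger.
pose h : R := L / M.+1%:R; have h0 : 0 < h by rewrite divr_gt0.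
have step (i : {ffun 'I_m -> 'I_M.+1}) (t : R) : 0 <= t <= 1 -> cube (gpt i + t *: (h *: dl a)).
 move=> /andP[t0 t1] b; rewrite !mxE eqxx /=.
 have [->|_] := eqVneq b a; last by rewrite !mulr0 addr0; have := gpt_cube i b; rewrite mxE.
 rewrite mulr1 -addrA lerDl lerD2l; apply/andP; split.
  by rewrite addr_ge0 ?mulr_ge0 ?invr_ge0 // ltW.
 apply: (@le_trans _ _ (L * (i a)%:R / M.+1%:R + h)); first by rewrite lerD2l ler_piMl // ltW.
 rewrite /h -mulrA -mulrDr -[leRHS]mulr1 ler_wpM2l ?(ltW L0) // -{2}[M.+1%:R^-1]mul1r.
 by rewrite -mulrDl ler_pdivrMr ?ltr0n // mul1r natr1 ler_nat.
have i1 : 0 <= (1 : R) <= 1 by rewrite lexx ler01.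
have est (i : {ffun 'I_m -> 'I_M.+1}) :
  `|f (gpt i + h *: dl a) - f (gpt i) - h * partial a f (gpt i)| <= C * h ^+ 2.
 have [|t t01 E] := @MVT_line _ _ f (gpt i) (h *: dl a) (fun y => h * partial a f y).
  move=> t /(step i)/QU Ut; apply: is_derive_scaled; exact: smooth_derivable sf Ut.
 rewrite E -mulrBr normrM gtr0_norm // (_ : C * h ^+ 2 = h * (h * C)); last by ring.
 rewrite ler_wpM2l ?(ltW h0) //.
 have [t0 t1] := andP t01.
 have [|s /andP[s0 s1] E'] := @MVT_line _ _ (partial a f) (gpt i) (t *: (h *: dl a))
  (fun y => t * h * partial a (partial a f) y).
  move=> s /andP[s0 s1]; rewrite (scalerA t h); apply: is_derive_scaled.
  apply: smooth_derivable (smooth_partial a sf) _; apply: QU.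
  rewrite -(scalerA t h) (scalerA s t); apply: (step i (s * t)).
  by rewrite mulr_ge0 //= mulr_ile1.
 rewrite E' normrM ger0_norm; last by rewrite mulr_ge0 // ltW.
 apply: ler_pM => //; first by rewrite mulr_ge0 // ltW.
  by rewrite ler_piMl // ltW.
 by apply: HC; rewrite (scalerA s t); apply: step; rewrite mulr_ge0 //= mulr_ile1.
(* The cyclic shift of the index along [a]; where it wraps around, [per] identifies the two opposite
   faces. *)
pose sg (i : {ffun 'I_m -> 'I_M.+1}) : {ffun 'I_m -> 'I_M.+1} :=
 [ffun b => if b == a then ordS (i b) else i b].
have sgI : injective sg.
 move=> i j /ffunP E; apply/ffunP => b; have := E b; rewrite !ffunE.
 by case: ifP => // _ /(can_inj (@ordSK _)).
have shift i : f (gpt i + h *: dl a) = f (gpt (sg i)).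
 have [lt|ge] := ltnP (i a).+1 M.+1.
  congr f; apply/rowP => b; rewrite !mxE !ffunE eqxx /=.
  have [->|_] := eqVneq b a; last by rewrite mulr0 addr0.
  by rewrite /= modn_small // mulr1 /h -[(i a).+1%:R]natr1 mulrDr mulr1 [in RHS]mulrDl addrA.
 have ia : (i a).+1 = M.+1 by apply/eqP; rewrite eqn_leq ge ltn_ord.
 rewrite -(per (gpt (sg i))); last first.
 - by rewrite mxE ffunE eqxx /= ia modnn mulr0 mul0r addr0.
 - exact: gpt_cube.
 congr f; apply/rowP => b; rewrite !mxE !ffunE eqxx /=.
 have [->|_] := eqVneq b a; last by rewrite !mulr0 !addr0.
 have iM : L * (i a)%:R / M.+1%:R + h = L.
  rewrite /h -mulrDl -{2}[L]mulr1 -mulrDr natr1 ia mulfK // pnatr_eq0 //.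
 by rewrite /= ia modnn !mulr0 mul0r addr0 !mulr1 -addrA iM.
have tot : \sum_(i : {ffun 'I_m -> 'I_M.+1}) (f (gpt i + h *: dl a) - f (gpt i)) = 0.
 rewrite sumrB (eq_bigr _ (fun i _ => shift i)).
 by rewrite [X in _ - X](reindex_inj sgI) subrr.
have B : `|h * \sum_(i : {ffun 'I_m -> 'I_M.+1}) partial a f (gpt i)|
  <= #|{ffun 'I_m -> 'I_M.+1}|%:R * (C * h ^+ 2).
 have -> : h * \sum_(i : {ffun 'I_m -> 'I_M.+1}) partial a f (gpt i) =
   - \sum_(i : {ffun 'I_m -> 'I_M.+1})
    (f (gpt i + h *: dl a) - f (gpt i) - h * partial a f (gpt i)).
  by rewrite [in RHS]sumrB tot sub0r opprK mulr_sumr.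
 rewrite normrN.
 apply: le_trans (ler_norm_sum _ _ _) _.
 apply: le_trans (ler_sum _ (fun i _ => est i)) _.
 by rewrite sumr_const mulr_natl.
rewrite /rsum normrM gtr0_norm ?invr_gt0 ?card_grid_gt0 // ler_pdivrMl ?card_grid_gt0 //.
move: B; rewrite normrM gtr0_norm // -ler_pdivlMl // => B; apply: le_trans B _.
rewrite -[C * L / _]mulrA -/h le_eqVlt; apply/orP; left; apply/eqP; field.
by rewrite gt_eqF.
Unshelve. all: by end_near. Qed.

End Cube.

(** * Fejer kernels and Parseval *)

Section Fejer.
Context {R : realType} {m : nat}.
Variables (x0 : 'rV[R]_m) (L : R).
Hypothesis L0 : 0 < L.
Implicit Types (f g phi : 'rV[R]_m -> R) (x y : 'rV[R]_m) (a : 'I_m) (k : 'I_m -> int).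
Local Notation Q := (cube x0 L).
Local Notation av := (avg x0 L).
Local Notation bd := (bdq x0 L).

Definition freq : R := 2 * pi / L.

Lemma freq_gt0 : 0 < freq.
Proof. by rewrite divr_gt0 // mulr_gt0 // pi_gt0. Qed.

Definition phase k x : R := freq * \sum_a (k a)%:~R * (x 0 a - x0 0 a).
Local Notation th := phase.

Lemma thD k l x : th (fun a => k a + l a) x = th k x + th l x.
Proof.
rewrite /th -mulrDr -big_split; congr (_ * _); apply: eq_bigr => a _ /=.
by rewrite intrD mulrDl.
Qed.

Lemma thB k l x : th (fun a => k a - l a) x = th k x - th l x.
Proof.
rewrite /th -mulrBr -sumrB; congr (_ * _); apply: eq_bigr => a _ /=.
by rewrite intrB mulrBl.
Qed.

Lemma th0 k x : (forall a, k a = 0) -> th k x = 0.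
Proof. by move=> k0; rewrite /th big1 ?mulr0 // => a _; rewrite k0 mul0r. Qed.

Lemma smooth_th U k : open U -> smooth_on U (th k).
Proof.
move=> oU; apply: smooth_scale => //; apply: smooth_sum => // a _.
apply: smooth_scale => //; apply: smooth_subr => //; first exact: smooth_coord.
exact: smooth_cst.
Qed.

Lemma partial_th k a x : partial a (th k) x = freq * (k a)%:~R.
Proof.
have dB b : derivable (fun y : 'rV[R]_m => y 0 b - x0 0 b) x (dl a).
 apply: (@smooth_derivable _ _ setT) => //.
 by apply: smooth_subr => //; [exact: openT|exact: smooth_coord|exact: smooth_cst].
have dS : derivable (fun y : 'rV[R]_m => \sum_b (k b)%:~R * (y 0 b - x0 0 b)) x (dl a).
 apply: derivable_sumI => b _; apply: derivableM' (dB b).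
 exact: (@derivable_cst R 'rV[R]_m R).
rewrite /th (partialZ _ dS); congr (_ * _).
rewrite partial_sum => [|b _]; last first.
 by apply: derivableM' (dB b); exact: (@derivable_cst R 'rV[R]_m R).
rewrite (bigD1 a) //= big1 ?addr0 => [|b ba]; rewrite (partialZ _ (dB _)).
 rewrite (@smooth_partialB _ _ setT) ?partial_coord ?partial_cst ?eqxx ?subr0 ?mulr1 //.
  exact: smooth_coord.
 exact: smooth_cst.
rewrite (@smooth_partialB _ _ setT) ?partial_coord ?partial_cst ?(negbTE ba) ?subr0 ?mulr0 //.
 exact: smooth_coord.
exact: smooth_cst.
Qed.

Lemma trig_periodZ (t : R) (z : int) :
 sin (t + z%:~R * (2 * pi)) = sin t /\ cos (t + z%:~R * (2 * pi)) = cos t.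
Proof.
have H n : forall t : R, sin (t + n%:R * (2 * pi)) = sin t /\ cos (t + n%:R * (2 * pi)) = cos t.
 elim: n => [|n IH] s; first by rewrite mul0r addr0.
 rewrite -natr1 mulrDl mul1r addrA; have -> : 2 * pi = pi *+ 2 :> R by rewrite mulr_natl.
 by rewrite sinD2pi cosD2pi -[pi *+ 2]mulr_natl.
case: (intP z) => [|n|n]; first by rewrite mul0r addr0.
 exact: H.
have [] := H n.+1 (t + (- n.+1%:Z)%:~R * (2 * pi)).
rewrite mulrNz mulNr addrNK => -> ->; by [].
Qed.

Lemma th_shift k a x : th k (x + L *: dl a) = th k x + (k a)%:~R * (2 * pi).
Proof.
rewrite /th [in LHS](eq_bigr (fun b => (k b)%:~R * (x 0 b - x0 0 b) + (k b)%:~R * (L * (b == a)%:R))).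
 rewrite big_split /= mulrDr; congr (_ + _).
 rewrite (bigD1 a) //= eqxx mulr1 big1 ?addr0 => [|b ba]; last by rewrite (negbTE ba) !mulr0.
 by rewrite /freq; field; rewrite gt_eqF.
by move=> b _; rewrite !mxE eqxx /= -mulrDr; congr (_ * _); ring.
Qed.

Lemma sin_th_shift k a x : sin (th k (x + L *: dl a)) = sin (th k x).
Proof. by rewrite th_shift; have [] := trig_periodZ (th k x) (k a). Qed.

Lemma cos_th_shift k a x : cos (th k (x + L *: dl a)) = cos (th k x).
Proof. by rewrite th_shift; have [] := trig_periodZ (th k x) (k a). Qed.

Lemma bdq_cos (h : 'rV[R]_m -> R) : bd (fun x => cos (h x)).
Proof. by exists 1 => x _; exact: cos_max. Qed.

Lemma bdq_sin (h : 'rV[R]_m -> R) : bd (fun x => sin (h x)).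
Proof. by exists 1 => x _; exact: sin_max. Qed.

Lemma partial_sin_th k a x : partial a (fun y => sin (th k y)) x = cos (th k x) * (freq * (k a)%:~R).
Proof.
have D := partial_comp1 (is_derive_sin (th k x)) (@smooth_derivable R m setT _ a x (smooth_th k openT) I).
by rewrite D partial_th.
Qed.

Lemma partial_cos_th k a x : partial a (fun y => cos (th k y)) x = - sin (th k x) * (freq * (k a)%:~R).
Proof.
have D := partial_comp1 (is_derive_cos (th k x)) (@smooth_derivable R m setT _ a x (smooth_th k openT) I).
by rewrite D partial_th.
Qed.

Lemma avg_cos k : av (fun x => cos (th k x)) = [forall a, k a == 0]%:R.
Proof.
case: forallP => [k0|/forallP/forallPn[a ka]].
 rewrite -[RHS](avg_cst x0 L); apply: avg_ext => // x _.
 by rewrite th0 ?cos0 // => a; exact/eqP/k0.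
have c0 : freq * (k a)%:~R != 0 by rewrite mulf_neq0 ?intr_eq0 // gt_eqF // freq_gt0.
apply: (mulfI c0); rewrite mulr0 -avgZ //; last exact: bdq_cos.
have := @avg_partial R m x0 L L0 setT (fun x => sin (th k x)) a openT.
have -> : partial a (fun x => sin (th k x)) = (fun x => freq * (k a)%:~R * cos (th k x)).
 by apply/funext => x; rewrite partial_sin_th mulrC.
by apply => // [|x _ _]; [apply: smooth_sin openT _; exact: smooth_th openT|exact: sin_th_shift].
Qed.

Lemma avg_sin k : av (fun x => sin (th k x)) = 0.
Proof.
have [k0|] := boolP [forall a, k a == 0].
 rewrite -[RHS](avg_cst x0 L); apply: avg_ext => // x _.
 by rewrite th0 ?sin0 // => a; exact/eqP/(forallP k0).
case/forallPn => a ka.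
have c0 : - (freq * (k a)%:~R) != 0.
 by rewrite oppr_eq0 mulf_neq0 ?intr_eq0 // gt_eqF // freq_gt0.
apply: (mulfI c0); rewrite mulr0 -avgZ //; last exact: bdq_sin.
have := @avg_partial R m x0 L L0 setT (fun x => cos (th k x)) a openT.
have -> : partial a (fun x => cos (th k x)) = (fun x => - (freq * (k a)%:~R) * sin (th k x)).
 by apply/funext => x; rewrite partial_cos_th mulrC mulrN mulNr.
by apply => // [|x _ _]; [apply: smooth_cos openT _; exact: smooth_th openT|exact: cos_th_shift].
Qed.

Lemma avg_cosB k y : av (fun x => cos (th k x - th k y)) = [forall a, k a == 0]%:R.
Proof.
have -> : av (fun x => cos (th k x - th k y)) =
  av (fun x => cos (th k y) * cos (th k x) + sin (th k y) * sin (th k x)).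
 by apply: avg_ext => // x _; rewrite cosB mulrC [X in _ + X]mulrC.
rewrite avgD //; try by apply: bdqM; [exact: bdq_cst|exact: bdq_cos].
 rewrite avgZ ?avgZ ?avg_cos ?avg_sin ?mulr0 ?addr0 //; [|exact: bdq_sin|exact: bdq_cos].
 case: forallP => [k0|_]; last by rewrite mulr0.
 by rewrite th0 ?cos0 ?mulr1 // => a; exact/eqP/k0.
by apply: bdqM; [exact: bdq_cst|exact: bdq_sin].
Qed.

Section Kernel.
Variable N : nat.
Local Notation I := {ffun 'I_m -> 'I_N.+1}.
Local Notation card := (#|{: I}|%:R : R).

Definition dk (j l : I) : 'I_m -> int := fun a => (j a)%:Z - (l a)%:Z.

(** The Fejer kernel in several variables: the squared modulus of a sum of exponentials over a box
    of frequencies, divided by the number of its terms and expanded into differences of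
    frequencies. *)
Definition fj x y : R := card^-1 * \sum_(j : I) \sum_(l : I) cos (th (dk j l) x - th (dk j l) y).

Let card_gt0 : 0 < card := @card_grid_gt0 R m N.

Lemma fj_ge0 x y : 0 <= fj x y.
Proof.
pose P (j : I) : R := th (fun a => (j a)%:Z) x - th (fun a => (j a)%:Z) y.
rewrite mulr_ge0 ?invr_ge0 ?(ltW card_gt0) //.
have -> : \sum_(j : I) \sum_(l : I) cos (th (dk j l) x - th (dk j l) y) =
  (\sum_j cos (P j)) ^+ 2 + (\sum_j sin (P j)) ^+ 2.
 rewrite !expr2 !mulr_suml -big_split; apply: eq_bigr => j _.
 rewrite !mulr_sumr -big_split; apply: eq_bigr => l _ /=.
 by rewrite -cosB /P !thB; congr cos; ring.
by rewrite addr_ge0 // sqr_ge0.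
Qed.

Lemma dk_eq0 j l : [forall a, dk j l a == 0] = (j == l).
Proof.
apply/forallP/eqP => [H|-> a]; last by rewrite /dk subrr.
by apply/ffunP => a; apply: val_inj; have := H a; rewrite subr_eq0 => /eqP [].
Qed.

Lemma bdq_fj y : bd (fun x => fj x y).
Proof.
apply: bdqM; first exact: bdq_cst.
by apply: bdq_sum => j; apply: bdq_sum => l; exact: bdq_cos.
Qed.

Lemma avg_fj y : av (fun x => fj x y) = 1.
Proof.
have bs j : bd (fun x => \sum_(l : I) cos (th (dk j l) x - th (dk j l) y)).
 by apply: bdq_sum => l; exact: bdq_cos.
rewrite avgZ //; last by apply: bdq_sum.
rewrite avg_sum // (eq_bigr (fun=> 1)) => [|j _].
 by rewrite sumr_const mulVf // gt_eqF.
rewrite avg_sum // => [|l]; last exact: bdq_cos.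
rewrite (eq_bigr (fun l => (j == l)%:R)) => [|l _]; last by rewrite avg_cosB dk_eq0.
by rewrite (bigD1 j) //= eqxx big1 ?addr0 // => l /negbTE; rewrite eq_sym => ->.
Qed.

Definition ek a : 'I_m -> int := fun b => (b == a)%:Z.

Lemma th_ek a x : th (ek a) x = freq * (x 0 a - x0 0 a).
Proof.
rewrite /th (bigD1 a) //= /ek eqxx mul1r big1 ?addr0 // => b ba.
by rewrite (negbTE ba) mul0r.
Qed.

Let cnt a (e : 'I_m -> int) : R := \sum_(j : I) \sum_(l : I) [forall b, dk j l b + e b == 0]%:R.

(** [cnt] counts pairs of frequencies whose difference is prescribed. Every [j] with [j a] nonzero
    has the partner that is smaller by one in direction [a]; the exceptional [j] are a fraction
    $1/(N+1)$ of all. *)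
Lemma count_shift a : card - card / N.+1%:R <= cnt a (fun b => - ek a b).
Proof.
have c0 : \sum_(j : I) (j a == 0)%:R = card / N.+1%:R.
 have -> : \sum_(j : I) (j a == 0)%:R = \sum_(j : I) \prod_b (if b == a then (j b == 0)%:R else 1) :> R.
  apply: eq_bigr => j _; rewrite (bigD1 a) //= eqxx big1 ?mulr1 // => b /negbTE -> //.
 rewrite -(bigA_distr_bigA (fun b (i : 'I_N.+1) => if b == a then (i == 0)%:R else 1)) /=.
 have S1 : \sum_(i : 'I_N.+1) (i == 0)%:R = 1 :> R.
  by rewrite (bigD1 (0 : 'I_N.+1)) //= big1 ?addr0 // => i /negbTE ->.
 rewrite (bigD1 a) //= eqxx S1 mul1r.
 rewrite (eq_bigr (fun=> N.+1%:R)) => [|b /negbTE ->]; last by rewrite sumr_const card_ord.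
 rewrite prodr_const card_ffun !card_ord.
 have -> : #|[pred i | i != a]| = m.-1 by rewrite cardC1 card_ord.
 case: (m) a => [[]//|m' _] /=.
 by rewrite natrX exprS mulrC mulKf // pnatr_eq0.
rewrite -c0 -[card]mulr1 -[#|_|%:R * 1]/(#|_|%:R * 1) mulr_natl -sumr_const -sumrB /cnt.
apply: ler_sum => j _; have [j0|j0] := eqVneq (j a) 0.
 by rewrite subrr; apply: sumr_ge0 => l _; rewrite ler0n.
rewrite subr0; pose l : I := [ffun b => if b == a then ord_pred (j b) else j b].
rewrite (bigD1 l) //=; apply: (@le_trans _ _ 1%:R); last first.
 rewrite -[leLHS]addr0; apply: lerD; last by apply: sumr_ge0 => ? _; rewrite ler0n.
 rewrite (_ : [forall b, _]) //; apply/forallP => b; rewrite /dk /l ffunE /ek.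
 have [->|_] := eqVneq b a; last by rewrite subrr oppr0 addr0.
 have ja : (0 < j a)%N by rewrite lt0n; apply: contraNneq j0 => H; apply/eqP/val_inj.
 rewrite /= -[X in (X.-1 %% _)%N]/(j a + N.+1)%N.
 have -> : ((j a + N.+1).-1 %% N.+1)%N = (j a).-1.
  rewrite -{1}(prednK ja) addSn /= modnDr modn_small //.
  by apply: leq_ltn_trans (leq_pred _) _; exact: ltn_ord.
 by rewrite -{1}(prednK ja) -addn1 PoszD addrAC addrK subrr.
by rewrite lexx.
Qed.

Lemma count_shift' a : card - card / N.+1%:R <= cnt a (ek a).
Proof.
apply: le_trans (count_shift a) _; rewrite /cnt exchange_big /=.
rewrite le_eqVlt; apply/orP; left; apply/eqP.
apply: eq_bigr => j _; apply: eq_bigr => l _; congr (_%:R); congr nat_of_bool.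
apply: eq_forallb => b; rewrite -oppr_eq0 /dk; congr (_ == _); ring.
Qed.

(** The kernel concentrates near [y]. Multiplication by the cosine shifts the frequencies by one in
    direction [a], and [count_shift] says that only a fraction $1/(N+1)$ of the coincidences is
    lost. *)
Lemma avg_fj_cos a y : av (fun x => fj x y * (1 - cos (freq * (x 0 a - y 0 a)))) <= N.+1%:R^-1.
Proof.
have E x : fj x y * (1 - cos (freq * (x 0 a - y 0 a))) = fj x y - card^-1 * \sum_(j : I) \sum_(l : I)
 2^-1 * (cos (th (fun b => dk j l b + ek a b) x - th (fun b => dk j l b + ek a b) y)
  + cos (th (fun b => dk j l b - ek a b) x - th (fun b => dk j l b - ek a b) y)).
 rewrite mulrBr mulr1; congr (_ - _); rewrite -mulrA; congr (_ * _).
 rewrite mulr_suml; apply: eq_bigr => j _; rewrite mulr_suml; apply: eq_bigr => l _.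
 rewrite !(thB (dk j l)) !(thD (dk j l)) !th_ek.
 set A := th _ x; set B := th _ y.
 have -> : A + freq * (x 0 a - x0 0 a) - (B + freq * (y 0 a - x0 0 a)) =
  (A - B) + freq * (x 0 a - y 0 a) by ring.
 have -> : A - freq * (x 0 a - x0 0 a) - (B - freq * (y 0 a - x0 0 a)) =
  (A - B) - freq * (x 0 a - y 0 a) by ring.
 by move: (A - B) (freq * _) => u v; rewrite cosD cosB; field.
have bc j l : bd (fun x => 2^-1 * (cos (th (fun b => dk j l b + ek a b) x - th (fun b => dk j l b + ek a b) y)
  + cos (th (fun b => dk j l b - ek a b) x - th (fun b => dk j l b - ek a b) y))).
 by apply: bdqM; [exact: bdq_cst|apply: bdqD; exact: bdq_cos].
have bj j : bd (fun x => \sum_(l : I) 2^-1 * (cos (th (fun b => dk j l b + ek a b) x - th (fun b => dk j l b + ek a b) y)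
  + cos (th (fun b => dk j l b - ek a b) x - th (fun b => dk j l b - ek a b) y))).
 by apply: bdq_sum => l.
rewrite (avg_ext L0 (g := fun x => fj x y - card^-1 * \sum_(j : I) \sum_(l : I)
 2^-1 * (cos (th (fun b => dk j l b + ek a b) x - th (fun b => dk j l b + ek a b) y)
  + cos (th (fun b => dk j l b - ek a b) x - th (fun b => dk j l b - ek a b) y)))) //.
rewrite avgB //; [|exact: bdq_fj|by apply: bdqM; [exact: bdq_cst|apply: bdq_sum => j]].
rewrite avg_fj avgZ //; last by apply: bdq_sum.
rewrite avg_sum // (eq_bigr (fun j => \sum_(l : I) 2^-1 * ([forall b, dk j l b + ek a b == 0]%:R
 + [forall b, dk j l b - ek a b == 0]%:R))); last first.
 move=> j _; rewrite avg_sum //; apply: eq_bigr => l _.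
 rewrite avgZ // ?avgD ?avg_cosB //; [exact: bdq_cos|exact: bdq_cos|].
 by apply: bdqD; exact: bdq_cos.
have -> : \sum_(j : I) \sum_(l : I) 2^-1 * ([forall b, dk j l b + ek a b == 0]%:R
 + [forall b, dk j l b - ek a b == 0]%:R) = 2^-1 * (cnt a (ek a) + cnt a (fun b => - ek a b)) :> R.
 rewrite /cnt -big_split mulr_sumr; apply: eq_bigr => j _.
 by rewrite /= -big_split mulr_sumr.
have H1 := count_shift a; have H2 := count_shift' a.
rewrite lerBlDl -lerBlDr ler_pdivlMl // mulrBr mulr1.
by move: (cnt a (ek a)) (cnt a _) (card - _) H1 H2 => c1 c2 z h1 h2; lra.
Qed.

End Kernel.

(** Vanishing on the boundary lets [phi] pass to the torus, where the trigonometric kernels live. *)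
Definition bdy0 phi := forall x, Q x -> (exists a, x 0 a = x0 0 a \/ x 0 a = x0 0 a + L) -> phi x = 0.

Lemma cos_eq1 (t : R) : `|t| <= 2 * pi -> cos t = 1 -> t = 0 \/ `|t| = 2 * pi.
Proof.
move=> tpi; rewrite -cos_norm => c1.
have [t0|t0] := eqVneq t 0; first by left.
right; apply/eqP; rewrite eq_le tpi /= leNgt; apply/negP => lt.
have : 0 < sin (`|t| / 2).
 apply: sin_gt0_pi; rewrite divr_gt0 ?normr_gt0 //= ltr_pdivrMr // mulrC //.
have : sin (`|t| / 2) ^+ 2 = 0.
 rewrite sin2cos2; have := cos_mulr2n (`|t| / 2).
 have -> : (`|t| / 2) *+ 2 = `|t| by rewrite -mulr_natr divfK.
 rewrite c1 => H; have : cos (`|t| / 2) ^+ 2 = 1 by lra.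
 by move=> ->; rewrite subrr.
by move=> /eqP; rewrite sqrf_eq0 => /eqP ->; rewrite ltxx.
Qed.

(** A replacement for the squared distance on the torus, made of the very factors that [avg_fj_cos]
    controls. *)
Definition hdist x y : R := \sum_a (1 - cos (freq * (x 0 a - y 0 a))).

Lemma hdist_ge0 x y : 0 <= hdist x y.
Proof. by apply: sumr_ge0 => a _; rewrite subr_ge0 cos_le1. Qed.

Lemma hdist_eq0 phi x y : bdy0 phi -> Q x -> Q y -> hdist x y = 0 -> phi x = phi y.
Proof.
move=> b0 Qx Qy /eqP; rewrite psumr_eq0 => [|a _]; last by rewrite subr_ge0 cos_le1.
move=> /allP H.
have Hc a : x 0 a = y 0 a \/ `|x 0 a - y 0 a| = L.
 have := H a (mem_index_enum _); rewrite /= subr_eq0 eq_sym => /eqP c1.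
 have le1 : `|x 0 a - y 0 a| <= L.
  by rewrite ler_norml; have /andP[? ?] := Qx a; have /andP[? ?] := Qy a; apply/andP; split; lra.
 have fL : freq * L = 2 * pi by rewrite /freq divfK // gt_eqF.
 have [||E|E] := @cos_eq1 (freq * (x 0 a - y 0 a)).
 - rewrite normrM gtr0_norm ?freq_gt0 // -fL ler_wpM2l // ltW // freq_gt0 //.
 - exact: c1.
 - left; apply/eqP; rewrite -subr_eq0; move/eqP: E.
  by rewrite mulf_eq0 gt_eqF ?freq_gt0.
 - right; move: E; rewrite normrM gtr0_norm ?freq_gt0 // -fL.
  by move/(mulfI _); apply; rewrite gt_eqF // freq_gt0.
have [xy|] := pselect (forall a, x 0 a = y 0 a); first by congr phi; apply/rowP.
move=> /existsNP[a xya].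
have E : `|x 0 a - y 0 a| = L by case: (Hc a).
have [/andP[xa xb] /andP[ya yb]] := (Qx a, Qy a).
rewrite !b0 //; exists a; have [d|d] := leP (y 0 a) (x 0 a).
- by move: E; rewrite ger0_norm ?subr_ge0 // => E; left; lra.
- by move: E; rewrite ltr0_norm ?subr_lt0 // => E; right; lra.
- by move: E; rewrite ger0_norm ?subr_ge0 // => E; right; lra.
- by move: E; rewrite ltr0_norm ?subr_lt0 // => E; left; lra.
Qed.

Lemma cont_hdist (z : 'rV[R]_m * 'rV[R]_m) : {for z, continuous (fun z => hdist z.1 z.2)}.
Proof.
apply: cvg_big => [|a _]; first exact: add_continuous.
apply: cvgB; first exact: cvg_cst.
apply: (@continuous_comp _ _ _ (fun z : 'rV[R]_m * 'rV[R]_m => freq * (z.1 0 a - z.2 0 a)) cos); last exact: continuous_cos.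
apply: cvgM; first exact: cvg_cst.
apply: cvgB; apply: (@cvg_comp _ _ _ _ (fun v : 'rV[R]_m => v 0 a) _ (nbhs _)).
- exact: cvg_fst.
- exact: coord_continuous.
- exact: cvg_snd.
- exact: coord_continuous.
Qed.

(** Compactness of the square of the cube. Near a pair with [hdist] zero the two values of [phi]
    agree and continuity yields the term [e]; near any other pair [hdist] is bounded below and a
    large [C] absorbs the oscillation of [phi]. Taking [C] along the filter at infinity makes one
    [C] work for all pairs. *)
Lemma vanish_modulus phi (e : R) : (forall x, Q x -> {for x, continuous phi}) -> bdy0 phi -> 0 < e ->
 exists2 C : R, 0 <= C & forall x y, Q x -> Q y -> `|phi x - phi y| <= e + C * hdist x y.
Proof.
move=> cphi b0 e0.
have [B B0 HB] := continuous_bounded_on (@cube_compact R m x0 L) cphi.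
pose Q2 : set ('rV[R]_m * 'rV[R]_m) := Q `*` Q.
have cQ2 : compact Q2 by apply: compact_setX; exact: cube_compact.
have /near_covering_withinP cov := (compact_near_coveringP Q2).1 cQ2.
have := cov R (pinfty_nbhs R) (fun C z => `|phi z.1 - phi z.2| <= e + C * hdist z.1 z.2) _.
case=> [|M [Mr HM]].
 move=> z [/= Q1 Q2z].
 have [h0|hn0] := eqVneq (hdist z.1 z.2) 0.
  have e20 : 0 < e / 2 by rewrite divr_gt0.
  have H1 := cont_dist (cphi _ Q1) e20; have H2 := cont_dist (cphi _ Q2z) e20.
  exists ([set z' : 'rV[R]_m * 'rV[R]_m | `|phi z.1 - phi z'.1| <= e / 2 /\ `|phi z.2 - phi z'.2| <= e / 2],
   [set C | 0 < C]); first split => /=.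
  - by exists ([set w | `|phi z.1 - phi w| <= e / 2], [set w | `|phi z.2 - phi w| <= e / 2]).
  - exact: nbhs_pinfty_gt.
  move=> [[z1 z2] C] [[/= d1 d2] C0] _.
  apply: (@le_trans _ _ e); last by rewrite lerDl mulr_ge0 ?hdist_ge0 // ltW.
  have E := hdist_eq0 b0 Q1 Q2z h0; rewrite -E in d2.
  have -> : phi z1 - phi z2 = (phi z.1 - phi z2) - (phi z.1 - phi z1) by ring.
  by apply: le_trans (ler_normB _ _) _; rewrite [leRHS]splitr lerD.
 have hp : 0 < hdist z.1 z.2 by rewrite lt_neqAle eq_sym hn0 hdist_ge0.
 set h := hdist z.1 z.2 in hp.
 have h20 : 0 < h / 2 by rewrite divr_gt0.
 have H := @cont_dist R _ (fun z => hdist z.1 z.2) z _ (@cont_hdist z) h20.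
 exists ([set z' : 'rV[R]_m * 'rV[R]_m | `|hdist z.1 z.2 - hdist z'.1 z'.2| <= h / 2],
  [set C | 4 * B / h < C]); first split => //=.
  by apply: nbhs_pinfty_gt; exact: num_real.
 move=> [[z1 z2] C] [/= d1 C0] [/= Q1' Q2'].
 have hz : h / 2 <= hdist z1 z2 by move: d1; rewrite -/h ler_norml => /andP[_]; lra.
 apply: (@le_trans _ _ (2 * B)).
  by apply: le_trans (ler_normB _ _) _; rewrite mulr2n mulrDl mul1r lerD ?HB.
 apply: (@le_trans _ _ (C * hdist z1 z2)); last by rewrite lerDr ltW.
 apply: (@le_trans _ _ (4 * B / h * (h / 2))).
  by rewrite le_eqVlt; apply/orP; left; apply/eqP; field; rewrite gt_eqF.
 apply: ler_pM => //; last exact: ltW.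
 - by rewrite !mulr_ge0 ?invr_ge0 // ltW.
 - exact: ltW.
exists (`|M| + 1); first by rewrite addr_ge0.
move=> x y Qx Qy; apply: (HM (`|M| + 1)) (x, y) _ => //.
by rewrite (le_lt_trans (ler_norm M)) // ltrDl.
Qed.

(** By [vanish_modulus] the error is at most $e/2$ plus $C$ times the average of the kernel against
    [hdist], and the latter is at most $m/(N+1)$ by [avg_fj_cos]. *)
Lemma fejer phi (e : R) : (forall x, Q x -> {for x, continuous phi}) -> bdy0 phi -> 0 < e ->
 \forall N \near \oo, forall y, Q y -> `|phi y - av (fun x => phi x * fj N x y)| <= e.
Proof.
move=> cphi b0 e0; have e20 : 0 < e / 2 by rewrite divr_gt0.
have [C C0 HC] := vanish_modulus cphi b0 e20.
have bphi : bd phi by exact: cont_bdq.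
near=> N => y Qy.
have bK := bdq_fj N y.
have -> : phi y - av (fun x => phi x * fj N x y) = av (fun x => (phi y - phi x) * fj N x y).
 have E : phi y = av (fun x => phi y * fj N x y) by rewrite avgZ // avg_fj mulr1.
 rewrite {1}E -avgB //.
 - by apply: avg_ext => // x _; rewrite mulrBl.
 - by apply: bdqM => //; exact: bdq_cst.
 - exact: bdqM.
have bd1 : bd (fun x => (phi y - phi x) * fj N x y).
 by apply: bdqM => //; apply: bdqD; [exact: bdq_cst|exact: bdqN].
have bh a : bd (fun x => fj N x y * (1 - cos (freq * (x 0 a - y 0 a)))).
 by apply: bdqM => //; apply: bdqD; [exact: bdq_cst|apply: bdqN; exact: bdq_cos].
have bs : bd (fun x => \sum_a fj N x y * (1 - cos (freq * (x 0 a - y 0 a)))) by apply: bdq_sum.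
apply: le_trans (avg_abs_le L0 bd1) _.
apply: (@le_trans _ _ (av (fun x => e / 2 * fj N x y
  + C * \sum_a fj N x y * (1 - cos (freq * (x 0 a - y 0 a)))))).
 apply: avg_le => //; first exact: bdq_abs.
  by apply: bdqD; apply: bdqM => //; exact: bdq_cst.
 move=> x Qx; rewrite normrM [`|fj _ _ _|]ger0_norm ?fj_ge0 // -mulr_sumr.
 rewrite -/(hdist x y) [leRHS](_ : _ = (e / 2 + C * hdist x y) * fj N x y); last by ring.
 by rewrite ler_wpM2r ?fj_ge0 // distrC HC.
rewrite avgD //; try by apply: bdqM => //; exact: bdq_cst.
rewrite (avgZ L0 (e / 2) bK) (avgZ L0 C bs) avg_fj mulr1 [leRHS]splitr lerD2l avg_sum //.
apply: (@le_trans _ _ (C * (m%:R * N.+1%:R^-1))).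
 rewrite ler_wpM2l // -[m in m%:R]card_ord mulr_natl -sumr_const ler_sum // => a _.
 exact: avg_fj_cos.
rewrite mulrA ler_pdivrMr ?ltr0n // -ler_pdivrMl //.
apply: (@le_trans _ _ N%:R); last by rewrite ler_nat.
by near: N; exact: nbhs_infty_ger.
Unshelve. all: by end_near. Qed.

Definition cco phi k := av (fun x => phi x * cos (th k x)).
Definition sco phi k := av (fun x => phi x * sin (th k x)).

Lemma avg_mul_fj phi N y : bd phi ->
 av (fun x => phi x * fj N x y) = #|{ffun 'I_m -> 'I_N.+1}|%:R^-1 *
  \sum_(j : {ffun 'I_m -> 'I_N.+1}) \sum_(l : {ffun 'I_m -> 'I_N.+1})
  (cos (th (dk j l) y) * cco phi (dk j l) + sin (th (dk j l) y) * sco phi (dk j l)).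
Proof.
move=> bphi.
have bc (k : 'I_m -> int) : bd (fun x => cos (th k y) * (phi x * cos (th k x)) + sin (th k y) * (phi x * sin (th k x))).
 by apply: bdqD; apply: bdqM; rewrite ?/bdq; [exact: bdq_cst|apply: bdqM => //; exact: bdq_cos|
  exact: bdq_cst|apply: bdqM => //; exact: bdq_sin].
have bj (j : {ffun 'I_m -> 'I_N.+1}) : bd (fun x => \sum_(l : {ffun 'I_m -> 'I_N.+1})
  (cos (th (dk j l) y) * (phi x * cos (th (dk j l) x)) + sin (th (dk j l) y) * (phi x * sin (th (dk j l) x)))).
 by apply: bdq_sum => l; exact: bc.
rewrite (avg_ext L0 (g := fun x => #|{ffun 'I_m -> 'I_N.+1}|%:R^-1 *
  \sum_(j : {ffun 'I_m -> 'I_N.+1}) \sum_(l : {ffun 'I_m -> 'I_N.+1})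
  (cos (th (dk j l) y) * (phi x * cos (th (dk j l) x)) + sin (th (dk j l) y) * (phi x * sin (th (dk j l) x))))) //.
 rewrite avgZ //; last by apply: bdq_sum.
 congr (_ * _); rewrite avg_sum //; apply: eq_bigr => j _.
 rewrite avg_sum //; apply: eq_bigr => l _.
 have bC : bd (fun x => phi x * cos (th (dk j l) x)) by apply: bdqM => //; exact: bdq_cos.
 have bS : bd (fun x => phi x * sin (th (dk j l) x)) by apply: bdqM => //; exact: bdq_sin.
 rewrite avgD ?avgZ //; by apply: bdqM => //; exact: bdq_cst.
move=> x _; rewrite /fj mulrCA; congr (_ * _).
rewrite mulr_sumr; apply: eq_bigr => j _; rewrite mulr_sumr; apply: eq_bigr => l _.
rewrite cosB; ring.
Qed.

(** As [avg] is only an ultralimit of Riemann sums, its faithfulness is drawn from Fejer's theorem: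
    [phi y] is a limit of averages of [phi] against bounded nonnegative kernels, and each of them is
    squeezed between 0 and a multiple of the average of [phi]. *)
Lemma avg_pos phi : (forall x, Q x -> {for x, continuous phi}) -> bdy0 phi ->
 (forall x, Q x -> 0 <= phi x) -> av phi = 0 -> forall x, Q x -> phi x = 0.
Proof.
move=> cphi b0 p0 a0 y Qy; apply/eqP; rewrite -normr_le0; apply/ler_addgt0Pl => e e0.
have bphi : bd phi by exact: cont_bdq.
rewrite addr0; have [N _ /(_ N (leqnn _) y Qy)] := fejer cphi b0 e0.
have bK := bdq_fj N y; have [B HB] := bK.
rewrite (_ : av _ = 0) ?subr0 //.
have bm : bd (fun x => phi x * fj N x y) := bdqM bphi bK.
apply/eqP; rewrite eq_le; apply/andP; split; last first.
 by apply: avg_ge0 => // x Qx; rewrite mulr_ge0 ?p0 ?fj_ge0.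
rewrite -(mulr0 B) -a0 -avgZ //; apply: avg_le => // [|x Qx].
 by apply: bdqM => //; exact: bdq_cst.
rewrite mulrC ler_wpM2r ?p0 //; exact: le_trans (ler_norm _) (HB x Qx).
Qed.

End Fejer.

Section Parseval.
Context {R : realType} {m : nat}.
Variables (x0 : 'rV[R]_m) (L : R).
Hypothesis L0 : 0 < L.
Implicit Types (f g phi psi : 'rV[R]_m -> R) (x y : 'rV[R]_m) (a : 'I_m) (k : 'I_m -> int).
Local Notation Q := (cube x0 L).
Local Notation av := (avg x0 L).
Local Notation bd := (bdq x0 L).
Local Notation th := (phase x0 L).
Local Notation cosc := (cco x0 L).
Local Notation sinc := (sco x0 L).
Local Notation fj := (fj x0 L).
Local Notation freq := (@freq R L).
Local Notation I N := {ffun 'I_m -> 'I_N.+1}.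
Local Notation card N := (#|{: I N}|%:R : R).

Definition wco phi k := cosc phi k ^+ 2 + sinc phi k ^+ 2.

Lemma wco_ge0 phi k : 0 <= wco phi k.
Proof. by rewrite addr_ge0 ?sqr_ge0. Qed.

Let bdp (c : R) f : bd f -> bd (fun x => c * f x).
Proof. by move=> bf; apply: bdqM => //; exact: bdq_cst. Qed.

Lemma bdq_trig phi N : bd (fun y => \sum_(j : I N) \sum_(l : I N)
  (cos (th (dk j l) y) * cosc phi (dk j l) + sin (th (dk j l) y) * sinc phi (dk j l))).
Proof.
apply: bdq_sum => j; apply: bdq_sum => l.
by apply: bdqD; apply: bdqM; [exact: bdq_cos|exact: bdq_cst|exact: bdq_sin|exact: bdq_cst].
Qed.

Lemma bdq_conv phi N : bd phi -> bd (fun y => av (fun x => phi x * fj N x y)).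
Proof.
move=> bphi; have [C HC] := bdp (card N)^-1 (bdq_trig phi N).
by exists C => y Qy; rewrite avg_mul_fj //; exact: HC.
Qed.

Lemma avg_quad_fj phi N : bd phi ->
 av (fun y => phi y * av (fun x => phi x * fj N x y)) =
 (card N)^-1 * \sum_(j : I N) \sum_(l : I N) wco phi (dk j l).
Proof.
move=> bphi.
have bC k : bd (fun x => phi x * cos (th k x)) by apply: bdqM => //; exact: bdq_cos.
have bS k : bd (fun x => phi x * sin (th k x)) by apply: bdqM => //; exact: bdq_sin.
pose F (j l : I N) y := cosc phi (dk j l) * (phi y * cos (th (dk j l) y))
 + sinc phi (dk j l) * (phi y * sin (th (dk j l) y)).
have bF j l : bd (F j l) by apply: bdqD; exact: bdp.
rewrite (avg_ext L0 (g := fun y => (card N)^-1 * \sum_(j : I N) \sum_(l : I N) F j l y)).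
 rewrite avgZ //; last by apply: bdq_sum => j; apply: bdq_sum => l.
 congr (_ * _); rewrite avg_sum //; last by move=> j; apply: bdq_sum => l.
 apply: eq_bigr => j _; rewrite avg_sum //; apply: eq_bigr => l _.
 by rewrite /F avgD ?avgZ //; exact: bdp.
move=> y _; rewrite avg_mul_fj // mulrCA; congr (_ * _).
rewrite mulr_sumr; apply: eq_bigr => j _; rewrite mulr_sumr; apply: eq_bigr => l _.
by rewrite /F; ring.
Qed.

Lemma avg_conv_fj psi N : bd psi -> av (fun y => av (fun x => psi x * fj N x y)) = av psi.
Proof.
move=> bpsi.
pose F (j l : I N) y := cosc psi (dk j l) * cos (th (dk j l) y) + sinc psi (dk j l) * sin (th (dk j l) y).
have bF j l : bd (F j l) by apply: bdqD; apply: bdp; [exact: bdq_cos|exact: bdq_sin].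
rewrite (avg_ext L0 (g := fun y => (card N)^-1 * \sum_(j : I N) \sum_(l : I N) F j l y)).
 rewrite avgZ //; last by apply: bdq_sum => j; apply: bdq_sum => l.
 rewrite avg_sum //; last by move=> j; apply: bdq_sum => l.
 rewrite (eq_bigr (fun=> av psi)).
  by rewrite sumr_const -(mulr_natl (av psi)) mulrA mulVf ?mul1r // gt_eqF // card_grid_gt0.
 move=> j _; rewrite avg_sum //.
 rewrite (eq_bigr (fun l => (j == l)%:R * av psi)).
  rewrite (bigD1 j) //= eqxx mul1r big1 ?addr0 // => l; rewrite eq_sym => /negbTE ->.
  by rewrite mul0r.
 move=> l _; rewrite /F avgD ?avgZ ?avg_cos ?avg_sin ?mulr0 ?addr0 ?dk_eq0 //; try exact: bdq_cos;
  try exact: bdq_sin; try by apply: bdp; exact: bdq_cos.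
  rewrite mulrC; have [<-|_] := eqVneq j l; last by rewrite !mul0r.
  congr (_ * _); apply: avg_ext => // x _.
  by rewrite th0 ?cos0 ?mulr1 // => a; rewrite /dk subrr.
 by apply: bdp; exact: bdq_sin.
move=> y _; rewrite avg_mul_fj //; congr (_ * _).
by apply: eq_bigr => j _; apply: eq_bigr => l _; rewrite /F; ring.
Qed.

(** Bessel's inequality for Fejer means: $\phi(x)\phi(y)\le(\phi(x)^2+\phi(y)^2)/2$ is averaged
    against a nonnegative kernel of total mass one. *)
Lemma quad_fj_le phi N : bd phi ->
 (card N)^-1 * \sum_(j : I N) \sum_(l : I N) wco phi (dk j l) <= av (fun x => phi x ^+ 2).
Proof.
move=> bphi; rewrite -avg_quad_fj //.
have b2 : bd (fun x => phi x ^+ 2) by exact: bdqM.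
have bK y : bd (fun x => fj N x y) := @bdq_fj R m x0 L N y.
have bv := bdq_conv N b2.
apply: (@le_trans _ _ (av (fun y => 2^-1 * av (fun x => phi x ^+ 2 * fj N x y) + 2^-1 * phi y ^+ 2))).
 apply: avg_le => //.
 - by apply: bdqM => //; exact: bdq_conv.
 - by apply: bdqD; exact: bdp.
 move=> y Qy; have bpk : bd (fun x => phi x * fj N x y) by exact: bdqM.
 have bpk2 : bd (fun x => phi x ^+ 2 * fj N x y) by exact: bdqM.
 have Ey : phi y ^+ 2 = av (fun x => phi y ^+ 2 * fj N x y).
  have H1 := avg_fj x0 L0 N y.
  apply: esym; apply: etrans (avgZ L0 (phi y ^+ 2) (bK y)) _.
  by rewrite H1 mulr1.
 have by2 : bd (fun x => phi y ^+ 2 * fj N x y) := bdp _ (bK y).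
 rewrite [X in _ <= _ + _ * X]Ey -(avgZ L0 _ bpk) -(avgZ L0 _ bpk2) -(avgZ L0 _ by2).
 rewrite -(avgD L0 (bdp _ bpk2) (bdp _ by2)).
 apply: avg_le => //; [exact: bdp|by apply: bdqD; exact: bdp|].
 move=> x Qx; have K0 := fj_ge0 x0 L N x y.
 have H := mulr_ge0 K0 (sqr_ge0 (phi x - phi y)).
 rewrite -subr_ge0; move: H; move: (fj N x y) (phi x) (phi y) => u v w H.
 have -> : 2^-1 * (v ^+ 2 * u) + 2^-1 * (w ^+ 2 * u) - w * (v * u) = 2^-1 * (u * (v - w) ^+ 2) by field.
 by rewrite mulr_ge0.
rewrite avgD //; try exact: bdp.
by rewrite (avgZ L0 _ bv) (avgZ L0 _ b2) avg_conv_fj //; move: (av _) => u; lra.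
Qed.

(** The direction opposite to [quad_fj_le]: by [fejer], $\phi^2$ is uniformly close to the product
    of $\phi$ with its Fejer mean. *)
Lemma parseval_le phi (B : R) : (forall x, Q x -> {for x, continuous phi}) -> bdy0 x0 L phi ->
 (forall N, (card N)^-1 * \sum_(j : I N) \sum_(l : I N) wco phi (dk j l) <= B) ->
 av (fun x => phi x ^+ 2) <= B.
Proof.
move=> cphi b0 H; have bphi : bd phi by exact: cont_bdq.
have [C HC] := bphi; apply/ler_addgt0Pl => e e0.
pose D := `|C| + 1; have D0 : 0 < D by rewrite ltr_wpDl.
have [N _ /(_ N (leqnn _)) HN] := fejer L0 cphi b0 (divr_gt0 e0 D0).
have bc := bdq_conv N bphi; have b2 : bd (fun x => phi x ^+ 2) by exact: bdqM.
have bpc : bd (fun y => phi y * av (fun x => phi x * fj N x y)) by exact: bdqM.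
apply: le_trans (lerD (lexx e) (H N)); rewrite -avg_quad_fj // -lerBlDr -avgB //.
apply: le_trans (ler_norm _) _; apply: avg_norm_le => // y Qy.
rewrite expr2 -mulrBr normrM; apply: (@le_trans _ _ (D * (e / D))).
 apply: ler_pM => //; last exact: HN.
 by apply: le_trans (HC y Qy) _; apply: le_trans (ler_norm C) _; rewrite lerDl.
by rewrite mulrC divfK // gt_eqF.
Qed.

Section Derivative.
Variables (U : set 'rV[R]_m) (phi : 'rV[R]_m -> R).
Hypotheses (oU : open U) (QU : Q `<=` U) (sphi : smooth_on U phi) (b0 : bdy0 x0 L phi).

Let bphi : bd phi.
Proof. by apply: cont_bdq => x /QU; exact: smooth_cont. Qed.

Let bdphi a : bd (partial a phi).
Proof. by apply: cont_bdq => x /QU; exact: smooth_cont (smooth_partial a sphi). Qed.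

Lemma bdy0_face a x : Q x -> x 0 a = x0 0 a -> phi (x + L *: dl a) = phi x.
Proof.
move=> Qx xa; rewrite !b0 //; [by exists a; left| |by exists a; right; rewrite !mxE !eqxx xa mulr1].
move=> b; rewrite !mxE eqxx /=; have [->|_] := eqVneq b a; last by rewrite mulr0 addr0; exact: Qx.
by rewrite xa mulr1 lexx lerDl ltW.
Qed.

Lemma cco_partial a k : cosc (partial a phi) k = freq * (k a)%:~R * sinc phi k.
Proof.
have bC : bd (fun x => partial a phi x * cos (th k x)) by apply: bdqM => //; exact: bdq_cos.
have bS : bd (fun x => phi x * sin (th k x)) by apply: bdqM => //; exact: bdq_sin.
have H := @avg_partial R m x0 L L0 U (fun x => phi x * cos (th k x)) a oU QU _ _.
have sth := smooth_cos oU (smooth_th x0 L k oU).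
have := H (smooth_mul oU sphi sth) _; rewrite /cco /sco.
rewrite (avg_ext L0 (g := fun x => partial a phi x * cos (th k x)
 + (- (freq * (k a)%:~R)) * (phi x * sin (th k x)))); last first.
 move=> x /QU Ux; rewrite (smooth_partialM a sphi sth Ux) partial_cos_th; ring.
rewrite avgD ?avgZ // => [E|]; last exact: bdp.
apply/eqP; rewrite -subr_eq0 -mulNr; apply/eqP; apply: E => x Qx xa.
by rewrite bdy0_face // cos_th_shift.
Qed.

Lemma sco_partial a k : sinc (partial a phi) k = - (freq * (k a)%:~R * cosc phi k).
Proof.
have bC : bd (fun x => partial a phi x * sin (th k x)) by apply: bdqM => //; exact: bdq_sin.
have bS : bd (fun x => phi x * cos (th k x)) by apply: bdqM => //; exact: bdq_cos.
have H := @avg_partial R m x0 L L0 U (fun x => phi x * sin (th k x)) a oU QU _ _.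
have sth := smooth_sin oU (smooth_th x0 L k oU).
have := H (smooth_mul oU sphi sth) _; rewrite /cco /sco.
rewrite (avg_ext L0 (g := fun x => partial a phi x * sin (th k x)
 + freq * (k a)%:~R * (phi x * cos (th k x)))); last first.
 move=> x /QU Ux; rewrite (smooth_partialM a sphi sth Ux) partial_sin_th; ring.
rewrite avgD ?avgZ // => [E|]; last exact: bdp.
apply/eqP; rewrite -subr_eq0 opprK; apply/eqP; apply: E => x Qx xa.
by rewrite bdy0_face // sin_th_shift.
Qed.

Lemma wco_partial a k : wco (partial a phi) k = (freq * (k a)%:~R) ^+ 2 * wco phi k.
Proof. by rewrite /wco cco_partial sco_partial; ring. Qed.

Variable K : nat.
Hypothesis K0 : (0 < K)%N.

Definition kbox (i : {ffun 'I_m -> 'I_(K + K).+1}) : 'I_m -> int := fun a => (i a)%:Z - K%:Z.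

(** Outside the box some $|k_a|$ exceeds [K], and [wco_partial] then bounds the weight of that
    frequency by the weight in the derivative along [a]. *)
Lemma low_high k :
 wco phi k <= (\sum_(i : {ffun 'I_m -> 'I_(K + K).+1}) [forall a, k a == kbox i a]%:R * wco phi (kbox i))
 + (freq * K%:R) ^- 2 * \sum_a wco (partial a phi) k.
Proof.
have fK : 0 < freq * K%:R by rewrite mulr_gt0 ?freq_gt0 ?ltr0n.
have [kK|] := boolP [forall a, `|k a|%N <= K]%N.
 pose i : {ffun 'I_m -> 'I_(K + K).+1} := [ffun a => inord (absz (k a + K%:Z))].
 have ki : k = kbox i.
  apply/funext => a; rewrite /kbox ffunE inordK; last first.
   by have := forallP kK a; lia.
  by have := forallP kK a; lia.
 rewrite (bigD1 i) //= (_ : [forall a, _]) ?mul1r; last by apply/forallP => a; rewrite {1}ki.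
 rewrite -addrA -ki lerDl addr_ge0 //.
  by apply: sumr_ge0 => j _; rewrite mulr_ge0 ?wco_ge0.
 by rewrite mulr_ge0 ?invr_ge0 ?sqr_ge0 //; apply: sumr_ge0 => a _; exact: wco_ge0.
case/forallPn => a; rewrite -ltnNge => ka.
rewrite -[leLHS]add0r; apply: lerD.
 by apply: sumr_ge0 => j _; rewrite mulr_ge0 ?wco_ge0.
rewrite ler_pdivlMl ?exprn_gt0 // (bigD1 a) //= -[leLHS]addr0; apply: lerD; last first.
 by apply: sumr_ge0 => b _; exact: wco_ge0.
rewrite wco_partial ler_wpM2r ?wco_ge0 // [leLHS]exprMn [leRHS]exprMn ler_wpM2l ?sqr_ge0 //.
rewrite -[leRHS]real_normK ?num_real // lerXn2r ?nnegrE //.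
by rewrite -intr_norm -[K%:R]/(K%:Z%:~R) ler_int; lia.
Qed.

(** The quantitative core of Rellich's lemma: up to a small multiple of the Dirichlet integral, the
    mean square is controlled by finitely many Fourier coefficients. *)
Lemma rellich_cube : av (fun x => phi x ^+ 2) <=
 (\sum_(i : {ffun 'I_m -> 'I_(K + K).+1}) wco phi (kbox i))
 + (freq * K%:R) ^- 2 * \sum_a av (fun x => partial a phi x ^+ 2).
Proof.
apply: parseval_le => // [x /QU|N]; first exact: smooth_cont.
have c0 := @card_grid_gt0 R m N.
apply: (@le_trans _ _ ((card N)^-1 * \sum_(j : I N) \sum_(l : I N)
 ((\sum_(i : {ffun 'I_m -> 'I_(K + K).+1}) [forall a, dk j l a == kbox i a]%:R * wco phi (kbox i))
 + (freq * K%:R) ^- 2 * \sum_a wco (partial a phi) (dk j l)))).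
 rewrite ler_wpM2l ?invr_ge0 ?(ltW c0) //; apply: ler_sum => j _; apply: ler_sum => l _.
 exact: low_high.
rewrite (eq_bigr (fun j => (\sum_(l : I N) \sum_(i : {ffun 'I_m -> 'I_(K + K).+1})
  [forall a, dk j l a == kbox i a]%:R * wco phi (kbox i))
 + (freq * K%:R) ^- 2 * \sum_a \sum_(l : I N) wco (partial a phi) (dk j l))); last first.
 by move=> j _; rewrite big_split /= -mulr_sumr [X in _ + _ * X]exchange_big.
rewrite big_split /= -mulr_sumr [X in _ + _ * X]exchange_big mulrDr; apply: lerD.
 rewrite ler_pdivrMl // mulr_natl -sumr_const; apply: ler_sum => j _.
 rewrite exchange_big; apply: ler_sum => i _ /=; rewrite -mulr_suml -[leRHS]mul1r.
 rewrite ler_wpM2r ?wco_ge0 //.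
 (* For fixed [j] a given frequency of the box is a difference [dk j l] for at most one [l]. *)
 have [/existsP[l0 /forallP E]|] := boolP [exists l : I N, [forall a, dk j l a == kbox i a]].
  rewrite (bigD1 l0) //= (_ : [forall a, _]); last exact/forallP.
  rewrite big1 ?addr0 // => l ll0; case: forallP => // E'.
  case/eqP: ll0; apply/ffunP => a; apply: val_inj.
  have := etrans (eqP (E' a)) (esym (eqP (E a))); rewrite /dk.
  by move=> /addrI/oppr_inj[].
 move=> /existsPn E; rewrite big1 ?ler01 // => l _.
 by rewrite (negbTE (E l)).
rewrite mulrCA ler_wpM2l ?invr_ge0 ?sqr_ge0 // mulr_sumr; apply: ler_sum => a _.
exact: quad_fj_le.
Qed.

End Derivative.
End Parseval.

(** * Weyl's lemma *)

Lemma dist_cont (R : realType) (T : topologicalType) (f : T -> R) (x : T) :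
 (forall e : R, 0 < e -> \forall y \near x, `|f x - f y| <= e) -> {for x, continuous f}.
Proof. by move=> H; apply/cvgrPdist_le. Qed.

Section PosDef.
Context {R : realType} {m : nat}.
Implicit Types (x v : 'rV[R]_m).

Definition sqn v : R := \sum_a v 0 a ^+ 2.

Lemma sqn_ge0 v : 0 <= sqn v.
Proof. by apply: sumr_ge0 => a _; exact: sqr_ge0. Qed.

Lemma sqn_eq0 v : (sqn v == 0) = (v == 0).
Proof.
apply/idP/eqP => [|->]; last by rewrite /sqn big1 // => a _; rewrite mxE expr0n.
rewrite psumr_eq0 => [/allP H|a _]; last exact: sqr_ge0.
by apply/rowP => a; rewrite mxE; apply/eqP; rewrite -sqrf_eq0; exact: H (mem_index_enum a).
Qed.

Lemma sqn_coord v a : v 0 a ^+ 2 <= sqn v.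
Proof. by rewrite /sqn (bigD1 a) //= lerDl; apply: sumr_ge0 => b _; exact: sqr_ge0. Qed.

Lemma cont_sqn : continuous sqn.
Proof.
move=> v; apply: (@smooth_cont R m setT sqn v) => //.
apply: smooth_sum => [|a _]; first exact: openT.
by apply: smooth_mul; [exact: openT|exact: smooth_coord|exact: smooth_coord].
Qed.

Lemma sphere_compact : compact [set v : 'rV[R]_m | sqn v = 1].
Proof.
apply: bounded_closed_compact.
 exists 1; split=> // M M1 v /= v1; apply: ltW; apply: le_lt_trans M1.
 apply: rV_norm_le => // a; rewrite -(@ler_pXn2r _ 2) ?nnegrE // expr1n real_normK ?num_real //.
 by rewrite -v1 sqn_coord.
rewrite (_ : [set v | _] = sqn @^-1` [set 1]); last by [].
by apply: closed_comp => [v _|]; [exact: cont_sqn|exact: closed_eq].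
Qed.

(** The constant is the minimum of the form on the product of [Q] with the unit sphere. *)
Lemma posdef_lower (Q : set 'rV[R]_m) (A : 'I_m -> 'I_m -> 'rV[R]_m -> R) :
 compact Q -> (forall a b x, Q x -> {for x, continuous (A a b)}) ->
 (forall x v, Q x -> v != 0 -> 0 < \sum_a \sum_b A a b x * v 0 a * v 0 b) ->
 exists2 c : R, 0 < c & forall x v, Q x -> c * sqn v <= \sum_a \sum_b A a b x * v 0 a * v 0 b.
Proof.
move=> cQ cA pA; pose F (z : 'rV[R]_m * 'rV[R]_m) := \sum_a \sum_b A a b z.1 * z.2 0 a * z.2 0 b.
pose K := Q `*` [set v : 'rV[R]_m | sqn v = 1].
have cF z : K z -> {for z, continuous F}.
 move=> [Qz _]; apply: cvg_big => [|a _]; first exact: add_continuous.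
 apply: cvg_big => [|b _]; first exact: add_continuous.
 apply: cvgM; first apply: cvgM.
 - apply: (@cvg_comp _ _ _ (fun z : 'rV[R]_m * 'rV[R]_m => z.1) (A a b) _ (nbhs z.1)); first exact: cvg_fst.
  exact: cA.
 - apply: (@cvg_comp _ _ _ (fun z : 'rV[R]_m * 'rV[R]_m => z.2) (fun v : 'rV[R]_m => v 0 a) _ (nbhs z.2)); first exact: cvg_snd.
  exact: coord_continuous.
 - apply: (@cvg_comp _ _ _ (fun z : 'rV[R]_m * 'rV[R]_m => z.2) (fun v : 'rV[R]_m => v 0 b) _ (nbhs z.2)); first exact: cvg_snd.
  exact: coord_continuous.
have cK : compact K by apply: compact_setX => //; exact: sphere_compact.
have unit1 x v : v != 0 -> exists2 t : R, t ^+ 2 = sqn v & exists2 u, sqn u = 1 & v = t *: u.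
 move=> v0; have p : 0 < sqn v by rewrite lt_neqAle eq_sym sqn_eq0 v0 sqn_ge0.
 pose t := Num.sqrt (sqn v); have t0 : t != 0 by rewrite sqrtr_eq0 -ltNge.
 have t2 : t ^+ 2 = sqn v by rewrite sqr_sqrtr // sqn_ge0.
 exists t => //; exists (t^-1 *: v); last by rewrite scalerA mulfV // scale1r.
 rewrite /sqn (eq_bigr (fun a => t ^- 2 * v 0 a ^+ 2)) => [|a _]; last by rewrite mxE exprMn exprVn.
 by rewrite -mulr_sumr -/(sqn v) -t2 mulVf // expf_neq0.
have F0 x : \sum_a \sum_b A a b x * (0 : 'rV[R]_m) 0 a * (0 : 'rV[R]_m) 0 b = 0.
 by rewrite big1 // => a _; rewrite big1 // => b _; rewrite !mxE !mulr0.
(* The product is empty if [Q] is empty or the dimension is 0; only the zero vector is left and any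
   constant serves. *)
have [K0|nK] := pselect (K !=set0); last first.
 exists 1 => // x v Qx; have [->|/(unit1 x)[t _ [u u1 _]]] := eqVneq v 0.
  by rewrite F0 (_ : sqn 0 = 0) ?mulr0 //; apply/eqP; rewrite sqn_eq0.
 by case: nK; exists (x, u).
have wF : {within K, continuous F}.
 by apply: continuous_in_subspaceT => z; rewrite inE; exact: cF.
have [z0 /set_mem[Qz0 z01] Hz0] := compact_EVT_min K0 cK wF.
have z0n : z0.2 != 0 by rewrite -sqn_eq0 z01 oner_eq0.
exists (F z0); first exact: pA.
move=> x v Qx; have [->|/(unit1 x)[t t2 [u u1 ->]]] := eqVneq v 0.
 by rewrite F0 (_ : sqn 0 = 0) ?mulr0 //; apply/eqP; rewrite sqn_eq0.
have E : \sum_a \sum_b A a b x * (t *: u) 0 a * (t *: u) 0 b = F (x, u) * t ^+ 2.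
 rewrite /F mulr_suml; apply: eq_bigr => a _; rewrite mulr_suml; apply: eq_bigr => b _.
 by rewrite !mxE /=; ring.
have -> : sqn (t *: u) = t ^+ 2.
 rewrite -[RHS]mul1r -u1 /sqn mulr_suml; apply: eq_bigr => a _; rewrite mxE; ring.
by rewrite E ler_wpM2r ?sqr_ge0 //; apply: Hz0; rewrite inE.
Qed.

End PosDef.

(** * Trigonometric series with rapidly decreasing coefficients *)

Section TrigSeries.
Context {R : realType} {m : nat}.
Variables (x0 : 'rV[R]_m) (L : R).
Hypothesis L0 : 0 < L.
Implicit Types (x y : 'rV[R]_m) (a : 'I_m) (k : 'I_m -> int) (c d : ('I_m -> int) -> R).
Local Notation th := (phase x0 L).
Local Notation freq := (@freq R L).
Local Notation I N := {ffun 'I_m -> 'I_N.+1}.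
Local Notation card N := (#|{: I N}|%:R : R).

Definition kn k : R := 1 + \sum_a `|(k a)%:~R|.

Lemma kn_ge1 k : 1 <= kn k.
Proof. by rewrite lerDl; apply: sumr_ge0 => a _. Qed.

Lemma kn_gt0 k : 0 < kn k.
Proof. exact: lt_le_trans (kn_ge1 k). Qed.

Lemma kn_coord k a : `|(k a)%:~R : R| <= kn k.
Proof.
rewrite /kn (bigD1 a) //= addrCA lerDl addr_ge0 //.
by apply: sumr_ge0 => b _.
Qed.

Definition rapid c := forall N : nat, exists C : R, forall k, `|c k| <= C * kn k ^- N.

Lemma rapid_mulk c a (e : R) : rapid c -> rapid (fun k => e * (k a)%:~R * c k).
Proof.
move=> rc N; have [C HC] := rc N.+1; exists (`|e| * C) => k.
rewrite !normrM -!mulrA ler_wpM2l //.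
apply: le_trans (ler_pM _ _ (kn_coord k a) (HC k)) _ => //.
rewrite mulrCA ler_wpM2l //.
 have := le_trans (normr_ge0 _) (HC k); rewrite pmulr_lge0 // invr_gt0 exprn_gt0 // kn_gt0 //.
by rewrite exprS invfM mulrA mulfV ?mul1r // gt_eqF // kn_gt0.
Qed.

(** Fejer means of the series instead of ordinary partial sums, to match the shape of [avg_mul_fj]
    in the proof of [weyl]. *)
Definition tser c d (N : nat) x : R := (card N)^-1 * \sum_(j : I N) \sum_(l : I N)
 (c (dk j l) * cos (th (dk j l) x) + d (dk j l) * sin (th (dk j l) x)).

Lemma inv_sqr_le (t : R) : 0 <= t -> (1 + (t + 1) ^+ 2)^-1 <= 3 / (t + 1) - 3 / (t + 1 + 1).
Proof.
move=> t0; have p1 : 0 < t + 1 by rewrite ltr_wpDl.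
have p2 : 0 < t + 1 + 1 by rewrite ltr_wpDl // ltW.
have p3 : 0 < 1 + (t + 1) ^+ 2 by rewrite ltr_pwDl ?sqr_ge0.
have -> : 3 / (t + 1) - 3 / (t + 1 + 1) = 3 / ((t + 1) * (t + 1 + 1)).
 by field; rewrite (gt_eqF p1) (gt_eqF p2).
rewrite ler_pdivlMr ?mulr_gt0 // mulrC ler_pdivrMr //; nra.
Qed.

(** The increments of the potential [H] dominate the terms. It climbs to 3 at $i=j$, gains 1 there,
    and then stays below 7; hence the bound, uniform in [M] and in [j]. *)
Lemma sum_inv_sqr (M j : nat) : \sum_(i < M) (1 + (j%:R - i%:R : R) ^+ 2)^-1 <= 7.
Proof.
pose H (i : nat) : R := if (i <= j)%N then 3 / (j - i).+1%:R else 7 - 3 / (i - j)%N%:R.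
have step i : (1 + (j%:R - i%:R : R) ^+ 2)^-1 <= H i.+1 - H i.
 rewrite /H; case: (ltngtP i j) => ij.
 - have [n nE] : exists n, (j - i)%N = n.+1 by exists (j - i).-1; rewrite prednK // subn_gt0.
  have -> : (j - i.+1)%N = n by lia.
  have -> : j%:R - i%:R = n.+1%:R :> R by rewrite -natrB ?nE // ltnW.
  rewrite nE -[n.+2%:R]natr1 -[n.+1%:R]natr1; have n0 : 0 <= n%:R :> R by [].
  by move: (n%:R) n0 => t t0; have := inv_sqr_le t0; rewrite ?sqrrN; lra.
 - have [n nE] : exists n, (i - j)%N = n.+1 by exists (i - j).-1; rewrite prednK // subn_gt0.
  have -> : (i.+1 - j)%N = n.+2 by lia.
  have -> : j%:R - i%:R = - n.+1%:R :> R by rewrite -nE natrB ?opprB // ltnW.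
  rewrite nE -!natr1; have n0 : 0 <= n%:R :> R by [].
  by move: (n%:R) n0 => t t0; have := inv_sqr_le t0; rewrite ?sqrrN; lra.
 - by rewrite ij subSn // subnn subrr expr0n addr0 invr1; lra.
have h : \sum_(i < M) (1 + (j%:R - i%:R : R) ^+ 2)^-1 <= \sum_(i < M) (H i.+1 - H i).
 by apply: ler_sum => i _; exact: step.
apply: le_trans h _.
rewrite -(big_mkord xpredT (fun i => H i.+1 - H i)) telescope_sumr // lerBlDr.
have H0 : 0 <= H 0%N by rewrite /H leq0n divr_ge0.
apply: (@le_trans _ _ 7); last by rewrite lerDl.
rewrite /H; case: ifP => _; last by rewrite gerBl divr_ge0.
rewrite ler_pdivrMr ?ltr0n // -[leLHS]mulr1; apply: ler_pM => //; first lra.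
by rewrite ler1n.
Qed.

(** Decay of order [2 * m] is enough, since it is dominated by $\prod_a(1+k_a^2)^{-1}$. For fixed
    [j] the sum over [l] then factors into one-dimensional sums, each at most 7 by [sum_inv_sqr]. *)
Lemma tser_bounded c d : rapid c -> rapid d ->
 exists C : R, forall N x, `|tser c d N x| <= C.
Proof.
move=> rc rd; have [C HC] := rc (2 * m)%N; have [D HD] := rd (2 * m)%N.
have CD0 : 0 <= C + D.
 rewrite addr_ge0 //.
  by have := le_trans (normr_ge0 _) (HC (fun=> 0)); rewrite pmulr_lge0 // invr_gt0 exprn_gt0 // kn_gt0.
 by have := le_trans (normr_ge0 _) (HD (fun=> 0)); rewrite pmulr_lge0 // invr_gt0 exprn_gt0 // kn_gt0.
have knP k : kn k ^- (2 * m) <= \prod_a (1 + (k a)%:~R ^+ 2)^-1.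
 rewrite prodfV lef_pV2 ?posrE ?exprn_gt0 ?kn_gt0 //; last first.
  by apply: prodr_gt0 => a _; rewrite ltr_pwDl ?sqr_ge0.
 rewrite exprM -[m in X in _ <= X](card_ord m) -prodr_const; apply: ler_prod => a _.
 rewrite addr_ge0 ?sqr_ge0 //=.
 have := kn_coord k a; have := kn_ge1 k => k1 ka.
 have h : 1 + `|(k a)%:~R : R| <= kn k.
  by rewrite /kn lerD2l (bigD1 a) //= lerDl; apply: sumr_ge0 => b _.
 rewrite -[(k a)%:~R ^+ 2]real_normK ?num_real //.
 apply: (@le_trans _ _ ((1 + `|(k a)%:~R|) ^+ 2)); last first.
  by apply: lerXn2r; [rewrite nnegrE addr_ge0|rewrite nnegrE ltW // kn_gt0|exact: h].
 by rewrite sqrrD expr1n mul1r -addrA lerD2l lerDr mulrn_wge0.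
exists ((C + D) * 7 ^+ m) => N x; rewrite /tser normrM gtr0_norm ?invr_gt0 ?card_grid_gt0 //.
rewrite ler_pdivrMl ?card_grid_gt0 // mulr_natl -sumr_const.
apply: le_trans (ler_norm_sum _ _ _) _; apply: ler_sum => j _.
apply: le_trans (ler_norm_sum _ _ _) _.
apply: (@le_trans _ _ (\sum_(l : I N) (C + D) * \prod_a (1 + ((j a)%:R - (l a)%:R) ^+ 2)^-1)).
 apply: ler_sum => l _; apply: le_trans (ler_normD _ _) _.
 rewrite !normrM; apply: (@le_trans _ _ (C * kn (dk j l) ^- (2 * m) + D * kn (dk j l) ^- (2 * m))).
  apply: lerD.
   by apply: le_trans (HC (dk j l)); rewrite ler_piMr // cos_max.
  by apply: le_trans (HD (dk j l)); rewrite ler_piMr // sin_max.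
 rewrite -mulrDl ler_wpM2l //; apply: le_trans (knP _) _.
 rewrite le_eqVlt; apply/orP; left; apply/eqP; apply: eq_bigr => a _.
 by rewrite /dk intrB.
rewrite -mulr_sumr ler_wpM2l //.
rewrite -(bigA_distr_bigA (fun a (i : 'I_N.+1) => (1 + ((j a)%:R - i%:R : R) ^+ 2)^-1)) /=.
rewrite -[m in X in _ <= X](card_ord m) -prodr_const; apply: ler_prod => a _.
rewrite sum_inv_sqr andbT; apply: sumr_ge0 => i _.
by rewrite invr_ge0 addr_ge0 ?sqr_ge0.
Qed.

Lemma smooth_tser c d N : smooth_on setT (tser c d N).
Proof.
have oT : open (@setT 'rV[R]_m) := openT.
apply: smooth_scale => //; apply: smooth_sum => // j _; apply: smooth_sum => // l _.
apply: smooth_add => //; apply: smooth_scale => //; [apply: smooth_cos|apply: smooth_sin] => //;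
 exact: smooth_th.
Qed.

Lemma partial_tser c d N a x : partial a (tser c d N) x =
 tser (fun k => freq * (k a)%:~R * d k) (fun k => (- freq) * (k a)%:~R * c k) N x.
Proof.
have oT : open (@setT 'rV[R]_m) := openT.
have dc k : derivable (fun y => cos (th k y)) x (dl a).
 exact: smooth_derivable (smooth_cos oT (smooth_th x0 L k oT)) Logic.I.
have ds k : derivable (fun y => sin (th k y)) x (dl a).
 exact: smooth_derivable (smooth_sin oT (smooth_th x0 L k oT)) Logic.I.
have dC (e : R) f : derivable f x (dl a) -> derivable (fun y => e * f y) x (dl a).
 by move=> df; apply: derivableM' df; exact: (@derivable_cst R 'rV[R]_m R).
have dt j l : derivable (fun y => c (@dk m N j l) * cos (th (dk j l) y) + d (dk j l) * sin (th (dk j l) y)) x (dl a).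
 by apply: derivableD'; apply: dC.
have dj j : derivable (fun y => \sum_(l : I N) (c (dk j l) * cos (th (dk j l) y) + d (dk j l) * sin (th (dk j l) y))) x (dl a).
 by apply: derivable_sumI => l _; exact: dt.
rewrite /tser partialZ; last by apply: derivable_sumI => j _; exact: dj.
congr (_ * _); rewrite partial_sum => [|j _]; last exact: dj.
apply: eq_bigr => j _; rewrite partial_sum => [|l _]; last exact: dt.
apply: eq_bigr => l _; rewrite partialD; [|exact: dC|exact: dC].
rewrite (partialZ _ (dc _)) (partialZ _ (ds _)) partial_cos_th partial_sin_th.
move: (c _) (d _) (cos _) (sin _) => *; ring.
Qed.

Definition tlim c d x : R := ulim (fun N => tser c d N x).

Lemma tser_bds c d x : rapid c -> rapid d -> bds (fun N => tser c d N x).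
Proof. by move=> rc rd; have [C HC] := tser_bounded rc rd; exists C. Qed.

Let dcs c d a := (fun k => freq * (k a)%:~R * d k, fun k => (- freq) * (k a)%:~R * c k).

Lemma tser_lipschitz c d : rapid c -> rapid d ->
 exists2 C : R, 0 <= C & forall N x y, `|tser c d N x - tser c d N y| <= C * `|x - y|.
Proof.
move=> rc rd.
have H a : exists2 C : R, 0 <= C & forall N x, `|partial a (tser c d N) x| <= C.
 have [C HC] := tser_bounded (rapid_mulk a freq rd) (rapid_mulk a (- freq) rc).
 exists C; first exact: le_trans (normr_ge0 _) (HC 0%N x0).
 by move=> N x; rewrite partial_tser.
have {}H a := cid2 (H a).
exists (\sum_a projT1 (H a)); first by apply: sumr_ge0 => a _; case: (H a).
move=> N x y.
pose D z := \sum_a (x - y) 0 a * partial a (tser c d N) z.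
have st := smooth_tser c d N.
have [|t _] := @MVT_line R _ (tser c d N) y (x - y) D.
 move=> t _; apply/is_derive_lineE.
 apply: (@is_derive_chain R m (tser c d N) (fun s : R => y + s *: (x - y)) t).
  by move=> e e0; apply: smooth_approx openT _ st e0.
 move=> a; have -> : (fun s : R => (y + s *: (x - y)) 0 a) = (fun s => y 0 a + s * (x - y) 0 a).
  by apply/funext => s; rewrite !mxE.
 rewrite -[X in is_derive _ _ _ X]add0r.
 apply: (@is_deriveD R R R (cst (y 0 a)) (fun s => s * (x - y) 0 a)).
 exact: is_derive_mulc.
rewrite [y + _]addrC subrK => ->; apply: le_trans (ler_norm_sum _ _ _) _.
rewrite mulr_suml; apply: ler_sum => a _; rewrite normrM mulrC.
by apply: ler_pM => //; [case: (H a)|exact: rV_coord_le].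
Qed.

(** Termwise differentiation multiplies the coefficients by the frequency and keeps them rapidly
    decreasing. Lipschitz bounds uniform in the order of the Fejer mean pass to the ultralimit,
    first as continuity and then, through [is_derive_quad], as differentiability. *)
Lemma tlim_smooth c d : rapid c -> rapid d -> smooth_on setT (tlim c d).
Proof.
move=> rc rd n; elim: n c d rc rd => [|n IH] c d rc rd.
 apply/Ck_on0 => x _; apply: dist_cont => e e0.
 have [C C0 HC] := tser_lipschitz rc rd.
 have : \forall y \near x, `|x - y| <= e / (C + 1).
  apply/nbhs_ballP; exists (e / (C + 1)); first by rewrite /= divr_gt0 // ltr_wpDl.
  by move=> y; rewrite -ball_normE /= => /ltW.
 apply: filterS => y Hy; rewrite /tlim.
 have -> : ulim (fun N => tser c d N x) - ulim (fun N => tser c d N y)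
  = ulim (fun N => tser c d N x + (-1) * tser c d N y).
  rewrite ulimD ?ulimZ ?mulN1r //; try exact: tser_bds.
  by apply: bdsM; [exact: bds_cst|exact: tser_bds].
 apply: ulim_norm_le => N; rewrite mulN1r; apply: le_trans (HC N x y) _.
 apply: (@le_trans _ _ ((C + 1) * `|x - y|)); first by rewrite ler_wpM2r // lerDl.
 by rewrite -ler_pdivlMl ?ltr_wpDl // mulrC.
have C0 := IH _ _ rc rd.
have rdc a : rapid (dcs c d a).1 /\ rapid (dcs c d a).2 by split; exact: rapid_mulk.
have D a x : is_derive x (dl a) (tlim c d) (tlim (dcs c d a).1 (dcs c d a).2 x).
 have [r1 r2] := rdc a.
 have [C CC HC] := tser_lipschitz r1 r2.
 apply/is_derive_line0; apply: (@is_derive_quad _ _ _ _ C 1) => // h _.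
 rewrite add0r scale0r addr0 /tlim.
 have b1 := tser_bds (x + h *: dl a) rc rd; have b2 := tser_bds x rc rd.
 have b3 := tser_bds x r1 r2.
 have bm (e : R) u : bds u -> bds (fun n => e * u n) by move=> bu; apply: bdsM bu; exact: bds_cst.
 have -> : ulim (fun N => tser c d N (x + h *: dl a)) - ulim (fun N => tser c d N x)
   - h * ulim (fun N => tser (dcs c d a).1 (dcs c d a).2 N x) =
  ulim (fun N => tser c d N (x + h *: dl a) + ((-1) * tser c d N x
   + (- h) * tser (dcs c d a).1 (dcs c d a).2 N x)).
  rewrite ulimD ?ulimD ?ulimZ //; try by do ?[apply: bdsD|apply: bm].
  by rewrite mulN1r mulNr addrA.
 apply: ulim_norm_le => N; rewrite mulN1r mulNr addrA.
 have [|t /andP[t0 t1] E] := @MVT_line R _ (tser c d N) x (h *: dl a) (fun y => h * partial a (tser c d N) y).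
  move=> t _; apply: is_derive_scaled; exact: smooth_derivable (smooth_tser c d N) Logic.I.
 rewrite E partial_tser -mulrBr normrM.
 apply: (@le_trans _ _ (`|h| * (C * `|h|))); last first.
  by rewrite mulrCA -normrM -expr2 ger0_norm ?sqr_ge0.
 rewrite ler_wpM2l //; apply: le_trans (HC N _ _) _; rewrite ler_wpM2l //.
 rewrite addrC addKr scalerA normrZ normrM (ger0_norm t0).
 apply: (@le_trans _ _ (1 * `|h| * 1)); last by rewrite mul1r mulr1.
 by rewrite ler_pM ?mulr_ge0 ?norm_dl // ler_wpM2r.
apply/Ck_onS; split=> [x _|a].
 have cT : forall x, setT x -> {for x, continuous (tlim c d)}.
  by case: (n) C0 => [/Ck_on0|n' /Ck_onS[]].
 exact: cT.
split=> [x _|]; first by have [] := D a x.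
have [r1 r2] := rdc a; apply: Ck_on_ext (IH _ _ r1 r2) => // [|y _]; first exact: openT.
by rewrite (is_derive_partial (D a y)).
Qed.

End TrigSeries.

(** * Symbol estimates with a parameter *)

Section Symbols.
Context {R : realType} {m : nat} {K : Type}.
Variables (Q U : set 'rV[R]_m).
Hypotheses (oU : open U) (QU : Q `<=` U).
Implicit Types (w : K -> R) (f g : K -> 'rV[R]_m -> R).

(** Differentiation in $x$ does not change the weight, as for symbols of pseudodifferential
    operators: [w] only measures the dependence on the parameter [k], uniformly on [Q]. *)
Fixpoint sym (j : nat) w f : Prop :=
 (exists2 C : R, 0 <= C & forall k x, Q x -> `|f k x| <= C * w k) /\
 (if j is j'.+1 then forall i, sym j' w (fun k => partial i (f k)) else True).

Lemma sym_bound j w f : sym j w f ->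
 exists2 C : R, 0 <= C & forall k x, Q x -> `|f k x| <= C * w k.
Proof. by case: j => [|j] []. Qed.

Lemma symS j w f : sym j.+1 w f -> sym j w f.
Proof. by elim: j f => [|j IH] f [H1 H2] //; split=> // i; exact: IH. Qed.

Lemma sym_ext j w f g : (forall k x, U x -> f k x = g k x) -> sym j w f -> sym j w g.
Proof.
elim: j f g => [|j IH] f g fg [[C C0 HC] H2]; split=> //.
- by exists C => // k x Qx; rewrite -fg //; [exact: HC|exact: QU].
- by exists C => // k x Qx; rewrite -fg //; [exact: HC|exact: QU].
- by move=> i; apply: IH (H2 i) => k x Ux; apply: partial_ext oU Ux _ => y; exact: fg.
Qed.

Lemma sym_weight j w w' (D : R) f : 0 <= D -> (forall k, w k <= D * w' k) ->
 sym j w f -> sym j w' f.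
Proof.
move=> D0 ww; elim: j f => [|j IH] f [[C C0 HC] H2]; split=> //.
- exists (C * D); first exact: mulr_ge0.
 by move=> k x Qx; apply: le_trans (HC k x Qx) _; rewrite -mulrA ler_wpM2l // ww.
- exists (C * D); first exact: mulr_ge0.
 by move=> k x Qx; apply: le_trans (HC k x Qx) _; rewrite -mulrA ler_wpM2l // ww.
- by move=> i; apply: IH; exact: H2.
Qed.

Lemma sym_add j w f g : (forall k, smooth_on U (f k)) -> (forall k, smooth_on U (g k)) ->
 sym j w f -> sym j w g -> sym j w (fun k x => f k x + g k x).
Proof.
move: f g; elim: j => [|j IH] f g sf sg [[C C0 HC] Hf] [[D D0 HD] Hg]; split=> //.
- exists (C + D); first exact: addr_ge0.
 by move=> k x Qx; rewrite mulrDl; apply: le_trans (ler_normD _ _) _; rewrite lerD ?HC ?HD.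
- exists (C + D); first exact: addr_ge0.
 by move=> k x Qx; rewrite mulrDl; apply: le_trans (ler_normD _ _) _; rewrite lerD ?HC ?HD.
- move=> i; have := IH _ _ (fun k => smooth_partial i (sf k)) (fun k => smooth_partial i (sg k)) (Hf i) (Hg i).
 by apply: sym_ext => k x Ux; rewrite (smooth_partialD i (sf k) (sg k) Ux).
Qed.

Lemma sym_mul j w w' f g : (forall k, 0 <= w k) ->
 (forall k, smooth_on U (f k)) -> (forall k, smooth_on U (g k)) ->
 sym j w f -> sym j w' g -> sym j (fun k => w k * w' k) (fun k x => f k x * g k x).
Proof.
move=> w0; move: f g; elim: j => [|j IH] f g sf sg Hf Hg.
 have [C C0 HC] := sym_bound Hf; have [D D0 HD] := sym_bound Hg.
 split=> //; exists (C * D); first exact: mulr_ge0.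
 by move=> k x Qx; rewrite normrM mulrACA ler_pM ?HC ?HD.
split.
 have [C C0 HC] := sym_bound Hf; have [D D0 HD] := sym_bound Hg.
 exists (C * D); first exact: mulr_ge0.
 by move=> k x Qx; rewrite normrM mulrACA ler_pM ?HC ?HD.
move=> i; case: (Hf) (Hg) => _ Hf' [_ Hg'].
have sfi k := smooth_partial i (sf k); have sgi k := smooth_partial i (sg k).
have H1 := IH _ _ sfi sg (Hf' i) (symS Hg); have H2 := IH _ _ sf sgi (symS Hf) (Hg' i).
have := sym_add (fun k => smooth_mul oU (sfi k) (sg k)) (fun k => smooth_mul oU (sf k) (sgi k)) H1 H2.
by apply: sym_ext => k x Ux; rewrite (smooth_partialM i (sf k) (sg k) Ux).
Qed.

Lemma sym_scale j w w' (c : K -> R) f : (forall k, 0 <= w k) ->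
 (forall k, `|c k| <= w' k) -> (forall k, smooth_on U (f k)) ->
 sym j w f -> sym j (fun k => w' k * w k) (fun k x => c k * f k x).
Proof.
move=> w0 cw; move: f; elim: j => [|j IH] f sf Hf.
 have [C C0 HC] := sym_bound Hf; split=> //; exists C => // k x Qx.
 by rewrite normrM mulrCA ler_pM ?cw ?HC.
split.
 have [C C0 HC] := sym_bound Hf; exists C => // k x Qx.
 by rewrite normrM mulrCA ler_pM ?cw ?HC.
move=> i; case: (Hf) => _ /(_ i) Hf'.
have := IH _ (fun k => smooth_partial i (sf k)) Hf'; apply: sym_ext => k x Ux.
by rewrite (partialZ _ (@smooth_derivable _ _ _ _ i _ (sf k) Ux)).
Qed.

Lemma sym_const j (f0 : 'rV[R]_m -> R) : compact Q -> smooth_on U f0 -> sym j (fun=> 1) (fun=> f0).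
Proof.
move=> cQ; elim: j f0 => [|j IH] f0 sf; split=> //.
- have [C C0 HC] := continuous_bounded_on cQ (fun x Qx => smooth_cont sf (QU Qx)).
 by exists C => // _ x Qx; rewrite mulr1 HC.
- have [C C0 HC] := continuous_bounded_on cQ (fun x Qx => smooth_cont sf (QU Qx)).
 by exists C => // _ x Qx; rewrite mulr1 HC.
- by move=> i; apply: IH; exact: smooth_partial.
Qed.

Lemma sym_sum j w (I : Type) (r : seq I) (F : I -> K -> 'rV[R]_m -> R) :
 (forall k, 0 <= w k) -> (forall i k, smooth_on U (F i k)) ->
 (forall i, sym j w (F i)) -> sym j w (fun k x => \sum_(i <- r) F i k x).
Proof.
move=> w0 sF HF; elim: r => [|i r IH].
 have H0 : sym j w (fun _ => (fun=> 0 : R)).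
  elim: (j) => [|j' IHj]; split=> //.
  - by exists 0 => // k x _; rewrite normr0 mul0r.
  - by exists 0 => // k x _; rewrite normr0 mul0r.
  - by move=> i; apply: sym_ext IHj => k x _; rewrite partial_cst.
 by apply: sym_ext H0 => k x _; rewrite big_nil.
have := sym_add (sF i) (fun k => smooth_sum r oU (fun i _ => sF i k)) (HF i) IH.
by apply: sym_ext => k x _; rewrite big_cons.
Qed.

Lemma smooth_invf (f0 : 'rV[R]_m -> R) : smooth_on U f0 -> (forall x, U x -> f0 x != 0) ->
 smooth_on U (fun x => (f0 x)^-1).
Proof. by move=> sf n0; exact: smooth_inv. Qed.

Lemma partial_invf (f0 : 'rV[R]_m -> R) i x : smooth_on U f0 -> (forall x, U x -> f0 x != 0) -> U x ->
 partial i (fun x => (f0 x)^-1) x = (-1) * partial i f0 x * ((f0 x)^-1 * (f0 x)^-1).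
Proof.
move=> sf n0 Ux; have := partial_comp1 (is_derive_invr (n0 x Ux)) (@smooth_derivable _ _ _ _ i _ sf Ux).
by move=> ->; rewrite expr2; ring.
Qed.

Lemma sym_inv j w f (c : R) : 0 < c -> (forall k, 0 < w k) ->
 (forall k, smooth_on U (f k)) -> (forall k x, U x -> f k x != 0) ->
 (forall k x, Q x -> c * w k <= `|f k x|) ->
 sym j w f -> sym j (fun k => (w k)^-1) (fun k x => (f k x)^-1).
Proof.
move=> c0 w0 sf n0 lo Hf.
have B : exists2 C : R, 0 <= C & forall k x, Q x -> `|(f k x)^-1| <= C * (w k)^-1.
 exists c^-1; first by rewrite invr_ge0 ltW.
 move=> k x Qx; rewrite normfV -invfM lef_pV2 ?posrE ?mulr_gt0 ?w0 //; first exact: lo.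
 by rewrite normr_gt0 n0 //; exact: QU.
have si k := smooth_invf (sf k) (n0 k).
elim: j Hf => [|j IH] Hf; first by split.
split=> // i; case: (Hf) => _ /(_ i) Hf'.
have W1 k : 0 <= (w k)^-1 by rewrite invr_ge0 ltW ?w0.
have W2 k : 0 <= w k by rewrite ltW ?w0.
have I1 := IH (symS Hf); have H2 := sym_mul W1 si si I1 I1.
have sfi k := smooth_partial i (sf k).
have {Hf'}H3 : sym j (fun k => 1 * w k) (fun k x => -1 * partial i (f k) x).
 by apply: (sym_scale W2 _ sfi Hf') => k; rewrite normrN normr1.
have W3 k : 0 <= 1 * w k by rewrite mul1r.
have H4 := sym_mul W3 (fun k => smooth_scale (-1) oU (sfi k)) (fun k => smooth_mul oU (si k) (si k)) H3 H2.
have H5 := @sym_weight j _ (fun k => (w k)^-1) 1 _ ler01 _ H4.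
apply: sym_ext (H5 _) => [k x Ux|k].
 by rewrite (partial_invf i (sf k) (n0 k) Ux).
by rewrite !mul1r mulrA mulfV ?mul1r // gt_eqF // w0.
Qed.

End Symbols.

(** * Fourier coefficients of a weak solution *)

Section Weyl.
Context {R : realType} {m : nat}.
Variables (x0 : 'rV[R]_m) (L : R).
Hypothesis L0 : 0 < L.
Local Notation Q := (cube x0 L).
Local Notation th := (phase x0 L).
Local Notation freq := (@freq R L).
Variables (U : set 'rV[R]_m) (S : set 'rV[R]_m).
Hypotheses (oU : open U) (QU : Q `<=` U) (cS : closed S) (SQ : S `<=` Q).
Hypothesis Sbd : forall x, S x -> forall a, x 0 a != x0 0 a /\ x 0 a != x0 0 a + L.

Definition tst (phi : 'rV[R]_m -> R) := smooth_on U phi /\ (forall x, ~ S x -> phi x = 0).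

Lemma tst_partial phi a : tst phi -> tst (partial a phi).
Proof.
move=> [s z]; split; first exact: smooth_partial.
move=> x nSx; have oC : open (~` S) by exact: closed_openC.
by rewrite (partial_ext a oC nSx (g := fun=> 0)) ?partial_cst // => y; exact: z.
Qed.

Lemma tst_add phi psi : tst phi -> tst psi -> tst (fun x => phi x + psi x).
Proof.
move=> [s z] [s' z']; split; first exact: smooth_add.
by move=> x nS; rewrite z // z' // addr0.
Qed.

Lemma tst_mull f phi : smooth_on U f -> tst phi -> tst (fun x => f x * phi x).
Proof. by move=> sf [s z]; split; [exact: smooth_mul|move=> x nS; rewrite z // mulr0]. Qed.

Lemma tst_scale (c : R) phi : tst phi -> tst (fun x => c * phi x).
Proof. by move=> tp; apply: tst_mull => //; exact: smooth_cst. Qed.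

Lemma tst0 : tst (fun=> 0).
Proof. by split=> //; exact: smooth_cst. Qed.

Lemma tst_sum (I : Type) (r : seq I) (F : I -> 'rV[R]_m -> R) : (forall i, tst (F i)) ->
 tst (fun x => \sum_(i <- r) F i x).
Proof.
move=> tF; split; first by apply: smooth_sum => // i _; case: (tF i).
by move=> x nS; rewrite big1 // => i _; case: (tF i) => _; exact.
Qed.

Lemma tst_eq phi psi : tst phi -> tst psi -> (forall x, Q x -> phi x = psi x) -> phi = psi.
Proof.
move=> [_ z] [_ z'] E; apply/funext => x; have [/SQ/E//|nS] := pselect (S x).
by rewrite z // z'.
Qed.

Variable A : 'I_m -> 'I_m -> 'rV[R]_m -> R.
Hypothesis sA : forall a b, smooth_on U (A a b).
Hypothesis pA : forall x (v : 'rV[R]_m), U x -> v != 0 -> 0 < \sum_a \sum_b A a b x * v 0 a * v 0 b.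
Variable nu : R.

(** There is no first-order part: in holomorphic charts of a Kaehler metric the Laplacian has this
    shape by [laplacian_flat]. The zeroth-order term admits eigenvalue equations. *)
Definition ell (phi : 'rV[R]_m -> R) x : R :=
 \sum_a \sum_b A a b x * partial a (partial b phi) x + nu * phi x.

Lemma tst_ell phi : tst phi -> tst (ell phi).
Proof.
move=> tp; apply: tst_add; last exact: tst_scale.
apply: tst_sum => a; apply: tst_sum => b; apply: tst_mull => //.
by do 2 apply: tst_partial.
Qed.

Variable T : ('rV[R]_m -> R) -> R.
Hypothesis TD : forall phi psi, tst phi -> tst psi -> T (fun x => phi x + psi x) = T phi + T psi.
Hypothesis TZ : forall c phi, tst phi -> T (fun x => c * phi x) = c * T phi.
Variable B : R.
Hypothesis TB : forall phi (C : R), tst phi -> (forall x, Q x -> `|phi x| <= C) -> `|T phi| <= B * C.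
Hypothesis Tell : forall phi, tst phi -> T (ell phi) = 0.

Definition nz (k : 'I_m -> int) : Prop := exists a, k a != 0.

Definition qk (k : 'I_m -> int) x : R :=
 \sum_a \sum_b (freq * (k a)%:~R * (freq * (k b)%:~R)) * A a b x.

Lemma qk_lower : exists2 c : R, 0 < c & forall k x, nz k -> Q x -> c * kn k ^+ 2 <= qk k x.
Proof.
have [c c0 Hc] := posdef_lower (@cube_compact R m x0 L)
 (fun a b x Qx => smooth_cont (sA a b) (QU Qx)) (fun x v Qx => @pA x v (QU Qx)).
(* The 4 comes from $1+s\le2s$ for the sum $s\ge1$ of the $|k_a|$, the factor [m.+1] from the
   Cauchy-Schwarz inequality $s^2\le m\sum_ak_a^2$. *)
exists (c * freq ^+ 2 / (4 * m.+1%:R)).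
 by apply: divr_gt0; apply: mulr_gt0; rewrite ?exprn_gt0 ?(freq_gt0 L0) ?ltr0n.
move=> k x [a0 ka0] Qx; pose v : 'rV[R]_m := \row_a (freq * (k a)%:~R).
have -> : qk k x = \sum_a \sum_b A a b x * v 0 a * v 0 b.
 by apply: eq_bigr => a _; apply: eq_bigr => b _; rewrite !mxE; ring.
apply: le_trans (Hc x v Qx).
have -> : sqn v = freq ^+ 2 * \sum_a (k a)%:~R ^+ 2.
 by rewrite /sqn mulr_sumr; apply: eq_bigr => a _; rewrite mxE exprMn.
rewrite -[c * freq ^+ 2 / _ * _]mulrA [c * (_ * _)]mulrA ler_wpM2l ?(mulr_ge0 (ltW c0) (sqr_ge0 _)) //.
rewrite ler_pdivrMl ?mulr_gt0 ?ltr0n //.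
pose s : R := \sum_a `|(k a)%:~R|.
have s1 : 1 <= s.
 rewrite /s (bigD1 a0) //= -[leLHS]addr0; apply: lerD; last by apply: sumr_ge0.
 by rewrite -intr_norm -[1]/(1%:~R) ler_int; lia.
have cs : s ^+ 2 <= m%:R * \sum_a (k a)%:~R ^+ 2.
 rewrite /s expr2 mulr_suml.
 apply: (@le_trans _ _ (\sum_(a < m) \sum_(b < m) (2^-1 * (k a)%:~R ^+ 2 + 2^-1 * (k b)%:~R ^+ 2))).
  apply: ler_sum => a _; rewrite mulr_sumr; apply: ler_sum => b _.
  have := sqr_ge0 (`|(k a)%:~R : R| - `|(k b)%:~R|).
  rewrite -[(k a)%:~R ^+ 2]real_normK ?num_real // -[(k b)%:~R ^+ 2]real_normK ?num_real //.
  by move: `|_| `|_| => u t; rewrite sqrrB; lra.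
 rewrite (eq_bigr (fun a => m%:R * (2^-1 * (k a)%:~R ^+ 2) + 2^-1 * \sum_b (k b)%:~R ^+ 2)).
  rewrite big_split /= -mulr_sumr sumr_const card_ord -mulr_sumr -[(2^-1 * _) *+ m]mulr_natl.
  by move: (\sum_a _) => t; lra.
 move=> a _; rewrite big_split /= sumr_const card_ord -mulr_sumr.
 by rewrite mulr_natl.
have k2 : kn k ^+ 2 <= 4 * s ^+ 2.
 rewrite (_ : 4 * s ^+ 2 = (2 * s) ^+ 2); last by ring.
 apply: lerXn2r; rewrite ?nnegrE ?(ltW (kn_gt0 k)) //; first by rewrite mulr_ge0 // (le_trans ler01).
 by rewrite /kn -/s; lra.
apply: le_trans k2 _; rewrite -mulrA ler_wpM2l //; apply: le_trans cs _.
by rewrite ler_wpM2r ?sumr_ge0 ?ler_nat // => a _; exact: sqr_ge0.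
Qed.

Definition fq := {k : 'I_m -> int | nz k}.
Implicit Types (k : fq).

Let kap k a : R := freq * (sval k a)%:~R.
Let q k := qk (sval k).
Let Th k := th (sval k).

Let smq k : smooth_on U (q k).
Proof. by apply: smooth_sum => // a _; apply: smooth_sum => // b _; exact: smooth_scale. Qed.

Let q_gt0 k x : U x -> 0 < q k x.
Proof.
move=> Ux; pose v : 'rV[R]_m := \row_a kap k a.
have -> : q k x = \sum_a \sum_b A a b x * v 0 a * v 0 b.
 apply: eq_bigr => a _; apply: eq_bigr => b _; rewrite !mxE /kap.
 by move: (freq * _) (freq * _) (A _ _ _) => *; ring.
apply: pA => //; have [a ka] := svalP k; apply/eqP => /rowP /(_ a).
rewrite !mxE /kap /= => /eqP; rewrite mulf_eq0 (gt_eqF (freq_gt0 L0)) /= intr_eq0.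
by rewrite (negbTE ka).
Qed.

Let q_neq0 k x : U x -> q k x != 0.
Proof. by move=> Ux; rewrite gt_eqF // q_gt0. Qed.

Definition mk k (c : 'rV[R]_m -> R) x :=
 \sum_a \sum_b A a b x * (kap k a * partial b c x + kap k b * partial a c x).

Definition trg k (al be : 'rV[R]_m -> R) x := al x * cos (Th k x) + be x * sin (Th k x).

Lemma partial_trg k al be a x : smooth_on U al -> smooth_on U be -> U x ->
 partial a (trg k al be) x =
 trg k (fun y => partial a al y + kap k a * be y) (fun y => partial a be y + (- kap k a) * al y) x.
Proof.
move=> sa sb Ux; have sth := smooth_th x0 L (sval k) oU.
have sc := smooth_cos oU sth; have ss := smooth_sin oU sth.
rewrite /trg (smooth_partialD a (smooth_mul oU sa sc) (smooth_mul oU sb ss) Ux).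
rewrite (smooth_partialM a sa sc Ux) (smooth_partialM a sb ss Ux).
rewrite partial_cos_th partial_sin_th -/(Th k) -/(kap k a).
move: (al x) (be x) (partial _ _ _) (partial _ _ _) (kap k a) (cos _) (sin _) => *; ring.
Qed.

Lemma smooth_trg k al be : smooth_on U al -> smooth_on U be -> smooth_on U (trg k al be).
Proof.
move=> sa sb; have sth := smooth_th x0 L (sval k) oU.
by apply: smooth_add; [|apply: smooth_mul|apply: smooth_mul] => //; [apply: smooth_cos|apply: smooth_sin].
Qed.

Lemma tst_trg k al be : tst al -> tst be -> tst (trg k al be).
Proof.
move=> [sa za] [sb zb]; split; first exact: smooth_trg.
by move=> x nS; rewrite /trg za // zb // !mul0r addr0.
Qed.

(** A derivative that falls on the phase exchanges cosine and sine. The terms with one such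
    derivative are collected in [mk], those with two in [qk], which carries the leading power of the
    frequency. *)
Lemma ell_trg k al be x : smooth_on U al -> smooth_on U be -> U x ->
 ell (trg k al be) x = trg k (fun y => ell al y + mk k be y - q k y * al y)
               (fun y => ell be y - mk k al y - q k y * be y) x.
Proof.
move=> sa sb Ux.
have E a b : partial a (partial b (trg k al be)) x =
  (partial a (partial b al) x + kap k b * partial a be x + kap k a * partial b be x
   - kap k a * kap k b * al x) * cos (Th k x)
 + (partial a (partial b be) x - kap k b * partial a al x - kap k a * partial b al x
   - kap k a * kap k b * be x) * sin (Th k x).
 have sp c f : smooth_on U f -> smooth_on U (fun y => c * f y) by move=> sf; exact: smooth_scale.
 have s1 := smooth_add oU (smooth_partial b sa) (sp (kap k b) _ sb).
 have s2 := smooth_add oU (smooth_partial b sb) (sp (- kap k b) _ sa).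
 rewrite (partial_ext a oU Ux (fun y Uy => partial_trg k b sa sb Uy)) partial_trg //.
 rewrite /trg (smooth_partialD a (smooth_partial b sa) (sp (kap k b) _ sb) Ux).
 rewrite (smooth_partialD a (smooth_partial b sb) (sp (- kap k b) _ sa) Ux).
 rewrite (partialZ _ (@smooth_derivable _ _ _ _ a _ sa Ux)) (partialZ _ (@smooth_derivable _ _ _ _ a _ sb Ux)).
 move: (partial _ _ _) (partial _ _ _) (partial a _ _) (partial a _ _) (partial b _ _) (partial b _ _).
 move: (al x) (be x) (kap k a) (kap k b) (cos _) (sin _) => *; ring.
rewrite /ell /mk /q /qk {1}/trg.
have F (c : R) (G H : 'I_m -> 'I_m -> R) : (\sum_a \sum_b G a b) + c * (\sum_a \sum_b H a b) =
  \sum_a \sum_b (G a b + c * H a b).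
 rewrite mulr_sumr -big_split; apply: eq_bigr => a _; rewrite mulr_sumr -big_split; exact: eq_bigr.
rewrite /trg; set c := cos _; set s := sin _.
transitivity (\sum_a \sum_b A a b x * partial a (partial b (trg k al be)) x + nu * al x * c + nu * be x * s).
 by rewrite /trg -/c -/s; move: (\sum_a _) (al x) (be x) => *; ring.
have E0 : \sum_a \sum_b A a b x * partial a (partial b (trg k al be)) x =
 \sum_a \sum_b (A a b x * partial a (partial b al) x +
 (1 * (A a b x * (kap k a * partial b be x + kap k b * partial a be x)) +
  (- al x) * (freq * (sval k a)%:~R * (freq * (sval k b)%:~R) * A a b x))) * c +
 \sum_a \sum_b (A a b x * partial a (partial b be) x +
 ((-1) * (A a b x * (kap k a * partial b al x + kap k b * partial a al x)) +
  (- be x) * (freq * (sval k a)%:~R * (freq * (sval k b)%:~R) * A a b x))) * s.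
 rewrite -[X in _ = _ + X]mul1r F; apply: eq_bigr => a _; apply: eq_bigr => b _; rewrite E -/c -/s /kap.
 move: (partial a (partial b al) x) (partial a (partial b be) x) (partial a al x) (partial b al x).
 move: (partial a be x) (partial b be x) (freq * (sval k a)%:~R) (freq * (sval k b)%:~R) (A a b x) => *; ring.
have G (e : R) (H : 'I_m -> 'I_m -> R) : \sum_a \sum_b H a b * e = (\sum_a \sum_b H a b) * e.
 by rewrite mulr_suml; apply: eq_bigr => a _; rewrite mulr_suml.
have F' (c1 c2 : R) (G1 H1 H2 : 'I_m -> 'I_m -> R) :
 \sum_a \sum_b (G1 a b + (c1 * H1 a b + c2 * H2 a b)) =
 (\sum_a \sum_b G1 a b) + (c1 * (\sum_a \sum_b H1 a b) + c2 * (\sum_a \sum_b H2 a b)).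
 rewrite !mulr_sumr -!big_split; apply: eq_bigr => a _.
 by rewrite !mulr_sumr -!big_split.
rewrite [X in X + _ + _]E0 !G !F'.
have fin (P1 M1 q1 P2 M2 a b n c1 s1 : R) : (P1 + (1 * M1 + (- a) * q1)) * c1 +
  (P2 + ((-1) * M2 + (- b) * q1)) * s1 + n * a * c1 + n * b * s1 =
  (P1 + n * a + M1 - q1 * a) * c1 + (P2 + n * b - M2 - q1 * b) * s1 by ring.
exact: fin.
Qed.

Let iq k x := (q k x)^-1.

Let siq k : smooth_on U (iq k).
Proof. by apply: smooth_inv => // x; exact: q_neq0. Qed.

Let tst_iq k f : tst f -> tst (fun x => iq k x * f x).
Proof. exact: tst_mull. Qed.

Let smk k f : smooth_on U f -> smooth_on U (mk k f).
Proof.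
move=> sf; apply: smooth_sum => // a _; apply: smooth_sum => // b _; apply: smooth_mul => //.
by apply: smooth_add => //; apply: smooth_scale => //; exact: smooth_partial.
Qed.

Let tst_mk k f : tst f -> tst (mk k f).
Proof.
move=> tf; apply: tst_sum => a; apply: tst_sum => b; apply: tst_mull => //.
by apply: tst_add; apply: tst_scale; exact: tst_partial.
Qed.

Let nxa (al be : fq -> 'rV[R]_m -> R) k x :=
 ell (fun y => iq k y * al k y) x + mk k (fun y => iq k y * be k y) x.

Let nxb (al be : fq -> 'rV[R]_m -> R) k x :=
 ell (fun y => iq k y * be k y) x + (-1) * mk k (fun y => iq k y * al k y) x.

(** [T] annihilates [ell] of the oscillating function with both amplitudes divided by $q_k$. The
    leading part of the result is minus the original function, so [T] may be evaluated on the
    remaining lower-order part, whose amplitudes are smaller by one power of the frequency. *)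
Lemma T_step k (al be : fq -> 'rV[R]_m -> R) : tst (al k) -> tst (be k) ->
 T (trg k (al k) (be k)) = T (trg k (nxa al be k) (nxb al be k)).
Proof.
move=> ta tb; have t1 := tst_iq k ta; have t2 := tst_iq k tb.
have tn : tst (trg k (nxa al be k) (nxb al be k)).
 apply: tst_trg; first exact: tst_add (tst_ell t1) (tst_mk k t2).
 exact: tst_add (tst_ell t2) (tst_scale (-1) (tst_mk k t1)).
have t0 := tst_trg k ta tb; have tt := tst_trg k t1 t2.
have E : ell (trg k (fun y => iq k y * al k y) (fun y => iq k y * be k y)) =
  (fun x => trg k (nxa al be k) (nxb al be k) x + (-1) * trg k (al k) (be k) x).
 apply: tst_eq; [exact: tst_ell|exact: tst_add tn (tst_scale _ t0)|move=> x /QU Ux].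
 rewrite ell_trg //; [|by case: t1|by case: t2].
 rewrite /trg /nxa /nxb /iq; have := q_neq0 k Ux.
 move: (ell _ x) (ell _ x) (mk _ _ x) (mk _ _ x) (q k x) (al k x) (be k x) (cos _) (sin _) => *; field; assumption.
have := Tell tt; rewrite E TD ?TZ //; last exact: tst_scale.
by move/eqP; rewrite mulN1r subr_eq0 => /eqP.
Qed.

Local Notation sy := (@sym R m fq Q).
Let K1 k : R := kn (sval k).

Let K1_gt0 k : 0 < K1 k. Proof. exact: kn_gt0. Qed.
Let K1_ge0 k : 0 <= K1 k. Proof. exact: ltW. Qed.

Lemma sym_q j : sy j (fun k => K1 k ^+ 2) q.
Proof.
have fq0 := ltW (freq_gt0 L0).
apply: (sym_sum oU QU) => [k|a k|a]; first exact: exprn_ge0.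
 by apply: smooth_sum => // b _; exact: smooth_scale.
apply: (sym_sum oU QU) => [k|b k|b]; [exact: exprn_ge0|exact: smooth_scale|].
have H := sym_const (K := fq) QU j (@cube_compact R m x0 L) (sA a b).
have H2 := @sym_scale _ _ fq Q U oU QU j (fun=> 1) (fun k => freq ^+ 2 * K1 k ^+ 2)
 (fun k => freq * (sval k a)%:~R * (freq * (sval k b)%:~R)) _ (fun=> ler01) _ (fun=> sA a b) H.
apply: sym_weight (H2 _) => [|k|k]; first exact: (exprn_ge0 2 fq0).
- by rewrite mulr1.
- rewrite mulrACA -expr2 normrM ger0_norm ?sqr_ge0 // ler_wpM2l ?sqr_ge0 // normrM expr2.
 by apply: ler_pM => //; exact: kn_coord.
Qed.

Lemma sym_iq j : sy j (fun k => (K1 k ^+ 2)^-1) iq.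
Proof.
have [c c0 Hc] := qk_lower.
apply: (sym_inv oU QU c0 _ smq q_neq0 _ (sym_q j)) => [k|k x Qx]; first exact: exprn_gt0.
by apply: le_trans (Hc _ _ (svalP k) Qx) (ler_norm _).
Qed.

Lemma sym_iqM j w (al : fq -> 'rV[R]_m -> R) : (forall k, 0 <= w k) -> (forall k, tst (al k)) ->
 sy j w al -> sy j (fun k => (K1 k ^+ 2)^-1 * w k) (fun k x => iq k x * al k x).
Proof.
move=> w0 ta Ha; apply: (sym_mul oU QU _ siq (fun k => (ta k).1) (sym_iq j) Ha) => k.
by rewrite invr_ge0 exprn_ge0.
Qed.

Lemma sym_ell j w (al : fq -> 'rV[R]_m -> R) : (forall k, 0 <= w k) -> (forall k, tst (al k)) ->
 sy j.+2 w al -> sy j w (fun k => ell (al k)).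
Proof.
move=> w0 ta Ha.
have sc := @sym_const _ _ fq Q U QU j _ (@cube_compact R m x0 L).
have spp a b k : smooth_on U (partial a (partial b (al k))).
 by apply: smooth_partial; apply: smooth_partial; case: (ta k).
have W := @sym_weight _ _ fq Q j _ _ 1 _ ler01.
have w1 (k : fq) : 1 * w k <= 1 * w k by [].
apply: (sym_add oU QU) => [k|k||].
- by apply: smooth_sum => // a _; apply: smooth_sum => // b _; apply: smooth_mul.
- by apply: smooth_scale => //; case: (ta k).
- apply: (sym_sum oU QU) => [//|a k|a]; first by apply: smooth_sum => // b _; apply: smooth_mul.
 apply: (sym_sum oU QU) => [//|b k|b]; first by apply: smooth_mul.
 have H := (Ha.2 b).2 a.
 exact: W w1 (sym_mul oU QU (fun=> ler01) (fun=> sA a b) (spp a b) (sc _ (sA a b)) H).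
- have H := symS (symS Ha).
 have sn : smooth_on U (fun=> nu) by exact: smooth_cst.
 have := sym_mul oU QU (fun=> ler01) (fun=> sn) (fun k => (ta k).1) (sc _ sn) H.
 exact: W.
Qed.

Lemma sym_mk j w (al : fq -> 'rV[R]_m -> R) : (forall k, 0 <= w k) -> (forall k, tst (al k)) ->
 sy j.+1 w al -> sy j (fun k => K1 k * w k) (fun k => mk k (al k)).
Proof.
move=> w0 ta Ha; have fq0 := ltW (freq_gt0 L0).
have sc := @sym_const _ _ fq Q U QU j _ (@cube_compact R m x0 L).
have Kw k : 0 <= K1 k * w k by rewrite mulr_ge0.
have sp a k : smooth_on U (partial a (al k)) by apply: smooth_partial; case: (ta k).
have H a b : sy j (fun k => K1 k * w k) (fun k x => kap k a * partial b (al k) x).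
 have := @sym_scale _ _ fq Q U oU QU j w (fun k => freq * K1 k) (kap^~ a) _ w0 _ (sp b) (Ha.2 b).
 move=> H; apply: (sym_weight fq0 _ (H _)) => k; first by rewrite -mulrA.
 by rewrite normrM ger0_norm // ler_wpM2l // kn_coord.
have skp a b k : smooth_on U (fun x => kap k a * partial b (al k) x) by exact: smooth_scale.
have sk a b k : smooth_on U (fun x => kap k a * partial b (al k) x + kap k b * partial a (al k) x).
 exact: smooth_add.
apply: (sym_sum oU QU) => [//|a k|a]; first by apply: smooth_sum => // b _; apply: smooth_mul.
apply: (sym_sum oU QU) => [//|b k|b]; first by apply: smooth_mul.
have HH := sym_add oU QU (skp a b) (skp b a) (H a b) (H b a).
have := sym_mul oU QU (fun=> ler01) (fun=> sA a b) (sk a b) (sc _ (sA a b)) HH.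
by apply: sym_weight ler01 _ => k; rewrite !mul1r.
Qed.

(** Each use of [T_step] costs two derivatives of the amplitudes and gains one power of the
    frequency; this is why symbols of order [N.*2] are asked for. *)
Lemma T_rapid N : forall w (al be : fq -> 'rV[R]_m -> R), (forall k, 0 <= w k) ->
 (forall k, tst (al k)) -> (forall k, tst (be k)) -> sy N.*2 w al -> sy N.*2 w be ->
 exists C : R, forall k, `|T (trg k (al k) (be k))| <= C * (w k * K1 k ^- N).
Proof.
elim: N => [|N IH] w al be w0 ta tb Ha Hb.
 have [C C0 HC] := sym_bound Ha; have [D D0 HD] := sym_bound Hb.
 exists (B * (C + D)) => k; rewrite expr0 invr1 mulr1 -mulrA; apply: TB; first exact: tst_trg.
 move=> x Qx; apply: le_trans (ler_normD _ _) _; rewrite mulrDl !normrM; apply: lerD.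
  by apply: le_trans (HC k x Qx); rewrite ler_piMr // cos_max.
 by apply: le_trans (HD k x Qx); rewrite ler_piMr // sin_max.
have tna k := tst_iq k (ta k); have tnb k := tst_iq k (tb k).
have w0' k : 0 <= (K1 k ^+ 2)^-1 * w k by rewrite mulr_ge0 ?invr_ge0 ?exprn_ge0.
have Ha' := sym_iqM w0 ta Ha; have Hb' := sym_iqM w0 tb Hb.
pose w' k := (K1 k)^-1 * w k.
have W1 (f : fq -> 'rV[R]_m -> R) : sy N.*2 (fun k => (K1 k ^+ 2)^-1 * w k) f -> sy N.*2 w' f.
 apply: sym_weight ler01 _ => // k; rewrite mul1r ler_wpM2r // lef_pV2 ?posrE ?exprn_gt0 //.
 by rewrite expr2 ler_peMr // kn_ge1.
have W2 (f : fq -> 'rV[R]_m -> R) : sy N.*2 (fun k => K1 k * ((K1 k ^+ 2)^-1 * w k)) f -> sy N.*2 w' f.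
 apply: sym_weight ler01 _ => // k; rewrite mul1r mulrA expr2 invfM mulrA mulfV ?mul1r //.
 by rewrite gt_eqF.
have E1 := W1 _ (sym_ell w0' tna Ha'); have E2 := W1 _ (sym_ell w0' tnb Hb').
have M1 := W2 _ (sym_mk w0' tna (symS Ha')); have M2 := W2 _ (sym_mk w0' tnb (symS Hb')).
have w'0 k : 0 <= w' k by rewrite mulr_ge0 ?invr_ge0.
have te1 k := tst_ell (tna k); have te2 k := tst_ell (tnb k).
have tm1 k := tst_scale (-1) (tst_mk k (tna k)); have tm2 k := tst_mk k (tnb k).
have M1' : sy N.*2 w' (fun k x => (-1) * mk k (fun y => iq k y * al k y) x).
 have := @sym_scale _ _ fq Q U oU QU _ w' (fun=> 1) (fun=> -1) _ w'0 _ (fun k => (tst_mk k (tna k)).1) M1.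
 move=> H; apply: sym_weight ler01 _ (H _) => k; first by rewrite !mul1r.
 by rewrite normrN normr1.
have [C HC] := IH w' (nxa al be) (nxb al be) w'0 (fun k => tst_add (te1 k) (tm2 k))
 (fun k => tst_add (te2 k) (tm1 k))
 (sym_add oU QU (fun k => (te1 k).1) (fun k => (tm2 k).1) E1 M2)
 (sym_add oU QU (fun k => (te2 k).1) (fun k => (tm1 k).1) E2 M1').
exists C => k; rewrite T_step // exprS invfM; apply: le_trans (HC k) _.
by rewrite /w' [(K1 k)^-1 * w k]mulrC -mulrA.
Qed.

Variable chi : 'rV[R]_m -> R.
Hypothesis tchi : tst chi.

Definition tc (k : 'I_m -> int) : R := T (fun x => chi x * cos (th k x)).
Definition td (k : 'I_m -> int) : R := T (fun x => chi x * sin (th k x)).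

Let tst_cos (k : 'I_m -> int) : tst (fun x => chi x * cos (th k x)).
Proof.
case: tchi => s z; split; last by move=> x nS; rewrite z // mul0r.
by apply: smooth_mul => //; apply: smooth_cos => //; exact: smooth_th.
Qed.

Let tst_sin (k : 'I_m -> int) : tst (fun x => chi x * sin (th k x)).
Proof.
case: tchi => s z; split; last by move=> x nS; rewrite z // mul0r.
by apply: smooth_mul => //; apply: smooth_sin => //; exact: smooth_th.
Qed.

Lemma rapid_td : rapid tc /\ rapid td.
Proof.
have [C C0 HC] := continuous_bounded_on (@cube_compact R m x0 L) (fun x Qx => smooth_cont tchi.1 (QU Qx)).
have tch : forall k : fq, tst ((fun=> chi) k) by [].
have t0 : forall k : fq, tst ((fun=> fun=> 0) k) by move=> _; exact: tst0.
have sc j := @sym_const _ _ fq Q U QU j _ (@cube_compact R m x0 L) tchi.1.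
have z0 : smooth_on U (fun=> 0 : R) by exact: smooth_cst.
have s0 j := @sym_const _ _ fq Q U QU j _ (@cube_compact R m x0 L) z0.
(* At frequency zero [qk] vanishes and [T_rapid] says nothing; there the weight [kn] is 1 and the
   sup bound on [T] is enough. *)
have low (c : ('I_m -> int) -> R) N (D : R) : (forall k : fq, `|c (sval k)| <= D * (1 * K1 k ^- N)) ->
 (forall k : 'I_m -> int, `|c k| <= B * C) -> forall k : 'I_m -> int, `|c k| <= (Num.max D (B * C)) * kn k ^- N.
 move=> H1 H2 k; have kN : (0 : R) <= (kn k : R) ^- N by rewrite invr_ge0 exprn_ge0 // ltW // kn_gt0.
 have [nk|nk] := pselect (nz k).
  apply: le_trans (H1 (exist _ k nk)) _; rewrite mul1r ler_wpM2r //.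
  by rewrite le_max lexx.
 have -> : (kn k : R) = 1.
  rewrite /kn big1 ?addr0 // => a _; apply/eqP; rewrite normr_eq0 intr_eq0.
  by apply/negP => /negP ka; apply: nk; exists a.
 by rewrite expr1n invr1 mulr1; apply: le_trans (H2 k) _; rewrite le_max lexx orbT.
split=> N.
- have [D HD] := T_rapid (fun=> ler01) tch t0 (sc N.*2) (s0 N.*2).
 exists (Num.max D (B * C)); apply: low => [k|k].
  by rewrite (_ : tc _ = T (trg k chi (fun=> 0))) //; congr T; apply/funext => x; rewrite /trg mul0r addr0.
 by apply: TB => // x Qx; rewrite normrM -[leRHS]mulr1 ler_pM ?HC ?cos_max.
- have [D HD] := T_rapid (fun=> ler01) t0 tch (s0 N.*2) (sc N.*2).
 exists (Num.max D (B * C)); apply: low => [k|k].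
  by rewrite (_ : td _ = T (trg k (fun=> 0) chi)) //; congr T; apply/funext => x; rewrite /trg mul0r add0r.
 by apply: TB => // x Qx; rewrite normrM -[leRHS]mulr1 ler_pM ?HC ?sin_max.
Qed.

(** The density is the trigonometric series whose coefficients are those of [chi] times [T]. For
    Fejer means there is an exact identity: [T] on [chi] times the mean of [phi] equals the average
    of [phi] against the mean of the series. Uniform convergence on both sides then gives the
    claim. *)
Lemma weyl : exists2 w : 'rV[R]_m -> R, smooth_on setT w &
 forall phi, smooth_on U phi -> bdy0 x0 L phi -> T (fun x => chi x * phi x) = avg x0 L (fun x => w x * phi x).
Proof.
have [rc rd] := rapid_td; exists (tlim x0 L tc td); first exact: tlim_smooth.
move=> phi sp b0.
have cphi x : Q x -> {for x, continuous phi} by move=> /QU; exact: smooth_cont.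
have bphi : bdq x0 L phi by exact: cont_bdq.
have [P HP] := bphi.
have [C C0 HC] := continuous_bounded_on (@cube_compact R m x0 L) (fun x Qx => smooth_cont tchi.1 (QU Qx)).
pose tr N (f g : {ffun 'I_m -> 'I_N.+1} -> {ffun 'I_m -> 'I_N.+1} -> R) : R :=
 #|{: {ffun 'I_m -> 'I_N.+1}}|%:R^-1 * \sum_j \sum_l (f j l + g j l).
pose KN N y := avg x0 L (fun x => phi x * fj x0 L N x y).
have TKN N : T (fun y => chi y * KN N y) = tr N (fun j l => cco x0 L phi (dk j l) * tc (dk j l))
 (fun j l => sco x0 L phi (dk j l) * td (dk j l)).
 have ct (j l : {ffun 'I_m -> 'I_N.+1}) := tst_scale (cco x0 L phi (dk j l)) (tst_cos (dk j l)).
 have st (j l : {ffun 'I_m -> 'I_N.+1}) := tst_scale (sco x0 L phi (dk j l)) (tst_sin (dk j l)).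
 have tsumT (I : finType) (F : I -> 'rV[R]_m -> R) : (forall i, tst (F i)) ->
   T (fun x => \sum_i F i x) = \sum_i T (F i).
  move=> tF; elim: (index_enum I) => [|i r IH].
   rewrite big_nil; under [X in T X]eq_fun do rewrite big_nil.
   by have := TZ 0 tst0; rewrite !mul0r.
  by rewrite big_cons -IH -TD //; [congr T; apply/funext => x; rewrite big_cons|exact: tst_sum].
 rewrite /tr; under eq_bigr => j _ do under eq_bigr => l _ do rewrite /tc /td -TZ ?(tst_cos, tst_sin) // -TZ ?(tst_cos, tst_sin) // -TD ?(ct, st) //.
 under eq_bigr => j _ do rewrite -(tsumT _ _ (fun l => tst_add (ct j l) (st j l))).
 rewrite -(tsumT _ _ (fun j => tst_sum _ (fun l => tst_add (ct j l) (st j l)))).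
 rewrite -TZ; last by apply: tst_sum => j; apply: tst_sum => l; exact: tst_add.
 congr T; apply/funext => y; rewrite /KN avg_mul_fj // mulrCA; congr (_ * _).
 rewrite mulr_sumr; apply: eq_bigr => j _; rewrite mulr_sumr; apply: eq_bigr => l _.
 move: (chi y) (cos _) (sin _) (cco _ _ _ _) (sco _ _ _ _) => *; ring.
have tKN N : tst (fun y => chi y * KN N y).
 split; last by move=> x nS; rewrite tchi.2 // mul0r.
 apply: smooth_mul => //; first exact: tchi.1.
 have oT := oU; rewrite /KN.
 rewrite (_ : (fun y => _) = (fun y => #|{: {ffun 'I_m -> 'I_N.+1}}|%:R^-1 *
  \sum_(j : {ffun 'I_m -> 'I_N.+1}) \sum_(l : {ffun 'I_m -> 'I_N.+1})
  (cos (th (dk j l) y) * cco x0 L phi (dk j l) + sin (th (dk j l) y) * sco x0 L phi (dk j l)))); last first.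
  by apply/funext => y; rewrite avg_mul_fj.
 apply: smooth_scale => //; apply: smooth_sum => // j _; apply: smooth_sum => // l _.
 apply: smooth_add => //; apply: smooth_mul => //; [apply: smooth_cos|exact: smooth_cst|apply: smooth_sin|exact: smooth_cst] => //;
 exact: smooth_th.
have AKN N : avg x0 L (fun x => phi x * tser x0 L tc td N x) =
 tr N (fun j l => cco x0 L phi (dk j l) * tc (dk j l)) (fun j l => sco x0 L phi (dk j l) * td (dk j l)).
 have bc (k : 'I_m -> int) : bdq x0 L (fun x => phi x * cos (th k x)) by apply: bdqM => //; exact: bdq_cos.
 have bs (k : 'I_m -> int) : bdq x0 L (fun x => phi x * sin (th k x)) by apply: bdqM => //; exact: bdq_sin.
 have bcc (c : R) (f : 'rV[R]_m -> R) : bdq x0 L f -> bdq x0 L (fun x => f x * c).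
  by move=> bf; apply: bdqM => //; exact: bdq_cst.
 have avc (c : R) (f : 'rV[R]_m -> R) : bdq x0 L f -> avg x0 L (fun x => f x * c) = avg x0 L f * c.
  by move=> bf; rewrite mulrC -avgZ //; congr avg; apply/funext => x; rewrite mulrC.
 have b2 (j l : {ffun 'I_m -> 'I_N.+1}) : bdq x0 L (fun x => phi x * cos (th (dk j l) x) * tc (dk j l)
   + phi x * sin (th (dk j l) x) * td (dk j l)) by apply: bdqD; apply: bcc.
 have b3 (j : {ffun 'I_m -> 'I_N.+1}) : bdq x0 L (fun x => \sum_l (phi x * cos (th (dk j l) x) * tc (dk j l)
   + phi x * sin (th (dk j l) x) * td (dk j l))) by apply: bdq_sum.
 rewrite /tr; transitivity (avg x0 L (fun x => #|{: {ffun 'I_m -> 'I_N.+1}}|%:R^-1 *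
  \sum_(j : {ffun 'I_m -> 'I_N.+1}) \sum_(l : {ffun 'I_m -> 'I_N.+1})
   (phi x * cos (th (dk j l) x) * tc (dk j l) + phi x * sin (th (dk j l) x) * td (dk j l)))).
  congr avg; apply/funext => x; rewrite /tser mulrCA; congr (_ * _).
  rewrite mulr_sumr; apply: eq_bigr => j _; rewrite mulr_sumr; apply: eq_bigr => l _.
  move: (phi x) (cos _) (sin _) (tc _) (td _) => *; ring.
 rewrite avgZ //; last by apply: bdq_sum.
 congr (_ * _); rewrite avg_sum //; apply: eq_bigr => j _; rewrite avg_sum //; apply: eq_bigr => l _.
 by rewrite avgD ?avc //; apply: bcc.
(* Pointwise convergence along the ultrafilter becomes uniform on the cube by compactness, the Fejer
   means being equi-Lipschitz. *)
have unif (e : R) : 0 < e -> uf [set N | forall x, Q x -> `|tser x0 L tc td N x - tlim x0 L tc td x| <= e].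
 move=> e0; have [D D0 HD] := tser_lipschitz x0 L0 rc rd.
 have lD x y : `|tlim x0 L tc td x - tlim x0 L tc td y| <= D * `|x - y|.
  have bx := tser_bds x0 L0 x rc rd; have by' := tser_bds x0 L0 y rc rd.
  have bm : bds (fun N => (-1) * tser x0 L tc td N y) by apply: bdsM => //; exact: bds_cst.
  rewrite -[X in _ - X]mul1r -mulNr -ulimZ // -ulimD //; apply: ulim_norm_le => N.
  by rewrite mulN1r; exact: HD.
 have := @cube_compact R m x0 L; rewrite compact_near_coveringP => cov.
 apply: (cov nat uf (fun N x => `|tser x0 L tc td N x - tlim x0 L tc td x| <= e)) => x Qx.
 have d0 : 0 < e / (3 * (D + 1)) by rewrite divr_gt0 // mulr_gt0 // ltr_wpDl.
 have e3 : 0 < e / 3 by rewrite divr_gt0.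
 exists (ball x (e / (3 * (D + 1))), [set N | `|tlim x0 L tc td x - tser x0 L tc td N x| <= e / 3]).
  split=> /=; first exact: nbhsx_ballx.
  by apply: ulim_near => //; exact: tser_bds.
 move=> [y N] /= [xy HN].
 have De : D * `|x - y| <= e / 3.
  move: xy; rewrite -ball_normE /ball_ /= => xy.
  apply: (@le_trans _ _ ((D + 1) * (e / (3 * (D + 1))))).
   by apply: ler_pM => //; [rewrite lerDl|exact: ltW].
  by rewrite le_eqVlt; apply/orP; left; apply/eqP; field; rewrite gt_eqF // ltr_wpDl.
 have h1 := HD N x y; have h2 := lD x y.
 move: (tser _ _ _ _ _ _) (tser _ _ _ _ _ _) (tlim _ _ _ _ _) (tlim _ _ _ _ _) (D * _) De h1 h2 HN => t1 t2 l1 l2 r De.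
 rewrite !ler_norml => /andP[? ?] /andP[? ?] /andP[? ?]; apply/andP; split; lra.
have sw := tlim_smooth x0 L0 rc rd.
have bw : bdq x0 L (tlim x0 L tc td) by apply: cont_bdq => x _; exact: smooth_cont sw Logic.I.
apply/eqP; rewrite -subr_eq0 -normr_le0; apply/ler_addgt0Pr => e e0; rewrite add0r.
have [d' d'0 Hd'] : exists2 d', 0 < d' & (`|B| * C + `|P|) * d' <= e.
 exists (e / (`|B| * C + `|P| + 1)); first by rewrite divr_gt0 // ltr_wpDl // addr_ge0 // mulr_ge0.
 rewrite mulrA ler_pdivrMr; last by rewrite ltr_wpDl // addr_ge0 // mulr_ge0.
 by rewrite mulrC ler_pM2l // lerDl.
have U1 := unif d' d'0; have U2 := uf_eventually (fejer L0 cphi b0 d'0).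
have U3 := @filterI nat uf (@filter_filter nat uf uf_proper) _ _ U1 U2.
have [N [HN1 HN2]] := @filter_ex _ _ uf_proper _ U3.
have E1 : `|T (fun x => chi x * phi x) - T (fun y => chi y * KN N y)| <= `|B| * (C * d').
 have t1 : tst (fun x => chi x * phi x).
  by split; [apply: smooth_mul => //; exact: tchi.1|move=> x nS; rewrite tchi.2 // mul0r].
 have t2 := tst_scale (-1) (tKN N).
 rewrite -[X in _ - X]mul1r -mulNr -TZ // -TD //.
 apply: (@le_trans _ _ (B * (C * d'))); last by rewrite ler_wpM2r ?ler_norm // mulr_ge0 // ltW.
 apply: TB; first exact: tst_add.
 move=> x Qx; rewrite mulN1r -mulrBr normrM ler_pM ?HC //; exact: HN2.
have E2 : `|avg x0 L (fun x => phi x * tser x0 L tc td N x) - avg x0 L (fun x => tlim x0 L tc td x * phi x)| <= `|P| * d'.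
 have bt : bdq x0 L (tser x0 L tc td N) by have [D HD] := tser_bounded x0 L0 rc rd; exists D => x _.
 rewrite -avgB //; [|exact: bdqM|exact: bdqM].
 apply: (avg_norm_le L0) => x Qx; rewrite [tlim _ _ _ _ _ * _]mulrC -mulrBr normrM ler_pM ?HN1 //.
 by apply: le_trans (HP x Qx) (ler_norm _).
rewrite TKN -AKN in E1; apply: le_trans Hd'; rewrite mulrDl -mulrA.
move: E1 E2; rewrite !ler_norml => /andP[? ?] /andP[? ?]; apply/andP; split; lra.
Qed.

End Weyl.

(** * Kaehler geometry in a chart *)

Section MatrixCalculus.
Context {R : realType} {m : nat}.
Variable U : set 'rV[R]_m.
Hypothesis oU : open U.
Implicit Types (x : 'rV[R]_m) (a b c d : 'I_m).

Definition smx r s (F : 'rV[R]_m -> 'M[R]_(r, s)) := forall i j, smooth_on U (fun x => F x i j).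

Definition pmx r s a (F : 'rV[R]_m -> 'M[R]_(r, s)) x : 'M[R]_(r, s) :=
 \matrix_(i, j) partial a (fun y => F y i j) x.

Lemma pmxE r s a (F : 'rV[R]_m -> 'M[R]_(r, s)) x i j : pmx a F x i j = partial a (fun y => F y i j) x.
Proof. by rewrite mxE. Qed.

Lemma smx_cst r s (A : 'M[R]_(r, s)) : smx (fun=> A).
Proof. by move=> i j; exact: smooth_cst. Qed.

Lemma smxM r s t (F : 'rV[R]_m -> 'M[R]_(r, s)) (G : 'rV[R]_m -> 'M[R]_(s, t)) :
 smx F -> smx G -> smx (fun x => F x *m G x).
Proof.
move=> sF sG i j; apply: smooth_ext oU (fun y _ => esym (mxE _ _ i j)) _.
by apply: smooth_sum => // k _; apply: smooth_mul.
Qed.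

Lemma smxD r s (F G : 'rV[R]_m -> 'M[R]_(r, s)) : smx F -> smx G -> smx (fun x => F x + G x).
Proof.
move=> sF sG i j; apply: smooth_ext oU (fun y _ => esym (mxE _ _ i j)) _.
exact: smooth_add.
Qed.

Lemma smxZ r s (k : R) (F : 'rV[R]_m -> 'M[R]_(r, s)) : smx F -> smx (fun x => k *: F x).
Proof.
move=> sF i j; apply: smooth_ext oU (fun y _ => esym (mxE _ _ i j)) _.
exact: smooth_scale.
Qed.

Lemma smx_tr r s (F : 'rV[R]_m -> 'M[R]_(r, s)) : smx F -> smx (fun x => (F x)^T).
Proof.
move=> sF i j; apply: smooth_ext oU (fun y _ => esym (mxE _ _ i j)) _; exact: sF.
Qed.

Lemma smx_pmx r s a (F : 'rV[R]_m -> 'M[R]_(r, s)) : smx F -> smx (pmx a F).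
Proof.
move=> sF i j; apply: smooth_ext oU (fun y _ => esym (mxE _ _ i j)) _; exact: smooth_partial.
Qed.

Lemma smx_trace r (F : 'rV[R]_m -> 'M[R]_r) : smx F -> smooth_on U (fun x => \tr (F x)).
Proof. by move=> sF; apply: smooth_sum. Qed.

Lemma smx_det r (F : 'rV[R]_m -> 'M[R]_r) : smx F -> smooth_on U (fun x => \det (F x)).
Proof.
move=> sF; apply: smooth_sum => // s _; apply: smooth_scale => //.
by apply: smooth_prod.
Qed.

Lemma smx_inv r (F : 'rV[R]_m -> 'M[R]_r) : (forall x, U x -> F x \in unitmx) -> smx F ->
 smx (fun x => invmx (F x)).
Proof.
move=> uF sF i j.
apply: (@smooth_ext _ _ U (fun x => (\det (F x))^-1 * ((-1) ^+ (j + i) * \det (row' j (col' i (F x)))))) => //.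
 by move=> y Uy; rewrite /invmx uF // !mxE.
apply: smooth_mul => //.
 by apply: smooth_inv; [|move=> x /uF; rewrite unitmxE unitfE|exact: smx_det].
apply: smooth_scale => //; apply: smx_det => k l.
by apply: (smooth_ext oU _ (sF (lift j k) (lift i l))) => y _; rewrite !mxE.
Qed.

Lemma pmxM r s t a (F : 'rV[R]_m -> 'M[R]_(r, s)) (G : 'rV[R]_m -> 'M[R]_(s, t)) x :
 smx F -> smx G -> U x ->
 pmx a (fun y => F y *m G y) x = pmx a F x *m G x + F x *m pmx a G x.
Proof.
move=> sF sG Ux; apply/matrixP => i j; rewrite !mxE -big_split /=.
rewrite (partial_ext a oU Ux (fun y _ => mxE _ _ i j)) partial_sum.
 by apply: eq_bigr => k _; rewrite (smooth_partialM a (sF i k) (sG k j) Ux) !mxE.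
by move=> k _; apply: (smooth_derivable (smooth_mul oU (sF i k) (sG k j)) Ux).
Qed.

Lemma pmxD r s a (F G : 'rV[R]_m -> 'M[R]_(r, s)) x : smx F -> smx G -> U x ->
 pmx a (fun y => F y + G y) x = pmx a F x + pmx a G x.
Proof.
move=> sF sG Ux; apply/matrixP => i j; rewrite !mxE.
by rewrite (partial_ext a oU Ux (fun y _ => mxE _ _ i j)) (smooth_partialD a (sF i j) (sG i j) Ux).
Qed.

Lemma pmx_cst r s a (A : 'M[R]_(r, s)) x : pmx a (fun=> A) x = 0.
Proof. by apply/matrixP => i j; rewrite !mxE partial_cst. Qed.

Lemma pmxMl r s t a (A : 'M[R]_(r, s)) (F : 'rV[R]_m -> 'M[R]_(s, t)) x : smx F -> U x ->
 pmx a (fun y => A *m F y) x = A *m pmx a F x.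
Proof. by move=> sF Ux; rewrite (pmxM a (smx_cst A) sF Ux) pmx_cst mul0mx add0r. Qed.

Lemma pmxMr r s t a (A : 'M[R]_(s, t)) (F : 'rV[R]_m -> 'M[R]_(r, s)) x : smx F -> U x ->
 pmx a (fun y => F y *m A) x = pmx a F x *m A.
Proof. by move=> sF Ux; rewrite (pmxM a sF (smx_cst A) Ux) pmx_cst mulmx0 addr0. Qed.

Lemma pmxZ r s a (k : R) (F : 'rV[R]_m -> 'M[R]_(r, s)) x : smx F -> U x ->
 pmx a (fun y => k *: F y) x = k *: pmx a F x.
Proof.
move=> sF Ux; apply/matrixP => i j; rewrite !mxE.
rewrite (partial_ext a oU Ux (fun y _ => mxE _ _ i j)) partialZ //.
exact: smooth_derivable (sF i j) Ux.
Qed.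

Lemma pmx_ext r s a (F G : 'rV[R]_m -> 'M[R]_(r, s)) x : U x -> (forall y, U y -> F y = G y) ->
 pmx a F x = pmx a G x.
Proof.
by move=> Ux FG; apply/matrixP => i j; rewrite !mxE; apply: partial_ext oU Ux _ => y /FG ->.
Qed.

Lemma pmx_trmx r s a (F : 'rV[R]_m -> 'M[R]_(r, s)) x : pmx a (fun y => (F y)^T) x = (pmx a F x)^T.
Proof.
apply/matrixP => i j; rewrite !mxE; congr (partial a _ x); apply/funext => y.
by rewrite mxE.
Qed.

Lemma partial_tr r a (F : 'rV[R]_m -> 'M[R]_r) x : smx F -> U x ->
 partial a (fun y => \tr (F y)) x = \tr (pmx a F x).
Proof.
move=> sF Ux; rewrite partial_sum => [|i _]; last exact: smooth_derivable (sF i i) Ux.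
by apply: eq_bigr => i _; rewrite mxE.
Qed.

Lemma pmx_inv r a (F : 'rV[R]_m -> 'M[R]_r) x : (forall y, U y -> F y \in unitmx) -> smx F -> U x ->
 pmx a (fun y => invmx (F y)) x = - (invmx (F x) *m pmx a F x *m invmx (F x)).
Proof.
move=> uF sF Ux; have sI := smx_inv uF sF.
have := pmxM a sI sF Ux.
rewrite (pmx_ext a Ux (G := fun=> 1%:M)) => [|y Uy]; last by rewrite mulVmx // uF.
rewrite pmx_cst => /esym/eqP; rewrite addr_eq0 => /eqP /(congr1 (fun X => X *m invmx (F x))).
by rewrite -[_ *m F x *m _]mulmxA (mulmxV (uF x Ux)) mulmx1 mulNmx => ->.
Qed.

Lemma pmxC r s a b (F : 'rV[R]_m -> 'M[R]_(r, s)) x : smx F -> U x ->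
 pmx a (pmx b F) x = pmx b (pmx a F) x.
Proof.
move=> sF Ux; apply/matrixP => i j; rewrite [LHS]pmxE [RHS]pmxE.
apply: etrans (partial_ext a oU Ux (fun y _ => pmxE b F y i j)) _.
apply: etrans (esym (partial_ext b oU Ux (fun y _ => pmxE a F y i j))).
exact: (partialC a b oU Ux (sF i j)).
Qed.

End MatrixCalculus.

Section KahlerChart.
Context {R : realType} {m : nat}.
Variables (J : 'M[R]_m) (U : set 'rV[R]_m) (g : 'rV[R]_m -> 'M[R]_m).
Hypotheses (JT : J^T = - J) (JJ : J *m J = - 1%:M) (oU : open U).
Hypotheses (sg : smx U g) (gT : forall x, U x -> (g x)^T = g x) (ug : forall x, U x -> g x \in unitmx).
Hypothesis hg : forall x, U x -> J *m g x *m J^T = g x.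
Hypothesis dw : forall x a b c, U x ->
 partial a (fun y => (J *m g y) b c) x + partial b (fun y => (J *m g y) c a) x
 + partial c (fun y => (J *m g y) a b) x = 0.
Implicit Types (x : 'rV[R]_m) (a b c d : 'I_m) (S : 'rV[R]_m -> 'M[R]_m).
Local Notation ig x := (invmx (g x)).

Lemma J_conj (A : 'M[R]_m) : J *m A *m J^T = A -> J *m A = A *m J.
Proof.
move=> h; rewrite -[in RHS]h -!mulmxA JT mulNmx JJ opprK mulmx1 //.
Qed.

Lemma Jg x : U x -> J *m g x = g x *m J.
Proof. by move=> Ux; apply: J_conj; exact: hg. Qed.

Lemma Jig x : U x -> J *m ig x = ig x *m J.
Proof.
move=> Ux; have ux := ug Ux.
by rewrite -[RHS](mulmxK ux) -[_ *m J *m g x]mulmxA (Jg Ux) (mulKmx ux).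
Qed.

Lemma igT x : U x -> (ig x)^T = ig x.
Proof. by move=> Ux; rewrite trmx_inv gT. Qed.

Lemma sig : smx U (fun x => ig x).
Proof. exact: smx_inv. Qed.

Lemma sJ : smx U (fun=> J). Proof. exact: smx_cst. Qed.

(* The cyclic condition says that the 2-form with matrix [J *m S] is closed. *)
Lemma closed_form S a x : smx U S -> U x -> (forall y, U y -> (S y)^T = S y) ->
 (forall y, U y -> J *m S y = S y *m J) ->
 (forall b c, partial a (fun y => (J *m S y) b c) x + partial b (fun y => (J *m S y) c a) x
  + partial c (fun y => (J *m S y) a b) x = 0) ->
 let A := \matrix_(b, c) pmx b S x a c in
 J *m pmx a S x = A *m J + J *m A^T.
Proof.
move=> sS Ux ST JS cl A.
have antis y b c : U y -> (J *m S y) b c = - (S y *m J) c b.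
 move=> Uy; have -> : (J *m S y) b c = (J *m S y)^T c b by rewrite [RHS]mxE.
 by rewrite trmx_mul ST // JT mulmxN mxE.
have -> : J *m A^T = - (A *m J)^T by rewrite trmx_mul JT mulNmx opprK.
apply/matrixP => b c; rewrite -(pmxMl oU a J sS Ux) pmxE !mxE.
have := cl b c.
have AJ i j : \sum_k A i k * J k j = partial i (fun y => (S y *m J) a j) x.
 rewrite -pmxE (pmxMr oU i J sS Ux) mxE; apply: eq_bigr => k _; by rewrite mxE.
rewrite !AJ.
rewrite (partial_ext b oU Ux (fun y Uy => antis y c a Uy)).
rewrite (partial_ext c oU Ux (fun y Uy => congr1 (fun Z : ('M[R]_m) => Z a b) (JS y Uy))).
have sSJ := smxM oU sS sJ.
have -> : partial b (fun y => - (S y *m J) a c) x = - partial b (fun y => (S y *m J) a c) x.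
 rewrite (_ : (fun y => _) = (fun y => (-1) * (S y *m J) a c)).
  by rewrite (partialZ _ (@smooth_derivable _ _ _ _ b _ (sSJ a c) Ux)) mulN1r.
 by apply/funext => y; rewrite mulN1r.
move: (partial _ _ _) (partial _ _ _) (partial _ _ _) => u v w; lra.
Qed.

Definition Cm a x : 'M[R]_m := \matrix_(b, c) christoffel g c a b x.

Lemma Cm_sym a b c x : U x -> Cm a x b c = Cm b x a c.
Proof.
move=> Ux; rewrite !mxE /christoffel; congr (_ * _); apply: eq_bigr => d _; congr (_ * _).
rewrite [in X in _ = _ - X](partial_ext d oU Ux (g := fun y => g y a b)) => [|y Uy]; first by rewrite [X in X - _]addrC.
by rewrite -[in LHS](gT Uy) mxE.
Qed.

Lemma Cm_g a x : U x -> Cm a x *m g x =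
 \matrix_(b, c) (2^-1 * (partial a (fun y => g y b c) x + partial b (fun y => g y a c) x
  - partial c (fun y => g y a b) x)).
Proof.
move=> Ux; apply/matrixP => b c; rewrite !mxE.
pose v : 'rV[R]_m := \row_d (partial a (fun y => g y b d) x + partial b (fun y => g y a d) x
  - partial d (fun y => g y a b) x).
transitivity (2^-1 * (v *m ig x *m g x) 0 c); last by rewrite mulmxKV ?ug // mxE.
rewrite mxE mulr_sumr; apply: eq_bigr => d _; rewrite !mxE /christoffel -mulrA; congr (_ * (_ * _)).
apply: eq_bigr => e _; rewrite mulrC mxE; congr (_ * _).
by rewrite -{1}(igT Ux) mxE.
Qed.

(** Compatibility of the Levi-Civita connection with the metric. *)
Lemma pmx_g a x : U x -> pmx a g x = Cm a x *m g x + g x *m (Cm a x)^T.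
Proof.
move=> Ux; have gb y b c : U y -> g y b c = g y c b by move=> Uy; rewrite -{1}(gT Uy) mxE.
have -> : g x *m (Cm a x)^T = (Cm a x *m g x)^T by rewrite trmx_mul (gT Ux).
rewrite Cm_g //; apply/matrixP => b c; rewrite pmxE !mxE.
rewrite (partial_ext a oU Ux (fun y Uy => gb y c b Uy)).
move: (partial _ _ _) (partial _ _ _) (partial _ _ _) => u v w; lra.
Qed.

(** This is $\nabla J=0$. By the Koszul formula the lowered Christoffel matrix is half of
    $\partial_ag+A-A^T$. The first term commutes with [J] because the metric is Hermitian;
    closedness of the fundamental form, in the shape of [E1] and [E2], says that $A-A^T$ does
    too. *)
Lemma Cm_J a x : U x -> Cm a x *m J = J *m Cm a x.
Proof.
move=> Ux; pose A := \matrix_(b, c) pmx b g x a c.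
have E1 : J *m pmx a g x = A *m J + J *m A^T.
 by apply: closed_form => // [y Uy|b c]; [exact: Jg|exact: dw].
have E2 : pmx a g x *m J = J *m A + A^T *m J.
 have := congr1 (fun Z => J *m Z *m J) E1.
 rewrite mulmxDr mulmxDl !mulmxA JJ -[J *m A *m J *m J]mulmxA JJ !mulNmx !mul1mx mulmxN mulmx1.
 by rewrite -opprD => /oppr_inj.
have JP : J *m pmx a g x = pmx a g x *m J.
 by rewrite -(pmxMl oU a J sg Ux) -(pmxMr oU a J sg Ux); apply: (@pmx_ext _ _ _ oU _ _ a _ _ x Ux) => y Uy; exact: Jg.
have L : Cm a x *m g x = 2^-1 *: (pmx a g x + A - A^T).
 by rewrite Cm_g //; apply/matrixP => b c; rewrite !mxE.
have key : Cm a x *m g x *m J = J *m (Cm a x *m g x).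
 rewrite L -scalemxAl -scalemxAr; congr (_ *: _).
 rewrite !mulmxDl !mulmxDr !mulmxN !mulNmx JP -!addrA; congr (_ + _).
 have := E1; rewrite JP E2 => /eqP; rewrite eq_sym -subr_eq0 => /eqP h.
 apply/eqP; rewrite -subr_eq0 -[X in _ == X]h; apply/eqP.
 by move: (A *m J) (J *m A) (A^T *m J) (J *m A^T) => B1 B2 B3 B4; apply/matrixP => i j; rewrite !mxE; ring.
have := congr1 (fun Z => Z *m ig x) key.
by rewrite -[Cm a x *m g x *m J]mulmxA -(Jg Ux) !mulmxA !(mulmxK (ug Ux)).
Qed.

Lemma smx_Cm a : smx U (Cm a).
Proof.
move=> b c; apply: smooth_ext oU (fun y _ => esym (mxE _ _ b c)) _; apply: smooth_scale => //.
apply: smooth_sum => // d _; apply: smooth_mul => //; first exact: sig.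
by apply: smooth_subr => //; [apply: smooth_add => //|]; apply: smooth_partial; exact: sg.
Qed.

Lemma pmx_ig a x : U x -> pmx a (fun y => ig y) x = - (ig x *m Cm a x) - (Cm a x)^T *m ig x.
Proof.
move=> Ux; rewrite (pmx_inv oU a ug sg Ux) (pmx_g a Ux) mulmxDr mulmxDl !mulmxA.
by rewrite mulVmx ?ug // mul1mx -[_ *m g x *m _]mulmxA mulmxV ?ug // mulmx1 opprD.
Qed.

Definition divg (V : 'rV[R]_m -> 'rV[R]_m) x : R := \sum_c (pmx c V x + V x *m Cm c x) 0 c.

(* Row [a] of [nab X] is the covariant derivative of the vector field [X] along [d_a]. *)
Definition nab (X : 'rV[R]_m -> 'rV[R]_m) x : 'M[R]_m :=
 \matrix_(a, c) (pmx a X x + X x *m Cm a x) 0 c.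

Lemma row_nab a X x : row a (nab X x) = pmx a X x + X x *m Cm a x.
Proof. by apply/rowP => c; rewrite mxE mxE. Qed.

Lemma divgE X x : divg X x = \tr (nab X x).
Proof. by apply: eq_bigr => c _; rewrite [RHS]mxE. Qed.

Lemma smx_nab X : smx U X -> smx U (nab X).
Proof.
move=> sX i j; apply: smooth_ext oU (fun y _ => esym (mxE _ _ i j)) _.
by apply: smxD => //; [exact: smx_pmx|apply: smxM => //; exact: smx_Cm].
Qed.

(** Leibniz rule; the bracket in the last sum is the covariant derivative of the endomorphism field
    [Q]. *)
Lemma divg_mul (X : 'rV[R]_m -> 'rV[R]_m) (Q : 'rV[R]_m -> 'M[R]_m) x : smx U X -> smx U Q -> U x ->
 divg (fun y => X y *m Q y) x = \tr (nab X x *m Q x) +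
  \sum_c (X x *m (pmx c Q x + Q x *m Cm c x - Cm c x *m Q x)) 0 c.
Proof.
move=> sX sQ Ux; rewrite /divg /mxtrace -big_split; apply: eq_bigr => c _ /=.
have -> : (nab X x *m Q x) c c = ((pmx c X x + X x *m Cm c x) *m Q x) 0 c.
 by rewrite -row_nab -row_mul [RHS]mxE.
have addE (A B : 'rV[R]_m) : A 0 c + B 0 c = (A + B) 0 c by rewrite [RHS]mxE.
rewrite (pmxM oU c sX sQ Ux) addE; congr (fun_of_matrix _ 0 c).
rewrite mulmxDl mulmxBr mulmxDr !mulmxA.
move: (_ *m Q x) (_ *m Q x) (X x *m pmx c Q x) (_ *m Cm c x) => B1 B2 B3 B4.
by apply/rowP => i; rewrite !mxE; ring.
Qed.

(** The index algebra of the contracted Ricci identity, detached from the calculus: [C] and [dC]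
    stand for Christoffel symbols and their derivatives, [X], [dX] and [d2] for the field and its
    first and second derivatives. Torsion-freeness is the symmetry hypothesis on [C]. *)
Lemma ricci_sums (C : 'I_m -> 'I_m -> 'I_m -> R) (dC : 'I_m -> 'I_m -> 'I_m -> 'I_m -> R)
 (dX : 'I_m -> 'I_m -> R) (X d2 : 'I_m -> R) a : (forall a b c, C a b c = C b a c) ->
 \sum_c (d2 c + \sum_b (dX c b * C a b c + X b * dC c a b c)
  + \sum_b (dX a b + \sum_d X d * C a d b) * C c b c
  - \sum_e C c a e * (dX e c + \sum_d X d * C e d c)) =
 \sum_c (d2 c + \sum_b (dX a b * C c b c + X b * dC a c b c))
 + \sum_b (\sum_c (dC c a b c - dC a c b c + \sum_e (C c e c * C a b e - C a e c * C c b e))) * X b.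
Proof.
move=> Cs.
have S1 : \sum_c \sum_b dX c b * C a b c = \sum_c \sum_e C c a e * dX e c.
 by rewrite exchange_big; apply: eq_bigr => b _; apply: eq_bigr => c _; rewrite (Cs b) mulrC.
have S4 : \sum_c \sum_b (\sum_d X d * C a d b) * C c b c = \sum_c \sum_b \sum_e (C c e c * C a b e) * X b.
 apply: eq_bigr => c _; rewrite exchange_big /=; apply: eq_bigr => b _; rewrite mulr_suml.
 by apply: eq_bigr => d _; ring.
have S5 : \sum_c \sum_e C c a e * (\sum_d X d * C e d c) = \sum_c \sum_b \sum_e (C a e c * C c b e) * X b.
 rewrite exchange_big; apply: eq_bigr => e _; rewrite exchange_big /=; apply: eq_bigr => c _; rewrite mulr_sumr.
 by apply: eq_bigr => d _; rewrite (Cs c a); ring.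
have E (G1 G2 G3 : 'I_m -> R) (G4 G5 : 'I_m -> 'I_m -> R) :
 \sum_c (G1 c + \sum_b (G4 c b + G5 c b) + G2 c - G3 c) =
 \sum_c G1 c + \sum_c \sum_b G4 c b + \sum_c \sum_b G5 c b + \sum_c G2 c - \sum_c G3 c.
 rewrite -sumrN -!big_split; apply: eq_bigr => c _; rewrite big_split /=; ring.
rewrite E.
have -> : \sum_c \sum_b (dX a b + \sum_d X d * C a d b) * C c b c =
 \sum_c \sum_b dX a b * C c b c + \sum_c \sum_b \sum_e (C c e c * C a b e) * X b.
 rewrite -S4 -big_split; apply: eq_bigr => c _; rewrite -big_split; apply: eq_bigr => b _.
 by rewrite mulrDl.
have -> : \sum_c \sum_e C c a e * (dX e c + \sum_d X d * C e d c) =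
 \sum_c \sum_b dX c b * C a b c + \sum_c \sum_b \sum_e (C a e c * C c b e) * X b.
 rewrite S1 -S5 -big_split; apply: eq_bigr => c _; rewrite -big_split; apply: eq_bigr => b _.
 by rewrite mulrDr.
have -> : \sum_b (\sum_c (dC c a b c - dC a c b c + \sum_e (C c e c * C a b e - C a e c * C c b e))) * X b =
 \sum_c \sum_b X b * dC c a b c - \sum_c \sum_b X b * dC a c b c +
 \sum_c \sum_b \sum_e (C c e c * C a b e) * X b - \sum_c \sum_b \sum_e (C a e c * C c b e) * X b.
 under eq_bigr => b _ do rewrite mulr_suml.
 rewrite exchange_big /= -!sumrN -!big_split; apply: eq_bigr => c _.
 rewrite /= -!sumrN -!big_split; apply: eq_bigr => b _ /=.
 rewrite mulrDl mulrBl mulr_suml; under [X in _ + X = _]eq_bigr => e _ do rewrite mulrBl.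
 by rewrite sumrB; move: (\sum_(e < m) _) (\sum_(e < m) _) => u v; ring.
have -> : \sum_c (d2 c + \sum_b (dX a b * C c b c + X b * dC a c b c)) =
 \sum_c d2 c + \sum_c \sum_b dX a b * C c b c + \sum_c \sum_b X b * dC a c b c.
 by rewrite -!big_split; apply: eq_bigr => c _; rewrite big_split /= addrA.
move: (\sum_c d2 c) (\sum_c \sum_b dX c b * _) (\sum_c \sum_b X b * dC c a b c) (\sum_c \sum_b dX a b * _) => t1 t2 t3 t4.
move: (\sum_c \sum_b X b * _) (\sum_c _) (\sum_c _) => t5 t6 t7; ring.
Qed.

(** The divergence of $\nabla_XX$. The field is arbitrary and $\nabla X$ may fail to be symmetric,
    so that the formula also applies to the field $JX$ in [kahler_bochner]. *)
Lemma bochner (X : 'rV[R]_m -> 'rV[R]_m) x : smx U X -> U x ->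
 divg (fun y => X y *m nab X y) x = \sum_a X x 0 a * partial a (divg X) x
  + (X x *m ricci g x *m (X x)^T) 0 0 + \tr (nab X x *m nab X x).
Proof.
move=> sX Ux; have sY := smx_nab sX.
rewrite (divg_mul sX sY Ux) addrC; congr (_ + _).
pose dX a b := partial a (fun y => X y 0 b) x.
pose dC a b c d := partial a (fun y => Cm b y c d) x.
pose C a b c := Cm a x b c.
have dXC a b c e : partial e (fun y => X y 0 b * Cm a y b c) x = dX e b * C a b c + X x 0 b * dC e a b c.
 by rewrite (smooth_partialM e (sX 0 b) (smx_Cm a b c) Ux).
have nabE y a c : nab X y a c = partial a (fun z => X z 0 c) y + \sum_b X y 0 b * Cm a y b c.
 rewrite [LHS]mxE [LHS]mxE pmxE; congr (_ + _); by rewrite mxE.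
have dY e a c : partial e (fun y => nab X y a c) x =
  partial e (partial a (fun y => X y 0 c)) x + \sum_b (dX e b * C a b c + X x 0 b * dC e a b c).
 rewrite (partial_ext e oU Ux (fun y _ => nabE y a c)).
 rewrite (smooth_partialD e (smooth_partial a (sX 0 c)) _ Ux); last first.
  by apply: smooth_sum => // b _; apply: smooth_mul; [exact: oU|exact: sX|exact: smx_Cm].
 congr (_ + _); rewrite partial_sum => [|b _]; first exact: eq_bigr.
 exact: smooth_derivable (smooth_mul oU (sX 0 b) (smx_Cm a b c)) Ux.
have ddiv a : partial a (divg X) x = \sum_c (partial a (partial c (fun y => X y 0 c)) x
  + \sum_b (dX a b * C c b c + X x 0 b * dC a c b c)).
 rewrite (partial_ext a oU Ux (fun y _ => divgE X y)) (partial_tr a sY Ux).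
 by apply: eq_bigr => c _; rewrite pmxE dY.
have ricE a b : ricci g x a b = \sum_c (dC c a b c - dC a c b c
  + \sum_e (C c e c * C a b e - C a e c * C c b e)).
 rewrite mxE; apply: eq_bigr => c _; rewrite /riemann /dC /C; congr (_ - _ + _).
 - by congr (partial c _ x); apply/funext => y; rewrite mxE.
 - by congr (partial a _ x); apply/funext => y; rewrite mxE.
 - by apply: eq_bigr => e _; rewrite !mxE.
have -> : (X x *m ricci g x *m (X x)^T) 0 0 = \sum_a X x 0 a * \sum_b ricci g x a b * X x 0 b.
 rewrite -mulmxA mxE; apply: eq_bigr => a _; rewrite mxE; congr (_ * _).
 by apply: eq_bigr => b _; rewrite [(X x)^T _ _]mxE.
rewrite -big_split /=.
transitivity (\sum_a X x 0 a * \sum_c (pmx c (nab X) x + nab X x *m Cm c x - Cm c x *m nab X x) a c).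
 under eq_bigr => c _ do rewrite mxE.
 by rewrite exchange_big; apply: eq_bigr => a _; rewrite mulr_sumr.
apply: eq_bigr => a _; rewrite -mulrDr; congr (_ * _); rewrite ddiv.
under [X in _ = _ + X]eq_bigr => b _ do rewrite ricE.
have Cs a1 b1 c1 : C a1 b1 c1 = C b1 a1 c1 by exact: Cm_sym.
rewrite -(ricci_sums dC dX (fun b => X x 0 b) _ a Cs).
have subE (Z1 Z2 : 'M[R]_m) i j : (Z1 - Z2) i j = Z1 i j - Z2 i j by rewrite !mxE.
apply: eq_bigr => c _; rewrite subE; congr (_ - _); last first.
 rewrite mxE; apply: eq_bigr => e _; rewrite nabE /C; congr (_ * (_ + _)).
rewrite mxE; congr (_ + _); last first.
 by rewrite mxE; apply: eq_bigr => b _; rewrite nabE.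
by rewrite pmxE dY (partialC c a oU Ux (sX 0 c)).
Qed.

(** The first-order term $p_c\Gamma^c_{ab}$ of a Hessian. *)
Definition Fm (p : 'rV[R]_m) x : 'M[R]_m := \matrix_(a, b) (p *m (Cm a x)^T) 0 b.

Lemma FmT p x : U x -> (Fm p x)^T = Fm p x.
Proof.
move=> Ux; apply/matrixP => a b; rewrite !mxE; apply: eq_bigr => c _.
by rewrite [in LHS]mxE [in RHS]mxE (Cm_sym _ _ _ Ux).
Qed.

Lemma Fm_MJ p x : U x -> Fm p x *m J = Fm (p *m J) x.
Proof.
move=> Ux; apply/row_matrixP => a; rewrite row_mul.
have rF q : row a (Fm q x) = q *m (Cm a x)^T by apply/rowP => b; rewrite mxE mxE.
rewrite !rF -!mulmxA; congr (_ *m _); have := congr1 trmx (Cm_J a Ux).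
by rewrite !trmx_mul JT mulNmx mulmxN => /oppr_inj ->.
Qed.

(* The Hessian of a function differs from its matrix of second derivatives by a
 J-anti-invariant matrix. *)
Lemma FmJ p x : U x -> Fm p x *m J = - (J *m Fm p x).
Proof.
by move=> Ux; rewrite (Fm_MJ p Ux) -(FmT _ Ux) -(Fm_MJ p Ux) trmx_mul JT (FmT _ Ux) mulNmx.
Qed.

Implicit Types (th ta : 'rV[R]_m -> 'rV[R]_m).

Definition Dm th x : 'M[R]_m := \matrix_(a, b) partial a (fun y => th y 0 b) x.

Definition clsd th := smx U th /\ forall x, U x -> (Dm th x)^T = Dm th x.

Definition shp th x : 'rV[R]_m := th x *m ig x.

Definition Hm th x : 'M[R]_m := Dm th x - Fm (th x) x.

(** By [PmH] this is the J-invariant part of [Hm]. It is written with bare derivatives because the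
    Christoffel term is J-anti-invariant ([FmJ]); this makes both its closedness and its behaviour
    under holomorphic changes of chart accessible. *)
Definition Pm th x : 'M[R]_m := 2^-1 *: (Dm th x + J *m Dm th x *m J^T).

Lemma smx_shp th : smx U th -> smx U (shp th).
Proof. by move=> s; apply: smxM => //; exact: sig. Qed.

Lemma smx_Dm th : smx U th -> smx U (Dm th).
Proof.
move=> s a b; apply: smooth_ext oU (fun y _ => esym (mxE _ _ a b)) _.
exact: smooth_partial.
Qed.

Lemma smx_Pm th : smx U th -> smx U (Pm th).
Proof.
move=> s; apply: smxZ => //; apply: smxD => //; first exact: smx_Dm.
by apply: smxM => //; [apply: smxM => //; [exact: smx_cst|exact: smx_Dm]|exact: smx_cst].
Qed.

Lemma nab_shp th x : smx U th -> U x -> nab (shp th) x = Hm th x *m ig x.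
Proof.
move=> s Ux; apply/row_matrixP => a; rewrite row_mul row_nab /shp.
rewrite (pmxM oU a s sig Ux) (pmx_ig a Ux).
have -> : row a (Hm th x) = pmx a th x - th x *m (Cm a x)^T.
 by apply/rowP => b; rewrite !mxE.
rewrite mulmxBr mulmxN mulmxBl !mulmxA.
move: (_ *m ig x) (_ *m ig x) (_ *m Cm a x) => A1 A2 A3.
by apply/rowP => b; rewrite !mxE; ring.
Qed.

Lemma HmT th x : clsd th -> U x -> (Hm th x)^T = Hm th x.
Proof. by move=> [_ h] Ux; rewrite /Hm linearB /= h // FmT. Qed.

Lemma PmT th x : clsd th -> U x -> (Pm th x)^T = Pm th x.
Proof.
by move=> [_ h] Ux; rewrite /Pm linearZ linearD /= !trmx_mul trmxK h // mulmxA.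
Qed.

Lemma JPm th x : J *m Pm th x = Pm th x *m J.
Proof.
rewrite /Pm -scalemxAr -scalemxAl; congr (_ *: _); rewrite mulmxDl mulmxDr !mulmxA JJ JT.
by rewrite !mulNmx !mulmxN mul1mx opprK mulNmx -[_ *m J *m J]mulmxA JJ mulmxN mulmx1 opprK addrC.
Qed.

Lemma PmH th x : U x -> Pm th x = 2^-1 *: (Hm th x + J *m Hm th x *m J^T).
Proof.
move=> Ux; rewrite /Pm /Hm; congr (_ *: _); rewrite mulmxBr mulmxBl.
have -> : J *m Fm (th x) x *m J^T = - Fm (th x) x.
 rewrite JT mulmxN -mulmxA (FmJ _ Ux) mulmxN opprK mulmxA JJ mulNmx mul1mx //.
by rewrite opprK addrACA [- _ + _]addNr addr0.
Qed.

Lemma JHJ th x : U x -> J *m Hm th x *m J = Hm th x - 2 *: Pm th x.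
Proof.
move=> Ux; rewrite (PmH th Ux) scalerA (_ : 2 * 2^-1 = 1) ?scale1r; last by field.
by move: (Hm th x) => H; rewrite opprD addrA subrr add0r JT mulmxN opprK.
Qed.

(* The covariant derivative of [Pm ta] contracts to half the differential of its
 trace because the 2-form with matrix [J *m Pm ta] is closed. *)
Definition Nm a ta x : 'M[R]_m := pmx a (Pm ta) x - Cm a x *m Pm ta x - Pm ta x *m (Cm a x)^T.

(** The form with matrix [J *m Pm ta] is half the exterior derivative of the 1-form [ta *m J], so
    its closedness is the symmetry of second derivatives. *)
Lemma closed_JPm ta a x : clsd ta -> U x ->
 let A := \matrix_(b, c) pmx b (Pm ta) x a c in
 J *m pmx a (Pm ta) x = A *m J + J *m A^T.
Proof.
move=> ct Ux; have [st Dt] := ct; apply: closed_form => //; [exact: smx_Pm|by move=> y Uy; exact: PmT|by move=> *; exact: JPm|].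
move=> b c; pose e y := ta y *m J.
have se : smx U e by apply: smxM => //; exact: smx_cst.
have De y : U y -> Dm e y = Dm ta y *m J.
 move=> Uy; apply/matrixP => i j; rewrite [LHS]mxE -pmxE (pmxMr oU i J st Uy) !mxE.
 by apply: eq_bigr => k _; rewrite !mxE.
have JP y i j : U y -> (J *m Pm ta y) i j = 2^-1 * (partial i (fun z => e z 0 j) y - partial j (fun z => e z 0 i) y).
 move=> Uy; have -> : J *m Pm ta y = 2^-1 *: (Dm e y - (Dm e y)^T).
  rewrite /Pm -scalemxAr De // trmx_mul (Dt y Uy) JT mulNmx opprK mulmxDr !mulmxA JJ.
  by rewrite mulmxN mulNmx mul1mx mulNmx opprK addrC.
 by rewrite !mxE.
have P2 i j k : partial k (fun y => (J *m Pm ta y) i j) x =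
 2^-1 * (partial k (partial i (fun z => e z 0 j)) x - partial k (partial j (fun z => e z 0 i)) x).
 rewrite (partial_ext k oU Ux (fun y Uy => JP y i j Uy)).
 have si := smooth_partial i (se 0 j); have sj := smooth_partial j (se 0 i).
 rewrite partialZ; last exact: smooth_derivable (smooth_subr oU si sj) Ux.
 by rewrite (smooth_partialB k si sj Ux).
rewrite !P2 (partialC c a oU Ux (se 0 b)) (partialC b a oU Ux (se 0 c)) (partialC c b oU Ux (se 0 a)).
move: (partial _ _ _) (partial _ _ _) (partial _ _ _) => u v w; ring.
Qed.

Lemma Nm_trace ta a x : clsd ta -> U x ->
 \sum_c (Nm c ta x *m ig x) a c = 2^-1 * \tr (Nm a ta x *m ig x).
Proof.
move=> ct Ux; pose A := \matrix_(b, c) pmx b (Pm ta) x a c.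
pose B := \matrix_(b, c) Nm b ta x a c; pose P := Pm ta x; pose F := Fm (row a P) x.
have BE : B = A - Cm a x *m P - F.
 apply/matrixP => b c; rewrite [LHS]mxE /Nm [LHS]mxE [in LHS]mxE [RHS]mxE [in RHS]mxE [in RHS]mxE.
 have opE (Z : 'M[R]_m) i j : (- Z) i j = - Z i j by rewrite mxE.
 rewrite !opE.
 congr (_ - _ - _).
  by rewrite [LHS]mxE [RHS]mxE; apply: eq_bigr => d _; rewrite (Cm_sym _ _ _ Ux).
 by rewrite [LHS]mxE [RHS]mxE [RHS]mxE; apply: eq_bigr => d _; rewrite [in RHS]mxE.
have NE : J *m Nm a ta x = B *m J + J *m B^T.
 have E := closed_JPm a ct Ux; rewrite -/A in E.
 have trmxB (Z1 Z2 : 'M[R]_m) : (Z1 - Z2)^T = Z1^T - Z2^T by rewrite linearB.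
 have FJ : F *m J = - (J *m F) by exact: FmJ.
 have CPJ : Cm a x *m P *m J = J *m (Cm a x *m P) by rewrite -mulmxA -JPm !mulmxA -(Cm_J a Ux).
 have BT : B^T = A^T - P *m (Cm a x)^T - F.
  by rewrite BE !trmxB trmx_mul (PmT ct Ux) (FmT _ Ux).
 have E1 : B *m J = A *m J - J *m (Cm a x *m P) + J *m F by rewrite BE !mulmxBl FJ opprK CPJ.
 have E2 : J *m B^T = J *m A^T - J *m (P *m (Cm a x)^T) - J *m F by rewrite BT !mulmxBr.
 have E3 : J *m Nm a ta x = A *m J + J *m A^T - J *m (Cm a x *m P) - J *m (P *m (Cm a x)^T).
  by rewrite /Nm !mulmxBr E.
 rewrite E1 E2 E3.
 move: (A *m J) (J *m A^T) (J *m (Cm a x *m P)) (J *m (P *m _)) (J *m F) => *.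
 by apply/matrixP => i j; rewrite !mxE; ring.
have NE2 : Nm a ta x = - (J *m B *m J) + B^T.
 have := congr1 (fun Z => - (J *m Z)) NE; rewrite mulmxDr !mulmxA JJ !mulNmx !mul1mx opprK => ->.
 by rewrite opprD opprK.
have -> : \sum_c (Nm c ta x *m ig x) a c = \tr (B *m ig x).
 apply: eq_bigr => c _; rewrite [LHS]mxE [RHS]mxE; apply: eq_bigr => b _; by rewrite [in RHS]mxE.
have tB : \tr (B^T *m ig x) = \tr (B *m ig x).
 by rewrite -mxtrace_tr trmx_mul trmxK (igT Ux) mxtrace_mulC.
have tJ : \tr (J *m B *m J *m ig x) = - \tr (B *m ig x).
 rewrite -mulmxA (Jig Ux) mulmxA mxtrace_mulC !mulmxA JJ mulNmx mul1mx mulNmx linearN /=.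
 by [].
by rewrite NE2 mulmxDl mulNmx linearD linearN /= tJ tB; lra.
Qed.

(** The last term is [Nm_trace]. Integrated, this formula is the source of the identity between
    $\int|P|^2$ and $\frac12\int(\Delta f)^2$ in [mean_pp]. *)
Lemma divg_Pm th ta x : clsd th -> clsd ta -> U x ->
 divg (fun y => shp th y *m (Pm ta y *m ig y)) x =
 \tr (Hm th x *m ig x *m (Pm ta x *m ig x))
 + 2^-1 * \sum_a shp th x 0 a * partial a (fun y => \tr (Pm ta y *m ig y)) x.
Proof.
move=> [sth _] ct Ux; have sP := smx_Pm ct.1; have sQ := smxM oU sP sig.
rewrite (divg_mul (smx_shp sth) sQ Ux) (nab_shp sth Ux); congr (_ + _).
have dQ c : pmx c (fun y => Pm ta y *m ig y) x = pmx c (Pm ta) x *m ig x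
  - Pm ta x *m ig x *m Cm c x - Pm ta x *m (Cm c x)^T *m ig x.
 by rewrite (pmxM oU c sP sig Ux) (pmx_ig c Ux) mulmxBr mulmxN !mulmxA addrA.
have E c : pmx c (fun y => Pm ta y *m ig y) x + Pm ta x *m ig x *m Cm c x - Cm c x *m (Pm ta x *m ig x)
 = Nm c ta x *m ig x.
 rewrite dQ /Nm !mulmxBl !mulmxA; move: (_ *m ig x) (_ *m ig x *m _) (_ *m _ *m ig x) (_ *m ig x) => *.
 by apply/matrixP => i j; rewrite !mxE; ring.
under eq_bigr => c _ do rewrite E mxE.
rewrite exchange_big mulr_sumr; apply: eq_bigr => a _ /=.
rewrite -mulr_sumr (Nm_trace a ct Ux) mulrCA; congr (_ * (_ * _)).
have trB (Z1 Z2 : 'M[R]_m) : \tr (Z1 - Z2) = \tr Z1 - \tr Z2 by rewrite linearB.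
rewrite (partial_tr a sQ Ux) dQ /Nm !mulmxBl !trB; congr (_ - _ - _).
by rewrite -[_ *m _ *m ig x]mulmxA mxtrace_mulC.
Qed.

Lemma trHm th x : clsd th -> U x -> divg (shp th) x = \tr (Pm th x *m ig x).
Proof.
move=> ct Ux; have G (A B : 'M[R]_m) : \tr ((2^-1 *: (A + B)) *m ig x) = 2^-1 * (\tr (A *m ig x) + \tr (B *m ig x)).
 by rewrite -scalemxAl mxtraceZ mulmxDl mxtraceD.
rewrite divgE (nab_shp ct.1 Ux) (PmH _ Ux) G.
have trN (Z : 'M[R]_m) : \tr (- Z) = - \tr Z by rewrite linearN.
have -> : \tr (J *m Hm th x *m J^T *m ig x) = \tr (Hm th x *m ig x).
 rewrite JT mulmxN mulNmx -mulmxA (Jig Ux) mulmxA trN mxtrace_mulC !mulmxA JJ.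
 by rewrite !mulNmx mul1mx trN opprK.
by move: (\tr _) => t; lra.
Qed.

Lemma divg_D th x : clsd th -> U x -> divg (shp th) x = \tr (Dm th x *m ig x).
Proof.
move=> ct Ux; rewrite (trHm ct Ux) /Pm -scalemxAl mxtraceZ mulmxDl mxtraceD.
have trN (Z : 'M[R]_m) : \tr (- Z) = - \tr Z by rewrite linearN.
have -> : \tr (J *m Dm th x *m J^T *m ig x) = \tr (Dm th x *m ig x).
 rewrite JT mulmxN mulNmx -mulmxA (Jig Ux) mulmxA trN mxtrace_mulC !mulmxA JJ.
 by rewrite !mulNmx mul1mx trN opprK.
by move: (\tr _) => t; lra.
Qed.

Definition grad (f : 'rV[R]_m -> R) x : 'rV[R]_m := \row_a partial a f x.

Lemma smx_grad f : smooth_on U f -> smx U (grad f).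
Proof.
move=> sf i b; apply: smooth_ext oU (fun y _ => esym (mxE _ _ i b)) _.
exact: smooth_partial.
Qed.

Lemma Dm_gradE f a b x : Dm (grad f) x a b = partial a (partial b f) x.
Proof. by rewrite mxE; congr (partial a _ x); apply/funext => y; rewrite mxE. Qed.

Lemma clsd_grad f : smooth_on U f -> clsd (grad f).
Proof.
move=> sf; split=> [|x Ux]; first exact: smx_grad.
by apply/matrixP => a b; rewrite [LHS]mxE !Dm_gradE; exact: (partialC _ _ oU Ux sf).
Qed.

Lemma hessianE f x : hessian g f x = Hm (grad f) x.
Proof.
have subE (Z1 Z2 : 'M[R]_m) i j : (Z1 - Z2) i j = Z1 i j - Z2 i j by rewrite !mxE.
apply/matrixP => a b; rewrite [LHS]mxE /Hm subE Dm_gradE; congr (_ - _).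
rewrite [RHS]mxE [RHS]mxE; apply: eq_bigr => c _; rewrite mulrC; congr (_ * _).
 by rewrite mxE.
by rewrite [RHS]mxE [RHS]mxE.
Qed.

Lemma laplacianE f x : smooth_on U f -> U x -> laplacian g f x = divg (shp (grad f)) x.
Proof.
move=> sf Ux; rewrite /laplacian hessianE mxtrace_mulC divgE nab_shp //.
exact: smx_grad.
Qed.

(** The Christoffel part of the Hessian is J-anti-invariant, so its trace against the J-invariant
    inverse metric vanishes. *)
Lemma laplacian_flat f x : smooth_on U f -> U x ->
 laplacian g f x = \sum_a \sum_b ig x a b * partial a (partial b f) x.
Proof.
move=> sf Ux; rewrite laplacianE // (divg_D (clsd_grad sf) Ux) mxtrace_mulC.
apply: eq_bigr => a _; rewrite mxE; apply: eq_bigr => b _; congr (_ * _).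
by rewrite -Dm_gradE -{1}((clsd_grad sf).2 x Ux) mxE.
Qed.

Definition nrm2 th x : R := (th x *m ig x *m (th x)^T) 0 0.

Lemma smooth_nrm2 th : smx U th -> smooth_on U (nrm2 th).
Proof. by move=> s; apply: smxM => //; [apply: smxM => //; exact: sig|exact: smx_tr]. Qed.

Lemma grad_nrm2 th x : clsd th -> U x -> grad (nrm2 th) x = 2 *: (shp th x *m Hm th x).
Proof.
move=> ct Ux; have sth := ct.1; apply/rowP => a; rewrite [LHS]mxE [RHS]mxE.
have s1 := smxM oU sth sig; have s2 := smx_tr oU sth.
have -> : partial a (nrm2 th) x = pmx a (fun y => th y *m ig y *m (th y)^T) x 0 0 by rewrite pmxE.
rewrite (pmxM oU a s1 s2 Ux) (pmxM oU a sth sig Ux) (pmx_ig a Ux) pmx_trmx.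
pose h := pmx a th x - th x *m (Cm a x)^T.
have hr : row a (Hm th x) = h by apply/rowP => b; rewrite !mxE.
have -> : (shp th x *m Hm th x) 0 a = (h *m ig x *m (th x)^T) 0 0.
 have -> : (shp th x *m Hm th x) 0 a = ((shp th x *m Hm th x)^T) a 0 by rewrite [RHS]mxE.
 rewrite trmx_mul (HmT ct Ux) /shp trmx_mul (igT Ux) -hr -!row_mul mulmxA.
 by rewrite [RHS]mxE.
have addE (A B : 'M[R]_1) : (A + B) 0 0 = A 0 0 + B 0 0 by rewrite mxE.
have oppE (A : 'M[R]_1) : (- A) 0 0 = - A 0 0 by rewrite mxE.
have t1 (A : 'M[R]_1) : A 0 0 = A^T 0 0 by rewrite mxE.
rewrite addE mulmxBr mulmxN mulmxDl mulmxBl mulNmx !mulmxA !(addE, oppE).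
rewrite (_ : h = pmx a th x - th x *m (Cm a x)^T) // !mulmxBl addE oppE.
rewrite [(_ *m (pmx a th x)^T) 0 0]t1 [(th x *m ig x *m Cm a x *m _) 0 0]t1 !trmx_mul !trmxK (igT Ux) !mulmxA.
move: ((_ *m ig x *m _) 0 0) ((_ *m ig x *m _) 0 0) => u v; ring.
Qed.

Lemma divgD (V W : 'rV[R]_m -> 'rV[R]_m) x : smx U V -> smx U W -> U x ->
 divg (fun y => V y + W y) x = divg V x + divg W x.
Proof.
move=> sV sW Ux; rewrite /divg -big_split; apply: eq_bigr => c _ /=.
by rewrite (pmxD oU c sV sW Ux) mulmxDl !mxE addrACA.
Qed.

Lemma divgZ k (V : 'rV[R]_m -> 'rV[R]_m) x : smx U V -> U x ->
 divg (fun y => k *: V y) x = k * divg V x.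
Proof.
move=> sV Ux; rewrite /divg mulr_sumr; apply: eq_bigr => c _ /=.
by rewrite (pmxZ oU c k sV Ux) -scalemxAl -scalerDr mxE.
Qed.

Lemma divg_ext (V W : 'rV[R]_m -> 'rV[R]_m) x : U x -> (forall y, U y -> V y = W y) ->
 divg V x = divg W x.
Proof.
move=> Ux VW; rewrite /divg; apply: eq_bigr => c _.
by rewrite (@pmx_ext _ _ _ oU _ _ c _ _ x Ux VW) (VW x Ux).
Qed.

Lemma nab_J (X : 'rV[R]_m -> 'rV[R]_m) x : smx U X -> U x ->
 nab (fun y => X y *m J) x = nab X x *m J.
Proof.
move=> sX Ux; apply/row_matrixP => a; rewrite row_mul !row_nab (pmxMr oU a J sX Ux) mulmxDl.
by rewrite -!mulmxA (Cm_J a Ux).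
Qed.

(** J-invariant and J-anti-invariant forms are orthogonal. *)
Lemma trace_type th ta x : U x -> \tr (Hm th x *m ig x *m (Pm ta x *m ig x)) =
 \tr (Pm th x *m ig x *m (Pm ta x *m ig x)).
Proof.
move=> Ux; have : J *m (Pm ta x *m ig x) = Pm ta x *m ig x *m J by rewrite mulmxA JPm -mulmxA (Jig Ux) mulmxA.
move: (Pm ta x *m ig x) => Q JQ.
have G (A B : 'M[R]_m) : \tr ((2^-1 *: (A + B)) *m ig x *m Q) =
  2^-1 * (\tr (A *m ig x *m Q) + \tr (B *m ig x *m Q)).
 by rewrite -!scalemxAl mxtraceZ !mulmxDl mxtraceD.
rewrite (PmH th Ux) G.
have e : J *m ig x *m Q = ig x *m Q *m J by rewrite (Jig Ux) -[ig x *m J *m Q]mulmxA JQ mulmxA.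
have -> : J *m Hm th x *m J^T *m ig x *m Q = - (J *m (Hm th x *m ig x *m Q) *m J).
 rewrite JT mulmxN !mulNmx -[_ *m J *m ig x]mulmxA -[_ *m (J *m ig x) *m Q]mulmxA e.
 by rewrite !mulmxA.
have trN (Z : 'M[R]_m) : \tr (- Z) = - \tr Z by rewrite linearN.
rewrite trN [\tr (J *m _ *m J)]mxtrace_mulC !mulmxA JJ !mulNmx mul1mx trN opprK.
by move: (\tr _) => t; lra.
Qed.

(* Weitzenboeck formula: the Bochner formulas for the vector fields [X] and [J X]
 dual to a closed 1-form are added up. *)
Lemma kahler_bochner th x : clsd th -> U x ->
 let X := shp th x in let M := Hm th x - Pm th x in
 2 * \tr (M *m ig x *m (M *m ig x)) + 2 * \tr (Pm th x *m ig x *m (Pm th x *m ig x))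
 + ((X *m ricci g x *m X^T) 0 0 + (X *m J *m ricci g x *m (X *m J)^T) 0 0)
 = laplacian g (nrm2 th) x - 2 * \sum_a X 0 a * partial a (divg (shp th)) x.
Proof.
move=> ct Ux X M; have sth := ct.1; have sX := smx_shp sth; have sN := smooth_nrm2 sth.
have sP := smx_Pm sth; have sn := smx_nab sX.
have sXn : smx U (fun y => shp th y *m nab (shp th) y) by exact: smxM.
have sXP : smx U (fun y => shp th y *m (Pm th y *m ig y)) by apply: smxM => //; apply: smxM => //; exact: sig.
have E1 : laplacian g (nrm2 th) x = 2 * divg (fun y => shp th y *m nab (shp th) y) x.
 rewrite laplacianE // -(divgZ 2 sXn Ux); apply: divg_ext => // y Uy.
 rewrite -[LHS]/(grad (nrm2 th) y *m ig y) (grad_nrm2 ct Uy) -scalemxAl -mulmxA.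
 by rewrite -(nab_shp sth Uy).
pose Z y := shp th y *m J.
have sZ : smx U Z by apply: smxM => //; exact: smx_cst.
(* The field $JX$ is divergence-free: the trace pairs the symmetric Hessian with the antisymmetric
   matrix [J *m ig]. *)
have trZ y : U y -> divg Z y = 0.
 move=> Uy; rewrite divgE (nab_J sX Uy) (nab_shp sth Uy) -mulmxA -(Jig Uy).
 have h : \tr (Hm th y *m (J *m ig y)) = - \tr (Hm th y *m (J *m ig y)).
  rewrite -{1}mxtrace_tr !trmx_mul (HmT ct Uy) (igT Uy) JT mulmxN mulNmx linearN /=.
  by rewrite mxtrace_mulC (Jig Uy).
 by move: (\tr _) h => t h; lra.
(* By [JHJ], $\nabla_{JX}JX=\nabla_XX-2PX$ with an index of $P$ raised. *)
have E2 : divg (fun y => Z y *m nab Z y) x =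
  divg (fun y => shp th y *m nab (shp th) y) x + (-2) * divg (fun y => shp th y *m (Pm th y *m ig y)) x.
 rewrite -(divgZ (-2) sXP Ux) -divgD //; last exact: smxZ.
 apply: divg_ext => // y Uy; rewrite /Z (nab_J sX Uy) (nab_shp sth Uy).
 move: (shp th y) => v; rewrite scalemxAr -mulmxDr -[v *m J *m _]mulmxA; congr (_ *m _).
 rewrite -[Hm th y *m ig y *m J]mulmxA -(Jig Uy) !mulmxA (JHJ th Uy).
 by rewrite mulmxBl scaleNr -scalemxAl.
have B1 := bochner sX Ux; have B2 := bochner sZ Ux.
have z0 : \sum_a Z x 0 a * partial a (divg Z) x = 0.
 rewrite big1 // => a _; rewrite (partial_ext a oU Ux (g := fun=> 0)) ?partial_cst ?mulr0 //.
rewrite z0 add0r E2 (divg_Pm ct ct Ux) (trace_type th th Ux) in B2.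
have E3 : \tr (nab Z x *m nab Z x) = \tr (nab (shp th) x *m nab (shp th) x) - 2 * \tr (Pm th x *m ig x *m (Pm th x *m ig x)).
 rewrite (nab_J sX Ux) (nab_shp sth Ux) -[X in _ - 2 * X](trace_type th th Ux).
 have -> : Hm th x *m ig x *m J *m (Hm th x *m ig x *m J) =
  Hm th x *m ig x *m (Hm th x *m ig x) - 2 *: (Hm th x *m ig x *m (Pm th x *m ig x)).
  rewrite scalemxAr -mulmxBr -[Hm th x *m ig x *m J *m _]mulmxA; congr (_ *m _).
  rewrite -[Hm th x *m ig x *m J]mulmxA -(Jig Ux) !mulmxA (JHJ th Ux).
  by rewrite mulmxBl -scalemxAl.
 by rewrite linearB linearZ.
have E4 : \tr (M *m ig x *m (M *m ig x)) = \tr (nab (shp th) x *m nab (shp th) x) - \tr (Pm th x *m ig x *m (Pm th x *m ig x)).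
 have trB (Z1 Z2 : 'M[R]_m) : \tr (Z1 - Z2) = \tr Z1 - \tr Z2 by rewrite linearB.
 rewrite (nab_shp sth Ux) /M; have := trace_type th th Ux; move: (Hm th x) (Pm th x) => H P tt.
 rewrite !mulmxBl !mulmxBr !trB tt [\tr (P *m ig x *m (H *m ig x))]mxtrace_mulC tt.
 move: (\tr _) (\tr _) => u v; ring.
have dt : \sum_a X 0 a * partial a (fun y => \tr (Pm th y *m ig y)) x = \sum_a X 0 a * partial a (divg (shp th)) x.
 by apply: eq_bigr => a _; congr (_ * _); apply: partial_ext oU Ux _ => y Uy; rewrite trHm.
rewrite dt E3 in B2; rewrite E1 E4.
move: B1 B2; rewrite -/X -[Z x]/(X *m J).
move: (divg _ _) (\tr _) (\tr _) (\sum_a _) (_ 0 0) (_ 0 0) => d t1 t2 s1 r1 r2; lra.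
Qed.

End KahlerChart.

(** * Unitary frames and the Hermitian Ricci bound *)

Section HermitianAlgebra.
Context {R : realType} {n : nat}.
Local Notation m := (n + n)%N.
Local Notation J := (Jmx n : 'M[R]_m).

Lemma JmxT : (J)^T = - J.
Proof. by rewrite /Jmx tr_block_mx !trmx0 linearN /= trmx1 opp_block_mx !oppr0 opprK. Qed.

Lemma JmxJ : J *m J = - 1%:M.
Proof.
rewrite /Jmx mulmx_block !mul0mx !mulmx0 !add0r !addr0 mul1mx mulNmx mul1mx.
by rewrite (scalar_mx_block n n 1) opp_block_mx !oppr0.
Qed.

Variable g : 'M[R]_m.
Hypotheses (gT : g^T = g) (hg : J *m g *m J^T = g).
Hypothesis gpos : forall v : 'rV[R]_m, v != 0 -> 0 < (v *m g *m v^T) 0 0.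

Definition gi (v w : 'rV[R]_m) : R := (v *m g *m w^T) 0 0.

Lemma giC v w : gi v w = gi w v.
Proof.
have t1 (A : 'M[R]_1) : A 0 0 = A^T 0 0 by rewrite mxE.
by rewrite /gi t1 !trmx_mul trmxK gT mulmxA.
Qed.

Lemma giZl k v w : gi (k *: v) w = k * gi v w.
Proof. by rewrite /gi -!scalemxAl mxE. Qed.

Lemma giJ v w : gi (v *m J) (w *m J) = gi v w.
Proof.
rewrite /gi trmx_mul !mulmxA -[in RHS]hg !mulmxA; congr (fun_of_matrix (_ *m _) 0 0).
Qed.

Lemma giJJ v w : gi (v *m J) w = - gi v (w *m J).
Proof.
rewrite -[LHS]giJ -mulmxA JmxJ mulmxN mulmx1 -scaleN1r giZl mulN1r //.
Qed.

Lemma giJ0 v : gi v (v *m J) = 0.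
Proof. have := giJJ v v; rewrite giC; move: (gi _ _) => t; lra. Qed.

Definition partial_frame k (e : nat -> 'rV[R]_m) := forall i j, (i < k)%N -> (j < k)%N ->
 gi (e i) (e j) = (i == j)%:R /\ gi (e i) (e j *m J) = 0.

(** Gram-Schmidt compatible with [J]. The kernel of [N] has dimension at least $2n-2k>0$; a unit
    vector in it is orthogonal to all $e_i$ and $Je_i$, and orthogonality to its own image under [J]
    is automatic by [giJ0]. *)
Lemma frame_step k e : (k < n)%N -> partial_frame k e -> exists e', partial_frame k.+1 e'.
Proof.
move=> kn He.
pose N : 'M[R]_(m, k + k) := row_mx (\matrix_(a, i) (g *m (e i)^T) a 0) (\matrix_(a, i) (g *m (e i *m J)^T) a 0).
have : kermx N != 0.
 rewrite -mxrank_eq0 mxrank_ker -lt0n subn_gt0.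
 by apply: leq_ltn_trans (rank_leq_col N) _; lia.
case/rowV0Pn => v vN v0.
have vo i : (i < k)%N -> gi v (e i) = 0 /\ gi v (e i *m J) = 0.
 move=> ik; have := sub_kermxP vN; rewrite mul_mx_row => /eqP.
 rewrite row_mx_eq0 => /andP[/eqP h1 /eqP h2]; split.
  have := congr1 (fun Z : 'rV[R]_k => Z 0 (Ordinal ik)) h1; rewrite mxE [RHS]mxE => h.
  by rewrite /gi -mulmxA mxE; apply: etrans h; apply: eq_bigr => a _; rewrite [in RHS]mxE.
 have := congr1 (fun Z : 'rV[R]_k => Z 0 (Ordinal ik)) h2; rewrite mxE [RHS]mxE => h.
 by rewrite /gi -mulmxA mxE; apply: etrans h; apply: eq_bigr => a _; rewrite [in RHS]mxE.
have p0 : 0 < gi v v by exact: gpos.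
pose t := (Num.sqrt (gi v v))^-1; pose u := t *: v.
have uu : gi u u = 1.
 rewrite /u giZl giC giZl mulrA /t -invfM -expr2 sqr_sqrtr ?mulVf ?gt_eqF //; exact: ltW.
have uo i : (i < k)%N -> gi u (e i) = 0 /\ gi u (e i *m J) = 0.
 by move=> /vo[h1 h2]; rewrite /u !giZl h1 h2 mulr0.
exists (fun i => if i == k then u else e i) => i j; rewrite !ltnS => ik jk.
case: (eqVneq i k) => [ik'|nik]; case: (eqVneq j k) => [jk'|njk].
- by rewrite ik' jk' eqxx uu giJ0.
- by have [|h1 h2] := uo j; [rewrite ltn_neqAle njk|rewrite h1 h2 ik' eq_sym (negbTE njk)].
- have [|h1 h2] := uo i; first by rewrite ltn_neqAle nik.
 rewrite giC h1 jk' (negbTE nik); split=> //.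
 by rewrite -[LHS]opprK -giJJ giC h2 oppr0.
- by apply: He; rewrite ltn_neqAle ?nik ?njk.
Qed.

Lemma exists_frame : exists E : 'M[R]_(n, m), unitary_frame g E.
Proof.
have [e He] : exists e, partial_frame n e.
 suff H k : (k <= n)%N -> exists e, partial_frame k e by exact: H.
 elim: k => [|k IH] kn; first by exists (fun=> 0).
 by have [e He] := IH (ltnW kn); exact: frame_step He.
exists (\matrix_(i < n) e i); rewrite /unitary_frame.
set E := \matrix_(i < n) e i.
have rE (i : 'I_n) : row i E = e i by rewrite rowK.
have rEJ (i : 'I_n) : row i (E *m J) = e i *m J by rewrite row_mul rE.
have ent r s (A : 'M[R]_(r, m)) (B : 'M[R]_(s, m)) i j : (A *m g *m B^T) i j = gi (row i A) (row j B).
 rewrite /gi [LHS]mxE [RHS]mxE; apply: eq_bigr => l _; rewrite -row_mul; congr (_ * _).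
  by rewrite [RHS]mxE.
 by rewrite [LHS]mxE [RHS]mxE [RHS]mxE.
rewrite mul_col_mx tr_col_mx mul_col_row (scalar_mx_block n n 1); congr block_mx; apply/matrixP => i j.
- by rewrite ent !rE (He _ _ (ltn_ord i) (ltn_ord j)).1 mxE.
- by rewrite ent rE rEJ (He _ _ (ltn_ord i) (ltn_ord j)).2 mxE.
- by rewrite ent rE rEJ giC (He _ _ (ltn_ord j) (ltn_ord i)).2 mxE.
- by rewrite ent !rEJ giJ (He _ _ (ltn_ord i) (ltn_ord j)).1 mxE.
Qed.

Lemma gu : g \in unitmx.
Proof.
have [E] := exists_frame; rewrite /unitary_frame; set F := col_mx _ _ => hE.
have := congr1 determinant hE; rewrite !det_mulmx det1 => h.
by rewrite unitmxE unitfE; apply/eqP => g0; move: h; rewrite g0 mulr0 mul0r => /esym/eqP; rewrite oner_eq0.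
Qed.

Lemma inv_frame : exists F : 'M[R]_m, invmx g = F^T *m F.
Proof.
have [E] := exists_frame; rewrite /unitary_frame; set F := col_mx _ _ => hE; exists F.
have gFF : g *m (F^T *m F) = 1%:M by rewrite mulmxA mulmx1C // mulmxA.
by rewrite -[RHS](mulKmx gu) gFF mulmx1.
Qed.

Lemma trace_inv (D : 'M[R]_m) : exists F : 'M[R]_m,
 (forall i, gi (row i F) (row i F) = 1) /\ \tr (invmx g *m D) = \sum_i (row i F *m D *m (row i F)^T) 0 0.
Proof.
have [E] := exists_frame; rewrite /unitary_frame; set F := col_mx _ _ => hE; exists F.
have ent (B : 'M[R]_m) i : (row i F *m B *m (row i F)^T) 0 0 = (F *m B *m F^T) i i.
 rewrite -row_mul [LHS]mxE [RHS]mxE; apply: eq_bigr => l _; congr (_ * _); first by rewrite mxE.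
 by rewrite !mxE.
split=> [i|]; first by rewrite /gi ent hE mxE eqxx.
have gFF : g *m (F^T *m F) = 1%:M by rewrite mulmxA mulmx1C // mulmxA.
rewrite (_ : invmx g = F^T *m F); last by rewrite -[RHS](mulKmx gu) gFF mulmx1.
rewrite -mulmxA mxtrace_mulC; apply: eq_bigr => i _; by rewrite ent.
Qed.

Lemma invmx_pos (v : 'rV[R]_m) : v != 0 -> 0 < (v *m invmx g *m v^T) 0 0.
Proof.
move=> v0; have h : v *m invmx g != 0.
 by apply: contraNneq v0 => h; rewrite -(mulmxKV gu v) h mul0mx.
have := gpos h; rewrite trmx_mul trmx_inv gT !mulmxA mulmxKV //; exact: gu.
Qed.

Lemma trace_inv_le0 (D : 'M[R]_m) : (forall v : 'rV[R]_m, (v *m D *m v^T) 0 0 <= 0) ->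
 \tr (invmx g *m D) <= 0.
Proof. by move=> D0; have [F [_ ->]] := trace_inv D; apply: sumr_le0. Qed.

Lemma trace_sqr_ge0 (A : 'M[R]_m) : A^T = A -> 0 <= \tr (A *m invmx g *m (A *m invmx g)).
Proof.
move=> AT; have [F ->] := inv_frame.
have -> : \tr (A *m (F^T *m F) *m (A *m (F^T *m F))) = \tr ((F *m A *m F^T) *m (F *m A *m F^T)^T).
 by rewrite !trmx_mul !trmxK AT !mulmxA [LHS]mxtrace_mulC !mulmxA.
apply: sumr_ge0 => i _; rewrite mxE; apply: sumr_ge0 => j _; rewrite [_^T _ _]mxE -expr2; exact: sqr_ge0.
Qed.

(** If $X=aE+b\,JE$ and $\xi=a+\sqrt{-1}\,b$, the vector $\sum\xi_iX_i$ is $(X-\sqrt{-1}JX)/\sqrt2$.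
    The real part of the sesquilinear form at $\xi$ is then half the sum of the values at $X$ and
    $JX$, while $|\xi|^2=|X|^2$. *)
Lemma ricci_real (B : 'M[R]_m) (X : 'rV[R]_m) :
 (forall E : 'M[R]_(n, m), unitary_frame g E -> herm_ge (mixed B E) 1%:M) ->
 2 * gi X X <= (X *m B *m X^T) 0 0 + (X *m J *m B *m (X *m J)^T) 0 0.
Proof.
move=> H; have [E hE] := exists_frame; have hH := H E hE.
move: (hE); rewrite /unitary_frame; set F := col_mx _ _ => hF.
have FF : F^T *m (F *m g) = 1%:M by apply: mulmx1C.
pose ab := X *m g *m F^T; pose a := lsubmx ab; pose b := rsubmx ab.
have XE : X = a *m E + b *m (E *m J).
 rewrite -mul_row_col hsubmxK /ab -/F.
 have : F^T *m F *m g = 1%:M by rewrite -mulmxA.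
 by move=> /mulmx1C h; rewrite -[X *m g *m F^T]mulmxA -mulmxA -[g *m F^T *m F]mulmxA h mulmx1.
pose c (s : nat) (A : 'M[R]_(1, s)) := map_mx (real_complex R) A.
pose xi : 'rV[R[i]]_n := c _ a + 'i%C *: c _ b.
have cM r s t (A1 : 'M[R]_(r, s)) (B1 : 'M[R]_(s, t)) : map_mx (real_complex R) (A1 *m B1) = map_mx (real_complex R) A1 *m map_mx (real_complex R) B1.
 exact: map_mxM.
have cjE s (u v : 'rV[R]_s) : map_mx (@conjc R) (c _ u - 'i%C *: c _ v) = c _ u + 'i%C *: c _ v.
 by apply/matrixP => i j; rewrite !mxE /=; simpc.
have sesq s (u v : 'rV[R]_s) (B1 : 'M[R]_s) : ((c _ u - 'i%C *: c _ v) *m map_mx (real_complex R) B1 *m (c _ u + 'i%C *: c _ v)^T) 0 0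
  = (((u *m B1 *m u^T) 0 0 + (v *m B1 *m v^T) 0 0) +i* ((u *m B1 *m v^T) 0 0 - (v *m B1 *m u^T) 0 0))%C.
 have e1 (u1 v1 : 'rV[R]_s) : (c _ u1 *m map_mx (real_complex R) B1 *m (c _ v1)^T) 0 0 = ((u1 *m B1 *m v1^T) 0 0)%:C%C.
  by rewrite /c map_trmx -!map_mxM mxE.
 have -> : (c s u + 'i%C *: c s v)^T = (c s u)^T + 'i%C *: (c s v)^T by rewrite linearD linearZ.
 have addE (A1 B2 : 'M[R[i]]_1) : (A1 + B2) 0 0 = A1 0 0 + B2 0 0 by rewrite mxE.
 have oppE (A1 : 'M[R[i]]_1) : (- A1) 0 0 = - A1 0 0 by rewrite mxE.
 have scE k (A1 : 'M[R[i]]_1) : (k *: A1) 0 0 = k * A1 0 0 by rewrite mxE.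
 rewrite mulmxBl [(_ - _) *m (_ + _)]mulmxBl !mulmxDr -!scalemxAl -!scalemxAr !(addE, oppE, scE) !e1.
 move: (_ 0 0) (_ 0 0) (_ 0 0) (_ 0 0) => p1 p2 p3 p4.
 by simpc; congr (_ +i* _)%C; ring.
have fX : xi *m frame10 E = ((Num.sqrt 2)^-1)%:C%C *: (c _ X - 'i%C *: c _ (X *m J)).
 have XJ : X *m J = a *m (E *m J) - b *m E.
  by rewrite XE mulmxDl -!mulmxA JmxJ !mulmxN !mulmx1.
 have ii : 'i%C * 'i%C = -1 :> R[i] by rewrite -expr2 sqr_i.
 rewrite /frame10 -scalemxAr; congr (_ *: _); rewrite /xi /c XJ XE map_mxD map_mxB !(cM 1%N).
 rewrite mulmxBr -scalemxAr !mulmxDl -!scalemxAl.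
 move: (_ *m _) (_ *m _) (_ *m _) (_ *m _) => A1 A2 A3 A4.
 by apply/matrixP => k l; rewrite !mxE [in LHS]mulrDr [in LHS]mulrA ii; ring.
have xi1 : xi = c _ a - 'i%C *: c _ (- b) by rewrite /xi /c map_mxN scalerN opprK.
have q2 : ((Num.sqrt 2)^-1 : R) * (Num.sqrt 2)^-1 = 2^-1 by rewrite -invfM -expr2 sqr_sqrtr.
have subE (A1 B2 : 'M[R[i]]_1) : (A1 - B2) 0 0 = A1 0 0 - B2 0 0 by rewrite !mxE.
have scE k (A1 : 'M[R[i]]_1) : (k *: A1) 0 0 = k * A1 0 0 by rewrite mxE.
have hE2 : (xi *m (mixed B E - 1%:M) *m (map_mx (@conjc R) xi)^T) 0 0 =
 (2^-1 : R)%:C%C * ((c _ X - 'i%C *: c _ (X *m J)) *m map_mx (real_complex R) B *m (c _ X + 'i%C *: c _ (X *m J))^T) 0 0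
 - (xi *m map_mx (real_complex R) 1%:M *m (map_mx (@conjc R) xi)^T) 0 0.
 rewrite mulmxBr mulmxBl subE map_mx1; congr (_ - _); rewrite /mixed.
 have -> : xi *m (frame10 E *m map_mx (real_complex R) B *m (map_mx (@conjc R) (frame10 E))^T) *m (map_mx (@conjc R) xi)^T
  = (xi *m frame10 E) *m map_mx (real_complex R) B *m (map_mx (@conjc R) (xi *m frame10 E))^T.
  by rewrite map_mxM trmx_mul !mulmxA.
 have tZ k (A1 : 'rV[R[i]]_m) : (k *: A1)^T = k *: A1^T by rewrite linearZ.
 rewrite fX map_mxZ cjE tZ -!scalemxAl -scalemxAr scalerA scE; congr (_ * _).
 rewrite -q2 rmorphM /=; congr (_ * _); by simpc.
have XX : gi X X = (a *m a^T) 0 0 + (b *m b^T) 0 0.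
 have -> : gi X X = (ab *m ab^T) 0 0.
  rewrite /ab !trmx_mul trmxK gT /gi; congr (fun_of_matrix _ 0 0).
  have h : F^T *m F *m g = 1%:M by rewrite -mulmxA.
  by rewrite -!mulmxA [F^T *m (F *m _)]mulmxA [F^T *m F *m (g *m _)]mulmxA h mul1mx.
 by rewrite -(hsubmxK ab) -/a -/b tr_row_mx mul_row_col mxE.
have := hH xi; rewrite hE2 sesq xi1 cjE sesq !mulmx1.
rewrite lecE /= => /andP[_]; rewrite mul0r subr0; have -> : (- b *m (- b)^T) 0 0 = (b *m b^T) 0 0 by rewrite linearN /= mulNmx mulmxN opprK.
rewrite -XX.
move: (gi X X) (_ 0 0) (_ 0 0) => u v w; lra.
Qed.

End HermitianAlgebra.

(** * Pairing a form of given type with a rank-one form *)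

Section Pairing.
Context {R : realType} {n : nat}.
Local Notation m := (n + n)%N.
Local Notation J := (Jmx n : 'M[R]_m).
Variable g : 'M[R]_m.
Hypotheses (gT : g^T = g) (hg : J *m g *m J^T = g).
Hypothesis gpos : forall v : 'rV[R]_m, v != 0 -> 0 < (v *m g *m v^T) 0 0.
Local Notation G := (invmx g).

Let ug : g \in unitmx. Proof. exact: (gu gT hg gpos). Qed.
Let GT : G^T = G. Proof. by rewrite trmx_inv gT. Qed.
Let JTJ : J^T *m J = 1%:M. Proof. by rewrite JmxT mulNmx JmxJ opprK. Qed.
Let JTJT : J^T *m J^T = - 1%:M. Proof. by rewrite JmxT mulNmx mulmxN opprK JmxJ. Qed.
Let JG : J *m G = G *m J.
Proof.
have Jg : J *m g = g *m J by rewrite -[in RHS]hg -mulmxA JTJ mulmx1.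
by apply: (can_inj (mulKmx ug)); rewrite [RHS]mulmxA mulmxV // mul1mx mulmxA -Jg mulmxK.
Qed.
Let JTG : J^T *m G = G *m J^T. Proof. by rewrite JmxT mulNmx mulmxN JG. Qed.

Let t1 (A : 'M[R]_1) : A 0 0 = A^T 0 0. Proof. by rewrite mxE. Qed.

Let f (A B : 'M[R]_m) := \tr (A *m G *m (B *m G)).
Let fC A B : f A B = f B A. Proof. exact: mxtrace_mulC. Qed.
Let fD A B C : f (A + B) C = f A C + f B C. Proof. by rewrite /f !mulmxDl mxtraceD. Qed.
Let fZ k A B : f (k *: A) B = k * f A B. Proof. by rewrite /f -!scalemxAl mxtraceZ. Qed.
Let fS A (v : 'rV[R]_m) : f A (v^T *m v) = (v *m G *m A *m G *m v^T) 0 0.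
Proof. by rewrite /f -[v^T *m v *m G]mulmxA mulmxA mxtrace_mulC !mulmxA trace_mx11. Qed.

Let f3 A B C a b : f (A + a *: B + b *: C) (A + a *: B + b *: C) =
 f A A + a ^+ 2 * f B B + b ^+ 2 * f C C + 2 * a * f A B + 2 * b * f A C + 2 * a * b * f B C.
Proof.
have E X : f X (A + a *: B + b *: C) = f X A + a * f X B + b * f X C.
 by rewrite fC fD fD fZ fZ (fC A X) (fC B X) (fC C X).
by rewrite fD fD fZ fZ !E (fC B A) (fC C A) (fC C B); ring.
Qed.

(* The square norm of [A - t T - u g], [T] being the part of type [e] of [v^T v]. *)
Lemma typed_pairing (e t u : R) (A : 'M[R]_m) (v : 'rV[R]_m) : e * e = 1 -> A^T = A -> J *m A *m J^T = e *: A ->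
 forall eta, eta = (v *m G *m v^T) 0 0 ->
 0 <= \tr (A *m G *m (A *m G)) - 2 * t * (v *m G *m A *m G *m v^T) 0 0 + t ^+ 2 * eta ^+ 2 / 2
  - 2 * u * (\tr (A *m G) - t * ((1 + e) / 2) * eta) + u ^+ 2 * m%:R.
Proof.
move=> ee AT JA eta etaE; pose S := v^T *m v; pose w := v *m J^T; pose S' := w^T *m w.
have S'E : S' = J *m S *m J^T by rewrite /S' /w trmx_mul trmxK /S !mulmxA.
pose T := 2^-1 *: (S + e *: S').
have ST : S^T = S by rewrite /S trmx_mul trmxK.
have S'T : S'^T = S' by rewrite /S' trmx_mul trmxK.
have TT : T^T = T by rewrite /T linearZ linearD /= ST; congr (_ *: (_ + _)); rewrite linearZ /= S'T.
have JT' : J *m T *m J^T = e *: T.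
 have JS : J *m S' *m J^T = S.
  have -> : J *m S' *m J^T = (J *m J) *m S *m (J^T *m J^T) by rewrite S'E !mulmxA.
  by rewrite JmxJ JTJT mulNmx mul1mx mulNmx mulmxN mulmx1 opprK.
 rewrite /T -!scalemxAr -!scalemxAl mulmxDr mulmxDl -scalemxAr -scalemxAl JS -S'E scalerA mulrC -scalerA.
 by congr (_ *: _); rewrite scalerDr scalerA ee scale1r addrC.
have wl : w *m G = v *m G *m J^T by rewrite /w -mulmxA JTG mulmxA.
have wr : G *m w^T = J *m G *m v^T by rewrite /w trmx_mul trmxK mulmxA JG.
have wG (B : 'M[R]_m) : w *m G *m B *m G *m w^T = v *m G *m (J *m B *m J^T) *m G *m v^T.
 have -> : J *m B *m J^T = J^T *m B *m J by rewrite JmxT mulmxN !mulNmx.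
 by rewrite wl -(mulmxA _ G w^T) wr !mulmxA.
have hZ k (B : 'M[R]_m) : (v *m G *m (k *: B) *m G *m v^T) 0 0 = k * (v *m G *m B *m G *m v^T) 0 0.
 by rewrite -scalemxAr -!scalemxAl mxE.
have hD (B C : 'M[R]_m) : (v *m G *m (B + C) *m G *m v^T) 0 0 = (v *m G *m B *m G *m v^T) 0 0 + (v *m G *m C *m G *m v^T) 0 0.
 by rewrite mulmxDr !mulmxDl mxE.
have pair (B : 'M[R]_m) : J *m B *m J^T = e *: B -> f B T = (v *m G *m B *m G *m v^T) 0 0.
 move=> JB; rewrite fC /T fZ fD fZ !(fC _ B) !fS wG JB hZ mulrA ee mul1r.
 by move: (_ 0 0) => z; field.
(* A vector is orthogonal to its image under [J], so the two halves of [T] do not interact and the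
   square norm of [T] is half of [eta ^+ 2]. *)
have w0 : (v *m G *m w^T) 0 0 = 0.
 have e1 : v *m G *m w^T = v *m J *m G *m v^T by rewrite -mulmxA wr !mulmxA.
 have e2 : (v *m G *m w^T)^T = - (v *m J *m G *m v^T).
  by rewrite trmx_mul trmxK trmx_mul GT mulmxA wl -(mulmxA v) -JTG JmxT mulNmx mulmxN mulNmx !mulmxA.
 have := congr1 (fun B : 'M[R]_1 => B 0 0) e2; rewrite -e1 [LHS]mxE [RHS]mxE; move: (_ 0 0) => z; lra.
have TS : (v *m G *m T *m G *m v^T) 0 0 = eta ^+ 2 / 2.
 have m11 (a b : 'M[R]_1) : (a *m b) 0 0 = a 0 0 * b 0 0 by rewrite mxE big_ord1.
 have q (z : 'rV[R]_m) : (v *m G *m (z^T *m z) *m G *m v^T) 0 0 = (v *m G *m z^T) 0 0 * (z *m G *m v^T) 0 0.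
  by rewrite -m11 !mulmxA.
 rewrite /T hZ hD hZ.
 by rewrite !q w0 mul0r mulr0 addr0 -etaE expr2 mulrC.
have gg : g *m G = 1%:M by exact: mulmxV.
have fg B : f B g = \tr (B *m G) by rewrite /f gg mulmx1.
have tS (z : 'rV[R]_m) : \tr (z^T *m z *m G) = (z *m G *m z^T) 0 0.
 by rewrite -mulmxA mxtrace_mulC trace_mx11.
have Tg : \tr (T *m G) = (1 + e) / 2 * eta.
 rewrite /T -scalemxAl mxtraceZ mulmxDl mxtraceD -scalemxAl mxtraceZ !tS.
 have -> : (w *m G *m w^T) 0 0 = eta.
  by rewrite etaE wl /w trmx_mul trmxK mulmxA -(mulmxA _ J^T) JTJ mulmx1.
 by rewrite -etaE; field.
have AB : (A + (- t) *: T + (- u) *: g)^T = A + (- t) *: T + (- u) *: g.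
 have sy (B : 'M[R]_m) i j : B^T = B -> B j i = B i j by move=> BT; rewrite -{1}BT mxE.
 by move: (T) TT => T' TT'; apply/matrixP => i j; rewrite !mxE (sy A) // (sy T') // (sy g).
have H : 0 <= f (A + (- t) *: T + (- u) *: g) (A + (- t) *: T + (- u) *: g) by exact: (trace_sqr_ge0 gT hg gpos AB).
have gg' : f g g = m%:R by rewrite fg gg mxtrace1.
move: H; rewrite f3 gg' (pair A JA) (pair T JT') TS !fg Tg.
have -> : \tr (A *m G *m (A *m G)) = f A A by [].
by move: (f A A) (\tr (A *m G)) (_ 0 0) => a b c; lra.
Qed.

End Pairing.

(** * Calculus on the manifold *)

Section ManifoldCalculus.
Context {R : realType} {n : nat} {M : topologicalType}.
Variable K : kahler R n M.
Local Notation m := (n + n)%N.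
Local Notation ch := (chart_at K).
Local Notation U p := (img (ch p)).
Local Notation crd p r := (Defs.coord (ch p) r).
Local Notation crv p x := (coordV (ch p) x).
Implicit Types (p q r : M) (x y : 'rV[R]_m) (u v w : M -> R).

Definition loc_fun p u : 'rV[R]_m -> R := u \o coordV (ch p).
Local Notation loc := loc_fun.

Lemma coordVK p x : U p x -> crd p (crv p x) = x /\ dom (ch p) (crv p x).
Proof. by move=> [r dr <-]; rewrite coordK. Qed.

Lemma U_open p : open (U p). Proof. exact: img_open. Qed.

Lemma U_crd p r : dom (ch p) r -> U p (crd p r). Proof. by move=> dr; exists r. Qed.

Lemma loc_crd p u r : dom (ch p) r -> loc p u (crd p r) = u r.
Proof. by move=> dr; rewrite /loc /= coordK. Qed.

Lemma overlapP p q x : overlap (ch p) (ch q) x <-> U p x /\ dom (ch q) (crv p x).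
Proof.
split=> [[r [dp dq] <-]|[Ux dq]]; first by split; [exact: U_crd|rewrite coordK].
by have [e dp] := coordVK Ux; exists (crv p x).
Qed.

Lemma overlap_crd p q r : dom (ch p) r -> dom (ch q) r -> overlap (ch p) (ch q) (crd p r).
Proof. by move=> dp dq; exists r. Qed.

Lemma open_overlap p q : open (overlap (ch p) (ch q)).
Proof.
rewrite openE => x /overlapP[Ux dq].
have H1 : nbhs x (U p) by apply: open_nbhs_nbhs; split; [exact: U_open|].
have H2 : nbhs x (coordV (ch p) @^-1` dom (ch q)).
 by apply: (coordV_cont Ux); apply: open_nbhs_nbhs; split; [exact: dom_open|].
apply: filterS (filterI H1 H2) => y [Uy dy]; exact/overlapP.
Qed.

Lemma loc_transition p q u x : overlap (ch p) (ch q) x ->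
 loc p u x = loc q u (transition (ch p) (ch q) x).
Proof. by move=> /overlapP[Ux dq]; rewrite /loc /= /transition coordK. Qed.

Lemma transition_crd p q r : dom (ch p) r -> transition (ch p) (ch q) (crd p r) = crd q r.
Proof. by move=> dp; rewrite /transition coordK. Qed.

Lemma transition_U p q x : overlap (ch p) (ch q) x -> U q (transition (ch p) (ch q) x).
Proof. by move=> /overlapP[Ux dq]; exists (crv p x). Qed.

Lemma smooth_locP u : (forall r, exists p W,
  [/\ dom (ch p) r, open W, W (crd p r) & smooth_on W (loc p u)]) -> smooth K u.
Proof.
move=> H q; apply: smooth_loc => x Ux; have [e dq] := coordVK Ux.
have [p [W [dp oW Wr sW]]] := H (crv q x).
pose tau := transition (ch q) (ch p); pose O := overlap (ch q) (ch p).
have oO : open O := @open_overlap q p.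
have ct y : O y -> {for y, continuous tau}.
 move=> Oy; apply: (@cont_map _ _ _ O tau) => // b; exact: (@transition_smooth R n M K q p b).
exists (O `&` tau @^-1` W); split.
- rewrite openE => y [Oy Wy]; apply: filterI; first exact: open_nbhs_nbhs.
 by apply: ct => //; exact: open_nbhs_nbhs.
- by split; [exact/overlapP|rewrite /tau /= -[X in transition _ _ X]e transition_crd].
- have oV : open (O `&` tau @^-1` W).
  rewrite openE => y [Oy Wy]; apply: filterI; first exact: open_nbhs_nbhs.
  by apply: ct => //; exact: open_nbhs_nbhs.
 apply: (smooth_ext oV (f := loc p u \o tau)) => [y [Oy _]|].
  by rewrite [RHS](@loc_transition q p).
 apply: (smooth_map oV oW) => //; first by move=> y [].
 move=> b; apply: smooth_sub (@transition_smooth R n M K q p b); by move=> y [].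
Qed.

Lemma sm_cst (c : R) : smooth K (fun=> c).
Proof. by move=> p; exact: smooth_cst. Qed.

Lemma sm_add u v : smooth K u -> smooth K v -> smooth K (fun r => u r + v r).
Proof. by move=> su sv p; exact: (smooth_add (@U_open p) (su p) (sv p)). Qed.

Lemma sm_mul u v : smooth K u -> smooth K v -> smooth K (fun r => u r * v r).
Proof. by move=> su sv p; exact: (smooth_mul (@U_open p) (su p) (sv p)). Qed.

Lemma sm_scale (c : R) u : smooth K u -> smooth K (fun r => c * u r).
Proof. by move=> su p; exact: (smooth_scale c (@U_open p) (su p)). Qed.

Lemma sm_sub u v : smooth K u -> smooth K v -> smooth K (fun r => u r - v r).
Proof. by move=> su sv p; exact: (smooth_subr (@U_open p) (su p) (sv p)). Qed.

Lemma sm_inv u : smooth K u -> (forall r, u r != 0) -> smooth K (fun r => (u r)^-1).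
Proof. move=> su u0 p; apply: (@smooth_inv _ _ _ (loc p u) (@U_open p)); last exact: su.
by move=> x _; exact: u0. Qed.

Lemma sm_powR u (a : R) : smooth K u -> (forall r, 0 < u r) -> smooth K (fun r => u r `^ a).
Proof. move=> su u0 p; apply: (@smooth_powR _ _ _ (loc p u) a (@U_open p)); last exact: su.
by move=> x _; exact: u0. Qed.

Lemma sm_sum (I : Type) (s : seq I) (F : I -> M -> R) : (forall i, smooth K (F i)) ->
 smooth K (fun r => \sum_(i <- s) F i r).
Proof.
move=> sF p; apply: (@smooth_sum _ _ (U p) I s xpredT (fun i => loc p (F i)) (@U_open p)) => i _.
exact: sF.
Qed.

Lemma sm_cont u : smooth K u -> continuous u.
Proof.
move=> su r; have dr : dom (ch r) r by exact: chart_at_dom.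
have c1 : {for r, continuous (loc r u \o Defs.coord (ch r))}.
 apply: continuous_comp; first exact: coord_cont.
 exact: smooth_cont (su r) (U_crd dr).
have ev : \forall s \near r, loc r u (crd r s) = u s.
 have : nbhs r (dom (ch r)) by apply: open_nbhs_nbhs; split; [exact: dom_open|].
 by apply: filterS => s ds; exact: loc_crd.
rewrite /prop_for /continuous_at in c1 *.
rewrite -(loc_crd u dr); apply: cvg_trans c1; apply: near_eq_cvg.
by apply: filterS ev => s /= ->.
Qed.

Definition ext0 p (phi : 'rV[R]_m -> R) r : R := if `[< dom (ch p) r >] then phi (crd p r) else 0.
Local Notation ext := ext0.

Lemma loc_ext p phi x : U p x -> loc p (ext p phi) x = phi x.
Proof. by move=> /coordVK[e d]; rewrite /loc /ext /= asboolT // e. Qed.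

Lemma ext_crd p phi r : dom (ch p) r -> ext p phi r = phi (crd p r).
Proof. by move=> d; rewrite /ext asboolT. Qed.

Section ExtSmooth.
Hypothesis hM : hausdorff_space M.
Variables (p : M) (S : set 'rV[R]_m).
Hypotheses (cS : compact S) (SU : S `<=` U p).

Lemma patch_closed : closed (coordV (ch p) @` S).
Proof.
apply: compact_closed => //; apply: continuous_compact => //.
apply: continuous_in_subspaceT => x /set_mem /SU Ux; exact: coordV_cont.
Qed.

(** In a Hausdorff space the image of the compact [S] is closed, so an extension by zero vanishes
    near every point outside the chart domain. The neighbourhood depends on [S] alone. *)
Lemma off_patch r : ~ dom (ch p) r -> exists O, [/\ open O, O r & forall s, O s ->
 forall phi, (forall x, ~ S x -> phi x = 0) -> ext p phi s = 0].
Proof.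
move=> nd; exists (~` (coordV (ch p) @` S)); split.
- exact: closed_openC patch_closed.
- by move=> [x Sx e]; apply: nd; rewrite -e; have [] := coordVK (SU Sx).
- move=> s nS phi p0; rewrite /ext; case: ifPn => // /asboolP d; apply: p0 => Sx; apply: nS.
 by exists (crd p s) => //; rewrite coordK.
Qed.

Lemma smooth_ext0 phi : smooth_on (U p) phi -> (forall x, ~ S x -> phi x = 0) -> smooth K (ext p phi).
Proof.
move=> sp p0; apply: smooth_locP => r; have [d|nd] := pselect (dom (ch p) r).
 exists p, (U p); split=> //; [exact: U_open|exact: U_crd|].
 by apply: smooth_ext (@U_open p) _ sp => x Ux; rewrite loc_ext.
have [W [oW Wr W0]] := off_patch nd; have dr : dom (ch r) r by exact: chart_at_dom.
exists r, (U r `&` coordV (ch r) @^-1` W).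
have oV : open (U r `&` coordV (ch r) @^-1` W).
 rewrite openE => y [Uy Oy]; apply: filterI; first by apply: open_nbhs_nbhs; split; [exact: U_open|].
 by apply: (coordV_cont Uy); exact: open_nbhs_nbhs.
split=> //; first by split; [exact: U_crd|rewrite /= coordK].
apply: smooth_ext oV _ (smooth_cst _ 0) => y [_ Wy]; by rewrite /loc /= W0.
Qed.

End ExtSmooth.

End ManifoldCalculus.

(** * Change of holomorphic charts *)

Section ChartChange.
Context {R : realType} {n : nat} {M : topologicalType}.
Variable K : kahler R n M.
Local Notation m := (n + n)%N.
Local Notation J := (Jmx n : 'M[R]_m).
Local Notation ch := (chart_at K).
Local Notation U p := (img (ch p)).
Local Notation crd p r := (Defs.coord (ch p) r).
Local Notation loc := (loc_fun K).
Local Notation tau p q := (transition (ch p) (ch q)).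
Implicit Types (p q r : M) (x y : 'rV[R]_m) (u v w : M -> R).

Lemma gx_unit p x : U p x -> gmx K p x \in unitmx.
Proof. by move=> Ux; apply: gu; [exact: gmx_sym|exact: gmx_hermitian|move=> v; exact: gmx_pos]. Qed.

Lemma gx_smx p : smx (U p) (gmx K p).
Proof. by move=> a b; exact: gmx_smooth. Qed.

Lemma laplacian_patch p f x : smooth_on (U p) f -> U p x ->
 laplacian (gmx K p) f x = \sum_a \sum_b invmx (gmx K p x) a b * partial a (partial b f) x.
Proof.
move=> sf Ux; apply: (@laplacian_flat _ _ J (U p)) => //.
- exact: JmxT.
- exact: JmxJ.
- exact: U_open.
- exact: gx_smx.
- exact: gmx_sym.
- exact: gx_unit.
- exact: gmx_hermitian.
- exact: omega_closed.
Qed.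

Lemma laplacian_Pm p f x : smooth_on (U p) f -> U p x ->
 laplacian (gmx K p) f x = \tr (Pm J (grad f) x *m invmx (gmx K p x)).
Proof.
move=> sf Ux; rewrite (@laplacianE _ _ (U p)) //.
- apply: (@trHm _ _ J (U p)) => //.
 + exact: JmxT.
 + exact: JmxJ.
 + exact: U_open.
 + exact: gx_smx.
 + exact: gmx_sym.
 + exact: gx_unit.
 + exact: gmx_hermitian.
 + exact: omega_closed.
 + by apply: clsd_grad => //; exact: U_open.
- exact: U_open.
- exact: gx_smx.
- exact: gmx_sym.
- exact: gx_unit.
Qed.

(** The second derivatives of the transition map contribute the matrix [Q], which is
    J-anti-invariant because the Jacobian and its derivatives commute with [J]. Taking the
    J-invariant part removes [Q], and what is left transforms as a tensor. *)
Lemma chart_change p q x : overlap (ch p) (ch q) x -> exists D : 'M[R]_m,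
 [/\ D \in unitmx, gmx K p x = D *m gmx K q (tau p q x) *m D^T,
  forall u, smooth K u -> grad (loc p u) x = grad (loc q u) (tau p q x) *m D^T &
  forall u, smooth K u -> Pm J (grad (loc p u)) x = D *m Pm J (grad (loc q u)) (tau p q x) *m D^T].
Proof.
move=> Ox; set O := overlap (ch p) (ch q) in Ox; have oO : open O := @open_overlap _ _ _ K p q.
pose t := tau p q; have st b : smooth_on O (fun x => t x 0 b) by exact: transition_smooth.
have OU y : O y -> U q (t y) by exact: transition_U.
pose Jac y := Defs.jacobian t y; pose D := Jac x.
have sJac : smx O Jac.
 move=> a b; apply: (smooth_ext oO (f := partial a (fun y => t y 0 b))) .
  by move=> y _; rewrite /Jac mxE.
 exact: smooth_partial.
have gD : gmx K p x = D *m gmx K q (t x) *m D^T by exact: gmx_change.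
have uD : D \in unitmx.
 have Up : U p x by have /overlapP[] := Ox.
 have := gx_unit Up; rewrite gD !unitmxE !det_mulmx !unitfE mulf_eq0 negb_or => /andP[+ _].
 by rewrite mulf_eq0 negb_or => /andP[].
have sO u : smooth K u -> smooth_on (U q) (loc q u) by exact.
have E1 u b y : smooth K u -> O y ->
  partial b (loc p u) y = \sum_c partial b (fun z => t z 0 c) y * partial c (loc q u) (t y).
 move=> su Oy; rewrite (partial_ext b oO Oy (fun z Oz => loc_transition u Oz)).
 exact: (partial_map (@U_open _ _ _ K q) OU st b Oy (sO u su)).
exists D; split=> // u su.
 apply/rowP => b; rewrite [LHS]mxE E1 // [RHS]mxE; apply: eq_bigr => c _.
 by rewrite [in RHS]mxE [D^T _ _]mxE [D _ _]mxE mulrC.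
pose f := loc q u; have sf : smooth_on (U q) f by exact: sO.
pose Q : 'M[R]_m := \matrix_(a, b) \sum_c (pmx a Jac x) b c * partial c f (t x).
have sfc c : smooth_on O (fun y => partial c f (t y)).
 exact: (smooth_map oO (@U_open _ _ _ K q) OU st (smooth_partial c sf)).
have E2 : Dm (grad (loc p u)) x = D *m Dm (grad f) (t x) *m D^T + Q.
 have addE (Z1 Z2 : 'M[R]_m) i j : (Z1 + Z2) i j = Z1 i j + Z2 i j by rewrite !mxE.
 apply/matrixP => a b; rewrite Dm_gradE addE.
 rewrite (partial_ext a oO Ox (fun y Oy => E1 u b y su Oy)) partial_sum; last first.
  by move=> c _; apply: (smooth_derivable (smooth_mul oO (smooth_partial b (st c)) (sfc c)) Ox).
 rewrite [(_ *m D^T) a b]mxE [Q a b]mxE -big_split; apply: eq_bigr => c _ /=.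
 rewrite (smooth_partialM a (smooth_partial b (st c)) (sfc c) Ox) addrC.
 have -> : partial a (fun y => partial c f (t y)) x = \sum_d D a d * partial d (partial c f) (t x).
  rewrite (partial_map (@U_open _ _ _ K q) OU st a Ox (smooth_partial c sf)).
  by apply: eq_bigr => d _; rewrite [in RHS]mxE.
 have -> : pmx a Jac x b c = partial a (partial b (fun z => t z 0 c)) x.
  by rewrite pmxE; congr (partial a _ x); apply/funext => y; rewrite mxE.
 congr (_ + _); rewrite [D^T c b]mxE [D b c]mxE mulrC; congr (_ * _).
 by rewrite [RHS]mxE; apply: eq_bigr => d _; rewrite -(Dm_gradE f d c (t x)).
have JD y : O y -> J *m Jac y = Jac y *m J by move=> Oy; exact: (transition_holo Oy).
have dJac a : J *m pmx a Jac x = pmx a Jac x *m J.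
 rewrite -(pmxMl oO a J sJac Ox) -(pmxMr oO a J sJac Ox).
 exact: (@pmx_ext _ _ _ oO _ _ a _ _ x Ox).
pose F (z : 'rV[R]_m) : 'M[R]_m := \matrix_(a, b) (z *m (pmx a Jac x)^T) 0 b.
have FT z : (F z)^T = F z.
 apply/matrixP => a b; rewrite !mxE; apply: eq_bigr => c _; congr (_ * _).
 have e a' b' : (pmx a' Jac x)^T c b' = partial a' (partial b' (fun z => t z 0 c)) x.
  rewrite [LHS]mxE [LHS]pmxE; congr (partial a' _ x); apply/funext => y; exact: mxE.
 exact: etrans (e b a) (etrans (partialC b a oO Ox (st c)) (esym (e a b))).
have FJ z : F z *m J = F (z *m J).
 apply/row_matrixP => a; rewrite row_mul.
 have rF z' : row a (F z') = z' *m (pmx a Jac x)^T by apply/rowP => b; rewrite mxE mxE.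
 rewrite !rF -!mulmxA; congr (_ *m _); have := congr1 trmx (dJac a).
 by rewrite !trmx_mul JmxT mulNmx mulmxN => /oppr_inj.
have QF : Q = F (grad f (t x)).
 apply/matrixP => a b; rewrite [LHS]mxE [RHS]mxE [RHS]mxE; apply: eq_bigr => c _.
 by rewrite mulrC [in RHS]mxE [in RHS]mxE.
have QJ : Q *m J = - (J *m Q).
 by rewrite QF FJ -FT -FJ trmx_mul JmxT FT mulNmx.
have Q0 : Q + J *m Q *m J^T = 0.
 by rewrite JmxT mulmxN -mulmxA QJ mulmxN opprK mulmxA JmxJ mulNmx mul1mx subrr.
rewrite /Pm E2 -scalemxAr -scalemxAl; congr (_ *: _).
rewrite mulmxDr mulmxDl addrACA Q0 addr0 mulmxDr mulmxDl; congr (_ + _).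
have DJ : D^T *m J^T = J^T *m D^T by rewrite -!trmx_mul (JD x Ox).
by rewrite !mulmxA (JD x Ox) -[_ *m D^T *m J^T]mulmxA DJ !mulmxA.
Qed.

Lemma conj_inv (D g : 'M[R]_m) : D \in unitmx -> g \in unitmx ->
 D^T *m invmx (D *m g *m D^T) *m D = invmx g.
Proof.
move=> uD ug; set h := D *m g *m D^T.
have uh : h \in unitmx by rewrite /h !unitmx_mul unitmx_tr uD ug.
have e : g *m (D^T *m invmx h *m D) = 1%:M.
 rewrite -[LHS](mulKmx uD) !mulmxA.
 rewrite (_ : invmx D *m D *m g *m D^T *m invmx h *m D = invmx D *m (h *m invmx h) *m D).
  by rewrite mulmxV // mulmx1 mulVmx.
 by rewrite /h !mulmxA.
by rewrite -[LHS](mulKmx ug) e mulmx1.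
Qed.

(** The value at [r] is computed in the chart attached to [r], so that it is a function on [M] by
    construction; [lapM_patch] shows that every other chart gives the same. *)
Definition laplaceM u r : R := laplacian (gmx K r) (loc r u) (crd r r).
Local Notation lapM := laplaceM.

Definition gradM u v r : R :=
 (grad (loc r u) (crd r r) *m invmx (gmx K r (crd r r)) *m (grad (loc r v) (crd r r))^T) 0 0.
Local Notation ipM := gradM.

Definition hessM u v r : R :=
 \tr (Pm J (grad (loc r u)) (crd r r) *m invmx (gmx K r (crd r r))
    *m (Pm J (grad (loc r v)) (crd r r) *m invmx (gmx K r (crd r r)))).
Local Notation ppM := hessM.

Lemma change_at p r : dom (ch p) r -> exists D : 'M[R]_m,
 [/\ D^T *m invmx (gmx K p (crd p r)) *m D = invmx (gmx K r (crd r r)),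
  forall u, smooth K u -> grad (loc p u) (crd p r) = grad (loc r u) (crd r r) *m D^T &
  forall u, smooth K u -> Pm J (grad (loc p u)) (crd p r) = D *m Pm J (grad (loc r u)) (crd r r) *m D^T].
Proof.
move=> dp; have dr : dom (ch r) r by exact: chart_at_dom.
have [D [uD gD H1 H2]] := chart_change (overlap_crd dp dr).
rewrite transition_crd // in gD H1 H2; exists D; split=> //.
rewrite gD; apply: conj_inv => //; exact: gx_unit (U_crd dr).
Qed.

Lemma lapM_patch u p r : smooth K u -> dom (ch p) r ->
 lapM u r = laplacian (gmx K p) (loc p u) (crd p r).
Proof.
move=> su dp; have dr : dom (ch r) r by exact: chart_at_dom.
have [D [gD _ PD]] := change_at dp.
have sl q : smooth_on (U q) (loc q u) by exact: su.
rewrite /lapM (laplacian_Pm (sl r) (U_crd dr)) (laplacian_Pm (sl p) (U_crd dp)).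
rewrite PD // -gD; move: (Pm _ _ _) (invmx _) => A i.
by rewrite -[D *m _ *m D^T *m _]mulmxA -[D *m _ *m _]mulmxA [RHS]mxtrace_mulC !mulmxA.
Qed.

Lemma ipM_patch u v p r : smooth K u -> smooth K v -> dom (ch p) r ->
 ipM u v r = (grad (loc p u) (crd p r) *m invmx (gmx K p (crd p r)) *m (grad (loc p v) (crd p r))^T) 0 0.
Proof.
move=> su sv dp; have [D [gD H _]] := change_at dp.
by rewrite /ipM -gD !H // trmx_mul trmxK !mulmxA.
Qed.

Lemma ppM_patch u v p r : smooth K u -> smooth K v -> dom (ch p) r ->
 ppM u v r = \tr (Pm J (grad (loc p u)) (crd p r) *m invmx (gmx K p (crd p r))
    *m (Pm J (grad (loc p v)) (crd p r) *m invmx (gmx K p (crd p r)))).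
Proof.
move=> su sv dp; have [D [gD _ H]] := change_at dp.
rewrite /ppM -gD !H //; move: (Pm _ _ _) (Pm _ _ _) (invmx (gmx K p _)) => A B i.
by rewrite !mulmxA [LHS]mxtrace_mulC !mulmxA.
Qed.

Lemma sm_lap u : smooth K u -> smooth K (lapM u).
Proof.
move=> su; apply: smooth_locP => r; have dr : dom (ch r) r by exact: chart_at_dom.
exists r, (U r); split=> //; [exact: U_open|exact: U_crd|].
apply: (smooth_ext (@U_open _ _ _ K r) (f := fun x => \sum_a \sum_b invmx (gmx K r x) a b * partial a (partial b (loc r u)) x)).
 move=> x Ux; have [e d] := coordVK Ux.
 by rewrite /loc_fun /= (lapM_patch su d) e laplacian_patch //; exact: (su r).
have oU := @U_open _ _ _ K r.
apply: smooth_sum => // a _; apply: smooth_sum => // b _; apply: smooth_mul => //.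
 by apply: smx_inv => //; [move=> x; exact: gx_unit|exact: gx_smx].
by apply: smooth_partial; apply: smooth_partial; exact: (su r).
Qed.

Lemma sm_ip u v : smooth K u -> smooth K v -> smooth K (ipM u v).
Proof.
move=> su sv; apply: smooth_locP => r; have dr : dom (ch r) r by exact: chart_at_dom.
exists r, (U r); split=> //; [exact: U_open|exact: U_crd|].
have oU := @U_open _ _ _ K r.
apply: (smooth_ext oU (f := fun x => (grad (loc r u) x *m invmx (gmx K r x) *m (grad (loc r v) x)^T) 0 0)).
 by move=> x Ux; have [e d] := coordVK Ux; rewrite /loc_fun /= (ipM_patch su sv d) e.
apply: smxM => //; last by apply: smx_tr => //; apply: smx_grad => //; exact: (sv r).
apply: smxM => //; first by apply: smx_grad => //; exact: (su r).
by apply: smx_inv => //; [move=> x; exact: gx_unit|exact: gx_smx].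
Qed.

Lemma sm_pp u v : smooth K u -> smooth K v -> smooth K (ppM u v).
Proof.
move=> su sv; apply: smooth_locP => r; have dr : dom (ch r) r by exact: chart_at_dom.
exists r, (U r); split=> //; [exact: U_open|exact: U_crd|].
have oU := @U_open _ _ _ K r.
apply: (smooth_ext oU (f := fun x => \tr (Pm J (grad (loc r u)) x *m invmx (gmx K r x)
    *m (Pm J (grad (loc r v)) x *m invmx (gmx K r x))))).
 by move=> x Ux; have [e d] := coordVK Ux; rewrite /loc_fun /= (ppM_patch su sv d) e.
have si : smx (U r) (fun x => invmx (gmx K r x)).
 by apply: smx_inv => //; [move=> x; exact: gx_unit|exact: gx_smx].
have sP w : smooth K w -> smx (U r) (Pm J (grad (loc r w))).
 by move=> sw; apply: smx_Pm => //; apply: smx_grad => //; exact: (sw r).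
apply: smx_trace => //; apply: smxM => //; apply: smxM => //; exact: sP.
Qed.

Lemma ipMC u v r : ipM u v r = ipM v u r.
Proof.
have t1 (A : 'M[R]_1) : A 0 0 = A^T 0 0 by rewrite mxE.
have dr : dom (ch r) r by exact: chart_at_dom.
by rewrite /ipM t1 !trmx_mul trmxK trmx_inv (gmx_sym (U_crd dr)) mulmxA.
Qed.

Lemma ipM_ge0 u r : 0 <= ipM u u r.
Proof.
have dr : dom (ch r) r by exact: chart_at_dom.
have Ux := U_crd dr.
case: (eqVneq (grad (loc r u) (crd r r)) 0) => [g0|n0]; first by rewrite /ipM g0 !mul0mx mxE.
apply: ltW; apply: invmx_pos n0; [exact: gmx_sym|exact: gmx_hermitian|move=> v; exact: gmx_pos].
Qed.

Lemma ipMDl u v w r : smooth K u -> smooth K v ->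
 ipM (fun s => u s + v s) w r = ipM u w r + ipM v w r.
Proof.
move=> su sv; have dr : dom (ch r) r by exact: chart_at_dom.
rewrite /ipM; have -> : grad (loc r (fun s => u s + v s)) (crd r r) =
 grad (loc r u) (crd r r) + grad (loc r v) (crd r r).
 by apply/rowP => a; rewrite !mxE; exact: (smooth_partialD a (su r) (sv r) (U_crd dr)).
by rewrite !mulmxDl mxE.
Qed.

Lemma ipMZl (c : R) u w r : smooth K u -> ipM (fun s => c * u s) w r = c * ipM u w r.
Proof.
move=> su; have dr : dom (ch r) r by exact: chart_at_dom.
rewrite /ipM; have -> : grad (loc r (fun s => c * u s)) (crd r r) = c *: grad (loc r u) (crd r r).
 apply/rowP => a; rewrite !mxE; apply: (@partialZ _ _ c (loc r u)).
 exact: smooth_derivable (su r) (U_crd dr).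
by rewrite -!scalemxAl mxE.
Qed.

Lemma ipM_cst (c : R) w r : ipM (fun=> c) w r = 0.
Proof.
rewrite /ipM; have -> : grad (loc r (fun=> c)) (crd r r) = 0.
 by apply/rowP => a; rewrite !mxE; exact: partial_cst.
by rewrite !mul0mx mxE.
Qed.

Lemma ipM_chain v (c : R) u r : (forall a, partial a (loc r v) (crd r r) = c * partial a (loc r u) (crd r r)) ->
 forall h, ipM v h r = c * ipM u h r.
Proof.
move=> H h; rewrite /ipM; have -> : grad (loc r v) (crd r r) = c *: grad (loc r u) (crd r r).
 by apply/rowP => a; rewrite !mxE.
by rewrite -!scalemxAl mxE.
Qed.

Lemma ipMM u v w r : smooth K u -> smooth K v ->
 ipM (fun s => u s * v s) w r = u r * ipM v w r + v r * ipM u w r.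
Proof.
move=> su sv; have dr : dom (ch r) r by exact: chart_at_dom.
rewrite /ipM; have -> : grad (loc r (fun s => u s * v s)) (crd r r) =
 u r *: grad (loc r v) (crd r r) + v r *: grad (loc r u) (crd r r).
 apply/rowP => a; rewrite !mxE -(loc_crd u dr) -(loc_crd v dr) addrC [X in X + _]mulrC.
 exact: (smooth_partialM a (su r) (sv r) (U_crd dr)).
by rewrite !mulmxDl -!scalemxAl !mxE.
Qed.

(* The divergence of [w grad u]. *)
Lemma lapM_chain v w u r : smooth K u -> smooth K v -> smooth K w ->
 (forall a x, U r x -> partial a (loc r v) x = loc r w x * partial a (loc r u) x) ->
 lapM v r = w r * lapM u r + ipM w u r.
Proof.
move=> su sv sw H; have dr : dom (ch r) r by exact: chart_at_dom.
have Ux := U_crd dr.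
have sl f : smooth K f -> smooth_on (U r) (loc r f) by exact.
rewrite /lapM (laplacian_patch (sl v sv) Ux) (laplacian_patch (sl u su) Ux) /ipM.
set x := crd r r; set i := invmx _; rewrite mxE mulr_sumr.
have -> : \sum_(j < m) (grad (loc r w) x *m i) 0 j * (grad (loc r u) x)^T j 0 =
 \sum_a \sum_b i a b * (partial a (loc r w) x * partial b (loc r u) x).
 rewrite exchange_big /=; apply: eq_bigr => b _; rewrite [(grad (loc r u) x)^T b 0]mxE [grad (loc r u) x _ _]mxE.
 rewrite mxE mulr_suml; apply: eq_bigr => a _; rewrite [grad _ _ _ _]mxE.
 move: (partial _ _ _) (partial _ _ _) (i a b) => *; ring.
rewrite -big_split; apply: eq_bigr => a _; rewrite mulr_sumr -big_split; apply: eq_bigr => b _ /=.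
rewrite (partial_ext a (@U_open _ _ _ K r) Ux (H b)) (smooth_partialM a (sl w sw) (smooth_partial b (sl u su)) Ux).
rewrite (loc_crd w dr).
by rewrite mulrDr addrC [i a b * (w r * _)]mulrCA.
Qed.

Lemma lapMD u v r : smooth K u -> smooth K v -> lapM (fun s => u s + v s) r = lapM u r + lapM v r.
Proof.
move=> su sv; have dr : dom (ch r) r by exact: chart_at_dom.
have Ux := U_crd dr.
have sl f : smooth K f -> smooth_on (U r) (loc r f) by exact.
rewrite /lapM (laplacian_patch (sl _ (sm_add su sv)) Ux) (laplacian_patch (sl u su) Ux) (laplacian_patch (sl v sv) Ux).
rewrite -big_split; apply: eq_bigr => a _; rewrite -big_split; apply: eq_bigr => b _ /=.
rewrite -mulrDr; congr (_ * _).
rewrite (partial_ext a (@U_open _ _ _ K r) Ux (fun y Uy => smooth_partialD b (su r) (sv r) Uy)).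
exact: (smooth_partialD a (smooth_partial b (su r)) (smooth_partial b (sv r)) Ux).
Qed.

Lemma lapMZ (c : R) u r : smooth K u -> lapM (fun s => c * u s) r = c * lapM u r.
Proof.
move=> su; rewrite (lapM_chain (u := u) (w := fun=> c)) ?ipM_cst ?addr0 //.
- exact: sm_scale.
- exact: sm_cst.
- by move=> a x Ux; apply: (@partialZ _ _ c (loc r u)); exact: smooth_derivable (su r) Ux.
Qed.

End ChartChange.

(** * Maximum principle and the mean *)

Section LocalMax.
Context {R : realType} {m : nat}.
Variables (V : set 'rV[R]_m) (f : 'rV[R]_m -> R) (x : 'rV[R]_m).
Hypotheses (oV : open V) (Vx : V x) (sf : smooth_on V f) (fmax : forall y, V y -> f y <= f x).

Lemma near_line (P : set 'rV[R]_m) (v : 'rV[R]_m) : (\forall h \near (0 : 'rV[R]_m), P h) ->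
 exists2 t0 : R, 0 < t0 & forall t, 0 <= t <= t0 -> P (t *: v).
Proof.
move=> /nbhs_ballP[d /= d0 H]; have v1 : 0 < `|v| + 1 by rewrite ltr_wpDl.
exists (d / 2 / (`|v| + 1)); first by rewrite !divr_gt0.
move=> t /andP[t0 t1]; apply: H; rewrite -ball_normE /ball_ /= sub0r normrN normrZ (ger0_norm t0).
apply: (@le_lt_trans _ _ (d / 2)); last by rewrite ltr_pdivrMr // ltr_pMr // ltr1n.
apply: (@le_trans _ _ (t * (`|v| + 1))); first by rewrite ler_wpM2l // lerDl.
by rewrite -ler_pdivlMr.
Qed.

Lemma local_max_grad a : partial a f x = 0.
Proof.
have H (s : R) : s * partial a f x <= 0.
 rewrite leNgt; apply/negP => c0; set c := s * _ in c0.
 have [c' cE] : {c' | c' = c} by exists c.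
 rewrite -cE in c0; have e0 : 0 < c' / (2 * (`|s| + 1)) by rewrite divr_gt0 // mulr_gt0 // ltr_wpDl.
 have A1 := smooth_approx oV Vx sf e0.
 have A2 : \forall h \near (0 : 'rV[R]_m), V (x + h).
  have : \forall y \near x, V y by exact: open_near.
  move=> /nbhs_ballP[d /= d0 H]; apply/nbhs_ballP; exists d => //= h hd; apply: H.
  by move: hd; rewrite -!ball_normE /ball_ /= opprD addNKr sub0r.
 have [t0 t00 /(_ t0)] := near_line (s *: dl a) (filterI A1 A2).
 rewrite lexx (ltW t00) => /(_ isT)[h1 /fmax h2].
 have S : \sum_b (t0 *: (s *: dl a)) 0 b * partial b f x = t0 * c'.
  rewrite (bigD1 a) //= big1 ?addr0 => [|b ba]; last by rewrite !mxE (negbTE ba) andbF !mulr0 mul0r.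
  by rewrite !mxE !eqxx mulr1 cE /c mulrA.
 rewrite S in h1.
 have n1 : `|t0 *: (s *: dl a) : 'rV[R]_m| <= t0 * `|s|.
  by rewrite !normrZ gtr0_norm // ler_wpM2l ?(ltW t00) // -[leRHS]mulr1 ler_wpM2l // norm_dl.
 have h3 : c' / (2 * (`|s| + 1)) * (t0 * `|s|) <= t0 * c' / 2.
  have s1 : 0 < `|s| + 1 by rewrite ltr_wpDl.
  have -> : c' / (2 * (`|s| + 1)) * (t0 * `|s|) = (t0 * c' / 2) * (`|s| / (`|s| + 1)) by field; rewrite gt_eqF.
  rewrite ler_piMr ?divr_ge0 ?mulr_ge0 ?(ltW t00) ?(ltW c0) //.
  by rewrite ler_pdivrMr // mul1r lerDl.
 have h4 : t0 * c' <= t0 * c' / 2.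
  apply: le_trans h3; apply: le_trans (ler_wpM2l (ltW e0) n1).
  move: h1 h2; rewrite ler_norml => /andP[h1 _] h2; move: h1.
  move: (f _) (f x) h2 (_ * `|_|) => u w h2 z; lra.
 have : 0 < t0 * c' by exact: mulr_gt0.
 move: (t0 * c') h4 => z; lra.
have := H 1; have := H (-1); lra.
Qed.

(** Otherwise the derivative [D] of [f] along [v] is zero at [x] and has positive slope there, so
    [f] increases strictly along a short segment. Only the first-order expansion of [D] is needed,
    no second-order Taylor formula. *)
Lemma local_max_hess (v : 'rV[R]_m) : \sum_a \sum_b v 0 a * v 0 b * partial a (partial b f) x <= 0.
Proof.
rewrite leNgt; apply/negP => c0; set c := (X in 0 < X) in c0.
pose D y := \sum_b v 0 b * partial b f y.
have sD : smooth_on V D by apply: smooth_sum => // b _; apply: smooth_scale => //; exact: smooth_partial.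
have D0 : D x = 0 by rewrite /D big1 // => b _; rewrite local_max_grad mulr0.
have Dc : \sum_a v 0 a * partial a D x = c.
 apply: eq_bigr => a _; rewrite /D partial_sum => [|b _]; last first.
  exact: smooth_derivable (smooth_scale (v 0 b) oV (smooth_partial b sf)) Vx.
 rewrite mulr_sumr; apply: eq_bigr => b _; rewrite partialZ ?mulrA //.
 exact: smooth_derivable (smooth_partial b sf) Vx.
have v1 : 0 < `|v| + 1 by rewrite ltr_wpDl.
have e0 : 0 < c / (2 * (`|v| + 1)) by rewrite divr_gt0 // mulr_gt0.
have A1 := smooth_approx oV Vx sD e0.
have A2 : \forall h \near (0 : 'rV[R]_m), V (x + h).
 have : \forall y \near x, V y by exact: open_near.
 move=> /nbhs_ballP[d /= d0 H]; apply/nbhs_ballP; exists d => //= h hd; apply: H.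
 by move: hd; rewrite -!ball_normE /ball_ /= opprD addNKr sub0r.
have [t0 t00 H] := near_line v (filterI A1 A2).
have Dpos t : 0 < t -> t <= t0 -> 0 < D (x + t *: v).
 move=> tp tt0; have [|h1 _] := H t; first by rewrite (ltW tp).
 have S : \sum_a (t *: v) 0 a * partial a D x = t * c.
  by rewrite -Dc mulr_sumr; apply: eq_bigr => a _; rewrite mxE mulrA.
 move: h1; rewrite S D0 subr0 normrZ (gtr0_norm tp) ler_norml => /andP[h1 _].
 have h3 : c / (2 * (`|v| + 1)) * (t * `|v|) <= t * c / 2.
  have -> : c / (2 * (`|v| + 1)) * (t * `|v|) = (t * c / 2) * (`|v| / (`|v| + 1)) by field; rewrite gt_eqF.
  rewrite ler_piMr ?divr_ge0 ?mulr_ge0 ?(ltW tp) ?(ltW c0) //.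
  by rewrite ler_pdivrMr // mul1r lerDl.
 have : 0 < t * c by exact: mulr_gt0.
 move: (t * c) (D _) (_ * (t * _)) h1 h3 => u w z; lra.
have step s t : 0 <= s -> s < t -> t <= t0 -> exists2 z, s <= z <= t & f (x + t *: v) - f (x + s *: v) = (t - s) * D (x + z *: v).
 move=> s0 st tt.
 have [|z /andP[z0 z1] E] := @MVT_line R _ f (x + s *: v) ((t - s) *: v) (fun y => (t - s) * D y).
  move=> z /andP[z0 z1].
  have inV : V (x + (s + z * (t - s)) *: v).
   have [|_] := H (s + z * (t - s)); last by [].
   have ts : 0 <= t - s by rewrite subr_ge0 ltW.
   rewrite addr_ge0 ?mulr_ge0 //=; apply: le_trans tt.
   by rewrite -lerBrDl ler_piMl.
  have -> : x + s *: v + z *: ((t - s) *: v) = x + (s + z * (t - s)) *: v.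
   by rewrite scalerA -addrA -scalerDl.
  set y := x + _; apply/is_derive_line0.
  have -> : (t - s) * D y = \sum_a ((t - s) * v 0 a) * partial a f y.
   by rewrite /D mulr_sumr; apply: eq_bigr => a _; rewrite mulrA.
  apply: (@is_derive_chain R m f (fun w : R => y + w *: ((t - s) *: v)) 0).
   by rewrite scale0r addr0 => e ep; apply: smooth_approx oV inV sf ep.
  move=> a; have -> : (fun w : R => (y + w *: ((t - s) *: v)) 0 a) = (fun w => y 0 a + w * ((t - s) * v 0 a)).
   by apply/funext => w; rewrite !mxE.
  rewrite -[X in is_derive _ _ _ X]add0r.
  apply: (@is_deriveD R R R (cst (y 0 a)) (fun w => w * ((t - s) * v 0 a))).
  exact: is_derive_mulc.
 exists (s + z * (t - s)).
  have ts : 0 <= t - s by rewrite subr_ge0 ltW.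
  by rewrite lerDl mulr_ge0 //= -lerBrDl ler_piMl.
 move: E; rewrite scalerA -!addrA -!scalerDl addrCA subrr addr0 => ->.
 by [].
(* Two halves: on the first the intermediate point may be [x] itself, where [D] is zero, and only a
   weak inequality results; the second provides the strict one. *)
have t2 : 0 < t0 / 2 by rewrite divr_gt0.
have [|//||z1 /andP[z10 z11] E1] := step 0 (t0 / 2) => //; first by lra.
have [||//|z2 /andP[z20 z21] E2] := step (t0 / 2) t0; [exact: ltW|lra|].
have [|_ /fmax h] := H t0; first by rewrite lexx (ltW t00).
have p1 : 0 <= f (x + (t0 / 2) *: v) - f (x + 0 *: v).
 rewrite E1 mulr_ge0 ?subr0 ?(ltW t2) //.
 move: z10; rewrite le_eqVlt => /orP[/eqP <-|z1p]; first by rewrite scale0r addr0 D0.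
 by apply/ltW/Dpos => //; lra.
have p2 : 0 < f (x + t0 *: v) - f (x + (t0 / 2) *: v).
 by rewrite E2 mulr_gt0 //; [lra|apply: Dpos => //; lra].
move: p1 p2 h; rewrite scale0r addr0.
move: (f _) (f _) (f _) => a1 a2 a3; lra.
Qed.

End LocalMax.

(** * The Hahn-Banach theorem on a space of functions *)

Section HahnBanach.
Context {R : realType} {T : Type}.
Variable S : (T -> R) -> Prop.
Hypothesis SD : forall f g, S f -> S g -> S (fun t => f t + g t).
Hypothesis SZ : forall (c : R) f, S f -> S (fun t => c * f t).
Hypothesis S0 : S (fun=> 0).

(** Functionals are normalized to 0 outside [S], so that comparing two of them on [S] compares them
    everywhere, which the order given to Zorn's lemma asks for. *)
Definition sublin (p : (T -> R) -> R) := [/\ forall f g, S f -> S g -> p (fun t => f t + g t) <= p f + p g,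
 forall (c : R) f, 0 < c -> S f -> p (fun t => c * f t) = c * p f & forall f, ~ S f -> p f = 0].

Variable p : (T -> R) -> R.
Hypothesis sp : sublin p.

Let Q := {q : (T -> R) -> R | sublin q /\ forall f, S f -> q f <= p f}.
Let ge (q1 q2 : Q) := `[< forall f, sval q2 f <= sval q1 f >].

Lemma sublin0 q : sublin q -> q (fun=> 0) = 0.
Proof.
move=> [_ qZ _]; have := qZ 2 _ (ltr0n R 2) S0; rewrite (_ : (fun t : T => 2 * 0 : R) = (fun=> 0)).
 by move=> h; lra.
by apply/funext => t; rewrite mulr0.
Qed.

Lemma sublin_opp q f : sublin q -> S f -> - q (fun t => -1 * f t) <= q f.
Proof.
move=> sq Sf; have [qD _ _] := sq; have := qD _ _ Sf (SZ (-1) Sf).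
rewrite (_ : (fun t => f t + -1 * f t) = (fun=> 0)) ?(sublin0 sq); first by lra.
by apply/funext => t; rewrite mulN1r subrr.
Qed.

Lemma minimal_sublin : exists2 q, sublin q /\ (forall f, S f -> q f <= p f) &
 forall q', sublin q' -> (forall f, S f -> q' f <= q f) -> forall f, q' f = q f.
Proof.
have [||||[q [sq qp]] Hq] := @Zorn Q ge.
- by move=> q; apply/asboolP => f.
- by move=> q1 q2 q3 /asboolP h1 /asboolP h2; apply/asboolP => f; exact: le_trans (h2 f) (h1 f).
- move=> [q1 H1] [q2 H2] /asboolP h1 /asboolP h2; apply: eq_exist; apply/funext => f.
 by apply/eqP; rewrite eq_le; apply/andP; split; [exact: h2|exact: h1].
- move=> A tA; have [[q0 Aq0]|nA] := pselect (exists q, A q); last first.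
  exists (exist _ p (conj sp (fun f _ => lexx (p f)))) => q Aq; case: nA; by exists q.
 pose I f := inf [set sval q f | q in A].
 have lbS f : S f -> has_inf [set sval q f | q in A].
  move=> Sf; split; first by exists (sval q0 f), q0.
  exists (- p (fun t => -1 * f t)) => _ [[q [sq qp]] Aq <-] /=.
  by apply: le_trans (sublin_opp sq Sf); rewrite lerN2 qp //; exact: SZ.
 have IA q f : S f -> A q -> I f <= sval q f.
  by move=> Sf Aq; apply: ge_inf; [exact: (lbS f Sf).2|exists q].
 have Ilb f c : S f -> (forall q, A q -> c <= sval q f) -> c <= I f.
  move=> Sf Hc; apply: lb_le_inf; first exact: (lbS f Sf).1.
  by move=> _ [q Aq <-]; exact: Hc.
 have n0 f : ~ S f -> I f = 0.
  move=> nS; rewrite /I (_ : [set _ | _ in _] = [set 0]) ?inf1 //.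
  apply/seteqP; split=> [_ [q Aq <-]|_ ->] /=; first by have [[_ _ qn] _] := svalP q; exact: qn.
  by exists q0 => //; have [[_ _ qn] _] := svalP q0; exact: qn.
 have sI : sublin I.
  split=> // [f g Sf Sg|c f c0 Sf].
   have key q1 q2 : A q1 -> A q2 -> I (fun t => f t + g t) <= sval q1 f + sval q2 g.
    move=> A1 A2; have [/asboolP h|/asboolP h] := tA _ _ A1 A2.
     apply: le_trans (IA q2 _ (SD Sf Sg) A2) _; have [[qD _ _] _] := svalP q2.
     by apply: le_trans (qD _ _ Sf Sg) _; rewrite lerD2r; exact: h.
    apply: le_trans (IA q1 _ (SD Sf Sg) A1) _; have [[qD _ _] _] := svalP q1.
    by apply: le_trans (qD _ _ Sf Sg) _; rewrite lerD2l; exact: h.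
   rewrite -lerBlDr; apply: (Ilb) => // q1 A1; rewrite lerBlDr addrC -lerBlDr.
   by apply: (Ilb) => // q2 A2; rewrite lerBlDr addrC; exact: key.
  have qZ q f' : sval (q : Q) (fun t => c * f' t) = c * sval q f' \/ ~ S f'.
   have [Sf'|] := pselect (S f'); last by right.
   by left; have [[_ qZ _] _] := svalP q; exact: qZ.
  apply/eqP; rewrite eq_le; apply/andP; split.
   rewrite -ler_pdivrMl //; apply: (Ilb) => // q Aq; rewrite ler_pdivrMl //.
   apply: le_trans (IA q _ (SZ c Sf) Aq) _; by have [->|] := qZ q f.
  apply: (Ilb) => [|q Aq]; first exact: SZ.
  have [->|//] := qZ q f; rewrite ler_pM2l //; exact: IA.
 have Ip f : S f -> I f <= p f.
  by move=> Sf; apply: le_trans (IA q0 f Sf Aq0) _; have [_ qp] := svalP q0; exact: qp.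
 exists (exist _ I (conj sI Ip)) => q Aq; apply/asboolP => f /=.
 have [Sf|nS] := pselect (S f); first exact: IA.
 by rewrite n0 //; have [[_ _ qn] _] := svalP q; rewrite qn.
exists q => // q' sq' h f.
have q'p f' : S f' -> q' f' <= p f' by move=> Sf; exact: le_trans (h f' Sf) (qp f' Sf).
have /(congr1 sval) /= -> // : exist _ q' (conj sq' q'p) = exist _ q (conj sq qp) :> Q.
apply: Hq; apply/asboolP => f' /=.
have [Sf|nS] := pselect (S f'); first exact: h.
by have [_ _ n1] := sq; have [_ _ n2] := sq'; rewrite n1 // n2.
Qed.

(** A minimal sublinear [q] is linear. For fixed [g] the functional
    $q'(h)=\inf_{t\ge0}(q(h+tg)-t\,q(g))$ is again sublinear and below [q], hence equal to it; $t=1$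
    gives $q(h)+q(g)\le q(h+g)$. *)
Lemma hahn_banach : exists I : (T -> R) -> R,
 [/\ forall f g, S f -> S g -> I (fun t => f t + g t) = I f + I g,
  forall (c : R) f, S f -> I (fun t => c * f t) = c * I f & forall f, S f -> I f <= p f].
Proof.
have [q [sq qp] qmin] := minimal_sublin; have [qD qZ qn] := sq.
have add f g : S f -> S g -> q (fun t => f t + g t) = q f + q g.
 move=> Sf Sg; apply/eqP; rewrite eq_le qD //=.
 pose E h := [set q (fun s => h s + t * g s) - t * q g | t in [set t : R | 0 <= t]].
 pose q' h := if `[< S h >] then inf (E h) else 0.
 have Stg (t : R) h : S h -> S (fun s => h s + t * g s) by move=> Sh; apply: SD => //; exact: SZ.
 have E0 h : E h (q h).
  by exists 0; rewrite /= ?lexx // mul0r subr0; congr q; apply/funext => s; rewrite mul0r addr0.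
 have qZ0 (t : R) h : 0 <= t -> S h -> q (fun s => t * h s) = t * q h.
  rewrite le_eqVlt => /orP[/eqP <- _|]; last exact: qZ.
  by rewrite mul0r -[RHS](sublin0 sq); congr q; apply/funext => s; rewrite mul0r.
 have lbE h : S h -> has_lbound (E h).
  move=> Sh; exists (- q (fun s => -1 * h s)) => _ [t t0 <-].
  have := qD _ _ (Stg t h Sh) (SZ (-1) Sh).
  rewrite (_ : (fun r => h r + t * g r + -1 * h r) = (fun r => t * g r)) ?(qZ0 t g t0 Sg).
   by move: (q _) (q _) (q g) => u1 u2 u3; lra.
  by apply/funext => r; ring.
 have q'E h t : S h -> 0 <= t -> q' h <= q (fun s => h s + t * g s) - t * q g.
  by move=> Sh t0; rewrite /q' asboolT //; apply: ge_inf; [exact: lbE|exists t].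
 have q'lb h (c : R) : S h -> (forall t, 0 <= t -> c <= q (fun s => h s + t * g s) - t * q g) -> c <= q' h.
  move=> Sh H; rewrite /q' asboolT //; apply: lb_le_inf; first by exists (q h).
  by move=> _ [t t0 <-]; exact: H.
 have sq' : sublin q'.
  split=> [h1 h2 S1 S2|c h c0 Sh|h nS]; last by rewrite /q' asboolF.
  - rewrite -lerBlDr; apply: (q'lb) => // t t0; rewrite lerBlDr addrC -lerBlDr.
   apply: (q'lb) => // s s0; rewrite lerBlDr.
   apply: le_trans (q'E _ (t + s) (SD S1 S2) (addr_ge0 t0 s0)) _.
   have := qD _ _ (Stg t _ S1) (Stg s _ S2).
   rewrite (_ : (fun r => h1 r + t * g r + (h2 r + s * g r)) = (fun r => h1 r + h2 r + (t + s) * g r)).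
    by move: (q _) (q _) (q _) (q g) => u1 u2 u3 u4; lra.
   by apply/funext => r; ring.
  - have sc (k : R) h' : 0 < k -> S h' -> q' (fun s => k * h' s) <= k * q' h'.
    move=> k0 Sh'; rewrite -ler_pdivrMl //; apply: (q'lb) => // t t0; rewrite ler_pdivrMl //.
    apply: le_trans (q'E _ (k * t) (SZ k Sh') (mulr_ge0 (ltW k0) t0)) _.
    rewrite mulrBr -(qZ k) //; last exact: Stg.
    rewrite (_ : (fun s => k * h' s + k * t * g s) = (fun s => k * (h' s + t * g s))) ?mulrA //.
    by apply/funext => s; ring.
   apply/eqP; rewrite eq_le sc //=.
   have := sc c^-1 (fun s => c * h s); rewrite invr_gt0 => /(_ c0 (SZ c Sh)).
   rewrite (_ : (fun s => c^-1 * (c * h s)) = h); first by rewrite ler_pdivlMl.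
   by apply/funext => s; rewrite mulKf // gt_eqF.
 have q'q h : S h -> q' h <= q h.
  move=> Sh; apply: le_trans (q'E h 0 Sh (lexx 0)) _; rewrite mul0r subr0.
  by rewrite le_eqVlt; apply/orP; left; apply/eqP; congr q; apply/funext => s; rewrite mul0r addr0.
 have := q'E f 1 Sf ler01; rewrite (qmin q' sq' q'q) mul1r lerBrDr.
 by rewrite (_ : (fun s => f s + 1 * g s) = (fun s => f s + g s)) //; apply/funext => s; rewrite mul1r.
exists q; split=> // c f Sf.
have neg f' : S f' -> q (fun t => -1 * f' t) = - q f'.
 move=> Sf'; have := add _ _ Sf' (SZ (-1) Sf'); rewrite (_ : (fun t => f' t + -1 * f' t) = (fun=> 0)).
  by rewrite (sublin0 sq) => h; lra.
 by apply/funext => t; rewrite mulN1r subrr.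
case: (ltrgtP c 0) => [c0|c0|->].
- have := qZ (- c) (fun t => -1 * f t); rewrite oppr_gt0 => /(_ c0 (SZ (-1) Sf)).
 rewrite neg // mulrNN => <-; congr q; apply/funext => t; ring.
- exact: qZ.
- by rewrite mul0r -[RHS](sublin0 sq); congr q; apply/funext => s; rewrite mul0r.
Qed.

End HahnBanach.

Section InvariantMean.
Context {R : realType} {n : nat} {M : topologicalType}.
Variable K : kahler R n M.
Local Notation m := (n + n)%N.
Local Notation ch := (chart_at K).
Local Notation U p := (img (ch p)).
Local Notation crd p r := (Defs.coord (ch p) r).
Local Notation loc := (loc_fun K).
Local Notation lapM := (laplaceM K).
Hypothesis hK : compact [set: M].
Variable r0 : M.
Implicit Types u f h : M -> R.

Lemma sm_max u : smooth K u -> exists r, forall s, u s <= u r.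
Proof.
move=> su; have [||r _ H] := @compact_EVT_max M R u [set: M] _ hK.
- by exists r0.
- by apply: continuous_subspaceT; exact: sm_cont su.
- by exists r => s; apply: H; rewrite in_setT.
Qed.

Lemma lapM_cst (c : R) r : lapM (fun=> c) r = 0.
Proof.
rewrite (lapM_chain (u := fun=> c) (w := fun=> 0)) ?ipM_cst ?addr0 ?mul0r //; try exact: sm_cst.
by move=> a x Ux; rewrite mul0r; exact: partial_cst.
Qed.

Lemma max_loc u r : (forall s, u s <= u r) -> forall y, U r y -> loc r u y <= loc r u (crd r r).
Proof. by move=> H y _; rewrite loc_crd ?H //; exact: chart_at_dom. Qed.

Lemma max_grad u r : smooth K u -> (forall s, u s <= u r) -> grad (loc r u) (crd r r) = 0.
Proof.
move=> su H; have Ux := U_crd (chart_at_dom K r).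
apply/rowP => a; rewrite !mxE; apply: (local_max_grad (@U_open _ _ _ K r) Ux (su r) (max_loc H)).
Qed.

Lemma max_lap u r : smooth K u -> (forall s, u s <= u r) -> lapM u r <= 0.
Proof.
move=> su H; have Ux := U_crd (chart_at_dom K r).
have sl : smooth_on (U r) (loc r u) by exact: su.
rewrite /laplaceM (laplacian_patch sl Ux).
pose D : 'M[R]_m := \matrix_(b, a) partial a (partial b (loc r u)) (crd r r).
have -> : \sum_a \sum_b invmx (gmx K r (crd r r)) a b * partial a (partial b (loc r u)) (crd r r) = \tr (invmx (gmx K r (crd r r)) *m D).
 by rewrite /mxtrace; apply: eq_bigr => a _; rewrite mxE; apply: eq_bigr => b _; rewrite !mxE.
apply: trace_inv_le0; [exact: gmx_sym|exact: gmx_hermitian|by move=> v; exact: gmx_pos|].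
move=> v; apply: le_trans (local_max_hess (@U_open _ _ _ K r) Ux (su r) (max_loc H) v).
rewrite le_eqVlt; apply/orP; left; apply/eqP; rewrite mxE; apply: eq_bigr => a _.
rewrite mxE mxE mulr_suml; apply: eq_bigr => b _; rewrite mxE; ring.
Qed.

Lemma sm_bounded u : smooth K u -> exists2 B, 0 <= B & forall s, `|u s| <= B.
Proof.
move=> su; have [r Hr] := sm_max su; have [t Ht] := sm_max (sm_scale (-1) su).
exists (`|u r| + `|u t|); first by rewrite addr_ge0.
move=> s; have := Hr s; have := Ht s; have := ler_norm (u r); have := ler_norm (- u t).
rewrite normrN => h1 h2 h3 h4; rewrite ler_norml; apply/andP; split; have := normr_ge0 (u r); have := normr_ge0 (u t); lra.
Qed.

(* Plays the role of the integral against the normalized Riemannian volume. *)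
Definition mean (I : (M -> R) -> R) := [/\ forall f g, smooth K f -> smooth K g -> I (fun t => f t + g t) = I f + I g,
 forall (c : R) f, smooth K f -> I (fun t => c * f t) = c * I f,
 forall f, smooth K f -> (forall r, 0 <= f r) -> 0 <= I f,
 I (fun=> 1) = 1 & forall h, smooth K h -> I (lapM h) = 0].

(** [p f] is the infimum over smooth [h] of the supremum of $f+\Delta h$. At a minimum of [h] the
    Laplacian is nonnegative, so this supremum is at least the minimum of [f] and [p] is finite. A
    linear functional below [p] is at most $\sup f$, hence positive and normalized, and it is at
    most 0 on every Laplacian, of [h] and of [-h]. *)
Lemma exists_mean : exists I, mean I.
Proof.
pose E f := [set c : R | exists2 h, smooth K h & forall r, f r + lapM h r <= c].
pose p f := if `[< smooth K f >] then inf (E f) else 0.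
have low f c : smooth K f -> E f c -> exists r, f r <= c.
 move=> sf [h sh Hc]; have [r Hr] := sm_max (sm_scale (-1) sh); exists r.
 have := max_lap (sm_scale (-1) sh) Hr; rewrite lapMZ // => l; have := Hc r; move: (f r) (lapM h r) l => a b; lra.
have lbE f : smooth K f -> has_inf (E f).
 move=> sf; have [B B0 HB] := sm_bounded sf; split.
  exists B, (fun=> 0); first exact: sm_cst.
  by move=> r; rewrite lapM_cst addr0; exact: le_trans (ler_norm _) (HB r).
 exists (- B) => c Ec; have [r Hr] := low f c sf Ec; apply: le_trans Hr.
 by have := HB r; rewrite ler_norml => /andP[].
have pE f c : smooth K f -> E f c -> p f <= c.
 by move=> sf Ec; rewrite /p asboolT //; apply: ge_inf => //; exact: (lbE f sf).2.
have plb f c : smooth K f -> (forall d, E f d -> c <= d) -> c <= p f.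
 by move=> sf Hc; rewrite /p asboolT //; apply: lb_le_inf => //; exact: (lbE f sf).1.
have sc (c : R) f : 0 < c -> smooth K f -> p (fun t => c * f t) <= c * p f.
 move=> c0 sf; rewrite -ler_pdivrMl //; apply: (plb) => // d [h sh Hd]; rewrite ler_pdivrMl //.
 apply: pE; first exact: sm_scale.
 exists (fun t => c * h t); first exact: sm_scale.
 by move=> r; rewrite lapMZ // -mulrDr ler_pM2l.
have sp : sublin (smooth K) p.
 split=> [f g sf sg|c f c0 sf|f nf]; last by rewrite /p asboolF.
 - rewrite -lerBlDr; apply: (plb) => // d1 [h1 sh1 H1]; rewrite lerBlDr addrC -lerBlDr.
  apply: (plb) => // d2 [h2 sh2 H2]; rewrite lerBlDr; apply: pE; first exact: sm_add.
  exists (fun t => h1 t + h2 t); first exact: sm_add.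
  move=> r; rewrite lapMD //; have := H1 r; have := H2 r.
  move: (f r) (g r) (lapM h1 r) (lapM h2 r) => a b c d; lra.
 - apply/eqP; rewrite eq_le sc //=.
  have := sc c^-1 (fun s => c * f s); rewrite invr_gt0 => /(_ c0 (sm_scale c sf)).
  rewrite (_ : (fun s => c^-1 * (c * f s)) = f); first by rewrite ler_pdivlMl.
  by apply/funext => s; rewrite mulKf // gt_eqF.
have [I [ID IZ Ip]] := hahn_banach (@sm_add _ _ _ K) (@sm_scale _ _ _ K) (sm_cst K 0) sp.
have neg f : smooth K f -> (forall r, f r <= 0) -> I f <= 0.
 move=> sf f0; apply: le_trans (Ip f sf) _; apply: pE => //; exists (fun=> 0); first exact: sm_cst.
 by move=> r; rewrite lapM_cst addr0.
have pos f : smooth K f -> (forall r, 0 <= f r) -> 0 <= I f.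
 move=> sf f0; have := neg _ (sm_scale (-1) sf); rewrite IZ // => H.
 have : -1 * I f <= 0 by apply: H => r; rewrite mulN1r oppr_le0.
 by move: (I f) => z; lra.
have Ic (c : R) : I (fun=> c) <= c.
 apply: le_trans (Ip _ (sm_cst K c)) _; apply: pE; first exact: sm_cst.
 exists (fun=> 0); first exact: sm_cst.
 by move=> r; rewrite lapM_cst addr0.
have Il h : smooth K h -> I (lapM h) <= 0.
 move=> sh; apply: le_trans (Ip _ (sm_lap sh)) _; apply: pE; first exact: sm_lap.
 exists (fun t => -1 * h t); first exact: sm_scale.
 by move=> r; rewrite lapMZ // mulN1r subrr.
exists I; split=> //.
- have := Ic (-1); have := IZ (-1) _ (sm_cst K 1); rewrite mulN1r => ->.
 have := Ic 1; move: (I _) => z; lra.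
- move=> h sh; have := Il h sh; have := Il _ (sm_scale (-1) sh).
 rewrite (_ : lapM (fun t => -1 * h t) = (fun r => -1 * lapM h r)) ?IZ //; first by move: (I _) => z; lra.
 + exact: sm_lap.
 + by apply/funext => r; rewrite lapMZ.
Qed.

End InvariantMean.

(** * Cubes, balls and cut-offs in the charts *)

Section Patches.
Context {R : realType} {n : nat} {M : topologicalType}.
Variable K : kahler R n M.
Hypothesis hM : hausdorff_space M.
Local Notation m := (n + n)%N.
Local Notation J := (Jmx n : 'M[R]_m).
Local Notation ch := (chart_at K).
Local Notation U p := (img (ch p)).
Local Notation crd p r := (Defs.coord (ch p) r).
Local Notation crv p x := (coordV (ch p) x).
Local Notation loc := (loc_fun K).
Local Notation ext := (ext0 K).
Local Notation lapM := (laplaceM K).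
Local Notation oU p := (@U_open _ _ _ K p).

Lemma rad_ex p : exists e : R, 0 < e /\ forall x, `|x - crd p p| <= e -> U p x.
Proof.
have : nbhs (crd p p) (U p).
 by apply: open_nbhs_nbhs; split; [exact: U_open|exact: U_crd (chart_at_dom K p)].
move=> /nbhs_ballP[d /= d0 H]; exists (d / 2); split; first by rewrite divr_gt0.
move=> x xd; apply: H; rewrite -ball_normE /ball_ /= distrC; apply: le_lt_trans xd _.
by rewrite ltr_pdivrMr // ltr_pMr // ltr1n.
Qed.

Definition rd p : R := projT1 (cid (rad_ex p)).

Lemma rd_gt0 p : 0 < rd p. Proof. by rewrite /rd; case: cid => e []. Qed.

Lemma rd_U p x : `|x - crd p p| <= rd p -> U p x.
Proof. by rewrite /rd; case: cid => e [_ H] /=; exact: H. Qed.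

Definition corner p : 'rV[R]_m := crd p p - const_mx (rd p).
Definition side p : R := 2 * rd p.
Local Notation Q p := (cube (corner p) (side p)).
Local Notation av p := (avg (corner p) (side p)).

Lemma side_gt0 p : 0 < side p. Proof. by rewrite mulr_gt0 // rd_gt0. Qed.

Lemma cubeP p x : Q p x <-> forall a, `|x 0 a - crd p p 0 a| <= rd p.
Proof.
by split=> H a; have := H a; rewrite !mxE /side ler_norml => /andP[h1 h2]; apply/andP; split; move: h1 h2; move: (rd p) (x 0 a) (crd p p 0 a) => u v w; lra.
Qed.

Lemma cube_U p : Q p `<=` U p.
Proof.
move=> x /cubeP H; apply: rd_U; apply: rV_norm_le => [|a]; first exact: ltW (rd_gt0 p).
by have := H a; rewrite !mxE.
Qed.

Definition sq p x : R := sqn (x - crd p p).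

Lemma smooth_sqn (V : set 'rV[R]_m) c : open V -> smooth_on V (fun x => sqn (x - c)).
Proof.
move=> oV; apply: smooth_sum => // a _.
have e : smooth_on V (fun x : 'rV[R]_m => (x - c) 0 a).
 rewrite (_ : (fun x : 'rV[R]_m => (x - c) 0 a) = (fun x => x 0 a - c 0 a)).
  by apply: smooth_subr => //; [exact: smooth_coord|exact: smooth_cst].
 by apply/funext => x; rewrite !mxE.
by rewrite (_ : (fun x : 'rV[R]_m => (x - c) 0 a ^+ 2) = (fun x => (x - c) 0 a * (x - c) 0 a)) //; exact: smooth_mul.
Qed.

(** The concentric Euclidean balls are told apart by their squared radius in units of [rd p ^+ 2].
    The cut-off [cut] is supported in the ball of size 1/2 and equals 1 on the one of size 1/4,
    where [density] is tested; smaller balls of sizes 1/64, 1/256 and 1/512 follow. *)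
Definition ballK p := [set x | sq p x < rd p ^+ 2 / 4].
Local Notation bl := ballK.
Definition cballK p := [set x | sq p x <= rd p ^+ 2 / 4].
Local Notation cl := cballK.
Definition cb p := [set x | sq p x <= rd p ^+ 2 / 2].

Lemma cont_sqB c : continuous (fun x : 'rV[R]_m => sqn (x - c)).
Proof. by move=> x; apply: (smooth_cont (@smooth_sqn setT c openT)). Qed.

Lemma bl_open p : open (bl p).
Proof. exact: (open_comp (fun x _ => @cont_sqB (crd p p) x) (@open_lt R (rd p ^+ 2 / 4))). Qed.

Lemma cb_closed p : closed (cb p).
Proof. exact: (closed_comp (fun x _ => @cont_sqB (crd p p) x) (@closed_le R (rd p ^+ 2 / 2))). Qed.

Lemma cl_closed p : closed (cl p).
Proof. exact: (closed_comp (fun x _ => @cont_sqB (crd p p) x) (@closed_le R (rd p ^+ 2 / 4))). Qed.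

Lemma bl_cl p : bl p `<=` cl p.
Proof. by move=> x; rewrite /bl /cl /=; exact: ltW. Qed.

Lemma cl_cb p : cl p `<=` cb p.
Proof.
move=> x h; have := exprn_gt0 2 (rd_gt0 p); move: h; rewrite /cl /cb /=; move: (sq p x) (rd p ^+ 2) => u v; lra.
Qed.

Lemma bl_cb p : bl p `<=` cb p. Proof. by move=> x /bl_cl /cl_cb. Qed.

Lemma cb_coord p x a : cb p x -> `|x 0 a - crd p p 0 a| < rd p.
Proof.
rewrite /cb /= => h; have := sqn_coord (x - crd p p) a; rewrite !mxE => h1.
have r0 := exprn_gt0 2 (rd_gt0 p).
rewrite -(ltr_pXn2r (_ : 0 < 2)%N) ?nnegrE ?(ltW (rd_gt0 p)) // real_normK ?num_real //.
move: h h1 r0; rewrite /sq; move: (sqn _) (rd p ^+ 2) (_ ^+ 2) => u v w; lra.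
Qed.

Lemma cb_cube p : cb p `<=` Q p.
Proof. by move=> x h; apply/cubeP => a; exact/ltW/cb_coord. Qed.

Lemma cb_U p : cb p `<=` U p. Proof. by move=> x /cb_cube; exact: cube_U. Qed.

Lemma bl_U p : bl p `<=` U p. Proof. by move=> x /bl_cb; exact: cb_U. Qed.

Lemma cb_compact p : compact (cb p).
Proof. exact: subclosed_compact (@cb_closed p) (@cube_compact _ _ (corner p) (side p)) (@cb_cube p). Qed.

Lemma bl_center p : bl p (crd p p).
Proof. by rewrite /bl /= /sq subrr (_ : sqn 0 = 0) ?divr_gt0 ?exprn_gt0 ?rd_gt0 //; apply/eqP; rewrite sqn_eq0. Qed.

Lemma cb_bd p x : cb p x -> forall a, x 0 a != corner p 0 a /\ x 0 a != corner p 0 a + side p.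
Proof.
move=> h a; have := cb_coord a h; rewrite !mxE /side ltr_norml => /andP[h1 h2]; split; apply/eqP => e;
move: h1 h2; rewrite e; move: (rd p) (crd p p 0 a) => u v; lra.
Qed.

Definition cut p x : R := bump (rd p ^+ 2 / 2 - sq p x) / (bump (rd p ^+ 2 / 2 - sq p x) + bump (sq p x - rd p ^+ 2 / 4)).

Lemma cut_den p x : 0 < bump (rd p ^+ 2 / 2 - sq p x) + bump (sq p x - rd p ^+ 2 / 4).
Proof.
have r0 := exprn_gt0 2 (rd_gt0 p); have [h|h] := ltP (sq p x) (rd p ^+ 2 / 2).
 by apply: ltr_wpDr (bump_ge0 _) _; apply: bump_gt0; rewrite subr_gt0.
apply: ltr_wpDl (bump_ge0 _) _; apply: bump_gt0; rewrite subr_gt0.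
move: h r0; move: (sq p x) (rd p ^+ 2) => u v; lra.
Qed.

Local Notation tsp p := (tst (U p) (cb p)).
Local Notation lt p := (tst (U p) (cl p)).

Lemma cut_smooth p (V : set 'rV[R]_m) : open V -> smooth_on V (cut p).
Proof.
move=> oV.
have s1 : smooth_on V (fun x => bump (rd p ^+ 2 / 2 - sq p x)).
 apply: smooth_bump => //; apply: smooth_subr => //; [exact: smooth_cst|exact: smooth_sqn].
have s2 : smooth_on V (fun x => bump (sq p x - rd p ^+ 2 / 4)).
 apply: smooth_bump => //; apply: smooth_subr => //; [exact: smooth_sqn|exact: smooth_cst].
apply: smooth_mul => //; apply: smooth_inv => //; last exact: smooth_add.
by move=> x _; rewrite gt_eqF // cut_den.
Qed.

Lemma cut_tst p : tsp p (cut p).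
Proof.
split; first exact: cut_smooth (oU p).
move=> x /negP; rewrite -ltNge => h; rewrite /cut bump_eq0 ?mul0r // subr_le0; exact: ltW.
Qed.

Lemma cut1 p x : cl p x -> cut p x = 1.
Proof.
move=> h; rewrite /cut (bump_eq0 (t := sq p x - _)); last by rewrite subr_le0; exact: h.
rewrite addr0 divff // gt_eqF //; apply: bump_gt0; rewrite subr_gt0.
have r0 := exprn_gt0 2 (rd_gt0 p); move: h r0; rewrite /cl /=; move: (sq p x) (rd p ^+ 2) => u v; lra.
Qed.

Lemma lt_tsp p phi : lt p phi -> tsp p phi.
Proof. by move=> [s z]; split=> // x nc; apply: z => /cl_cb. Qed.

Lemma ext_smooth p phi : tsp p phi -> smooth K (ext p phi).
Proof. by move=> [s z]; exact: (smooth_ext0 hM (@cb_compact p) (@cb_U p) s z). Qed.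

Lemma extD p phi psi : ext p (fun x => phi x + psi x) = (fun r => ext p phi r + ext p psi r).
Proof. by apply/funext => r; rewrite /ext0; case: ifP => // _; rewrite addr0. Qed.

Lemma extZ p (c : R) phi : ext p (fun x => c * phi x) = (fun r => c * ext p phi r).
Proof. by apply/funext => r; rewrite /ext0; case: ifP => // _; rewrite mulr0. Qed.

Lemma near_patch r (O : set M) : open O -> O r -> exists W,
 [/\ open W, W (crd r r), W `<=` U r & forall y, W y -> O (crv r y)].
Proof.
move=> oO Or; have dr : dom (ch r) r by exact: chart_at_dom.
exists (U r `&` coordV (ch r) @^-1` O); split=> //; last by move=> y [].
- rewrite openE => y [Uy Oy]; apply: filterI; first by apply: open_nbhs_nbhs; split; [exact: U_open|].
 by apply: (coordV_cont Uy); exact: open_nbhs_nbhs.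
- by split; [exact: U_crd|rewrite /= coordK].
Qed.

Lemma local0 u r (O : set M) : smooth K u -> open O -> O r -> (forall s, O s -> u s = 0) ->
 [/\ grad (loc r u) (crd r r) = 0, lapM u r = 0 & Pm J (grad (loc r u)) (crd r r) = 0].
Proof.
move=> su oO Or u0; have dr : dom (ch r) r by exact: chart_at_dom.
have [W [oW Wr WU WO]] := near_patch oO Or.
have l0 y : W y -> loc r u y = 0 by move=> /WO/u0.
have p0 a y : W y -> partial a (loc r u) y = 0.
 by move=> Wy; rewrite (@partial_ext _ _ W _ (fun=> 0) a y oW Wy l0) partial_cst.
have pp0 a b y : W y -> partial a (partial b (loc r u)) y = 0.
 by move=> Wy; rewrite (@partial_ext _ _ W _ (fun=> 0) a y oW Wy (p0 b)) partial_cst.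
have D0 : Dm (grad (loc r u)) (crd r r) = 0.
 by apply/matrixP => a b; rewrite Dm_gradE pp0 // mxE.
have sl : smooth_on (U r) (loc r u) by exact: su.
split.
- by apply/rowP => a; rewrite !mxE p0.
- rewrite /laplaceM (laplacian_patch sl (U_crd dr)) big1 // => a _; rewrite big1 // => b _.
 by rewrite pp0 // mulr0.
- by rewrite /Pm D0 mulmx0 mul0mx addr0 scaler0.
Qed.

Lemma off_tsp p phi r : tsp p phi -> ~ dom (ch p) r -> exists W, [/\ open W, W r & forall s, W s -> ext p phi s = 0].
Proof.
move=> [_ z] nd; have [W [oW Wr H]] := off_patch hM (@cb_compact p) (@cb_U p) nd.
by exists W; split=> // s Ws; exact: H.
Qed.

Lemma grad_ext p phi r : tsp p phi -> dom (ch p) r -> grad (loc p (ext p phi)) (crd p r) = grad phi (crd p r).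
Proof.
move=> _ d; apply/rowP => a; rewrite !mxE.
apply: (partial_ext (U := U p)); [exact: U_open|exact: U_crd|by move=> y Uy; rewrite loc_ext].
Qed.

Lemma lap_ext p phi : tsp p phi -> lapM (ext p phi) = ext p (laplacian (gmx K p) phi).
Proof.
move=> tp; have se := ext_smooth tp; apply/funext => r; have [d|nd] := pselect (dom (ch p) r).
 rewrite (lapM_patch se d) (ext_crd _ d); have Ux := U_crd d.
 have sl : smooth_on (U p) (loc p (ext p phi)) by exact: se.
 rewrite (laplacian_patch sl Ux) (laplacian_patch tp.1 Ux); apply: eq_bigr => a _; apply: eq_bigr => b _.
 have E0 z : U p z -> loc p (ext p phi) z = phi z by move=> Uz; rewrite loc_ext.
 by rewrite (partial_ext a (oU p) Ux (fun y Uy => partial_ext b (oU p) Uy E0)).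
have [W [oW Wr W0]] := off_tsp tp nd.
have [_ -> _] := local0 se oW Wr W0.
by rewrite /ext0 asboolF.
Qed.

Section Density.
Variables (nu B : R) (T : (M -> R) -> R).
Hypothesis TD : forall f g, smooth K f -> smooth K g -> T (fun r => f r + g r) = T f + T g.
Hypothesis TZ : forall (c : R) f, smooth K f -> T (fun r => c * f r) = c * T f.
Hypothesis TB : forall f (C : R), smooth K f -> (forall r, `|f r| <= C) -> `|T f| <= B * C.
Hypothesis Tnu : forall f, smooth K f -> T (fun r => lapM f r + nu * f r) = 0.

(** [weyl] for the functional $\phi\mapsto T(\phi)$ on functions extended by zero from the chart.
    The series [w] is defined on the whole space but represents [T] only for tests supported in the
    ball where the cut-off is 1. *)
Lemma density p : exists2 w : 'rV[R]_m -> R, smooth_on setT w &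
 forall phi, lt p phi -> T (ext p phi) = av p (fun x => w x * phi x).
Proof.
pose A a b x := invmx (gmx K p x) a b.
have sA a b : smooth_on (U p) (A a b).
 exact: (smx_inv (oU p) (@gx_unit _ _ _ K p) (gx_smx K p) a b).
have pA x (v : 'rV[R]_m) : U p x -> v != 0 -> 0 < \sum_a \sum_b A a b x * v 0 a * v 0 b.
 move=> Ux v0; have := @invmx_pos _ _ (gmx K p x) (gmx_sym Ux) (gmx_hermitian Ux) (fun v => gmx_pos Ux) v v0.
 rewrite mxE; under eq_bigr do rewrite !mxE mulr_suml.
 rewrite exchange_big /= => h; apply: (lt_le_trans h); rewrite le_eqVlt; apply/orP; left; apply/eqP.
 by apply: eq_bigr => a _; apply: eq_bigr => b _; rewrite /A [v 0 a * _]mulrC.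
have [||||w sw H] := weyl (side_gt0 p) (oU p) (@cube_U p) (@cb_closed p) (@cb_cube p) sA pA
 (nu := nu) (T := fun phi => T (ext p phi)) (B := B) _ _ _ _ (cut_tst p).
- by move=> phi psi t1 t2; rewrite extD TD //; exact: ext_smooth.
- by move=> c phi t1; rewrite extZ TZ //; exact: ext_smooth.
- move=> phi C tp HC; apply: TB; first exact: ext_smooth.
 have C0 : 0 <= C by apply: le_trans (normr_ge0 _) (HC (crd p p) _); exact: cb_cube (bl_cb (bl_center p)).
 move=> r; rewrite /ext0; case: ifP => [_|_]; last by rewrite normr0.
 have [/cb_cube/HC//|nc] := pselect (cb p (crd p r)).
 by rewrite tp.2 // normr0.
- move=> phi tp; rewrite -[RHS](Tnu (ext_smooth tp)); congr T.
 rewrite (lap_ext tp); apply/funext => r; rewrite /ext0; case: ifP => [/asboolP d|_]; last by rewrite mulr0 addr0.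
 by rewrite (laplacian_patch tp.1 (U_crd d)).
exists w => // phi lp; rewrite -H; last 2 first.
- exact: lp.1.
- move=> x Qx [a xa]; apply: lp.2 => /cl_cb /(@cb_bd p x) /(_ a) [/eqP h1 /eqP h2]; by case: xa.
congr (T (ext p _)); apply/funext => x; have [/cut1->|nb] := pselect (cl p x); first by rewrite mul1r.
by rewrite lp.2 // mulr0.
Qed.

End Density.
End Patches.

(** * Hopf's lemma *)

Section Hopf.
Context {R : realType} {m : nat}.
Variables (V : set 'rV[R]_m) (A : 'I_m -> 'I_m -> 'rV[R]_m -> R) (B : 'I_m -> 'rV[R]_m -> R) (C w : 'rV[R]_m -> R).
Hypotheses (oV : open V) (sA : forall a b, smooth_on V (A a b)) (sB : forall a, smooth_on V (B a)) (sC : smooth_on V C).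
Hypothesis pA : forall x (v : 'rV[R]_m), V x -> v != 0 -> 0 < \sum_a \sum_b A a b x * v 0 a * v 0 b.
Hypothesis nA : forall x (D : 'I_m -> 'I_m -> R), V x -> (forall v : 'rV[R]_m, \sum_a \sum_b v 0 a * v 0 b * D a b <= 0) ->
 \sum_a \sum_b A a b x * D a b <= 0.
Hypotheses (sw : smooth_on V w) (w0 : forall x, V x -> 0 <= w x).
Definition lin_op f x : R := \sum_a \sum_b A a b x * partial a (partial b f) x + \sum_a B a x * partial a f x + C x * f x.
Hypothesis Lw : forall x, V x -> lin_op w x = 0.

Lemma smooth_sqnB (W : set 'rV[R]_m) c : open W -> smooth_on W (fun x => sqn (x - c)).
Proof.
move=> oW; apply: smooth_sum => // a _.
have e : smooth_on W (fun x : 'rV[R]_m => (x - c) 0 a).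
 rewrite (_ : (fun x : 'rV[R]_m => (x - c) 0 a) = (fun x => x 0 a - c 0 a)).
  by apply: smooth_subr => //; [exact: smooth_coord|exact: smooth_cst].
 by apply/funext => x; rewrite !mxE.
by rewrite (_ : (fun x : 'rV[R]_m => (x - c) 0 a ^+ 2) = (fun x => (x - c) 0 a * (x - c) 0 a)) //; exact: smooth_mul.
Qed.

Lemma cont_sqnB c : continuous (fun x : 'rV[R]_m => sqn (x - c)).
Proof. by move=> x; apply: (smooth_cont (@smooth_sqnB setT c openT)). Qed.

Lemma partial_coordB (c : 'rV[R]_m) a b (x : 'rV[R]_m) : partial a (fun y : 'rV[R]_m => (y - c) 0 b) x = (b == a)%:R.
Proof.
rewrite (_ : (fun y : 'rV[R]_m => (y - c) 0 b) = (fun y => y 0 b - c 0 b)); last by apply/funext => y; rewrite !mxE.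
rewrite (@smooth_partialB _ _ setT) ?partial_coord ?partial_cst ?subr0 //; [exact: smooth_coord|exact: smooth_cst].
Qed.

Lemma partial_sqnB (c : 'rV[R]_m) a (x : 'rV[R]_m) : partial a (fun x => sqn (x - c)) x = 2 * (x - c) 0 a.
Proof.
have sc b : smooth_on setT (fun y : 'rV[R]_m => (y - c) 0 b).
 rewrite (_ : (fun x : 'rV[R]_m => (x - c) 0 b) = (fun x => x 0 b - c 0 b)).
  by apply: smooth_subr; [exact: openT|exact: smooth_coord|exact: smooth_cst].
 by apply/funext => z; rewrite !mxE.
rewrite partial_sum => [|b _]; last exact: smooth_derivable (smooth_mul openT (sc b) (sc b)) I.
rewrite (bigD1 a) //= big1 ?addr0 => [|b ba].
 by rewrite (smooth_partialM a (sc a) (sc a)) // partial_coordB eqxx mul1r mulr1 mulr2n mulrDl !mul1r.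
by rewrite (smooth_partialM a (sc b) (sc b)) // partial_coordB (negbTE ba) mul0r mulr0 addr0.
Qed.

Lemma ball_compact c (t : R) : compact [set x : 'rV[R]_m | sqn (x - c) <= t].
Proof.
have H : [set x : 'rV[R]_m | sqn (x - c) <= t] `<=` cube (c - const_mx (`|t| + 1)) (2 * (`|t| + 1)).
 move=> x h a; have := le_trans (sqn_coord (x - c) a) h; rewrite !mxE => h1.
 have h2 : (x 0 a - c 0 a) ^+ 2 <= (`|t| + 1) ^+ 2.
  apply: le_trans h1 _; have := normr_ge0 t; have := ler_norm t; move: (`|t|) => u; nra.
 have t1 : 0 <= `|t| + 1 by rewrite addr_ge0.
 move: h2; rewrite -ler_sqrt ?exprn_ge0 // !sqrtr_sqr (ger0_norm t1) ler_norml => /andP[h3 h4].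
 by apply/andP; split; move: h3 h4; move: (`|t| + 1) (x 0 a) (c 0 a) => u v z; lra.
exact: subclosed_compact (closed_comp (fun x _ => @cont_sqnB c x) (@closed_le R t)) (@cube_compact _ _ _ _) H.
Qed.

Lemma lin_opB (e : R) h u y : smooth_on V h -> smooth_on V u -> V y ->
 lin_op (fun y => e * h y - u y) y = e * lin_op h y - lin_op u y.
Proof.
move=> sh su Vy; set f := fun y => _.
have pf a x : V x -> partial a f x = e * partial a h x - partial a u x.
 by move=> Vx; rewrite (smooth_partialB a (smooth_scale e oV sh) su Vx) (partialZ e (smooth_derivable sh Vx)).
have ppf a b : partial a (partial b f) y = e * partial a (partial b h) y - partial a (partial b u) y.
 rewrite (partial_ext a oV Vy (pf b)) (smooth_partialB a (smooth_scale e oV (smooth_partial b sh)) (smooth_partial b su) Vy).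
 by rewrite (partialZ e (smooth_derivable (smooth_partial b sh) Vy)).
have E1 : \sum_a \sum_b A a b y * partial a (partial b f) y =
  e * \sum_a \sum_b A a b y * partial a (partial b h) y - \sum_a \sum_b A a b y * partial a (partial b u) y.
 rewrite mulr_sumr -sumrB; apply: eq_bigr => a _; rewrite mulr_sumr -sumrB; apply: eq_bigr => b _.
 by rewrite ppf; move: (A a b y) (partial a _ y) (partial a _ y) => *; ring.
have E2 : \sum_a B a y * partial a f y = e * \sum_a B a y * partial a h y - \sum_a B a y * partial a u y.
 rewrite mulr_sumr -sumrB; apply: eq_bigr => a _.
 by rewrite pf //; move: (B a y) (partial a _ y) (partial a _ y) => *; ring.
have comb (x1 x2 y1 y2 c h' u' : R) : (e * x1 - x2) + (e * y1 - y2) + c * (e * h' - u') = e * (x1 + y1 + c * h') - (x2 + y2 + c * u') by ring.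
exact: etrans (congr2 (fun s t => s + t + C y * f y) E1 E2) (comb _ _ _ _ _ _ _).
Qed.

Variables (c0 : 'rV[R]_m) (D : R).
Hypotheses (BV : [set x | sqn (x - c0) <= D] `<=` V) (wc : 0 < w c0).
Local Notation s x := (sqn (x - c0)).

(** Hopf's barrier $e^{-\alpha s}-e^{-\alpha D}$ with $s$ the squared distance from the centre. Away
    from the centre, large $\alpha$ makes the second-order term, quadratic in $\alpha$, dominate the
    rest; [k] bounds the zeroth-order coefficient, whose sign is unknown. *)
Lemma barrier (r : R) : 0 < r -> exists k al : R, [/\ 0 <= k, 0 < al, forall x, s x <= D -> C x <= k &
 forall x, r <= s x -> s x <= D ->
 let h := fun y => expR (- al * s y) - expR (- al * D) in
 0 < lin_op h x - k * h x].
Proof.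
move=> r0; pose Kb : set 'rV[R]_m := [set x | s x <= D].
have cK : compact Kb by exact: ball_compact.
have cont f x : smooth_on V f -> Kb x -> {for x, continuous f} by move=> sf /BV; exact: smooth_cont.
have [la la0 Hla] := posdef_lower cK (fun a b x Kx => cont _ x (sA a b) Kx) (fun x v Kx => @pA x v (BV Kx)).
have [k k0 Hk] := continuous_bounded_on cK (fun x Kx => cont _ x sC Kx).
pose F x := \sum_a A a a x + \sum_a B a x * (x - c0) 0 a.
have sF : smooth_on V F.
 apply: smooth_add => //; first by apply: smooth_sum.
 apply: smooth_sum => // a _; apply: smooth_mul => //.
 rewrite (_ : (fun x : 'rV[R]_m => (x - c0) 0 a) = (fun x => x 0 a - c0 0 a)).
  by apply: smooth_subr => //; [exact: smooth_coord|exact: smooth_cst].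
 by apply/funext => z; rewrite !mxE.
have [La L0 HL] := continuous_bounded_on cK (fun x Kx => cont _ x sF Kx).
(* Chosen so that $\alpha\cdot\mathrm{la}\cdot r=\mathrm{la}\cdot r+\mathrm{La}+k$, where [la * r]
   bounds the quadratic form below on the annulus and [La] bounds the linear term [F]. *)
pose al := 1 + (La + k) / (la * r).
have al1 : 1 <= al by rewrite /al lerDl divr_ge0 ?addr_ge0 ?mulr_ge0 ?(ltW la0) ?(ltW r0).
exists k, al; split=> //; [exact: lt_le_trans ltr01 al1|by move=> x Kx; exact: le_trans (ler_norm _) (Hk x Kx)|].
move=> x rx Kx; pose h y := expR (- al * s y) - expR (- al * D).
change (0 < lin_op h x - k * h x).
have Vx := BV Kx; pose E y := expR (- al * s y).
have sS : smooth_on setT (fun y : 'rV[R]_m => - al * s y) by apply: smooth_scale; [exact: openT|exact: smooth_sqnB openT].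
have sE : smooth_on setT E by apply: smooth_exp; [exact: openT|].
have pE a y : partial a E y = - 2 * al * (y - c0) 0 a * E y.
 rewrite (@partial_comp1 _ _ expR (fun y => - al * s y) a y (E y)); last exact: smooth_derivable sS I.
 rewrite partialZ ?partial_sqnB; first by move: (E y) (_ 0 a) => u v; ring.
 exact: smooth_derivable (smooth_sqnB c0 openT) I.
have ph a y : partial a h y = - 2 * al * ((y - c0) 0 a * E y).
 rewrite (smooth_partialB a sE (smooth_cst _ _)) // partial_cst subr0 pE; move: (E y) (_ 0 a) => u v; ring.
have pph a b : partial a (partial b h) x = (4 * al ^+ 2 * (x - c0) 0 a * (x - c0) 0 b - 2 * al * (b == a)%:R) * E x.
 have sc : smooth_on setT (fun y : 'rV[R]_m => (y - c0) 0 b).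
  rewrite (_ : (fun x : 'rV[R]_m => (x - c0) 0 b) = (fun x => x 0 b - c0 0 b)).
   by apply: smooth_subr; [exact: openT|exact: smooth_coord|exact: smooth_cst].
  by apply/funext => z; rewrite !mxE.
 have -> : partial b h = (fun y => - 2 * al * ((y - c0) 0 b * E y)) by apply/funext => y; exact: ph.
 rewrite partialZ; last exact: smooth_derivable (smooth_mul openT sc sE) I.
 rewrite (smooth_partialM a sc sE) // pE partial_coordB; move: (E x) ((x - c0) 0 a) ((x - c0) 0 b) ((b == a)%:R : R) => u v z t; ring.
have -> : lin_op h x - k * h x = E x * (4 * al ^+ 2 * (\sum_a \sum_b A a b x * (x - c0) 0 a * (x - c0) 0 b) - 2 * al * F x) + (C x - k) * h x.
 rewrite /lin_op mulrBl addrA; congr (_ + _ - _).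
 have e1 : \sum_a \sum_b A a b x * partial a (partial b h) x =
  E x * (4 * al ^+ 2) * (\sum_a \sum_b A a b x * (x - c0) 0 a * (x - c0) 0 b) - E x * (2 * al) * \sum_a A a a x.
  rewrite !mulr_sumr -sumrB; apply: eq_bigr => a _.
  rewrite [X in _ = _ - X](_ : _ = \sum_b E x * (2 * al) * (A a b x * (b == a)%:R)); last first.
   rewrite (bigD1 a) //= big1 ?addr0 ?eqxx ?mulr1 // => b /negbTE ->; by rewrite !mulr0.
  rewrite mulr_sumr -sumrB; apply: eq_bigr => b _; rewrite pph.
  move: (E x) ((x - c0) 0 a) ((x - c0) 0 b) ((b == a)%:R : R) (A a b x) => u v z t y; ring.
 have e2 : \sum_a B a x * partial a h x = - E x * (2 * al) * \sum_a B a x * (x - c0) 0 a.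
  rewrite mulr_sumr; apply: eq_bigr => a _; rewrite ph; move: (E x) (_ 0 a) (B a x) => u v z; ring.
 have comb (u' q t1 t2 : R) : (u' * (4 * al ^+ 2) * q - u' * (2 * al) * t1) + - u' * (2 * al) * t2 =
  u' * (4 * al ^+ 2 * q - 2 * al * (t1 + t2)) by ring.
 exact: etrans (congr2 +%R e1 e2) (comb _ _ _ _).
have E0 : 0 < E x by exact: expR_gt0.
have h1 := Hla x (x - c0) Kx.
have hE : h x <= E x by rewrite /h lerBlDr lerDl expR_ge0.
have h0 : 0 <= h x.
 by rewrite /h subr_ge0 ler_expR !mulNr lerN2 ler_wpM2l // (le_trans ler01 al1).
have h2 : - (2 * k) * E x <= (C x - k) * h x.
 have := Hk x Kx; rewrite ler_norml => /andP[c1 _].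
 apply: (@le_trans _ _ (- (2 * k) * h x)); last by rewrite ler_wpM2r //; move: c1; move: (C x) => u; lra.
 by rewrite !mulNr lerN2 ler_wpM2l // mulr_ge0.
have h3 : F x <= La by exact: le_trans (ler_norm _) (HL x Kx).
have h4 : la * r <= \sum_a \sum_b A a b x * (x - c0) 0 a * (x - c0) 0 b.
 by apply: le_trans h1; rewrite ler_pM2l.
have h5 : 0 < 4 * al ^+ 2 * (la * r) - 2 * al * La - 2 * k.
 have lr : 0 < la * r by exact: mulr_gt0.
 have e : al * (la * r) = la * r + (La + k) by rewrite /al mulrDl mul1r divfK // gt_eqF.
 have : 0 < 2 * al * (2 * (al * (la * r)) - La - k).
  rewrite e mulr_gt0 ?mulr_gt0 //; first exact: lt_le_trans ltr01 al1.
  by move: lr L0 k0; move: (la * r) => u; lra.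
 have : k <= al * k by rewrite ler_peMl.
 move: (la * r) => u; nra.
apply: lt_le_trans (lerD (lexx _) h2).
rewrite [E x * _]mulrC -mulrDl mulr_gt0 //.
have a0 : 0 <= al by exact: le_trans ler01 al1.
have h6 : 4 * al ^+ 2 * (la * r) <= 4 * al ^+ 2 * (\sum_a \sum_b A a b x * (x - c0) 0 a * (x - c0) 0 b).
 by rewrite ler_wpM2l // mulr_ge0 // exprn_ge0.
have h7 : 2 * al * F x <= 2 * al * La by rewrite ler_wpM2l // mulr_ge0.
move: h5 h6 h7; move: (4 * al ^+ 2 * _) (4 * al ^+ 2 * _) (2 * al * _) (2 * al * _) => u v z t; lra.
Qed.

(** The multiple $eh$ of the barrier is compared with [w] on an annulus. A positive maximum of
    $eh-w$ can lie neither on the inner sphere, where $h<1$ and $w\ge e$, nor on the outer one,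
    where $h=0\le w$; at an interior one the differential inequality for [h] is violated. *)
Lemma hopf x1 : s x1 < D -> 0 < w x1.
Proof.
move=> s1; have D0 : 0 < D by apply: le_lt_trans s1; exact: sqn_ge0.
have Vc : V c0 by apply: BV; rewrite /= subrr (_ : sqn 0 = 0) ?ltW //; apply/eqP; rewrite sqn_eq0.
have [r [r0 rw]] : exists r, 0 < r /\ forall x, s x <= r -> w c0 / 2 <= w x.
 have e0 : 0 < w c0 / 2 by rewrite divr_gt0.
 have := cont_dist (smooth_cont sw Vc) e0 => /nbhs_ballP[d /= d0 H].
 exists ((d / 2) ^+ 2); split; first by rewrite exprn_gt0 // divr_gt0.
 move=> x sx; have xd : `|x - c0| <= d / 2.
  apply: rV_norm_le => [|a]; first by rewrite divr_ge0 // ltW.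
  have := le_trans (sqn_coord (x - c0) a) sx; rewrite -ler_sqrt ?exprn_ge0 ?divr_ge0 ?(ltW d0) // !sqrtr_sqr.
  by rewrite [`|d / 2|]ger0_norm // divr_ge0 // ltW.
 have := H x; rewrite -ball_normE /ball_ /= distrC => /(_ _).
 have -> : `|x - c0| < d by apply: le_lt_trans xd _; rewrite ltr_pdivrMr // ltr_pMr // ltr1n.
 by move=> /(_ isT); rewrite ler_norml => /andP[_]; move: (w c0) (w x) => u v; lra.
have [|rx] := lerP (s x1) r; first by move=> /rw; apply: lt_le_trans; rewrite divr_gt0.
have [k [al [k0 alp Ck H]]] := barrier r0.
pose h y := expR (- al * s y) - expR (- al * D).
have al0 := ltW alp.
(* Half the central value is the lower bound for [w] on the inner ball supplied by continuity. *)
pose e := w c0 / 2; have e0 : 0 < e by rewrite divr_gt0.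
pose f y := e * h y - w y.
have sh : smooth_on V h.
 apply: smooth_subr => //; last exact: smooth_cst.
 by apply: smooth_exp => //; apply: smooth_scale => //; exact: smooth_sqnB.
have seh : smooth_on V (fun y => e * h y) by exact: smooth_scale.
have sf : smooth_on V f by exact: smooth_subr.
pose Ann : set 'rV[R]_m := [set x | s x <= D] `&` [set x | r <= s x].
have cA : compact Ann.
 apply: (subclosed_compact _ (@ball_compact c0 D)); last by move=> x [].
 apply: closedI; first exact: (closed_comp (fun x _ => @cont_sqnB c0 x) (@closed_le R D)).
 exact: (closed_comp (fun x _ => @cont_sqnB c0 x) (@closed_ge R r)).
have [||y /set_mem[yD yr] ymax] := @compact_EVT_max _ R f Ann _ cA.
- by exists x1; split; apply: ltW.
- by apply: continuous_in_subspaceT => x /set_mem [/BV Vx _]; exact: smooth_cont sf Vx.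
have h1 x : h x <= 1 - expR (- al * D).
 by rewrite /h lerD2r -(expR0 R) ler_expR mulNr oppr_le0 mulr_ge0 // sqn_ge0.
have h1' x : h x < 1 by apply: le_lt_trans (h1 x) _; rewrite ltrBlDr ltrDl expR_gt0.
suff fy : f y <= 0.
 have := ymax x1 (mem_set (conj (ltW s1) (ltW rx) : Ann x1)).
 have hp : 0 < h x1 by rewrite /h subr_gt0 ltr_expR !mulNr ltrN2 ltr_pM2l.
 move=> /le_trans /(_ fy); rewrite /f subr_le0; apply: lt_le_trans; exact: mulr_gt0.
rewrite leNgt; apply/negP => fp.
have Vy := BV yD.
have yr' : r < s y.
 rewrite lt_neqAle yr andbT; apply/eqP => e1; move: fp; rewrite /f subr_gt0 => /lt_le_trans.
 have := rw y; rewrite -e1 lexx => /(_ isT) l1 l2.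
 have := l2 (e * 1) (ler_wpM2l (ltW e0) (ltW (h1' y))); rewrite mulr1 /e => l3.
 by have := le_lt_trans l1 l3; rewrite ltxx.
have yD' : s y < D.
 rewrite lt_neqAle yD andbT; apply/eqP => e1; move: fp; rewrite /f /h e1 subrr mulr0 sub0r oppr_gt0 => l1.
 by have := w0 Vy; rewrite leNgt l1.
pose W : set 'rV[R]_m := [set x | s x < D] `&` [set x | r < s x].
have oW : open W.
 apply: openI; first exact: (open_comp (fun x _ => @cont_sqnB c0 x) (@open_lt R D)).
 exact: (open_comp (fun x _ => @cont_sqnB c0 x) (@open_gt R r)).
have WV : W `<=` V by move=> x [/ltW xD _]; exact: BV.
have Wy : W y by [].
have fW x : W x -> f x <= f y.
 by move=> [x1D x1r]; apply: ymax; apply: mem_set; split; exact: ltW.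
have sfW := smooth_sub WV sf.
have g0 a := local_max_grad oW Wy sfW fW a.
have hess := nA Vy (fun v => local_max_hess oW Wy sfW fW v).
have Hp : 0 < lin_op h y - k * h y by exact: (H y yr yD).
have Lf : lin_op f y = e * lin_op h y - lin_op w y by exact: lin_opB.
have Lf2 : lin_op f y <= C y * f y.
 rewrite /lin_op [X in _ + X + _]big1 ?addr0 => [|a _]; last by rewrite g0 mulr0.
 by rewrite -[leRHS]add0r lerD2r.
have key (e' L' h' w' k' C' : R) : 0 <= k' * w' -> (C' - k') * (e' * h' - w') <= 0 ->
  e' * L' <= C' * (e' * h' - w') -> 0 < e' * (L' - k' * h') -> False by nra.
apply: (key e (lin_op h y) (h y) (w y) k (C y)); first exact: mulr_ge0 k0 (w0 Vy).
- by apply: mulr_le0_ge0 (ltW fp); rewrite subr_le0; exact: Ck.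
- by move: Lf2; rewrite Lf Lw // subr0.
- exact: mulr_gt0.
Qed.

End Hopf.

(** * The density of the mean *)

Section SqnBalls.
Context {R : realType} {m : nat}.

Lemma sqn_ball (W : set 'rV[R]_m) x : open W -> W x -> exists2 t : R, 0 < t & forall y, sqn (y - x) < t -> W y.
Proof.
move=> oW Wx; have : nbhs x W by exact: open_nbhs_nbhs.
move=> /nbhs_ballP[d /= d0 H]; exists ((d / 2) ^+ 2); first by rewrite exprn_gt0 // divr_gt0.
move=> y sy; apply: H; rewrite -ball_normE /ball_ /= distrC; apply: (@le_lt_trans _ _ (d / 2)).
 apply: rV_norm_le => [|a]; first by rewrite divr_ge0 // ltW.
 have := le_trans (sqn_coord (y - x) a) (ltW sy); rewrite -ler_sqrt ?exprn_ge0 ?divr_ge0 ?(ltW d0) // !sqrtr_sqr.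
 by rewrite [`|d / 2|]ger0_norm // divr_ge0 // ltW.
by rewrite ltr_pdivrMr // ltr_pMr // ltr1n.
Qed.

Lemma sqn_triangle (u v w : 'rV[R]_m) : sqn (u - w) <= 2 * sqn (u - v) + 2 * sqn (v - w).
Proof.
rewrite /sqn !mulr_sumr -big_split /=; apply: ler_sum => a _; rewrite !mxE.
rewrite -subr_ge0 [leRHS](_ : _ = (u 0 a - 2 * v 0 a + w 0 a) ^+ 2) ?sqr_ge0 //; ring.
Qed.

Lemma sqnC (u v : 'rV[R]_m) : sqn (u - v) = sqn (v - u).
Proof. by apply: eq_bigr => a _; rewrite !mxE -sqrrN opprB. Qed.

Lemma sqnxx (u : 'rV[R]_m) : sqn (u - u) = 0.
Proof. by rewrite subrr; apply/eqP; rewrite sqn_eq0. Qed.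

Definition bmp (x : 'rV[R]_m) (t : R) y : R := bump (t - sqn (y - x)).

Lemma bmp_smooth (V : set 'rV[R]_m) x t : open V -> smooth_on V (bmp x t).
Proof.
move=> oV; apply: smooth_bump => //; apply: smooth_subr => //; [exact: smooth_cst|exact: smooth_sqnB].
Qed.

Lemma bmp_pos x t y : sqn (y - x) < t -> 0 < bmp x t y.
Proof. by move=> h; apply: bump_gt0; rewrite subr_gt0. Qed.

Lemma bmp_off x t y : t <= sqn (y - x) -> bmp x t y = 0.
Proof. by move=> h; apply: bump_eq0; rewrite subr_le0. Qed.

End SqnBalls.

Section LocalTests.
Context {R : realType} {n : nat} {M : topologicalType}.
Variable K : kahler R n M.
Hypothesis hM : hausdorff_space M.
Hypothesis hK : compact [set: M].
Local Notation m := (n + n)%N.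
Local Notation ch := (chart_at K).
Local Notation U p := (img (ch p)).
Local Notation crd p r := (Defs.coord (ch p) r).
Local Notation crv p x := (coordV (ch p) x).
Local Notation loc := (loc_fun K).
Local Notation ext := (ext0 K).
Local Notation oU p := (@U_open _ _ _ K p).
Local Notation av p := (avg (corner K p) (side K p)).
Local Notation bl := (ballK K).
Local Notation cl := (cballK K).
Local Notation lt p := (tst (U p) (cl p)).

Lemma lt_bdq p F : smooth_on (U p) F -> bdq (corner K p) (side K p) F.
Proof. by move=> sF; apply: cont_bdq => x /cube_U; exact: smooth_cont. Qed.

Lemma lt_bdy p F : (forall x, ~ cl p x -> F x = 0) -> bdy0 (corner K p) (side K p) F.
Proof. move=> z x Qx [a xa]; apply: z => /cl_cb /(@cb_bd _ _ _ K p x) /(_ a) [/eqP h1 /eqP h2]; by case: xa. Qed.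

Lemma av_partial p a F : lt p F -> av p (partial a F) = 0.
Proof.
move=> [sF z]; apply: (avg_partial (side_gt0 K p) (oU p) (@cube_U _ _ _ K p) sF) => x Qx xa.
rewrite !z // => /cl_cb /(@cb_bd _ _ _ K p) /(_ a) [/eqP h1 /eqP h2]; [by case: h1|apply: h2].
by rewrite !mxE !eqxx mulr1 xa !mxE.
Qed.

(** The fundamental lemma of the calculus of variations: the test function is [F] times a bump, and
    faithfulness of the average ([avg_pos]) concludes. *)
Lemma av_test p F (W : set 'rV[R]_m) : smooth_on (U p) F -> open W -> W `<=` bl p ->
 (forall phi, lt p phi -> (forall x, ~ W x -> phi x = 0) -> av p (fun x => F x * phi x) = 0) ->
 forall x, W x -> F x = 0.
Proof.
move=> sF oW Wb H x Wx; have [t t0 tW] := sqn_ball oW Wx.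
have sb := bmp_smooth x t (oU p).
have off y : ~ W y -> bmp x t y = 0 by move=> nW; apply: bmp_off; rewrite leNgt; apply/negP => /tW.
have lp : lt p (fun y => F y * bmp x t y).
 split; first exact: smooth_mul (oU p) sF sb.
 by move=> y nb; rewrite off ?mulr0 // => /Wb/bl_cl.
have s2 : smooth_on (U p) (fun y => F y * (F y * bmp x t y)) by exact: smooth_mul (oU p) sF lp.1.
have := @avg_pos R m (corner K p) (side K p) (side_gt0 K p) (fun y => F y * (F y * bmp x t y)).
move=> /(_ (fun y Qy => smooth_cont s2 (cube_U Qy))) h.
have /h : bdy0 (corner K p) (side K p) (fun y => F y * (F y * bmp x t y)).
 by apply: lt_bdy => y nb; rewrite lp.2 // mulr0.
move=> h2; have : F x * (F x * bmp x t x) = 0.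
 apply: h2 => [y _||].
 - by rewrite mulrA mulr_ge0 ?bump_ge0 // -expr2 sqr_ge0.
 - by apply: H => // y nW; rewrite off // mulr0.
 - exact: cb_cube (bl_cb (Wb _ Wx)).
move=> /eqP; rewrite mulrA mulf_eq0 (gt_eqF (bmp_pos _)) ?sqnxx // orbF mulf_eq0 orbb => /eqP //.
Qed.

Lemma finite_subcover (V : M -> set M) : (forall r, open (V r)) -> (forall r, V r r) ->
 exists l : seq M, forall s, exists2 r, r \in l & V r s.
Proof.
move=> oV Vr; apply: contrapT => nl.
pose F : set_system M := [set A | exists l : seq M, forall s, (forall r, r \in l -> ~ V r s) -> A s].
have FF : ProperFilter F.
 split=> [[l Hl]|]; first apply: nl.
  exists l => s; apply: contrapT => ns; apply: (Hl s) => r rl Vrs; by apply: ns; exists r.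
 split; first by exists [::].
 - move=> A B [l Hl] [l' Hl']; exists (l ++ l') => s H; split.
   by apply: Hl => r rl; apply: H; rewrite mem_cat rl.
  by apply: Hl' => r rl; apply: H; rewrite mem_cat rl orbT.
 - by move=> A B AB [l Hl]; exists l => s H; apply/AB/Hl.
have [|p [_ clp]] := hK FF; first by exists [::].
have [|s [ns Vs]] := clp (~` V p) (V p) _ (open_nbhs_nbhs (conj (oV p) (Vr p))); last exact: ns.
by exists [:: p] => s H; apply: H; rewrite mem_head.
Qed.

(** Partitions of unity as an induction principle: a smooth function is a finite sum of functions
    supported in small coordinate balls. The cover [O] lets each use prescribe how small. *)
Lemma patch_ind (O : M -> set M) (Pr : (M -> R) -> Prop) : (forall r, open (O r)) -> (forall r, O r r) ->
 Pr (fun=> 0) -> (forall f g, smooth K f -> smooth K g -> Pr f -> Pr g -> Pr (fun s => f s + g s)) ->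
 (forall r phi, lt r phi -> (forall s, ~ O r s -> ext r phi s = 0) -> Pr (ext r phi)) ->
 forall f, smooth K f -> Pr f.
Proof.
move=> oO Or P0 PD Pe f sf.
have ex r : exists t : R, 0 < t /\ forall y, sqn (y - crd r r) < t -> bl r y /\ O r (crv r y).
 have [W [oW Wr WU WO]] := near_patch K (oO r) (Or r).
 have [t t0 tW] := sqn_ball (openI oW (@bl_open _ _ _ K r)) (conj Wr (@bl_center _ _ _ K r)).
 by exists t; split=> // y /tW [/WO].
pose t r := projT1 (cid (ex r)).
have tP r : 0 < t r /\ forall y, sqn (y - crd r r) < t r -> bl r y /\ O r (crv r y) by rewrite /t; case: cid.
pose b r := ext r (bmp (crd r r) (t r)).
have lb r : lt r (bmp (crd r r) (t r)).
 split; first exact: bmp_smooth (oU r).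
 by move=> y nb; apply: bmp_off; rewrite leNgt; apply/negP => /((tP r).2)[/bl_cl].
have sb r : smooth K (b r) by apply: ext_smooth => //; exact: lt_tsp (lb r).
have b0 r s : 0 <= b r s by rewrite /b /ext0; case: ifP => // _; exact: bump_ge0.
have br r : 0 < b r r.
 rewrite /b ext_crd; last exact: chart_at_dom.
 by apply: bmp_pos; rewrite sqnxx; exact: (tP r).1.
pose V r := [set s | 0 < b r s].
have oV r : open (V r) by apply: (open_comp (fun s _ => @sm_cont _ _ _ K _ (sb r) s) (@open_gt R 0)).
have [D HD] := finite_subcover oV br.
pose B s := \sum_(r <- D) b r s.
have sB : smooth K B by exact: sm_sum.
have B0 s : 0 < B s.
 have [r rD rs] := HD s.
 rewrite /B (big_rem r) //=; apply: ltr_wpDr => //; exact: sumr_ge0.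
pose h s := f s / B s.
have sh : smooth K h by apply: sm_mul => //; apply: sm_inv => // s; rewrite gt_eqF.
have -> : f = (fun s => \sum_(r <- D) b r s * h s).
 by apply/funext => s; rewrite -mulr_suml /h mulrC divfK // gt_eqF.
suff [] : smooth K (fun s => \sum_(r <- D) b r s * h s) /\ Pr (fun s => \sum_(r <- D) b r s * h s) by [].
elim: (D) => [|r l [IH1 IH2]].
 rewrite (_ : (fun s => _) = (fun=> 0)); first by split=> //; exact: sm_cst.
 by apply/funext => s; rewrite big_nil.
rewrite (_ : (fun s => _) = (fun s => b r s * h s + \sum_(r <- l) b r s * h s)); last by apply/funext => s; rewrite big_cons.
have s1 : smooth K (fun s => b r s * h s) by exact: sm_mul.
split; first exact: sm_add.
apply: PD => //.
have lp : lt r (fun x => bmp (crd r r) (t r) x * loc r h x).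
 split; first by apply: smooth_mul (oU r) (lb r).1 _; exact: sh.
 by move=> x nb; rewrite (lb r).2 // mul0r.
rewrite (_ : (fun s => b r s * h s) = ext r (fun x => bmp (crd r r) (t r) x * loc r h x)).
 apply: Pe => // s nO; rewrite /ext0; case: ifP => // /asboolP d; rewrite bmp_off ?mul0r // leNgt.
 by apply/negP => /((tP r).2)[_]; rewrite coordK.
by apply/funext => s; rewrite /b /ext0; case: ifP => [/asboolP d|_]; [rewrite loc_crd|rewrite mul0r].
Qed.

End LocalTests.

Section MeanDensity.
Context {R : realType} {n : nat} {M : topologicalType}.
Variable K : kahler R n M.
Hypothesis hM : hausdorff_space M.
Hypothesis hK : compact [set: M].
Hypothesis hC : connected [set: M].
Local Notation m := (n + n)%N.
Local Notation ch := (chart_at K).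
Local Notation U p := (img (ch p)).
Local Notation crd p r := (Defs.coord (ch p) r).
Local Notation loc := (loc_fun K).
Local Notation ext := (ext0 K).
Local Notation lapM := (laplaceM K).
Local Notation oU p := (@U_open _ _ _ K p).
Local Notation Q p := (cube (corner K p) (side K p)).
Local Notation av p := (avg (corner K p) (side K p)).
Local Notation bl := (ballK K).
Local Notation cl := (cballK K).
Local Notation lt p := (tst (U p) (cl p)).
Local Notation G p := (fun a b x => invmx (gmx K p x) a b).
Variable mu : (M -> R) -> R.
Hypothesis mmu : mean K mu.

Let muD f g : smooth K f -> smooth K g -> mu (fun t => f t + g t) = mu f + mu g.
Proof. by have [H _ _ _ _] := mmu; exact: H. Qed.
Let muZ (c : R) f : smooth K f -> mu (fun t => c * f t) = c * mu f.
Proof. by have [_ H _ _ _] := mmu; exact: H. Qed.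
Let mup f : smooth K f -> (forall r, 0 <= f r) -> 0 <= mu f.
Proof. by have [_ _ H _ _] := mmu; exact: H. Qed.
Let mu1 : mu (fun=> 1) = 1. Proof. by have [_ _ _ H _] := mmu. Qed.
Let mul h : smooth K h -> mu (lapM h) = 0.
Proof. by have [_ _ _ _ H] := mmu; exact: H. Qed.

Lemma mean_bound f (C : R) : smooth K f -> (forall r, `|f r| <= C) -> `|mu f| <= 1 * C.
Proof.
move=> sf fC; have muC : mu (fun=> C * 1) = C by rewrite (muZ C (sm_cst K 1)) mu1 mulr1.
have sC := sm_cst K (C * 1).
have h1 : 0 <= mu (fun r => C * 1 + -1 * f r).
 apply: mup => [|r]; first exact: sm_add sC (sm_scale (-1) sf).
 by have := fC r; rewrite ler_norml => /andP[_]; move: (f r) => u; lra.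
have h2 : 0 <= mu (fun r => C * 1 + f r).
 apply: mup => [|r]; first exact: sm_add sC sf.
 by have := fC r; rewrite ler_norml => /andP[+ _]; move: (f r) => u; lra.
move: h1 h2; rewrite (muD sC (sm_scale (-1) sf)) (muD sC sf) (muZ _ sf) muC mul1r ler_norml => h1 h2.
by apply/andP; split; move: h1 h2; move: (mu f) => u; lra.
Qed.

Lemma mean_dens p : exists w : 'rV[R]_m -> R, smooth_on setT w /\
 forall phi, lt p phi -> mu (ext p phi) = av p (fun x => w x * phi x).
Proof.
have [|w sw H] := @density R n M K hM 0 1 mu muD muZ mean_bound _ p; last by exists w.
move=> f sf; rewrite -[RHS](mul sf); congr mu; apply/funext => r; by rewrite mul0r addr0.
Qed.

Definition dn p : 'rV[R]_m -> R := projT1 (cid (mean_dens p)).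

Lemma dn_smooth p : smooth_on setT (dn p). Proof. by rewrite /dn; case: cid => w []. Qed.

Lemma dn_int p phi : lt p phi -> mu (ext p phi) = av p (fun x => dn p x * phi x).
Proof. by rewrite /dn; case: cid => w [_ H] /=; exact: H. Qed.

Let sdn p : smooth_on (U p) (dn p). Proof. exact: smooth_sub (@subsetT _ _) (dn_smooth p). Qed.

Lemma dn_ge0 p x : bl p x -> 0 <= dn p x.
Proof.
move=> bx; rewrite leNgt; apply/negP => wx.
have [W [oW Wx WU]] : exists W : set 'rV[R]_m, [/\ open W, W x & forall y, W y -> bl p y /\ dn p y < 0].
 exists (bl p `&` [set y | dn p y < 0]); split; [|by split|by move=> y []].
 apply: openI; first exact: bl_open.
 by apply: (open_comp (fun y _ => smooth_cont (dn_smooth p) I) (@open_lt R 0)).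
have [t t0 tW] := sqn_ball oW Wx.
have lb : lt p (bmp x t).
 split; first exact: bmp_smooth (oU p).
 by move=> y nb; apply: bmp_off; rewrite leNgt; apply/negP => /tW /WU [/bl_cl].
have s2 : smooth_on (U p) (fun y => - dn p y * bmp x t y).
 by apply: smooth_mul (oU p) _ lb.1; apply: smooth_opp (oU p) _; exact: sdn.
have z : forall y, Q p y -> 0 <= - dn p y * bmp x t y.
 move=> y _; have [h|h] := ltP (sqn (y - x)) t; last by rewrite bmp_off // mulr0.
 by apply: mulr_ge0 (bump_ge0 _); rewrite oppr_ge0 ltW //; have [] := WU y (tW y h).
have b0 : bdy0 (corner K p) (side K p) (fun y => - dn p y * bmp x t y).
 by apply: lt_bdy => y nb; rewrite lb.2 // mulr0.
have e : av p (fun y => - dn p y * bmp x t y) = 0.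
 have h1 := avg_ge0 (side_gt0 K p) (lt_bdq s2) z.
 have h2 : 0 <= mu (ext p (bmp x t)).
  apply: mup => [|r]; first by apply: ext_smooth => //; exact: lt_tsp.
  by rewrite /ext0; case: ifP => // _; exact: bump_ge0.
 apply/eqP; rewrite eq_le h1 andbT.
 have -> : av p (fun y => - dn p y * bmp x t y) = -1 * av p (fun y => dn p y * bmp x t y).
  rewrite -(avgZ (side_gt0 K p)); last exact: lt_bdq (smooth_mul (oU p) (@sdn p) lb.1).
  by apply: (avg_ext (side_gt0 K p)) => y _; rewrite mulNr mulN1r.
 by rewrite mulN1r oppr_le0 -(dn_int lb).
have := avg_pos (side_gt0 K p) (fun y Qy => smooth_cont s2 (cube_U Qy)) b0 z e (cb_cube (bl_cb bx)).
move/eqP; rewrite mulf_eq0 oppr_eq0 (lt_eqF wx) /= gt_eqF //; apply: bmp_pos; by rewrite sqnxx.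
Qed.

Let sG p a b : smooth_on (U p) (G p a b).
Proof. exact: (smx_inv (oU p) (@gx_unit _ _ _ K p) (gx_smx K p) a b). Qed.

Let lt_scale p F phi : smooth_on (U p) F -> lt p phi -> lt p (fun x => F x * phi x).
Proof. by move=> sF [sp z]; split; [exact: smooth_mul (oU p) sF sp|move=> x nb; rewrite z ?mulr0]. Qed.

Let bdp p F : smooth_on (U p) F -> bdq (corner K p) (side K p) F.
Proof. exact: lt_bdq. Qed.

Let avD p F H : smooth_on (U p) F -> smooth_on (U p) H -> av p (fun x => F x + H x) = av p F + av p H.
Proof. by move=> sF sH; apply: (avgD (side_gt0 K p)); exact: bdp. Qed.

Let lt_part p a phi : lt p phi -> lt p (partial a phi).
Proof. exact: (tst_partial (@cl_closed _ _ _ K p) a). Qed.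

(* Two integrations by parts: the density is annihilated by the formal adjoint of the Laplacian. *)
Lemma dn_adjoint p x : bl p x ->
 \sum_a \sum_b partial b (partial a (fun y => dn p y * G p a b y)) x = 0.
Proof.
pose F x := \sum_a \sum_b partial b (partial a (fun y => dn p y * G p a b y)) x.
have sw a b : smooth_on (U p) (fun y => dn p y * G p a b y) by exact: smooth_mul (oU p) (@sdn p) (sG p a b).
have sF : smooth_on (U p) F.
 apply: smooth_sum (oU p) _ => a _; apply: smooth_sum (oU p) _ => b _.
 by do 2 apply: smooth_partial; exact: sw.
apply: (av_test sF (@bl_open _ _ _ K p)) => // phi lp _.
have t1 a b : lt p (fun x => G p a b x * partial a (partial b phi) x).
 by apply: lt_scale => //; do 2 apply: lt_part.
have lphi : lt p (fun x => \sum_a \sum_b G p a b x * partial a (partial b phi) x).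
 split; first by apply: smooth_sum (oU p) _ => a _; apply: smooth_sum (oU p) _ => b _; have [] := t1 a b.
 by move=> z nz; rewrite big1 // => a _; rewrite big1 // => b _; have [_ ->] := t1 a b.
have e0 : av p (fun x => dn p x * \sum_a \sum_b G p a b x * partial a (partial b phi) x) = 0.
 rewrite -(dn_int lphi) -[RHS](mul (ext_smooth hM (lt_tsp lp))) (lap_ext hM (lt_tsp lp)); congr mu.
 apply/funext => r; rewrite /ext0; case: ifP => // /asboolP d.
 by rewrite (laplacian_patch lp.1 (U_crd d)).
have ibp a b : av p (fun x => dn p x * G p a b x * partial a (partial b phi) x) =
  av p (fun x => partial b (partial a (fun y => dn p y * G p a b y)) x * phi x).
 have sab := sw a b; have lb := lt_part b lp.
 have l1 : lt p (fun x => dn p x * G p a b x * partial b phi x) by exact: lt_scale.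
 have l2 : lt p (fun x => partial a (fun y => dn p y * G p a b y) x * phi x).
  by apply: lt_scale => //; exact: smooth_partial.
 have E1 : av p (fun x => partial a (fun y => dn p y * G p a b y) x * partial b phi x) + av p (fun x => dn p x * G p a b x * partial a (partial b phi) x) = 0.
  rewrite -[RHS](av_partial a l1) -avD; last 2 first.
  - exact: smooth_mul (oU p) (smooth_partial a sab) lb.1.
  - exact: smooth_mul (oU p) sab (lt_part a lb).1.
  apply: (avg_ext (side_gt0 K p)) => z /cube_U Uz.
  by rewrite (smooth_partialM a sab lb.1 Uz).
 have E2 : av p (fun x => partial b (partial a (fun y => dn p y * G p a b y)) x * phi x) + av p (fun x => partial a (fun y => dn p y * G p a b y) x * partial b phi x) = 0.
  rewrite -[RHS](av_partial b l2) -avD; last 2 first.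
  - exact: smooth_mul (oU p) (smooth_partial b (smooth_partial a sab)) lp.1.
  - exact: smooth_mul (oU p) (smooth_partial a sab) lb.1.
  apply: (avg_ext (side_gt0 K p)) => z /cube_U Uz.
  by rewrite (smooth_partialM b (smooth_partial a sab) lp.1 Uz).
 move: E1 E2; move: (av p _) (av p _) (av p _) => u v z; lra.
rewrite -[RHS]e0 (avg_ext (side_gt0 K p) (g := fun x => \sum_a \sum_b partial b (partial a (fun y => dn p y * G p a b y)) x * phi x)); last first.
 by move=> z _; rewrite mulr_suml; apply: eq_bigr => a _; rewrite mulr_suml.
rewrite (avg_ext (side_gt0 K p) (f := fun x => dn p x * _) (g := fun x => \sum_a \sum_b dn p x * G p a b x * partial a (partial b phi) x)); last first.
 by move=> z _; rewrite mulr_sumr; apply: eq_bigr => a _; rewrite mulr_sumr; apply: eq_bigr => b _; rewrite mulrA.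
have b1 a b : bdq (corner K p) (side K p) (fun x => partial b (partial a (fun y => dn p y * G p a b y)) x * phi x).
 apply: bdp; apply: smooth_mul (oU p) _ lp.1; do 2 apply: smooth_partial; exact: sw.
have b2 a b : bdq (corner K p) (side K p) (fun x => dn p x * G p a b x * partial a (partial b phi) x).
 apply: bdp; apply: smooth_mul (oU p) (sw a b) _; do 2 apply: smooth_partial; exact: lp.1.
rewrite !(avg_sum (side_gt0 K p)); last 2 first.
- by move=> a; apply: bdq_sum => b.
- by move=> a; apply: bdq_sum => b.
apply: eq_bigr => a _; rewrite !(avg_sum (side_gt0 K p)) //.
by apply: eq_bigr => b _; rewrite ibp.
Qed.

(** Lower-order coefficients of the adjoint operator, obtained by expanding the double divergence of
    [dn_adjoint] with the Leibniz rule. *)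
Definition dnB p a x := \sum_b (partial b (G p a b) x + partial b (G p b a) x).
Definition dnC p x := \sum_a \sum_b partial b (partial a (G p a b)) x.

Lemma dn_lin p x : bl p x -> lin_op (G p) (dnB p) (dnC p) (dn p) x = 0.
Proof.
move=> bx; have Ux := bl_U bx; rewrite -[RHS](dn_adjoint bx) /lin_op /dnC mulr_suml.
have e a b : partial b (partial a (fun y => dn p y * G p a b y)) x =
 G p a b x * partial a (partial b (dn p)) x + partial b (G p a b) x * partial a (dn p) x
 + partial a (G p a b) x * partial b (dn p) x + partial b (partial a (G p a b)) x * dn p x.
 have sp i := smooth_partial i (@sdn p); have sg i := smooth_partial i (sG p a b).
 rewrite (partial_ext b (oU p) Ux (fun y Uy => smooth_partialM a (@sdn p) (sG p a b) Uy)).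
 rewrite (smooth_partialD b (smooth_mul (oU p) (sp a) (sG p a b)) (smooth_mul (oU p) (@sdn p) (sg a)) Ux).
 rewrite (smooth_partialM b (sp a) (sG p a b) Ux) (smooth_partialM b (@sdn p) (sg a) Ux).
 rewrite (partialC b a (oU p) Ux (@sdn p)).
 have comb (P g A Gb B Ga w H : R) : P * g + A * Gb + (B * Ga + w * H) = g * P + Gb * A + Ga * B + H * w by ring.
 exact: comb.
have -> : \sum_a dnB p a x * partial a (dn p) x = \sum_a \sum_b (partial b (G p a b) x * partial a (dn p) x + partial a (G p a b) x * partial b (dn p) x).
 transitivity (\sum_a \sum_b (partial b (G p a b) x * partial a (dn p) x) + \sum_a \sum_b (partial b (G p b a) x * partial a (dn p) x)).
  rewrite -big_split; apply: eq_bigr => a _; rewrite -big_split /dnB mulr_suml; apply: eq_bigr => b _; exact: mulrDl.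
 rewrite [X in _ + X]exchange_big -big_split; apply: eq_bigr => a _; by rewrite -big_split.
rewrite -!big_split; apply: eq_bigr => a _ /=; rewrite mulr_suml -!big_split; apply: eq_bigr => b _ /=.
exact: etrans (congr1 (fun t => t + _) (addrA _ _ _)) (esym (e a b)).
Qed.

(** Size 1/64 is dictated by [dn_hopf] and the factor 2 of [sqn_triangle]: two points of this ball
    have squared distance below 1/16, and the ball of that size around either of them stays inside
    the one of size 1/4. *)
Definition tballK p := [set x | sq K p x < rd K p ^+ 2 / 64].
Local Notation tb := tballK.

Lemma tb_bl p : tb p `<=` bl p.
Proof.
move=> x h; have := exprn_gt0 2 (rd_gt0 K p); move: h; rewrite /tb /ballK /=; move: (sq K p x) (rd K p ^+ 2) => u v; lra.
Qed.

Lemma tb_open p : open (tb p).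
Proof. exact: (open_comp (fun x _ => @cont_sqnB _ _ (crd p p) x) (@open_lt R (rd K p ^+ 2 / 64))). Qed.

Lemma tb_center p : tb p (crd p p).
Proof. by rewrite /tb /= /sq sqnxx divr_gt0 // exprn_gt0 // rd_gt0. Qed.

Lemma dn_hopf p x0 x1 : tb p x0 -> tb p x1 -> 0 < dn p x0 -> 0 < dn p x1.
Proof.
move=> t0 t1 w0; have sb : bl p `<=` U p by exact: bl_U.
have sGb a b : smooth_on (bl p) (G p a b) by exact: smooth_sub sb (sG p a b).
have pG x (v : 'rV[R]_m) : bl p x -> v != 0 -> 0 < \sum_a \sum_b G p a b x * v 0 a * v 0 b.
 move=> /sb Ux v0; have := @invmx_pos _ _ (gmx K p x) (gmx_sym Ux) (gmx_hermitian Ux) (fun v => gmx_pos Ux) v v0.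
 rewrite mxE; under eq_bigr do rewrite !mxE mulr_suml.
 rewrite exchange_big /= => h; apply: (lt_le_trans h); rewrite le_eqVlt; apply/orP; left; apply/eqP.
 by apply: eq_bigr => a _; apply: eq_bigr => b _; rewrite [v 0 a * _]mulrC.
have nG x (D : 'I_m -> 'I_m -> R) : bl p x -> (forall v : 'rV[R]_m, \sum_a \sum_b v 0 a * v 0 b * D a b <= 0) ->
  \sum_a \sum_b G p a b x * D a b <= 0.
 move=> /sb Ux HD; pose E : 'M[R]_m := \matrix_(b, a) D a b.
 have -> : \sum_a \sum_b G p a b x * D a b = \tr (invmx (gmx K p x) *m E).
  by rewrite /mxtrace; apply: eq_bigr => a _; rewrite mxE; apply: eq_bigr => b _; rewrite !mxE.
 apply: trace_inv_le0; [exact: gmx_sym|exact: gmx_hermitian|by move=> v; exact: gmx_pos|].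
 move=> v; apply: le_trans (HD v).
 rewrite le_eqVlt; apply/orP; left; apply/eqP; rewrite mxE; apply: eq_bigr => a _.
 rewrite mxE mxE mulr_suml; apply: eq_bigr => b _; rewrite mxE; ring.
have sB a : smooth_on (bl p) (dnB p a).
 apply: smooth_sub sb _; apply: smooth_sum (oU p) _ => b _; apply: smooth_add (oU p) _ _; apply: smooth_partial; exact: sG.
have sC : smooth_on (bl p) (dnC p).
 apply: smooth_sub sb _; apply: smooth_sum (oU p) _ => a _; apply: smooth_sum (oU p) _ => b _; do 2 apply: smooth_partial; exact: sG.
have sw : smooth_on (bl p) (dn p) by exact: smooth_sub (@subsetT _ _) (dn_smooth p).
apply: (hopf (@bl_open _ _ _ K p) sGb sB sC pG nG sw (@dn_ge0 p) (@dn_lin p) (c0 := x0) (D := rd K p ^+ 2 / 16) _ w0).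
- move=> x /= h; rewrite /ballK /=; move: t0; rewrite /tb /sq /= => t0.
 apply: le_lt_trans (sqn_triangle x x0 _) _.
 have := exprn_gt0 2 (rd_gt0 K p); move: h t0; move: (sqn _) (sqn _) (rd K p ^+ 2) => u v z; lra.
- apply: le_lt_trans (sqn_triangle x1 (crd p p) x0) _; rewrite [sqn (crd p p - x0)]sqnC.
 move: t0 t1; rewrite /tb /sq /=; move: (sqn _) (sqn _) (rd K p ^+ 2) => u v z; lra.
Qed.

(* The open set on which the mean vanishes is also closed, hence empty. *)
Definition null r := exists O : set M, [/\ open O, O r & forall f, smooth K f -> (forall s, ~ O s -> f s = 0) -> mu f = 0].

Definition nb p := [set s | dom (ch p) s /\ tb p (crd p s)].

Lemma nb_open p : open (nb p).
Proof.
rewrite openE => s [d t]; apply: filterI; first by apply: open_nbhs_nbhs; split; [exact: dom_open|].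
by apply: (coord_cont d); apply: open_nbhs_nbhs; split; [exact: tb_open|].
Qed.

Lemma nb_center p : nb p p. Proof. by split; [exact: chart_at_dom|exact: tb_center]. Qed.

Lemma null_dn p s : nb p s -> null s -> dn p (crd p s) = 0.
Proof.
move=> [d t] [W [oW0 Ws H]].
have oW : open (tb p `&` (U p `&` coordV (ch p) @^-1` W)).
 apply: openI; first exact: tb_open.
 rewrite openE => y [Uy Oy]; apply: filterI; first by apply: open_nbhs_nbhs; split; [exact: U_open|].
 by apply: (coordV_cont Uy); exact: open_nbhs_nbhs.
apply: (av_test (@sdn p) oW _ _) => [x [/tb_bl]//|phi lp off|]; last first.
 by split=> //; split; [exact: U_crd|rewrite /= coordK].
rewrite -(dn_int lp); apply: H; first by apply: ext_smooth => //; exact: lt_tsp.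
move=> r nO; rewrite /ext0; case: ifP => // /asboolP dr; apply: off => -[_ [_ /=]].
by rewrite coordK.
Qed.

Lemma dn_null p : dn p (crd p p) = 0 -> null p.
Proof.
move=> w0; have z x : tb p x -> dn p x = 0.
 move=> tx; apply/eqP; rewrite eq_le dn_ge0 ?andbT; last exact: tb_bl.
 rewrite leNgt; apply/negP => /(dn_hopf tx (@tb_center p)); by rewrite w0 ltxx.
exists (nb p); split; [exact: nb_open|exact: nb_center|move=> f sf off].
pose phi x := if `[< tb p x >] then loc p f x else 0.
have E x : U p x -> loc p f x = phi x.
 move=> Ux; rewrite /phi; case: ifP => // /asboolP nt; apply: off => -[_].
 by have [-> _] := coordVK Ux.
have lp : lt p phi.
 split; first by apply: smooth_ext (oU p) E _; exact: sf.
 by move=> x nc; rewrite /phi asboolF // => /tb_bl/bl_cl.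
have -> : f = ext p phi.
 apply/funext => r; rewrite /ext0; case: ifP => [/asboolP d|/asboolP nd]; last by apply: off => -[].
 by rewrite -E ?loc_crd //; exact: U_crd.
rewrite (dn_int lp) -(avg_cst (corner K p) (side K p) 0); apply: (avg_ext (side_gt0 K p)) => x _.
by rewrite /phi; case: ifP => [/asboolP /z ->|_]; rewrite ?mul0r ?mulr0.
Qed.

Lemma null_empty r : ~ null r.
Proof.
move=> nr; have all : null = [set: M].
 apply: hC; first by exists r.
 - exists null; last by rewrite setTI.
  rewrite openE => s [W [oW0 Ws H]]; apply: filterS (open_nbhs_nbhs (conj oW0 Ws)) => t Wt; by exists W.
 - exists null; last by rewrite setTI.
  move=> s cs; have [z [nz nbz]] := cs _ (open_nbhs_nbhs (conj (@nb_open s) (@nb_center s))).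
  apply: dn_null; apply/eqP; rewrite eq_le dn_ge0 ?andbT; last exact: tb_bl (@tb_center s).
  rewrite leNgt; apply/negP => /(dn_hopf (@tb_center s) nbz.2); by rewrite (null_dn nbz nz) ltxx.
have nl s : exists O : set M, [/\ open O, O s & forall f, smooth K f -> (forall s, ~ O s -> f s = 0) -> mu f = 0].
 by have : [set: M] s by []; rewrite -all.
pose O s := projT1 (cid (nl s)).
have HO s : [/\ open (O s), O s s & forall f, smooth K f -> (forall t, ~ O s t -> f t = 0) -> mu f = 0] by rewrite /O; case: cid.
(* If every point were null, a partition of unity would give mean 0 to the constant 1. *)
have := @patch_ind R n M K hM hK O (fun f => mu f = 0) _ _ _ _ _ (fun=> 1) (sm_cst K 1).
rewrite mu1 => /(_ _ _ _ _ _)/eqP; rewrite oner_eq0 => H; apply: (Bool.diff_false_true); apply: H.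
- by move=> s; have [] := HO s.
- by move=> s; have [] := HO s.
- by have := muZ 0 (sm_cst K 1); rewrite !mul0r.
- by move=> f g sf sg f0 g0; rewrite muD // f0 g0 addr0.
- move=> s phi lp off; have [_ _] := HO s; apply=> //; apply: ext_smooth => //; exact: lt_tsp.
Qed.

Lemma dn_pos p x : tb p x -> 0 < dn p x.
Proof.
move=> tx; rewrite lt0r dn_ge0 ?andbT; last exact: tb_bl.
apply/eqP => w0; apply: (@null_empty p); apply: dn_null; apply/eqP.
rewrite eq_le dn_ge0 ?andbT; last exact: tb_bl (@tb_center p).
by rewrite leNgt; apply/negP => /(dn_hopf (@tb_center p) tx); rewrite w0 ltxx.
Qed.

(** Multiplied by a small bump the function still has mean 0, and in the chart this mean is an
    average against the positive density, to which [avg_pos] applies. *)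
Lemma mean_pos f : smooth K f -> (forall r, 0 <= f r) -> mu f = 0 -> forall r, f r = 0.
Proof.
move=> sf f0 mf r; apply/eqP; apply: contraT => fr.
have Ur := U_crd (chart_at_dom K r).
have [t t0 tW] := sqn_ball (@tb_open r) (@tb_center r).
have lb : lt r (bmp (crd r r) t).
 split; first exact: bmp_smooth (oU r).
 by move=> y nb'; apply: bmp_off; rewrite leNgt; apply/negP => /tW/tb_bl/bl_cl.
have lp : lt r (fun x => loc r f x * bmp (crd r r) t x) by apply: lt_scale => //; exact: sf.
have sb := ext_smooth hM (lt_tsp lb).
have E : ext r (fun x => loc r f x * bmp (crd r r) t x) = (fun s => f s * ext r (bmp (crd r r) t) s).
 by apply/funext => s; rewrite /ext0; case: ifP => [/asboolP d|_]; rewrite ?mulr0 // loc_crd.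
have b01 s : 0 <= ext r (bmp (crd r r) t) s <= 1.
 by rewrite /ext0; case: ifP => _; rewrite ?lexx ?ler01 // bump_ge0 bump_le1.
have e0 : mu (fun s => f s * ext r (bmp (crd r r) t) s) = 0.
 apply/eqP; rewrite eq_le; apply/andP; split; last first.
  by apply: mup => [|s]; [exact: sm_mul|rewrite mulr_ge0 //; case/andP: (b01 s)].
 have s1 := sm_mul sf sb.
 have := mup (sm_add sf (sm_scale (-1) s1)); rewrite (muD sf (sm_scale (-1) s1)) (muZ _ s1) mf add0r mulN1r oppr_ge0; apply=> s.
 case/andP: (b01 s) (f0 s); move: (f s) (ext _ _ _) => u v; nra.
have sw : smooth_on (U r) (fun x => dn r x * (loc r f x * bmp (crd r r) t x)) by exact: smooth_mul (oU r) (@sdn r) lp.1.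
have b0 : bdy0 (corner K r) (side K r) (fun x => dn r x * (loc r f x * bmp (crd r r) t x)).
 by apply: lt_bdy => y nc; rewrite lp.2 // mulr0.
have zs y : Q r y -> 0 <= dn r y * (loc r f y * bmp (crd r r) t y).
 move=> _; have [h|h] := ltP (sqn (y - crd r r)) t; last by rewrite bmp_off // !mulr0.
 apply: mulr_ge0; first exact: dn_ge0 (tb_bl (tW y h)).
 by apply: mulr_ge0 (bump_ge0 _); exact: f0.
have e1 : av r (fun x => dn r x * (loc r f x * bmp (crd r r) t x)) = 0 by rewrite -(dn_int lp) E.
have := avg_pos (side_gt0 K r) (fun y Qy => smooth_cont sw (cube_U Qy)) b0 zs e1 (cb_cube (bl_cb (@bl_center _ _ _ K r))).
move/eqP; rewrite mulf_eq0 (gt_eqF (dn_pos (@tb_center r))) /= mulf_eq0 loc_crd ?(negbTE fr); last exact: chart_at_dom.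
by rewrite /= gt_eqF // bmp_pos // sqnxx.
Qed.

End MeanDensity.

(** * Green's formula *)

Section LogDensity.
Context {R : realType} {n : nat} {M : topologicalType}.
Variable K : kahler R n M.
Hypothesis hM : hausdorff_space M.
Hypothesis hK : compact [set: M].
Hypothesis hC : connected [set: M].
Local Notation m := (n + n)%N.
Local Notation J := (Jmx n : 'M[R]_m).
Local Notation ch := (chart_at K).
Local Notation U p := (img (ch p)).
Local Notation crd p r := (Defs.coord (ch p) r).
Local Notation crv p x := (coordV (ch p) x).
Local Notation loc := (loc_fun K).
Local Notation ext := (ext0 K).
Local Notation lapM := (laplaceM K).
Local Notation ipM := (gradM K).
Local Notation oU p := (@U_open _ _ _ K p).
Local Notation Q p := (cube (corner K p) (side K p)).
Local Notation av p := (avg (corner K p) (side K p)).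
Local Notation bl := (ballK K).
Local Notation cl := (cballK K).
Local Notation lt p := (tst (U p) (cl p)).
Local Notation g p := (gmx K p).
Local Notation ig p x := (invmx (gmx K p x)).
Variable mu : (M -> R) -> R.
Hypothesis mmu : mean K mu.
Local Notation dn := (dn hM mmu).

Let muD f g : smooth K f -> smooth K g -> mu (fun t => f t + g t) = mu f + mu g.
Proof. by have [H _ _ _ _] := mmu; exact: H. Qed.
Let muZ (c : R) f : smooth K f -> mu (fun t => c * f t) = c * mu f.
Proof. by have [_ H _ _ _] := mmu; exact: H. Qed.
Let mul h : smooth K h -> mu (lapM h) = 0.
Proof. by have [_ _ _ _ H] := mmu; exact: H. Qed.
Let sdn p : smooth_on (U p) (dn p). Proof. exact: smooth_sub (@subsetT _ _) (dn_smooth hM mmu p). Qed.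
Let sgx p := gx_smx K p.
Let gTx p : forall x, U p x -> (g p x)^T = g p x. Proof. exact: gmx_sym. Qed.
Let ugx p : forall x, U p x -> g p x \in unitmx. Proof. exact: gx_unit. Qed.
Let sigx p : smx (U p) (fun x => ig p x). Proof. exact: (smx_inv (oU p) (@ugx p) (@sgx p)). Qed.

Lemma smooth_pair (V : set 'rV[R]_m) (F H : 'rV[R]_m -> 'rV[R]_m) : open V -> smx V F -> smx V H ->
 smooth_on V (fun x => (F x *m (H x)^T) 0 0).
Proof.
move=> oV sF sH; apply: (smooth_ext oV (f := fun x => \sum_a F x 0 a * H x 0 a)) => [x _|].
 by rewrite mxE; apply: eq_bigr => a _; rewrite mxE.
by apply: smooth_sum => // a _; exact: smooth_mul oV (sF 0 a) (sH 0 a).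
Qed.

(** The contracted Christoffel symbols, that is, the logarithmic differential of the Riemannian
    volume density. *)
Definition Ga p x : 'rV[R]_m := \row_a \tr (Cm (g p) a x).

Lemma smx_Ga p : smx (U p) (Ga p).
Proof.
move=> i a; apply: (smooth_ext (oU p)) (smx_trace (oU p) (smx_Cm (oU p) (@sgx p) (@ugx p) a)) => x Ux.
by rewrite mxE.
Qed.

Lemma divg_flat p W x : U p x -> divg (g p) W x = \sum_a partial a (fun y => W y 0 a) x + \sum_a W x 0 a * Ga p x 0 a.
Proof.
move=> Ux; rewrite /divg -[RHS]addr0 -[LHS]addr0; congr (_ + _).
transitivity (\sum_a partial a (fun y => W y 0 a) x + \sum_c \sum_b W x 0 b * Cm (g p) c x b c).
 by rewrite -big_split; apply: eq_bigr => c _; rewrite mxE mxE [X in _ + X]mxE.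
congr (_ + _); rewrite exchange_big; apply: eq_bigr => b _; rewrite [Ga p x 0 b]mxE -mulr_sumr; congr (_ * _).
apply: eq_bigr => c _; exact: (Cm_sym (oU p) (@gTx p) c b c Ux).
Qed.

(** [dn] times the covector [theta]. Without the division it is smooth on the whole chart, also
    where positivity of [dn] has not been established. *)
Definition kap p x : 'rV[R]_m := grad (dn p) x - dn p x *: Ga p x.

Lemma smx_kap p : smx (U p) (kap p).
Proof.
move=> i a; rewrite (_ : (fun x => kap p x i a) = (fun x => partial a (dn p) x - dn p x * Ga p x 0 a)).
 apply: (smooth_subr (oU p)); first exact: smooth_partial.
 exact: smooth_mul (oU p) (@sdn p) (@smx_Ga p 0 a).
by apply/funext => x; rewrite ord1 !mxE.
Qed.

Lemma lt_divg p W : smx (U p) W -> (forall x, ~ cl p x -> W x = 0) -> exists2 phi, lt p phi & forall x, U p x -> divg (g p) W x = phi x.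
Proof.
move=> sW W0; have lW a : lt p (fun x => W x 0 a).
 by split; [exact: sW|move=> x nc; rewrite W0 // mxE].
exists (fun x => \sum_a partial a (fun y => W y 0 a) x + \sum_a W x 0 a * Ga p x 0 a); last by move=> x Ux; rewrite divg_flat.
split=> [|x nc].
 apply: (smooth_add (oU p)); first by apply: smooth_sum (oU p) _ => a _; exact: smooth_partial.
 by apply: smooth_sum (oU p) _ => a _; exact: smooth_mul (oU p) (sW 0 a) (@smx_Ga p 0 a).
rewrite !big1 ?addr0 // => a _; first by rewrite W0 // mxE mul0r.
by have [_ ->] := tst_partial (@cl_closed _ _ _ K p) a (lW a).
Qed.

Lemma stokes_dn p W : smx (U p) W -> (forall x, ~ cl p x -> W x = 0) ->
 av p (fun x => dn p x * divg (g p) W x) = - av p (fun x => (W x *m (kap p x)^T) 0 0).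
Proof.
move=> sW W0; have lW a : lt p (fun x => dn p x * W x 0 a).
 by split; [exact: smooth_mul (oU p) (@sdn p) (sW 0 a)|move=> x nc; rewrite W0 // mxE mulr0].
have sk : smooth_on (U p) (fun x => (W x *m (kap p x)^T) 0 0).
 exact: (smooth_pair (oU p) sW (@smx_kap p)).
have L := side_gt0 K p.
have sl a : smooth_on (U p) (partial a (fun x => dn p x * W x 0 a)) by apply: smooth_partial; exact: (lW a).1.
have E x : Q p x -> dn p x * divg (g p) W x = \sum_a partial a (fun x => dn p x * W x 0 a) x + -1 * (W x *m (kap p x)^T) 0 0.
 move=> /cube_U Ux; rewrite divg_flat // mulrDr !mulr_sumr [(_ *m _) 0 0]mxE mulr_sumr -!big_split.
 apply: eq_bigr => a _ /=; rewrite (smooth_partialM a (@sdn p) (sW 0 a) Ux) /kap !mxE.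
 move: (partial a _ x) (partial a _ x) (\tr _) (W x 0 a) (dn p x) => *; ring.
rewrite (avg_ext L E) (avgD L); last 2 first.
- apply: bdq_sum => a; exact: lt_bdq.
- by apply: lt_bdq; exact: (smooth_scale _ (oU p) sk).
rewrite (avgZ L) ?mulN1r; last exact: lt_bdq.
rewrite (avg_sum L) ?big1 ?add0r // => a; first by move=> _; exact: av_partial.
exact: lt_bdq.
Qed.

Lemma mean_divg p W : smx (U p) W -> (forall x, ~ cl p x -> W x = 0) ->
 mu (ext p (divg (g p) W)) = - av p (fun x => (W x *m (kap p x)^T) 0 0).
Proof.
move=> sW W0; rewrite -stokes_dn //; have [phi lp E] := lt_divg sW W0.
have -> : ext p (divg (g p) W) = ext p phi.
 by apply/funext => r; rewrite /ext0; case: ifP => // /asboolP d; rewrite E //; exact: U_crd.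
rewrite dn_int //; apply: (avg_ext (side_gt0 K p)) => x /cube_U Ux; by rewrite E.
Qed.

(** The mean annihilates Laplacians; after one integration by parts this says that [kap], with its
    index raised, is weakly divergence-free, and [av_test] makes it pointwise. *)
Lemma kap_div p x : bl p x -> \sum_a partial a (fun y => (kap p y *m ig p y) 0 a) x = 0.
Proof.
pose Y y := kap p y *m ig p y.
have sY a : smooth_on (U p) (fun y => Y y 0 a) by exact: (smxM (oU p) (@smx_kap p) (@sigx p) 0 a).
have sF : smooth_on (U p) (fun x => \sum_a partial a (fun y => Y y 0 a) x).
 by apply: smooth_sum (oU p) _ => a _; exact: smooth_partial.
apply: (av_test sF (@bl_open _ _ _ K p)) => // phi lp _.
have lg a : lt p (partial a phi) by exact: (tst_partial (@cl_closed _ _ _ K p) a lp).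
have sg : smx (U p) (shp (g p) (grad phi)).
 have sgr : smx (U p) (grad phi).
  by move=> i a; apply: (smooth_ext (oU p)) (smooth_partial a lp.1) => z _; rewrite mxE.
 exact: (smx_shp (oU p) (@sgx p) (@ugx p) sgr).
have g0 z : ~ cl p z -> shp (g p) (grad phi) z = 0.
 move=> nc; rewrite /shp (_ : grad phi z = 0) ?mul0mx //; apply/rowP => a.
 by rewrite !mxE (lg a).2.
have L := side_gt0 K p.
have e0 : av p (fun x => (shp (g p) (grad phi) x *m (kap p x)^T) 0 0) = 0.
 apply: oppr_inj; rewrite -mean_divg // oppr0 -[RHS](mul (ext_smooth hM (lt_tsp lp))) (lap_ext hM (lt_tsp lp)).
 congr mu; apply/funext => r; rewrite /ext0; case: ifP => // /asboolP d.
 by rewrite (laplacianE (oU p) (@sgx p) (@gTx p) (@ugx p) lp.1 (U_crd d)).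
have lY a : lt p (fun x => Y x 0 a * phi x).
 by split; [exact: smooth_mul (oU p) (sY a) lp.1|move=> z nc; rewrite lp.2 // mulr0].
have E z : Q p z -> (\sum_a partial a (fun y => Y y 0 a) z) * phi z =
  \sum_a partial a (fun w => Y w 0 a * phi w) z + -1 * (shp (g p) (grad phi) z *m (kap p z)^T) 0 0.
 move=> /cube_U Uz.
 have -> : (shp (g p) (grad phi) z *m (kap p z)^T) 0 0 = \sum_a Y z 0 a * partial a phi z.
  have t1 (A : 'M[R]_1) : A 0 0 = A^T 0 0 by rewrite mxE.
  rewrite t1 /shp !trmx_mul trmxK (igT (@gTx p) Uz) mulmxA mxE; apply: eq_bigr => a _.
  by rewrite [X in _ * X]mxE [X in _ * X]mxE.
 rewrite mulr_suml mulr_sumr -big_split; apply: eq_bigr => a _ /=.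
 rewrite (smooth_partialM a (sY a) lp.1 Uz).
 move: (partial a _ z) (partial a _ z) (Y z 0 a) (phi z) => *; ring.
rewrite (avg_ext L E) (avgD L); last 2 first.
- apply: bdq_sum => a; apply: lt_bdq; apply: smooth_partial; exact: (lY a).1.
- apply: lt_bdq; apply: smooth_scale (oU p) _; exact: (smooth_pair (oU p) sg (@smx_kap p)).
rewrite (avgZ L) ?e0 ?mulr0 ?addr0; last by apply: lt_bdq; exact: (smooth_pair (oU p) sg (@smx_kap p)).
rewrite (avg_sum L) ?big1 // => a; first by move=> _; exact: av_partial.
apply: lt_bdq; apply: smooth_partial; exact: (lY a).1.
Qed.

Local Notation tb := (tballK K).
Definition theta p x : 'rV[R]_m := (dn p x)^-1 *: kap p x.

Let tbU p : tb p `<=` U p. Proof. by move=> x /tb_bl; exact: bl_U. Qed.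
Let dn0 p x : tb p x -> dn p x != 0. Proof. by move=> t; rewrite gt_eqF // dn_pos. Qed.

Lemma th_coord p x a : tb p x -> theta p x 0 a = (dn p x)^-1 * partial a (dn p) x - Ga p x 0 a.
Proof. by move=> t; rewrite /theta /kap !mxE mulrBr mulrA mulVf ?mul1r //; exact: dn0. Qed.

Lemma smx_th p : smx (tb p) (theta p).
Proof.
move=> i a; rewrite (_ : (fun x => theta p x i a) = (fun x => (dn p x)^-1 * kap p x i a)); last by apply/funext => x; rewrite mxE.
apply: smooth_mul; [exact: tb_open| |exact: smooth_sub (@tbU p) (@smx_kap p i a)].
apply: smooth_inv; [exact: tb_open|exact: dn0|exact: smooth_sub (@tbU p) (@sdn p)].
Qed.

(** [Ga] is the differential of $\frac12\log\det g$. Closedness is read off from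
    $\frac12\mathrm{tr}(g^{-1}\partial g)$ directly, which avoids differentiating the
    determinant. *)
Lemma Ga_closed p a b x : U p x -> partial a (fun y => Ga p y 0 b) x = partial b (fun y => Ga p y 0 a) x.
Proof.
move=> Ux; have E c y : U p y -> Ga p y 0 c = 2^-1 * \tr (ig p y *m pmx c (g p) y).
 move=> Uy; rewrite mxE (pmx_g (oU p) (@gTx p) (@ugx p) c Uy) mulmxDr mxtraceD mulmxA mxtrace_mulC mulmxA.
 rewrite mulmxV ?ugx // mul1mx [ig p y *m (_ *m _)]mulmxA mulVmx ?ugx // mul1mx mxtrace_tr.
 by move: (\tr _) => t; lra.
have sp c := smx_pmx (oU p) c (@sgx p).
have F c d : partial c (fun y => Ga p y 0 d) x =
  2^-1 * \tr (- (ig p x *m pmx c (g p) x *m ig p x) *m pmx d (g p) x + ig p x *m pmx c (pmx d (g p)) x).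
 have sM : smx (U p) (fun y => ig p y *m pmx d (g p) y) by exact: (smxM (oU p) (@sigx p) (sp d)).
 rewrite (partial_ext c (oU p) Ux (E d)) (partialZ _ (smooth_derivable (smx_trace (oU p) sM) Ux)).
 rewrite (partial_tr c sM Ux) (pmxM (oU p) c (@sigx p) (sp d) Ux) (pmx_inv (oU p) c (@ugx p) (@sgx p) Ux) //.
have comb (G A B N N' : 'M[R]_m) : N = N' ->
  2^-1 * \tr (- (G *m A *m G) *m B + G *m N) = 2^-1 * \tr (- (G *m B *m G) *m A + G *m N').
 move=> ->; rewrite !mxtraceD !mulNmx !raddfN /=; congr (_ * (- _ + _)).
 by rewrite -!mulmxA [LHS]mxtrace_mulC -!mulmxA [LHS]mxtrace_mulC -!mulmxA.
exact: etrans (F a b) (etrans (comb _ _ _ _ _ (pmxC (oU p) a b (@sgx p) Ux)) (esym (F b a))).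
Qed.

Lemma th_clsd p : clsd (tb p) (theta p).
Proof.
split; first exact: smx_th.
move=> x tx; apply/matrixP => a b; rewrite !mxE; have Ux := tbU tx.
have oT := @tb_open _ _ _ K p.
have sG c := smooth_sub (@tbU p) (@smx_Ga p 0 c).
have sd := smooth_sub (@tbU p) (@sdn p).
have si : smooth_on (tb p) (fun y => (dn p y)^-1) by apply: smooth_inv oT (@dn0 p) sd.
have F c d : partial c (fun y => theta p y 0 d) x =
  - (dn p x)^-1 ^+ 2 * partial c (dn p) x * partial d (dn p) x + (dn p x)^-1 * partial c (partial d (dn p)) x - partial c (fun y => Ga p y 0 d) x.
 rewrite (partial_ext c oT tx (fun y ty => th_coord d ty)).
 rewrite (smooth_partialB c (smooth_mul oT si (smooth_partial d sd)) (sG d) tx).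
 rewrite (smooth_partialM c si (smooth_partial d sd) tx).
 rewrite (partial_comp1 (is_derive_invr (dn0 tx)) (smooth_derivable sd tx)); congr (_ + _ - _).
have comb (c s1 s2 q q' t t' : R) : q = q' -> t = t' -> - c ^+ 2 * s1 * s2 + c * q - t = - c ^+ 2 * s2 * s1 + c * q' - t'.
 by move=> -> ->; ring.
exact: etrans (F b a) (etrans (comb _ _ _ _ _ _ _ (partialC b a (oU p) Ux (@sdn p)) (Ga_closed b a Ux)) (esym (F a b))).
Qed.

(** Insert $\kappa=w\,\theta$, with $w$ the density, into [kap_div] and divide by $w$; the
    derivative of $w$ combines with [Ga] into $|\theta|^2$. *)
Lemma th_div p x : tb p x -> divg (g p) (shp (g p) (theta p)) x = - nrm2 (g p) (theta p) x.
Proof.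
move=> tx; have Ux := tbU tx; have oT := @tb_open _ _ _ K p.
have sX a : smooth_on (tb p) (fun y => shp (g p) (theta p) y 0 a).
 apply: (smxM oT (@smx_th p) _ 0 a) => i j; exact: smooth_sub (@tbU p) (@sigx p i j).
have sd := smooth_sub (@tbU p) (@sdn p).
have E a y : tb p y -> (kap p y *m ig p y) 0 a = dn p y * shp (g p) (theta p) y 0 a.
 by move=> ty; rewrite /shp /theta -scalemxAl [X in _ = _ * X]mxE mulrA mulfV ?mul1r //; exact: dn0.
have := kap_div (tb_bl tx).
under eq_bigr do rewrite (partial_ext _ oT tx (E _)) (smooth_partialM _ sd (sX _) tx).
rewrite big_split -mulr_sumr divg_flat //.
have -> : nrm2 (g p) (theta p) x = \sum_a shp (g p) (theta p) x 0 a * ((dn p x)^-1 * partial a (dn p) x) - \sum_a shp (g p) (theta p) x 0 a * Ga p x 0 a.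
 by rewrite /nrm2 mxE -sumrB; apply: eq_bigr => a _; rewrite [_^T _ _]mxE th_coord // mulrBr.
move=> /= h; have d0 := dn0 tx.
have -> : \sum_a shp (g p) (theta p) x 0 a * ((dn p x)^-1 * partial a (dn p) x) = (dn p x)^-1 * \sum_a partial a (dn p) x * shp (g p) (theta p) x 0 a.
 by rewrite mulr_sumr; apply: eq_bigr => a _; rewrite mulrCA [X in _ * X]mulrC.
move: h; move: (\sum_a _) (\sum_a _) (\sum_a _) => u v w h.
have -> : v = - (dn p x)^-1 * w by apply: (mulfI d0); rewrite mulrA mulrN mulfV // mulN1r; lra.
by ring.
Qed.

Hypothesis hRic : ricci_ge_omega K.
Local Notation th p := (theta p).

Let mup0 f : smooth K f -> (forall r, 0 <= f r) -> mu f = 0 -> forall r, f r = 0.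
Proof. exact: mean_pos. Qed.

Definition sballK p := [set x | sq K p x < rd K p ^+ 2 / 256].
Local Notation sb := sballK.
Definition csballK p := [set x | sq K p x <= rd K p ^+ 2 / 256].
Local Notation csb := csballK.
Definition nb2 p := [set s | dom (ch p) s /\ sb p (crd p s)].

Lemma sb_open p : open (sb p).
Proof. exact: (open_comp (fun x _ => @cont_sqnB _ _ (crd p p) x) (@open_lt R (rd K p ^+ 2 / 256))). Qed.

Lemma csb_closed p : closed (csb p).
Proof. exact: (closed_comp (fun x _ => @cont_sqnB _ _ (crd p p) x) (@closed_le R (rd K p ^+ 2 / 256))). Qed.

Lemma sb_center p : sb p (crd p p).
Proof. by rewrite /sb /= /sq sqnxx divr_gt0 ?ltr0n ?exprn_gt0 ?rd_gt0. Qed.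

Lemma csb_tb p : csb p `<=` tb p.
Proof.
move=> x h; have := exprn_gt0 2 (rd_gt0 K p); move: h; rewrite /csb /tballK /=; move: (sq K p x) (rd K p ^+ 2) => u v; lra.
Qed.

Lemma sb_tb p : sb p `<=` tb p. Proof. by move=> x h; apply: csb_tb; exact: ltW. Qed.

Lemma nb2_open p : open (nb2 p).
Proof.
rewrite openE => s [d t]; apply: filterI; first by apply: open_nbhs_nbhs; split; [exact: dom_open|].
by apply: (coord_cont d); apply: open_nbhs_nbhs; split; [exact: sb_open|].
Qed.

Lemma nb2_center p : nb2 p p. Proof. by split; [exact: chart_at_dom|exact: sb_center]. Qed.

(** Multiplication by [b], which vanishes outside the smaller neighbourhood [nb2 p], globalizes
    functions such as those built from [theta] that are smooth only on the ball of size 1/64. *)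
Definition tcut p (b : M -> R) (F : 'rV[R]_m -> R) x := if `[< tb p x >] then loc p b x * F x else 0.

Lemma lt_tcut p b F : smooth K b -> (forall s, ~ nb2 p s -> b s = 0) -> smooth_on (tb p) F -> lt p (tcut p b F).
Proof.
move=> sb' b0 sF; split; last by move=> x nc; rewrite /tcut asboolF // => /tb_bl/bl_cl.
apply: smooth_loc => x Ux; have [tx|ntx] := pselect (tb p x).
 exists (tb p); split=> //; first exact: tb_open.
 apply: (smooth_ext (@tb_open _ _ _ K p) (f := fun x => loc p b x * F x)) => [y ty|]; first by rewrite /tcut asboolT.
 apply: smooth_mul (@tb_open _ _ _ K p) _ sF; exact: smooth_sub (@tbU p) (sb' p).
exists (U p `&` ~` csb p); have oW : open (U p `&` ~` csb p).
 by apply: openI; [exact: U_open|exact: closed_openC (@csb_closed p)].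
split=> //; first by split=> // /csb_tb.
apply: (smooth_ext oW (f := fun=> 0)) => [y [Uy nc]|]; last exact: smooth_cst.
rewrite /tcut; case: ifP => // _; rewrite /loc_fun /= b0 ?mul0r // => -[_]; have [-> _] := coordVK Uy.
by move=> h; apply: nc; exact: ltW h.
Qed.

Lemma ext_tcut p b F s : (forall s, ~ nb2 p s -> b s = 0) -> dom (ch p) s -> ext p (tcut p b F) s = b s * F (crd p s).
Proof.
move=> b0 d; rewrite (ext_crd _ d) /tcut; case: ifP => [/asboolP t|/asboolP nt]; first by rewrite (loc_crd _ d).
by rewrite b0 ?mul0r // => -[_ /sb_tb].
Qed.

Lemma ext_tcut0 p b F s : b s = 0 -> ext p (tcut p b F) s = 0.
Proof.
move=> bs; rewrite /ext0; case: ifP => // /asboolP d; rewrite /tcut; case: ifP => // _.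
by rewrite (loc_crd _ d) bs mul0r.
Qed.

Definition hp p psi x : R := (shp (g p) (grad (loc p psi)) x *m (th p x)^T) 0 0.

Let sgr p psi : smooth K psi -> smx (U p) (grad (loc p psi)).
Proof.
move=> sp i a; have s' : smooth_on (U p) (loc p psi) by exact: sp.
by apply: (smooth_ext (oU p)) (smooth_partial a s') => z _; rewrite mxE.
Qed.

Let sX p psi : smooth K psi -> smx (U p) (shp (g p) (grad (loc p psi))).
Proof. by move=> sp; exact: (smx_shp (oU p) (@sgx p) (@ugx p) (@sgr p psi sp)). Qed.

Lemma hp_smooth p psi : smooth K psi -> smooth_on (tb p) (hp p psi).
Proof.
move=> sp; apply: (smooth_pair (@tb_open _ _ _ K p)); last exact: smx_th.
by move=> i j; exact: smooth_sub (@tbU p) (@sX p psi sp i j).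
Qed.

(** Green's formula for [b] supported in one chart, up to a defect that pairs the differential of
    [psi] with [theta]. *)
Lemma stokes p b psi : smooth K b -> (forall s, ~ nb2 p s -> b s = 0) -> smooth K psi ->
 mu (fun s => b s * lapM psi s + ipM b psi s) = - mu (ext p (tcut p b (hp p psi))).
Proof.
move=> sb' b0 sp; pose be := tcut p b (fun=> 1); pose X := shp (g p) (grad (loc p psi)).
have lb : lt p be by apply: lt_tcut => //; exact: smooth_cst.
have bE y : U p y -> be y = loc p b y.
 move=> Uy; rewrite /be /tcut; case: ifP => [_|/asboolP nt]; first by rewrite mulr1.
 by rewrite /loc_fun /= b0 // => -[_ /sb_tb]; have [-> _] := coordVK Uy.
have eE : ext p be = b.
 apply/funext => s; have [d|nd] := pselect (dom (ch p) s); first by rewrite ext_tcut // mulr1.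
 by rewrite ext_tcut0 b0 // => -[].
pose W y := be y *: X y.
have sW : smx (U p) W.
 move=> i a; apply: (smooth_ext (oU p)) (smooth_mul (oU p) lb.1 (@sX p psi sp i a)) => y _; by rewrite !mxE.
have W0 y : ~ cl p y -> W y = 0 by move=> nc; rewrite /W lb.2 // scale0r.
have E : ext p (divg (g p) W) = (fun s => b s * lapM psi s + ipM b psi s).
 apply/funext => s; have [d|nd] := pselect (dom (ch p) s); last first.
  have [V [oV Vs V0]] := off_tsp hM (lt_tsp lb) nd; rewrite eE in V0.
  have [h _ _] := local0 sb' oV Vs V0.
  by rewrite /gradM h !mul0mx mxE V0 // mul0r addr0 /ext0 asboolF.
 have Ux := U_crd d; have sl : smooth_on (U p) (loc p psi) by exact: sp.
 rewrite (ext_crd _ d) (lapM_patch sp d) (ipM_patch sb' sp d).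
 rewrite (laplacianE (oU p) (@sgx p) (@gTx p) (@ugx p) sl Ux) !divg_flat // mulrDr -addrA [X in _ = _ + X]addrC addrA.
 have -> : \sum_a W (crd p s) 0 a * Ga p (crd p s) 0 a = b s * \sum_a X (crd p s) 0 a * Ga p (crd p s) 0 a.
  by rewrite mulr_sumr; apply: eq_bigr => a _; rewrite /W mxE bE // (loc_crd _ d) mulrA.
 congr (_ + _).
 have -> : (grad (loc p b) (crd p s) *m ig p (crd p s) *m (grad (loc p psi) (crd p s))^T) 0 0 = \sum_a partial a be (crd p s) * X (crd p s) 0 a.
  rewrite -mulmxA mxE; apply: eq_bigr => a _; rewrite [grad _ _ 0 a]mxE (partial_ext a (oU p) Ux bE); congr (_ * _).
  have -> : X (crd p s) 0 a = (X (crd p s))^T a 0 by rewrite [RHS]mxE.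
  by rewrite /X /shp trmx_mul (igT (@gTx p) Ux).
 rewrite mulr_sumr -big_split; apply: eq_bigr => a _ /=.
 rewrite (partial_ext a (oU p) Ux (g := fun y => be y * X y 0 a)) => [|y _]; last by rewrite mxE.
 by rewrite (smooth_partialM a lb.1 (@sX p psi sp 0 a) Ux) bE // (loc_crd _ d) addrC.
rewrite -E mean_divg //; congr (- _).
rewrite (dn_int hM mmu (lt_tcut sb' b0 (@hp_smooth p psi sp))); apply: (avg_ext (side_gt0 K p)) => y /cube_U Uy.
rewrite /W /be /tcut; case: ifP => [/asboolP ty|_]; last by rewrite scale0r mul0mx mxE mulr0.
rewrite mulr1 -scalemxAl mxE mulrCA; congr (_ * _); rewrite /hp /theta linearZ -scalemxAr [X in _ = _ * X]mxE mulrA mulfV ?mul1r //.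
by rewrite gt_eqF // dn_pos.
Qed.

Lemma mean_eq F H : smooth K F -> smooth K H ->
 (forall f, smooth K f -> mu (fun s => f s * F s) = mu (fun s => f s * H s)) -> forall r, F r = H r.
Proof.
move=> sF sH key r; have sd := sm_sub sF sH.
have e0 : mu (fun s => (F s - H s) * (F s - H s)) = 0.
 have s1 := sm_mul sd sF; have s2 := sm_scale (-1) (sm_mul sd sH).
 rewrite (_ : (fun s => _) = (fun s => (F s - H s) * F s + -1 * ((F s - H s) * H s))).
  by rewrite (muD s1 s2) (muZ _ (sm_mul sd sH)) (key _ sd) mulN1r subrr.
 by apply/funext => s; ring.
have := mup0 (sm_mul sd sd) (fun s => sqr_ge0 _) e0 r => /eqP.
by rewrite mulf_eq0 orbb subr_eq0 => /eqP.
Qed.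

(** The left-hand side of [stokes] does not refer to a chart, hence neither does the defect;
    faithfulness of the mean turns this into a pointwise statement. No transformation rule for
    densities is involved. *)
Lemma hp_glob p r psi : nb2 p r -> smooth K psi -> hp p psi (crd p r) = hp r psi (crd r r).
Proof.
move=> np sp; have [W [oW Wr WU WO]] := near_patch K (@nb2_open p) np.
have [t t0 tW] := sqn_ball (openI oW (@sb_open r)) (conj Wr (@sb_center r)).
have lb : lt r (bmp (crd r r) t).
 split; first exact: bmp_smooth (oU r).
 by move=> y nc; apply: bmp_off; rewrite leNgt; apply/negP => /tW [_ /sb_tb/tb_bl/bl_cl].
pose b := ext r (bmp (crd r r) t); have sb' : smooth K b by apply: ext_smooth => //; exact: lt_tsp.
have bb s : ~ (nb2 r s /\ nb2 p s) -> b s = 0.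
 move=> nn; rewrite /b /ext0; case: ifP => // /asboolP d; apply: bmp_off; rewrite leNgt; apply/negP => /tW [W1 W2].
 apply: nn; split; first by split.
 by have := WO _ W1; rewrite coordK.
have br s : ~ nb2 r s -> b s = 0 by move=> h; apply: bb => -[].
have bp s : ~ nb2 p s -> b s = 0 by move=> h; apply: bb => -[].
pose Hp := ext p (tcut p b (hp p psi)); pose Hr := ext r (tcut r b (hp r psi)).
have sHp : smooth K Hp by apply: ext_smooth => //; apply: lt_tsp; apply: lt_tcut => //; exact: hp_smooth.
have sHr : smooth K Hr by apply: ext_smooth => //; apply: lt_tsp; apply: lt_tcut => //; exact: hp_smooth.
have key f : smooth K f -> mu (fun s => f s * Hp s) = mu (fun s => f s * Hr s).
 move=> sf; have sbf : smooth K (fun s => b s * f s) by exact: sm_mul.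
 have E q : (forall s, ~ nb2 q s -> b s = 0) -> (fun s => f s * ext q (tcut q b (hp q psi)) s) = ext q (tcut q (fun s => b s * f s) (hp q psi)).
  move=> bq; apply/funext => s; have [d|nd] := pselect (dom (ch q) s).
   rewrite !ext_tcut // => [|s' ns]; last by rewrite bq // mul0r.
   by rewrite mulrA [f s * _]mulrC.
  have b0 : b s = 0 by apply: bq => -[].
  by rewrite !ext_tcut0 ?b0 ?mulr0 // mul0r.
 have zp s : ~ nb2 p s -> b s * f s = 0 by move=> ns; rewrite bp // mul0r.
 have zr s : ~ nb2 r s -> b s * f s = 0 by move=> ns; rewrite br // mul0r.
 have e1 := stokes sbf zp sp; have e2 := stokes sbf zr sp.
 have e3 := etrans (esym e1) e2.
 apply: oppr_inj; exact: etrans (congr1 (fun h => - mu h) (E p bp)) (etrans e3 (congr1 (fun h => - mu h) (esym (E r br)))).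
have br0 : 0 < b r by rewrite /b ext_crd; [apply: bmp_pos; rewrite sqnxx|exact: chart_at_dom].
have e1 : Hp r = b r * hp p psi (crd p r) by case: np => d _; exact: (ext_tcut _ bp d).
have e2 : Hr r = b r * hp r psi (crd r r) by exact: (ext_tcut _ br (chart_at_dom K r)).
have e3 := mean_eq sHp sHr key r.
exact: (mulfI (lt0r_neq0 br0) (etrans (esym e1) (etrans e3 e2))).
Qed.

Lemma exists_grad r (v : 'rV[R]_m) : exists2 psi, smooth K psi & grad (loc r psi) (crd r r) = v.
Proof.
pose ell x := \sum_a v 0 a * (x : 'rV[R]_m) 0 a.
have sl V : open V -> smooth_on V ell.
 by move=> oV; apply: smooth_sum => // a _; apply: smooth_scale => //; exact: smooth_coord.
have tp : tst (U r) (cb K r) (fun x => cut K r x * ell x).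
 split; first by apply: smooth_mul (oU r) (cut_smooth K r (oU r)) (sl _ (oU r)).
 by move=> x nc; rewrite (cut_tst K r).2 // mul0r.
exists (ext r (fun x => cut K r x * ell x)); first exact: ext_smooth.
have Ux := U_crd (chart_at_dom K r).
rewrite (grad_ext tp (chart_at_dom K r)); apply/rowP => a; rewrite mxE.
rewrite (partial_ext (U := bl r) (g := ell) a (@bl_open _ _ _ K r) (@bl_center _ _ _ K r)) => [|y by_]; last first.
 by rewrite cut1 ?mul1r //; exact: bl_cl.
rewrite /ell partial_sum => [|b _]; last exact: smooth_derivable (smooth_scale (v 0 b) openT (smooth_coord _ b)) I.
rewrite (bigD1 a) //= big1 ?addr0 => [|b ba]; rewrite partialZ ?partial_coord ?eqxx ?mulr1 ?(negbTE ba) ?mulr0 //;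
 exact: smooth_derivable (smooth_coord setT _) I.
Qed.

Definition thn r : R := nrm2 (g r) (th r) (crd r r).

(** Every covector is the differential of a global function at the point ([exists_grad]), so the
    pairings of [hp_glob] determine [theta], which therefore transforms as a covector. *)
Lemma thn_glob p r : nb2 p r -> nrm2 (g p) (th p) (crd p r) = thn r.
Proof.
move=> np; have d := np.1; have [D [gD H _]] := change_at d.
set x := crd p r in gD H *; set y := crd r r in gD H *.
have t1 (A : 'M[R]_1) : A 0 0 = A^T 0 0 by rewrite mxE.
have Ux := U_crd d; have Uy := U_crd (chart_at_dom K r).
have E (v : 'rV[R]_m) : v *m (D^T *m ig p x *m (th p x)^T) = v *m (ig r y *m (th r y)^T).
 have [psi sp gv] := exists_grad r v; have := hp_glob np sp.
 rewrite /hp /shp -/x -/y (H _ sp) gv -!mulmxA => e; apply/matrixP => i j; rewrite !ord1; exact: e.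
have E2 : D^T *m ig p x *m (th p x)^T = ig r y *m (th r y)^T.
 have gen (A B : 'cV[R]_m) : (forall v : 'rV[R]_m, v *m A = v *m B) -> A = B.
  by move=> h; rewrite -[A]mul1mx -[B]mul1mx; apply/row_matrixP => i; rewrite !row_mul; exact: h.
 exact: (gen _ _ E).
have uD : D^T *m ig p x \in unitmx.
 have : D^T *m ig p x *m D \in unitmx by rewrite gD unitmx_inv; exact: ugx.
 by rewrite unitmx_mul => /andP[].
have E3 : (th p x)^T = D *m (th r y)^T.
 by apply: (can_inj (mulKmx uD)); rewrite E2 -gD mulmxA.
rewrite /nrm2 E3 (_ : th p x = th r y *m D^T) ?mulmxA; last by apply: trmx_inj; rewrite E3 trmx_mul trmxK.
by rewrite /thn /nrm2 -/y -gD !mulmxA.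
Qed.

Lemma thn_smooth : smooth K thn.
Proof.
apply: smooth_locP => r; exists r, (sb r); split; [exact: chart_at_dom|exact: sb_open|exact: sb_center|].
have oS := @sb_open r.
have Ub : sb r `<=` U r by move=> x /sb_tb/tbU.
apply: (smooth_ext oS (f := nrm2 (g r) (th r))) => [x sx|].
 have [e d] := coordVK (Ub x sx).
 by rewrite /loc_fun /= -(@thn_glob r) ?e //; split=> //; rewrite e.
apply: (smooth_nrm2 oS); [|by move=> x /Ub; exact: ugx|].
- by move=> i j; exact: smooth_sub Ub (@sgx r i j).
- by move=> i j; exact: smooth_sub (@sb_tb r) (@smx_th r i j).
Qed.

Lemma laplacian_ext (W : set 'rV[R]_m) f h p x : open W -> W x -> (forall y, W y -> f y = h y) ->
 laplacian (g p) f x = laplacian (g p) h x.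
Proof.
move=> oW Wx fh; rewrite /laplacian; congr (\tr (_ *m _)); apply/matrixP => a b; rewrite !mxE.
rewrite (partial_ext a oW Wx (fun y Wy => partial_ext b oW Wy fh)); congr (_ - _).
by apply: eq_bigr => c _; rewrite (partial_ext c oW Wx fh).
Qed.

Lemma thn0 r : thn r = 0.
Proof.
have [s Hs] := sm_max hK r thn_smooth.
have n0 p x : tb p x -> 0 <= nrm2 (g p) (th p) x.
 move=> /tbU Ux; case: (eqVneq (th p x) 0) => [e|ne]; first by rewrite /nrm2 e !mul0mx mxE.
 by apply: ltW; apply: invmx_pos => //; [exact: gmx_sym|exact: gmx_hermitian|move=> v; exact: gmx_pos].
suff s0 : thn s = 0.
 by apply/eqP; rewrite eq_le -{1}s0 Hs /=; apply: n0; exact: tb_center.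
set x := crd s s; have tx : tb s x by exact: tb_center.
have Ux := tbU tx; have Tu y : tb s y -> U s y by exact: tbU.
have sgt : smx (tb s) (g s) by move=> i j; exact: smooth_sub (@tbU s) (@sgx s i j).
have cth := th_clsd s.
have ob := @sb_open s; have sx : sb s x by exact: sb_center.
have locE y : sb s y -> loc s thn y = nrm2 (g s) (th s) y.
 move=> sy; have [e d] := coordVK (Tu _ (sb_tb sy)).
 by rewrite /loc_fun /= -(@thn_glob s) ?e //; split=> //; rewrite e.
have gr0 a : partial a (nrm2 (g s) (th s)) x = 0.
 rewrite -(partial_ext a ob sx locE); have := congr1 (fun v : 'rV[R]_m => v 0 a) (max_grad thn_smooth Hs).
 by rewrite !mxE.
have lp0 : laplacian (g s) (nrm2 (g s) (th s)) x <= 0.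
 by rewrite -(laplacian_ext s ob sx locE); exact: max_lap thn_smooth Hs.
(* By [th_div] the divergence is $-|\theta|^2$, whose derivatives vanish at the maximum. This
   disposes of the one term of the Bochner formula without a sign. *)
have dv0 : \sum_a shp (g s) (th s) x 0 a * partial a (divg (g s) (shp (g s) (th s))) x = 0.
 apply: big1 => a _; have oT := @tb_open _ _ _ K s.
 rewrite (partial_ext a oT tx (g := fun y => -1 * nrm2 (g s) (th s) y)) => [|y ty]; last first.
  by rewrite (th_div ty) mulN1r.
 rewrite partialZ ?gr0 ?mulr0 //.
 exact: smooth_derivable (smooth_nrm2 oT sgt (fun y ty => ugx (Tu y ty)) (@smx_th s)) tx.
have := @kahler_bochner R m J (tb s) (g s) JmxT JmxJ (@tb_open _ _ _ K s) sgt (fun y ty => gTx (Tu y ty))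
 (fun y ty => ugx (Tu y ty)) (fun y ty => gmx_hermitian (Tu y ty)) (fun y a b c ty => omega_closed a b c (Tu y ty)) _ x cth tx.
cbv zeta; rewrite dv0 mulr0 subr0 => Bo.
have q1 := trace_sqr_ge0 (gmx_sym Ux) (gmx_hermitian Ux) (fun v => gmx_pos Ux).
have oT := @tb_open _ _ _ K s.
have HT := HmT oT (fun y ty => gTx (Tu y ty)) cth tx; have PT := PmT J cth tx.
have q2 := q1 _ PT; have : (Hm (g s) (th s) x - Pm J (th s) x)^T = Hm (g s) (th s) x - Pm J (th s) x.
 by rewrite linearB /= HT PT.
move=> /q1 q3.
have q4 := ricci_real (gmx_sym Ux) (gmx_hermitian Ux) (fun v => gmx_pos Ux) (shp (g s) (th s) x) (hRic (p := s)).
have X0 : shp (g s) (th s) x = 0.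
 have key (a b c d e l : R) : 2 * a + 2 * b + (c + d) = l -> 0 <= b -> 0 <= a -> 2 * e <= c + d -> 0 < e -> l <= 0 -> False by lra.
 apply/eqP; apply: contraT => /(gmx_pos Ux) q5; by case: (key _ _ _ _ _ _ Bo q2 q3 q4 q5 lp0).
by rewrite /thn /nrm2 -/x; move: X0; rewrite /shp => ->; rewrite mul0mx mxE.
Qed.

Lemma kap0 p x : sb p x -> kap p x = 0.
Proof.
move=> sx; have tx := sb_tb sx; have Ux := tbU tx; have [e d] := coordVK Ux.
have np : nb2 p (crv p x) by split=> //; rewrite e.
have := thn_glob np; rewrite thn0 e => h.
have t0 : th p x = 0.
 apply/eqP; apply: contraT => ne.
 have := invmx_pos (gmx_sym Ux) (gmx_hermitian Ux) (fun v => gmx_pos Ux) ne.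
 by move: h; rewrite /nrm2 => ->; rewrite ltxx.
have dp : dn p x != 0 by rewrite gt_eqF // dn_pos.
by move: t0; rewrite /theta => /eqP; rewrite scaler_eq0 invr_eq0 (negbTE dp) /= => /eqP.
Qed.

Lemma mean_div0 p W : smx (U p) W -> (forall x, ~ sb p x -> W x = 0) -> mu (ext p (divg (g p) W)) = 0.
Proof.
move=> sW W0; rewrite mean_divg // => [|x nc]; last by apply: W0 => /sb_tb/tb_bl/bl_cl.
apply/eqP; rewrite oppr_eq0; apply/eqP; rewrite -(avg_cst (corner K p) (side K p) 0).
apply: (avg_ext (side_gt0 K p)) => x _; have [sx|ns] := pselect (sb p x).
 by rewrite kap0 // trmx0 mulmx0 mxE.
by rewrite W0 // mul0mx mxE.
Qed.

Lemma mean_sym f psi : smooth K f -> smooth K psi -> mu (fun s => f s * lapM psi s + ipM f psi s) = 0.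
Proof.
move=> sf sp.
have mu0 : mu (fun=> 0) = 0.
 by have := muZ 0 (sm_cst K 1); rewrite !mul0r.
apply: (patch_ind hM hK nb2_open nb2_center (Pr := fun f => mu (fun s => f s * lapM psi s + ipM f psi s) = 0)) sf.
- by rewrite -[RHS]mu0; congr mu; apply/funext => s; rewrite mul0r ipM_cst addr0.
- move=> f1 f2 s1 s2 h1 h2; have E := sm_lap sp.
 have t1 := sm_add (sm_mul s1 E) (sm_ip s1 sp); have t2 := sm_add (sm_mul s2 E) (sm_ip s2 sp).
 rewrite -[RHS]addr0 -{1}h1 -h2 -(muD t1 t2); congr mu; apply/funext => s; rewrite ipMDl // mulrDl addrACA //.
- move=> r phi lp off; have se := ext_smooth hM (lt_tsp lp); rewrite (stokes (p := r)) //.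
 apply/eqP; rewrite oppr_eq0; apply/eqP; rewrite -[RHS]mu0; congr mu; apply/funext => s.
 have [d|nd] := pselect (dom (ch r) s); last by rewrite ext_tcut0 // off // => -[].
 rewrite (ext_tcut _ off d).
 have [ns|nn] := pselect (nb2 r s); last by rewrite off // mul0r.
 have [_ ss] := ns; have k0 := kap0 ss.
 by rewrite /hp /theta k0 scaler0 trmx0 mulmx0 mxE mulr0.
Qed.

Local Notation ppM := (hessM K).

Let msym0 f psi : smooth K f -> smooth K psi -> mu (fun s => f s * lapM psi s + ipM f psi s) = 0.
Proof. exact: mean_sym. Qed.

(** One size smaller again: fields built from functions supported here vanish outside the ball of
    size 1/256, where [mean_div0] applies. *)
Definition c3 p := [set x | sq K p x <= rd K p ^+ 2 / 512].
Definition nb3 p := [set s | dom (ch p) s /\ [set x | sq K p x < rd K p ^+ 2 / 512] (crd p s)].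

Lemma c3_closed p : closed (c3 p).
Proof. exact: (closed_comp (fun x _ => @cont_sqnB _ _ (crd p p) x) (@closed_le R (rd K p ^+ 2 / 512))). Qed.

Lemma c3_sb p : c3 p `<=` sb p.
Proof.
move=> x h; have := exprn_gt0 2 (rd_gt0 K p); move: h; rewrite /c3 /sballK /=; move: (sq K p x) (rd K p ^+ 2) => u v; lra.
Qed.

Lemma nb3_open p : open (nb3 p).
Proof.
rewrite openE => s [d t]; apply: filterI; first by apply: open_nbhs_nbhs; split; [exact: dom_open|].
apply: (coord_cont d); apply: open_nbhs_nbhs; split=> //.
exact: (open_comp (fun x _ => @cont_sqnB _ _ (crd p p) x) (@open_lt R (rd K p ^+ 2 / 512))).
Qed.

Lemma nb3_center p : nb3 p p.
Proof. by split; [exact: chart_at_dom|rewrite /= /sq sqnxx divr_gt0 ?ltr0n ?exprn_gt0 ?rd_gt0]. Qed.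

Lemma PmD (f h : 'rV[R]_m -> R) (V : set 'rV[R]_m) x : open V -> smooth_on V f -> smooth_on V h -> V x ->
 Pm J (grad (fun y => f y + h y)) x = Pm J (grad f) x + Pm J (grad h) x.
Proof.
move=> oV sf sh Vx; have E : Dm (grad (fun y => f y + h y)) x = Dm (grad f) x + Dm (grad h) x.
 apply/matrixP => a b; rewrite [RHS]mxE; apply: etrans (Dm_gradE _ a b x) _.
 apply: etrans _ (esym (congr2 +%R (Dm_gradE f a b x) (Dm_gradE h a b x))).
 apply: etrans (partial_ext a oV Vx (fun y Vy => smooth_partialD b sf sh Vy)) _.
 exact: (smooth_partialD a (smooth_partial b sf) (smooth_partial b sh) Vx).
rewrite /Pm E; move: (Dm (grad f) x) (Dm (grad h) x) => A B.
by rewrite -scalerDr mulmxDr mulmxDl addrACA.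
Qed.

Lemma Pm_ext (f h : 'rV[R]_m -> R) (V : set 'rV[R]_m) x : open V -> V x -> (forall y, V y -> f y = h y) ->
 Pm J (grad f) x = Pm J (grad h) x.
Proof.
move=> oV Vx fh; have E : Dm (grad f) x = Dm (grad h) x.
 apply/matrixP => a b; apply: etrans (Dm_gradE f a b x) _; apply: etrans _ (esym (Dm_gradE h a b x)).
 exact: (partial_ext a oV Vx (fun y Vy => partial_ext b oV Vy fh)).
by rewrite /Pm E.
Qed.

Lemma ppMDr f1 f2 h s : smooth K f1 -> smooth K f2 -> ppM h (fun t => f1 t + f2 t) s = ppM h f1 s + ppM h f2 s.
Proof.
move=> s1 s2; have Ux := U_crd (chart_at_dom K s); rewrite /hessM.
rewrite (PmD (oU s) (f := loc s f1) (h := loc s f2) (s1 s) (s2 s) Ux).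
by rewrite mulmxDl mulmxDr mxtraceD.
Qed.

(** For [f] supported in a chart, integrate the divergence of the field $P_f(\nabla h)$, computed in
    [divg_Pm]. Green's formula turns the remaining $\frac12\langle\nabla\Delta f,\nabla h\rangle$
    into $-\frac12\Delta f\,\Delta h$. *)
Lemma mean_pp f h : smooth K f -> smooth K h -> mu (ppM h f) = 2^-1 * mu (fun s => lapM f s * lapM h s).
Proof.
move=> sf sh.
have mu0 : mu (fun=> 0) = 0 by have := muZ 0 (sm_cst K 1); rewrite !mul0r.
have local00 (O : set M) r u : smooth K u -> open O -> O r -> (forall s, O s -> u s = 0) -> Pm J (grad (loc r u)) (crd r r) = 0 /\ ipM (lapM u) h r = 0.
 move=> su oO Or u0; have [_ _ P0] := local0 su oO Or u0.
 have [g0 _ _] := local0 (sm_lap su) oO Or (fun s Os => let: And3 _ h _ := local0 su oO Os u0 in h).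
 by split=> //; rewrite /gradM g0 !mul0mx mxE.
apply: (patch_ind hM hK nb3_open nb3_center (Pr := fun f => mu (ppM h f) = 2^-1 * mu (fun s => lapM f s * lapM h s))) sf.
- rewrite (_ : (fun s => lapM (fun=> 0) s * lapM h s) = (fun=> 0)) ?mu0 ?mulr0; last first.
  by apply/funext => s; rewrite lapM_cst mul0r.
 rewrite -[RHS]mu0; congr mu; apply/funext => s.
 have [P0 _] := local00 _ s _ (sm_cst K 0) openT I (fun _ _ => erefl).
 by rewrite /hessM P0 mul0mx mulmx0 linear0.
- move=> f1 f2 s1 s2 h1 h2; rewrite (_ : ppM h _ = (fun s => ppM h f1 s + ppM h f2 s)); last first.
  by apply/funext => s; exact: ppMDr.
 have e3 := muD (sm_mul (sm_lap s1) (sm_lap sh)) (sm_mul (sm_lap s2) (sm_lap sh)).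
 apply: etrans (muD (sm_pp sh s1) (sm_pp sh s2)) _; apply: etrans (congr2 +%R h1 h2) _.
 apply: etrans (esym (mulrDr _ _ _)) _; apply: (congr1 (fun t => 2^-1 * t)); apply: etrans (esym e3) _.
 apply: (congr1 mu); apply/funext => s; apply: etrans (esym (mulrDl _ _ _)) _.
 exact: (congr1 (fun t => t * lapM h s) (esym (lapMD s s1 s2))).
move=> r phi lp off; set f0 := ext r phi; have se : smooth K f0 := ext_smooth hM (lt_tsp lp).
have l3 : tst (U r) (c3 r) phi.
 split; first exact: lp.1.
 move=> x nc; have [Ux|nU] := pselect (U r x); last by apply: lp.2 => /cl_cb/cb_U.
 have [e d] := coordVK Ux; rewrite -[LHS](congr1 phi e) -(ext_crd phi d); apply: off => -[_ /=]; rewrite e => q.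
 by apply: nc; exact: ltW q.
have pl a b : tst (U r) (c3 r) (partial a (partial b phi)).
 by do 2 apply: (tst_partial (@c3_closed r)).
have oUr := oU r; have sphi := lp.1; have cphi := clsd_grad oUr sphi.
have shl : smooth_on (U r) (loc r h) by exact: sh.
have chh := clsd_grad oUr shl.
pose W y := shp (g r) (grad (loc r h)) y *m (Pm J (grad phi) y *m ig r y).
have sW : smx (U r) W.
 have A1 : smx (U r) (shp (g r) (grad (loc r h))) := smx_shp oUr (@sgx r) (@ugx r) chh.1.
 have A2 : smx (U r) (fun y => Pm J (grad phi) y *m ig r y) by exact: (smxM oUr (smx_Pm J oUr cphi.1) (@sigx r)).
 exact: (smxM oUr A1 A2).
have W0 x : ~ sb r x -> W x = 0.
 move=> ns; have D0 : Dm (grad phi) x = 0.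
  by apply/matrixP => a b; rewrite Dm_gradE (pl a b).2 ?mxE // => /c3_sb.
 by rewrite /W /Pm D0 mulmx0 mul0mx addr0 scaler0 mul0mx mulmx0.
have E0 := mean_div0 sW W0.
have EE : ext r (divg (g r) W) = (fun s => ppM h f0 s + 2^-1 * ipM (lapM f0) h s).
 apply/funext => s; have [d|nd] := pselect (dom (ch r) s); last first.
  have [V [oV Vs V0]] := off_tsp hM (lt_tsp lp) nd.
  have [P0 i0] := local00 V s f0 se oV Vs V0.
  by rewrite i0 mulr0 addr0 /hessM P0 mul0mx mulmx0 linear0 /ext0 asboolF.
 have Ux := U_crd d; rewrite (ext_crd _ d).
 have Pf : Pm J (grad (loc r f0)) (crd r s) = Pm J (grad phi) (crd r s).
  by apply: (Pm_ext oUr Ux) => y Uy; exact: loc_ext.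
 rewrite (ppM_patch sh se d) (ipM_patch (sm_lap se) sh d) Pf.
 rewrite (divg_Pm JmxT JmxJ oUr (@sgx r) (@gTx r) (@ugx r) (@gmx_hermitian _ _ _ K r) (fun y a b c Uy => omega_closed a b c Uy) chh cphi Ux).
 rewrite (trace_type JmxT JmxJ oUr (@sgx r) (@gTx r) (@ugx r) (@gmx_hermitian _ _ _ K r) (fun y a b c Uy => omega_closed a b c Uy) (grad (loc r h)) (grad phi) Ux).
 congr (_ + _ * _).
 have lE y : U r y -> \tr (Pm J (grad phi) y *m ig r y) = loc r (lapM f0) y.
  move=> Uy; rewrite -(laplacian_Pm sphi Uy) (lap_ext hM (lt_tsp lp)).
  exact: (esym (loc_ext _ Uy)).
 have t1 (A : 'M[R]_1) : A 0 0 = A^T 0 0 by rewrite mxE.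
 rewrite [RHS]t1 !trmx_mul trmxK (igT (@gTx r) Ux) mulmxA [RHS]mxE; apply: eq_bigr => a _.
 have eT : (grad (loc r (lapM f0)) (crd r s))^T a 0 = partial a (loc r (lapM f0)) (crd r s) by rewrite [LHS]mxE [LHS]mxE.
 rewrite eT; exact: (congr1 (fun t => _ * t) (partial_ext a oUr Ux lE)).
have s1 := sm_pp sh se; have s2 := sm_ip (sm_lap se) sh; have s3 := sm_mul (sm_lap se) (sm_lap sh).
have e1 := msym0 (sm_lap se) sh.
have e2 := muD s3 s2; rewrite e1 in e2.
move: E0; rewrite EE (muD s1 (sm_scale _ s2)) (muZ _ s2).
move: e2; move: (mu (ppM h f0)) (mu (ipM _ _)) (mu _) => u v w; lra.
Qed.

(** * Rellich's lemma *)

Let mup f : smooth K f -> (forall r, 0 <= f r) -> 0 <= mu f.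
Proof. by have [_ _ H _ _] := mmu; exact: H. Qed.

Lemma mean_le f h : smooth K f -> smooth K h -> (forall r, f r <= h r) -> mu f <= mu h.
Proof.
move=> sf sh fh; have s1 := sm_add sh (sm_scale (-1) sf).
have := mup s1 (fun r => _); rewrite (muD sh (sm_scale (-1) sf)) (muZ _ sf) => H.
have : 0 <= mu h + -1 * mu f by apply: H => r; rewrite mulN1r subr_ge0.
by move: (mu f) (mu h) => u v; lra.
Qed.

Lemma quadE (A : 'M[R]_m) (v : 'rV[R]_m) : (v *m A *m v^T) 0 0 = \sum_a \sum_b A a b * v 0 a * v 0 b.
Proof.
rewrite mxE; under eq_bigr do rewrite !mxE mulr_suml.
rewrite exchange_big; apply: eq_bigr => a _; apply: eq_bigr => b _; by rewrite [v 0 a * _]mulrC.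
Qed.

Lemma compact_pos (A : set 'rV[R]_m) (f : 'rV[R]_m -> R) x0 : compact A -> A x0 -> (forall x, A x -> {for x, continuous f}) ->
 (forall x, A x -> 0 < f x) -> exists2 c : R, 0 < c & forall x, A x -> c <= f x.
Proof.
move=> cA Ax0 cf f0; have [||c /set_mem Ac H] := @compact_EVT_min _ R f A _ cA; first by exists x0.
 by apply: continuous_in_subspaceT => x /set_mem; exact: cf.
by exists (f c); [exact: f0|move=> x Ax; apply: H; exact: mem_set].
Qed.

Definition be p := bmp (crd p p) (rd K p ^+ 2 / 256).
Definition et p := bmp (crd p p) (rd K p ^+ 2 / 128).

Lemma be_tst p : tst (U p) (csb p) (be p).
Proof.
split; first exact: bmp_smooth (oU p).
by move=> y nc; apply: bmp_off; rewrite leNgt; apply/negP => h; apply: nc; exact: ltW h.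
Qed.

Lemma csb_cl p : csb p `<=` cl p. Proof. by move=> x /csb_tb/tb_bl/bl_cl. Qed.

Lemma csb_U p : csb p `<=` U p. Proof. by move=> x /csb_tb/tbU. Qed.

Lemma et_lt p : lt p (et p).
Proof.
split; first exact: bmp_smooth (oU p).
move=> y nc; apply: bmp_off; rewrite leNgt; apply/negP => h; apply: nc.
have := exprn_gt0 2 (rd_gt0 K p); move: h; rewrite /cballK /= /sq; move: (sqn _) (rd K p ^+ 2) => u v; lra.
Qed.

Lemma csb_compact p : compact (csb p).
Proof. exact: subclosed_compact (@csb_closed p) (@cb_compact _ _ _ K p) (fun x h => cl_cb (csb_cl h)). Qed.

Lemma csb_center p : csb p (crd p p). Proof. apply: ltW; exact: sb_center. Qed.

Let lt_mul p F phi : smooth_on (U p) F -> lt p phi -> lt p (fun x => phi x * F x).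
Proof. by move=> sF [sp z]; split; [exact: smooth_mul (oU p) sp sF|move=> x nb; rewrite z ?mul0r]. Qed.

Lemma be_lt p : lt p (be p).
Proof. by split; [exact: (be_tst p).1|move=> x nc; apply: (be_tst p).2 => /csb_cl]. Qed.

Lemma be_off p s : ~ nb2 p s -> ext p (be p) s = 0.
Proof.
move=> nn; rewrite /ext0; case: ifP => // /asboolP d; apply: bmp_off; rewrite leNgt; apply/negP => h.
by apply: nn; split.
Qed.

(** Averages over the coordinate cube, such as Fourier coefficients, become means against a smooth
    function once the density is divided out; this is legitimate where the cut-off [be] lives, since
    [dn] is positive there. *)
Lemma av_rep p h : smooth_on (U p) h -> exists2 psi, smooth K psi &
 forall f, smooth K f -> av p (fun x => be p x * loc p f x * h x) = mu (fun s => f s * psi s).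
Proof.
move=> sh; pose F x := h x / dn p x.
have sF : smooth_on (tb p) F.
 apply: smooth_mul (@tb_open _ _ _ K p) (smooth_sub (@tbU p) sh) _.
 apply: smooth_inv (@tb_open _ _ _ K p) _ (smooth_sub (@tbU p) (@sdn p)) => x tx.
 by rewrite gt_eqF // dn_pos.
have sb' : smooth K (ext p (be p)) := ext_smooth hM (lt_tsp (be_lt p)).
have b0 := @be_off p.
have lT := lt_tcut sb' b0 sF.
exists (ext p (tcut p (ext p (be p)) F)); first exact: (ext_smooth hM (lt_tsp lT)).
move=> f sf.
have lf : lt p (fun x => tcut p (ext p (be p)) F x * loc p f x) by apply: lt_mul.
have -> : (fun s => f s * ext p (tcut p (ext p (be p)) F) s) = ext p (fun x => tcut p (ext p (be p)) F x * loc p f x).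
 apply/funext => s; rewrite /ext0; case: ifP => [/asboolP d|_]; last by rewrite mulr0.
 by rewrite (loc_crd _ d) mulrC.
rewrite (dn_int hM mmu lf); apply: (avg_ext (side_gt0 K p)) => x /cube_U Ux.
rewrite /tcut; case: ifP => [/asboolP tx|/asboolP nt]; last first.
 by rewrite mul0r mulr0 (be_tst p).2 ?mul0r // => /csb_tb.
have d0 : dn p x != 0 by rewrite gt_eqF // dn_pos.
by rewrite loc_ext // /F; move: (be p x) (h x) (loc p f x) => u v w; field.
Qed.

(** On the support of [be] the density, the wider cut-off [et] and the inverse metric are bounded
    below by positive constants [d0], [e0] and [c]; they convert the coordinate Dirichlet integral
    into the intrinsic energy. *)
Lemma grad_bound p : exists2 C : R, 0 <= C & forall f, smooth K f ->
 \sum_a av p (fun x => partial a (fun y => be p y * loc p f y) x ^+ 2) <= C * mu (fun s => f s * f s + ipM f f s).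
Proof.
have cA := @csb_compact p; have L := side_gt0 K p.
have [d0 d0p Hd] := compact_pos cA (@csb_center p) (fun x h => smooth_cont (@sdn p) (csb_U h))
 (fun x h => dn_pos hM hK hC mmu (csb_tb h)).
have et_pos x : csb p x -> 0 < et p x.
 move=> h; apply: bmp_pos; have := exprn_gt0 2 (rd_gt0 K p); move: h; rewrite /csballK /= /sq; move: (sqn _) (rd K p ^+ 2) => u v; lra.
have [e0 e0p He] := compact_pos cA (@csb_center p) (fun x h => smooth_cont (et_lt p).1 (csb_U h)) et_pos.
have pG x (v : 'rV[R]_m) : csb p x -> v != 0 -> 0 < \sum_a \sum_b ig p x a b * v 0 a * v 0 b.
 move=> /csb_U Ux v0; have := @invmx_pos _ _ (gmx K p x) (gmx_sym Ux) (gmx_hermitian Ux) (fun v => gmx_pos Ux) v v0; by rewrite quadE.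
have [c c0 Hc] := posdef_lower cA (fun a b x h => smooth_cont (@sigx p a b) (csb_U h)) pG.
have [B B0 HB] := continuous_bounded_on cA (fun x h => smooth_cont (be_lt p).1 (csb_U h)).
have sD : smooth_on (U p) (fun x => \sum_a partial a (be p) x * partial a (be p) x).
 by apply: smooth_sum (oU p) _ => a _; apply: smooth_mul (oU p) _ _; apply: smooth_partial; exact: (be_lt p).1.
have [D D0 HD] := continuous_bounded_on cA (fun x h => smooth_cont sD (csb_U h)).
pose C1 := 2 * D + 2 * B ^+ 2 / c.
have C10 : 0 <= C1 by apply: addr_ge0; [exact: mulr_ge0|apply: divr_ge0 (ltW c0); apply: mulr_ge0 => //; exact: exprn_ge0].
have de0 : 0 < d0 * e0 := mulr_gt0 d0p e0p.
have CC : 0 <= C1 / (d0 * e0) := divr_ge0 C10 (ltW de0).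
exists (C1 / (d0 * e0)); first exact: CC.
move=> f sf; have sl : smooth_on (U p) (loc p f) by exact: sf.
pose q s := f s * f s + ipM f f s.
have sq' : smooth K q := sm_add (sm_mul sf sf) (sm_ip sf sf).
have slq : smooth_on (U p) (loc p q) by exact: sq'.
have q0 s : 0 <= q s by rewrite /q addr_ge0 ?ipM_ge0 // -expr2 sqr_ge0.
have le1 : lt p (fun x => et p x * loc p q x) by exact: lt_mul slq (et_lt p).
have tphi : tst (U p) (csb p) (fun y => be p y * loc p f y).
 by split; [exact: smooth_mul (oU p) (be_tst p).1 sl|move=> x nc; rewrite (be_tst p).2 // mul0r].
have sp a : smooth_on (U p) (partial a (fun y => be p y * loc p f y)) by apply: smooth_partial; exact: tphi.1.
have b1 a : bdq (corner K p) (side K p) (fun x => partial a (fun y => be p y * loc p f y) x ^+ 2).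
 by apply: lt_bdq; exact: (smooth_mul (oU p) (sp a) (sp a)).
rewrite -(avg_sum L) //.
have sdn2 : smooth_on (U p) (fun x => dn p x * (et p x * loc p q x)) := smooth_mul (oU p) (@sdn p) le1.1.
have step : mu (ext p (fun x => et p x * loc p q x)) <= mu q.
 apply: mean_le => // [|s]; first exact: (ext_smooth hM (lt_tsp le1)).
 rewrite /ext0; case: ifP => // /asboolP d; rewrite (loc_crd _ d); apply: ler_piMl => //; exact: bump_le1.
apply: (@le_trans _ _ (C1 / (d0 * e0) * mu (ext p (fun x => et p x * loc p q x)))); last first.
 exact: ler_wpM2l CC _ _ step.
rewrite (dn_int hM mmu le1) -(avgZ L); last exact: lt_bdq.
apply: (avg_le L); [by apply: bdq_sum => a|by apply: lt_bdq; exact: smooth_scale (oU p) sdn2|].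
move=> x /cube_U Ux; have [cx|nc] := pselect (csb p x); last first.
 rewrite big1 => [|a _]; last by rewrite (tst_partial (@csb_closed p) a tphi).2 // expr0n.
 have [/tb_bl bx|nt] := pselect (tb p x).
  apply: mulr_ge0 CC _; apply: mulr_ge0; first exact: dn_ge0.
  apply: mulr_ge0 (bump_ge0 _) (q0 _).
 rewrite [et p x]bmp_off ?mul0r ?mulr0 // leNgt; apply/negP => h; apply: nt.
 have := exprn_gt0 2 (rd_gt0 K p); move: h; rewrite /tballK /= /sq; move: (sqn _) (rd K p ^+ 2) => u v; lra.
have [e dd] := coordVK Ux.
pose v := grad (loc p f) x.
have qE : loc p q x = loc p f x * loc p f x + (v *m ig p x *m v^T) 0 0.
 by rewrite /loc_fun /= /q (ipM_patch sf sf dd) e.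
have vG : c * sqn v <= (v *m ig p x *m v^T) 0 0.
 by apply: le_trans (Hc x v cx) _; rewrite quadE.
have gE : \sum_a partial a (fun y => be p y * loc p f y) x ^+ 2 <= 2 * D * loc p f x ^+ 2 + 2 * B ^+ 2 * sqn v.
 apply: (@le_trans _ _ (2 * loc p f x ^+ 2 * (\sum_a partial a (be p) x * partial a (be p) x) + 2 * be p x ^+ 2 * sqn v)).
  rewrite /sqn !mulr_sumr -big_split; apply: ler_sum => a _ /=; rewrite (smooth_partialM a (be_tst p).1 sl Ux) [v 0 a]mxE.
  have key (x1 x2 x3 x4 : R) : (x1 * x4 + x3 * x2) ^+ 2 <= 2 * x4 ^+ 2 * (x1 * x1) + 2 * x3 ^+ 2 * x2 ^+ 2.
   rewrite -subr_ge0 [leRHS](_ : _ = (x1 * x4 - x3 * x2) ^+ 2) ?sqr_ge0 //; ring.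
  exact: key.
 apply: lerD; first by rewrite -mulrA -[leRHS]mulrA ler_wpM2l // mulrC ler_wpM2r ?sqr_ge0 // (le_trans (ler_norm _)) // HD.
 rewrite ler_wpM2r ?sqn_ge0 // ler_wpM2l // -[leLHS]real_normK ?num_real // ler_sqr ?nnegrE ?HB //.
apply: le_trans gE _.
have f20 := sqr_ge0 (loc p f x); have s0 := sqn_ge0 v.
have h1 : 2 * D * loc p f x ^+ 2 + 2 * B ^+ 2 * sqn v <= C1 * loc p q x.
 rewrite qE /C1; have : 2 * B ^+ 2 * sqn v <= 2 * B ^+ 2 / c * (v *m ig p x *m v^T) 0 0.
  have key (k0 S w : R) : 0 <= k0 -> c * S <= w -> k0 * S <= k0 / c * w.
   by move=> k00 h; rewrite -mulrA ler_wpM2l // ler_pdivlMl.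
  by apply: key => //; apply: mulr_ge0 => //; exact: exprn_ge0.
 have i0 : 0 <= (v *m ig p x *m v^T) 0 0 by apply: le_trans vG; rewrite mulr_ge0 // ltW.
 have c2 : 0 <= 2 * B ^+ 2 / c by apply: divr_ge0 (ltW c0); apply: mulr_ge0 => //; exact: exprn_ge0.
 move: (2 * B ^+ 2 / c) c2 (_ *m _) i0 (2 * B ^+ 2 * _) => k2 k20 w w0 k3 l1.
 have := mulr_ge0 D0 w0; have := mulr_ge0 k20 f20; rewrite -expr2 mulrDl !mulrDr; move: (loc p f x ^+ 2) => z; lra.
apply: le_trans h1 _.
have de : d0 * e0 <= dn p x * et p x by apply: ler_pM; rewrite ?(ltW d0p) ?(ltW e0p) ?Hd ?He.
have key (k0 z d y : R) : 0 <= k0 -> 0 < d -> 0 <= z -> d <= y -> k0 * z <= k0 / d * (y * z).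
 by move=> k00 dp z0 dy; rewrite -mulrA ler_wpM2l // ler_pdivlMl // ler_wpM2r.
by rewrite [dn p x * _]mulrA; apply: key => //; exact: q0.
Qed.

(** Compactness of the energy norm over the $L^2$ norm weighted by [h], stated without sequences:
    finitely many linear functionals suffice up to a small multiple of the energy. The weight makes
    the property additive, so that [patch_ind] can assemble [rellich] from the patches. *)
Definition compact_form (h : M -> R) := forall e : R, 0 < e -> exists (I : finType) (psi : I -> M -> R),
 (forall i, smooth K (psi i)) /\ forall f, smooth K f ->
 mu (fun s => h s * (f s * f s)) <= \sum_i mu (fun s => f s * psi i s) ^+ 2 + e * mu (fun s => f s * f s + ipM f f s).

Lemma compact_patch p phi : lt p phi -> (forall s, ~ nb3 p s -> ext p phi s = 0) -> compact_form (ext p phi).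
Proof.
move=> lp off e ep; have L := side_gt0 K p.
have l3 x : ~ c3 p x -> phi x = 0.
 move=> nc; have [Ux|nU] := pselect (U p x); last by apply: lp.2 => /cl_cb/cb_U.
 have [ex d] := coordVK Ux; rewrite -[LHS](congr1 phi ex) -(ext_crd phi d); apply: off => -[_ /=]; rewrite ex => q.
 by apply: nc; exact: ltW q.
have [C0 C00 HC0] := continuous_bounded_on (@cube_compact _ _ (corner K p) (side K p))
 (fun x Qx => smooth_cont (smooth_mul (oU p) (@sdn p) lp.1) (cube_U Qx)).
pose b0 := bump (rd K p ^+ 2 / 512 : R).
have b0p : 0 < b0 by apply: bump_gt0; rewrite divr_gt0 ?ltr0n ?exprn_gt0 ?rd_gt0.
have be0 x : c3 p x -> b0 <= be p x.
 move=> h; apply: bump_le; move: h; rewrite /c3 /= /sq; move: (sqn _) (rd K p ^+ 2) => u v; lra.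
pose C1 := C0 / b0 ^+ 2.
have C10 : 0 <= C1 by apply: divr_ge0 C00 _; apply: exprn_ge0; exact: ltW.
have [C2 C20 HC2] := grad_bound p.
have fq0 : 0 < freq (side K p) by exact: freq_gt0.
have [N N0 HN] : exists2 N : nat, (0 < N)%N & C1 * ((freq (side K p) * N%:R) ^- 2 * C2) <= e.
 pose t := C1 * C2 / (freq (side K p) ^+ 2 * e).
 have t0 : 0 <= t by apply: divr_ge0; [exact: mulr_ge0|apply: mulr_ge0 (ltW ep); apply: exprn_ge0; exact: ltW].
 exists (Num.bound t).+1 => //; set N := (_.+1).
 have tN : t < N%:R by apply: lt_le_trans (archi_boundP t0) _; rewrite ler_nat.
 have N1 : 1 <= N%:R :> R by rewrite ler1n.
 have f2 : 0 < freq (side K p) ^+ 2 by exact: exprn_gt0.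
 have h1 : C1 * C2 <= N%:R ^+ 2 * (freq (side K p) ^+ 2 * e).
  have h0 : t <= N%:R ^+ 2.
   by apply: le_trans (ltW tN) _; rewrite expr2 ler_peMl //; exact: le_trans ler01 N1.
  by move: h0; rewrite /t ler_pdivrMr // mulr_gt0.
 have -> : C1 * ((freq (side K p) * N%:R) ^- 2 * C2) = C1 * C2 / (freq (side K p) * N%:R) ^+ 2 by move: (_ ^- 2) => z; ring.
 have den : 0 < (freq (side K p) * N%:R) ^+ 2 by apply: exprn_gt0; exact: mulr_gt0 fq0 (lt_le_trans ltr01 N1).
 rewrite ler_pdivrMr //; apply: (le_trans h1).
 have comb (a b c : R) : a ^+ 2 * (b ^+ 2 * c) <= c * (b * a) ^+ 2.
  by rewrite exprMn le_eqVlt; apply/orP; left; apply/eqP; ring.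
 exact: comb.
pose I0 : finType := {ffun 'I_m -> 'I_(N + N).+1}.
have exc (i : I0) := @av_rep p (fun x => cos (phase (corner K p) (side K p) (kbox i) x)) (smooth_cos (oU p) (smooth_th _ _ _ (oU p))).
have exs (i : I0) := @av_rep p (fun x => sin (phase (corner K p) (side K p) (kbox i) x)) (smooth_sin (oU p) (smooth_th _ _ _ (oU p))).
pose pc i := s2val (cid2 (exc i)); pose ps i := s2val (cid2 (exs i)).
have spc i : smooth K (pc i) by rewrite /pc; case: cid2.
have sps i : smooth K (ps i) by rewrite /ps; case: cid2.
have Hpc i f : smooth K f -> cco (corner K p) (side K p) (fun x => be p x * loc p f x) (kbox i) = mu (fun s => f s * pc i s).
 by rewrite /pc; case: cid2 => psi s1 H /= sf; exact: H.
have Hps i f : smooth K f -> sco (corner K p) (side K p) (fun x => be p x * loc p f x) (kbox i) = mu (fun s => f s * ps i s).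
 by rewrite /ps; case: cid2 => psi s1 H /= sf; exact: H.
(* The constant is moved into the functionals; as they are squared, a factor with $C_1\le k^2$ is
   wanted. *)
pose k := 1 + C1; have k1 : C1 <= k ^+ 2 by rewrite /k; nra.
exists (I0 + I0)%type, (fun i => match i with inl i => fun s => k * pc i s | inr i => fun s => k * ps i s end); split.
 by case=> i; exact: sm_scale.
move=> f sf; have sl : smooth_on (U p) (loc p f) by exact: sf.
pose ph x := be p x * loc p f x.
have sph : smooth_on (U p) ph by exact: (smooth_mul (oU p) (be_lt p).1 sl).
have lf : lt p (fun x => phi x * (loc p f x * loc p f x)) by exact: (lt_mul (smooth_mul (oU p) sl sl) lp).
have -> : (fun s => ext p phi s * (f s * f s)) = ext p (fun x => phi x * (loc p f x * loc p f x)).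
 by apply/funext => s; rewrite /ext0; case: ifP => [/asboolP d|_]; rewrite ?mul0r // (loc_crd _ d).
rewrite (dn_int hM mmu lf); apply: (@le_trans _ _ (C1 * av p (fun x => ph x ^+ 2))).
 rewrite -(avgZ L); last by apply: lt_bdq; exact: (smooth_mul (oU p) sph sph).
 apply: (avg_le L).
 - by apply: lt_bdq; exact: (smooth_mul (oU p) (@sdn p) lf.1).
 - by apply: lt_bdq; exact: (smooth_scale _ (oU p) (smooth_mul (oU p) sph sph)).
 move=> x Qx; have [cx|nc] := pselect (c3 p x); last by rewrite l3 // mul0r mulr0 mulr_ge0 // sqr_ge0.
 have h1 : dn p x * phi x <= C0 by exact: le_trans (ler_norm _) (HC0 x Qx).
 rewrite mulrA /ph exprMn; apply: (@le_trans _ _ (C0 * loc p f x ^+ 2)).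
  by rewrite -expr2 ler_wpM2r // sqr_ge0.
 have bb : b0 ^+ 2 <= be p x ^+ 2 by rewrite ler_sqr ?nnegrE ?be0 ?(ltW b0p) // bump_ge0.
 have key (k0 z d y : R) : 0 <= k0 -> 0 < d -> 0 <= z -> d <= y -> k0 * z <= k0 / d * (y * z).
  by move=> k00 dp z0 dy; rewrite -mulrA ler_wpM2l // ler_pdivlMl // ler_wpM2r.
 by apply: key => //; [exact: exprn_gt0|exact: sqr_ge0].
have bph : bdy0 (corner K p) (side K p) ph.
 by apply: lt_bdy => x nc; rewrite /ph (be_lt p).2 // mul0r.
have Re := rellich_cube L (oU p) (@cube_U _ _ _ K p) sph bph N0.
apply: le_trans (ler_wpM2l C10 Re) _; rewrite mulrDr; apply: lerD.
 rewrite big_sumType /= -big_split mulr_sumr; apply: ler_sum => i _ /=.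
 rewrite /wco (Hpc i f sf) (Hps i f sf).
 have kz psi : smooth K psi -> mu (fun s => f s * (k * psi s)) = k * mu (fun s => f s * psi s).
  move=> spsi; rewrite -(muZ _ (sm_mul sf spsi)); congr mu; apply/funext => s; ring.
 rewrite (kz _ (spc i)) (kz _ (sps i)) !exprMn -mulrDr; apply: ler_wpM2r k1; apply: addr_ge0; exact: sqr_ge0.
have q0 : 0 <= mu (fun s => f s * f s + ipM f f s).
 apply: mup => [|s]; first exact: sm_add (sm_mul sf sf) (sm_ip sf sf).
 by rewrite addr_ge0 ?ipM_ge0 // -expr2 sqr_ge0.
have key (k0 r c S z : R) : 0 <= k0 -> 0 <= r -> S <= c * z -> k0 * (r * S) <= k0 * (r * c) * z.
 by move=> k00 r0 h; rewrite -!mulrA; do 2!apply: ler_wpM2l => //.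
apply: le_trans (ler_wpM2r q0 HN); apply: key C10 _ (HC2 f sf).
by rewrite invr_ge0; apply: exprn_ge0; apply: mulr_ge0 => //; exact: ltW.
Qed.

Lemma rellich : compact_form (fun=> 1).
Proof.
have mu0 : mu (fun=> 0) = 0 by have := muZ 0 (sm_cst K 1); rewrite !mul0r.
have q0 f : smooth K f -> 0 <= mu (fun s => f s * f s + ipM f f s).
 move=> sf; apply: mup => [|s]; first exact: sm_add (sm_mul sf sf) (sm_ip sf sf).
 by rewrite addr_ge0 ?ipM_ge0 // -expr2 sqr_ge0.
apply: (patch_ind hM hK (nb3_open) (nb3_center) (Pr := compact_form)) (sm_cst K 1).
- move=> e ep; exists 'I_0, (fun _ _ => 0); split=> [[]//|f sf].
 rewrite big_ord0 add0r (_ : (fun s => 0 * _) = (fun=> 0)) ?mu0; first by rewrite mulr_ge0 ?q0 // ltW.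
 by apply/funext => s; rewrite mul0r.
- move=> h1 h2 sh1 sh2 c1 c2 e ep; have e2 : 0 < e / 2 by rewrite divr_gt0.
 have [I1 [p1 [sp1 H1]]] := c1 _ e2; have [I2 [p2 [sp2 H2]]] := c2 _ e2.
 exists (I1 + I2)%type, (fun i => match i with inl i => p1 i | inr i => p2 i end); split; first by case.
 move=> f sf; have sff := sm_mul sf sf.
 rewrite (_ : (fun s => _) = (fun s => h1 s * (f s * f s) + h2 s * (f s * f s))); last by apply/funext => s; rewrite mulrDl.
 rewrite (muD (sm_mul sh1 sff) (sm_mul sh2 sff)) big_sumType /=.
 have := H1 f sf; have := H2 f sf; move: (mu _) (mu _) (mu _) (\sum_i _) (\sum_i _) => a b c d g; lra.
- by move=> r phi lp off; exact: compact_patch.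
Qed.

(** * The spectral gap *)

Variable r0 : M.

Let mu1 : mu (fun=> 1) = 1. Proof. by have [_ _ _ H _] := mmu. Qed.
Let mu0 : mu (fun=> 0) = 0. Proof. by have := muZ 0 (sm_cst K 1); rewrite !mul0r. Qed.
Let msym f psi : smooth K f -> smooth K psi -> mu (fun s => f s * lapM psi s) = - mu (fun s => ipM f psi s).
Proof.
move=> sf sp; have := mean_sym sf sp.
rewrite (muD (sm_mul sf (sm_lap sp)) (sm_ip sf sp)); move: (mu _) (mu _) => a b; lra.
Qed.

Section Functional.
Variables (nu B : R) (T : (M -> R) -> R).
Hypothesis TD : forall f g, smooth K f -> smooth K g -> T (fun r => f r + g r) = T f + T g.
Hypothesis TZ : forall (c : R) f, smooth K f -> T (fun r => c * f r) = c * T f.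
Hypothesis TB : forall f (C : R), smooth K f -> (forall r, `|f r| <= C) -> `|T f| <= B * C.
Hypothesis Tnu : forall f, smooth K f -> T (fun r => lapM f r + nu * f r) = 0.

(** In each chart the smooth function is the quotient of the density of [T] by the density of the
    mean; [patch_ind] adds the pieces up. *)
Lemma represent : exists2 F, smooth K F & forall f, smooth K f -> T f = mu (fun s => f s * F s).
Proof.
have T0 : T (fun=> 0) = 0 by have := TZ 0 (sm_cst K 1); rewrite !mul0r.
suff [F sF H] : exists2 F, smooth K F & forall f, smooth K f -> T (fun s => 1 * f s) = mu (fun s => f s * F s).
 by exists F => // f sf; rewrite -H //; congr T; apply/funext => s; rewrite mul1r.
apply: (patch_ind hM hK (@nb2_open) (@nb2_center) (Pr := fun h => exists2 F, smooth K F &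
 forall f, smooth K f -> T (fun s => h s * f s) = mu (fun s => f s * F s))) (sm_cst K 1).
- exists (fun=> 0) => [|f sf]; first exact: sm_cst.
 by apply: etrans _ (etrans (etrans T0 (esym mu0)) _); [congr T|congr mu]; apply/funext => s; rewrite ?mul0r ?mulr0.
- move=> h1 h2 s1 s2 [F1 sF1 H1] [F2 sF2 H2]; exists (fun s => F1 s + F2 s); first exact: sm_add.
 move=> f sf; have e : T (fun s => h1 s * f s + h2 s * f s) = mu (fun s => f s * F1 s + f s * F2 s).
  by rewrite (TD (sm_mul s1 sf) (sm_mul s2 sf)) (muD (sm_mul sf sF1) (sm_mul sf sF2)) H1 // H2.
 by apply: etrans _ (etrans e _); [congr T|congr mu]; apply/funext => s; rewrite ?mulrDl ?mulrDr.
move=> r phi lp off; have [w sw H] := @density R n M K hM nu B T TD TZ TB Tnu r.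
pose G x := w x / dn r x.
have sG : smooth_on (tb r) G.
 apply: smooth_mul (@tb_open _ _ _ K r) (smooth_sub (@subsetT _ _) sw) _.
 apply: smooth_inv (@tb_open _ _ _ K r) _ (smooth_sub (@tbU r) (@sdn r)) => x tx.
 by rewrite gt_eqF // dn_pos.
have lT := lt_tcut (ext_smooth hM (lt_tsp lp)) off sG.
exists (ext r (tcut r (ext r phi) G)); first exact: (ext_smooth hM (lt_tsp lT)).
move=> f sf; have sl : smooth_on (U r) (loc r f) by exact: sf.
have E psi : (fun s => ext r psi s * f s) = ext r (fun x => psi x * loc r f x).
 by apply/funext => s; rewrite /ext0; case: ifP => [/asboolP d|_]; rewrite ?mul0r // (loc_crd _ d).
rewrite E (H _ (lt_mul sl lp)).
have -> : (fun s => f s * ext r (tcut r (ext r phi) G) s) = ext r (fun x => tcut r (ext r phi) G x * loc r f x).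
 by rewrite -E; apply/funext => s; rewrite mulrC.
rewrite (dn_int hM mmu (lt_mul sl lT)); apply: (avg_ext (side_gt0 K r)) => x /cube_U Ux.
rewrite /tcut; case: ifP => [/asboolP tx|/asboolP nt]; last first.
 rewrite mul0r mulr0 -[phi x](loc_ext phi Ux) /loc_fun /= off ?mul0r ?mulr0 // => -[_].
 by have [-> _] := coordVK Ux => /sb_tb.
have d0 : dn r x != 0 by rewrite gt_eqF // dn_pos.
by rewrite loc_ext // /G; move: (w x) (phi x) (loc r f x) (dn r x) d0 => u v z d d0; field.
Qed.

End Functional.

Lemma grad0_line (V : set 'rV[R]_m) f x v : open V -> smooth_on V f -> (forall t, 0 <= t <= 1 -> V (x + t *: v)) ->
 (forall y, V y -> grad f y = 0) -> f (x + v) = f x.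
Proof.
move=> oV sf inV g0; have [|t _] := @MVT_line R _ f x v (fun=> 0); last by move/eqP; rewrite subr_eq0 => /eqP.
move=> t t01; have Vy := inV _ t01; set y := x + t *: v in Vy *; apply/is_derive_line0.
have e0 : 0 = \sum_a v 0 a * partial a f y.
 rewrite big1 // => a _; have := congr1 (fun w : 'rV[R]_m => w 0 a) (g0 y Vy); rewrite !mxE => ->; exact: mulr0.
rewrite [X in is_derive _ _ _ X]e0; apply: (@is_derive_chain R m f (fun w : R => y + w *: v) 0).
 by rewrite scale0r addr0 => e ep; apply: smooth_approx oV Vy sf ep.
move=> a; have -> : (fun w : R => (y + w *: v) 0 a) = (fun w => y 0 a + w * v 0 a).
 by apply/funext => w; rewrite !mxE.
rewrite -[X in is_derive _ _ _ X]add0r.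
by apply: (@is_deriveD R R R (cst (y 0 a)) (fun w => w * v 0 a)); exact: is_derive_mulc.
Qed.

Lemma gradient0_cst u r s : smooth K u -> (forall t, ipM u u t = 0) -> u s = u r.
Proof.
move=> su u0; have near0 p t : nb K p t -> u t = u p.
 move=> [d tt]; have dp := chart_at_dom K p; rewrite -(loc_crd u d) -(loc_crd u dp).
 have -> : crd p t = crd p p + (crd p t - crd p p) by rewrite addrC subrK.
 have sl : smooth_on (U p) (loc p u) by exact: su.
 apply: (grad0_line (oU p) sl) => [z /andP[z0 z1]|y Uy].
  apply: rd_U; rewrite addrC addKr normrZ (ger0_norm z0) -[leRHS]mul1r ler_pM //.
  apply: rV_norm_le => [|a]; first exact: ltW (rd_gt0 K p).
  by rewrite !mxE; apply: ltW; apply: cb_coord; exact: bl_cb (tb_bl tt).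
 have [e dy] := coordVK Uy; have := u0 (crv p y); rewrite (ipM_patch su su dy) e => h.
 apply/eqP; apply: contraT => ne.
 have := invmx_pos (gmx_sym Uy) (gmx_hermitian Uy) (fun v : 'rV[R]_m => @gmx_pos _ _ _ K p _ v Uy) ne.
 by rewrite h ltxx.
have all : [set t | u t = u r] = [set: M].
 apply: hC; first by exists r.
 - exists [set t | u t = u r]; last by rewrite setTI.
  rewrite openE => t ut; apply: filterS (open_nbhs_nbhs (conj (@nb_open _ _ _ K t) (@nb_center _ _ _ K t))) => z /near0.
  by rewrite /= ut.
 - exists [set t | u t = u r]; last by rewrite setTI.
  move=> t ct; have [z [uz nz]] := ct _ (open_nbhs_nbhs (conj (@nb_open _ _ _ K t) (@nb_center _ _ _ K t))).
  by rewrite /= -(near0 _ _ nz).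
by have : [set: M] s by []; rewrite -all.
Qed.

Lemma quadratic_zero (b c : R) : (forall t, 0 <= t * b + t ^+ 2 * c) -> b = 0.
Proof.
move=> H; apply/eqP; apply: contraT => b0.
have c0 : 0 < `|c| + 1 by rewrite ltr_wpDl.
(* For this value of [t] the linear term outweighs the quadratic one whatever the sign of [c]. *)
have := H (- b / (`|c| + 1)); have b2 : 0 < b ^+ 2 by rewrite exprn_even_gt0.
have k1 : 0 < (`|c| + 1)^-1 by rewrite invr_gt0.
have -> : - b / (`|c| + 1) * b + (- b / (`|c| + 1)) ^+ 2 * c = - b ^+ 2 * (`|c| + 1)^-1 * (1 - c * (`|c| + 1)^-1) by ring.
have cc : c * (`|c| + 1)^-1 < 1.
 by rewrite ltr_pdivrMr // mul1r (le_lt_trans (ler_norm c)) // ltrDl.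
rewrite leNgt; move/negP; case.
by rewrite !mulNr oppr_lt0 mulr_gt0 ?subr_gt0 // mulr_gt0.
Qed.

Let ipsc c g : smooth K g -> (fun s => ipM (fun t => c * g t) (fun t => c * g t) s) = (fun s => c ^+ 2 * ipM g g s).
Proof. by move=> sg; apply/funext => s; rewrite (ipMZl c _ s sg) ipMC (ipMZl c _ s sg) mulrA expr2. Qed.

Let mu_quad t a b c : smooth K a -> smooth K b -> smooth K c ->
 mu (fun s => a s + 2 * t * b s + t ^+ 2 * c s) = mu a + 2 * t * mu b + t ^+ 2 * mu c.
Proof.
move=> sa sb' sc; have s2 := sm_scale (2 * t) sb'; have s3 := sm_scale (t ^+ 2) sc.
by rewrite (muD (sm_add sa s2) s3) (muD sa s2) (muZ _ sb') (muZ _ sc).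
Qed.

(** If the inequality failed, the infimum [nu] of the Rayleigh quotient over functions of mean 0
    would lie below $2l$, and [nu / 2] would be an eigenvalue of [box] that is forbidden, or
    zero. *)
Lemma gap l f : (forall nu, eigenvalue_box K nu -> nu != 0 -> l <= nu) -> smooth K f -> mu f = 0 ->
 2 * l * mu (fun s => f s * f s) <= mu (fun s => ipM f f s).
Proof.
move=> hl sf f0; rewrite leNgt; apply/negP => flt.
pose L g := mu (fun s => g s * g s); pose E g := mu (fun s => ipM g g s).
have L0 g : smooth K g -> 0 <= L g by move=> sg; apply: mup => [|s]; [exact: sm_mul|exact: sqr_ge0].
have E0 g : smooth K g -> 0 <= E g by move=> sg; apply: mup => [|s]; [exact: sm_ip|exact: ipM_ge0].
pose C g := [/\ smooth K g, mu g = 0 & L g = 1].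
have nrm g : smooth K g -> mu g = 0 -> 0 < L g -> exists2 h, C h & E h = E g / L g.
 move=> sg g0 Lg; pose c := (Num.sqrt (L g))^-1.
 have c2 : c ^+ 2 = (L g)^-1 by rewrite exprVn sqr_sqrtr ?ltW.
 exists (fun s => c * g s); last by rewrite /E ipsc // (muZ _ (sm_ip sg sg)) c2 mulrC.
 split; [exact: sm_scale|by rewrite muZ // g0 mulr0|].
 rewrite /L (_ : (fun s => _) = (fun s => c ^+ 2 * (g s * g s))); last by apply/funext => s; ring.
 by rewrite (muZ _ (sm_mul sg sg)) c2 mulVf // gt_eqF.
have Lf : 0 < L f.
 rewrite lt0r L0 // andbT; apply/eqP => e; have := E0 _ sf; move: flt; rewrite -/(L f) -/(E f) e mulr0.
 by move=> h1 h2; have := le_lt_trans h2 h1; rewrite ltxx.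
pose A : set R := [set E g | g in C].
have [f1 Cf1 Ef1] := nrm _ sf f0 Lf.
have Alb : lbound A 0 by move=> _ [g [sg _ _] <-]; exact: E0.
have hA : has_inf A by split; [exists (E f1); exists f1|exists 0].
pose nu := inf A.
have nu0 : 0 <= nu by apply: lb_le_inf Alb; exact: hA.1.
have nul : nu < 2 * l.
 apply: (@le_lt_trans _ _ (E f1)); first by apply: ge_inf => //; [exact: hA.2|exists f1].
 by rewrite Ef1 ltr_pdivrMr.
have low g : smooth K g -> mu g = 0 -> nu * L g <= E g.
 move=> sg g0; have [Lg|] := ltP 0 (L g); last first.
  move=> h; have -> : L g = 0 by apply/eqP; rewrite eq_le h L0.
  by rewrite mulr0 E0.
 have [h Ch Eh] := nrm _ sg g0 Lg.
 have : nu <= E h by apply: ge_inf => //; [exact: hA.2|exists h].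
 by rewrite Eh ler_pdivlMr.
have ex j : exists g, C g /\ E g < nu + j.+1%:R^-1.
 have j0 : 0 < j.+1%:R^-1 :> R by rewrite invr_gt0 ltr0n.
 by have [_ [h1 Ch1 <-] h2] := inf_adherent j0 hA; exists h1.
pose F j := projT1 (cid (ex j)).
have FP j : C (F j) /\ E (F j) < nu + j.+1%:R^-1 by rewrite /F; case: cid.
have sF j : smooth K (F j) by have [[]] := FP j.
have bd phi (c : R) j : smooth K phi -> (forall r, `|phi r| <= c) -> `|mu (fun s => F j s * phi s)| <= c.
 move=> sp pc; have [[_ _ LF] _] := FP j.
 have LF' : mu (fun s => F j s * F j s) = 1 by exact: LF.
 have sFF := sm_mul (sF j) (sF j); have sq' := sm_scale (c / 2) (sm_add (sm_cst K 1) sFF).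
 have e : mu (fun s => c / 2 * (1 + F j s * F j s)) = c.
  by rewrite (muZ _ (sm_add (sm_cst K 1) sFF)) (muD (sm_cst K 1) sFF) mu1 LF'; field.
 (* In place of Cauchy-Schwarz: $|xy|\le\frac c2(1+x^2)$, where $x$ is a value of [F j], whose
    square has mean 1. *)
 have key (x y : R) : `|y| <= c -> - (c / 2 * (1 + x * x)) <= x * y /\ x * y <= c / 2 * (1 + x * x).
  rewrite ler_norml => /andP[h1 h2]; have p1 : 0 <= c + y by lra.
  have p2 : 0 <= c - y by lra.
  have q1 := mulr_ge0 p1 (sqr_ge0 (1 + x)); have q2 := mulr_ge0 p1 (sqr_ge0 (1 - x)).
  have q3 := mulr_ge0 p2 (sqr_ge0 (1 + x)); have q4 := mulr_ge0 p2 (sqr_ge0 (1 - x)).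
  by split; move: q1 q2 q3 q4; lra.
 rewrite ler_norml; apply/andP; split; last first.
  rewrite -[leRHS]e; apply: (mean_le (sm_mul (sF j) sp) sq') => s; exact: (key (F j s) (phi s) (pc s)).2.
 have -> : - c = mu (fun s => -1 * (c / 2 * (1 + F j s * F j s))) by rewrite (muZ _ sq') e mulN1r.
 apply: (mean_le (sm_scale (-1) sq') (sm_mul (sF j) sp)) => s; rewrite mulN1r; exact: (key (F j s) (phi s) (pc s)).1.
have bdsF phi : smooth K phi -> bds (fun j => mu (fun s => F j s * phi s)).
 by move=> sp; have [c _ pc] := sm_bounded hK r0 sp; exists c => j; exact: bd.
pose T phi := ulim (fun j => mu (fun s => F j s * phi s)).
have TD g h : smooth K g -> smooth K h -> T (fun s => g s + h s) = T g + T h.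
 move=> sg sh; rewrite /T -ulimD; [congr ulim|exact: bdsF|exact: bdsF].
 apply/funext => j; rewrite -(muD (sm_mul (sF j) sg) (sm_mul (sF j) sh)); congr mu; apply/funext => s; exact: mulrDr.
have TZ c g : smooth K g -> T (fun s => c * g s) = c * T g.
 move=> sg; rewrite /T -ulimZ; [congr ulim|exact: bdsF].
 apply/funext => j; rewrite -(muZ _ (sm_mul (sF j) sg)); congr mu; apply/funext => s; exact: mulrCA.
have TB g (c : R) : smooth K g -> (forall r, `|g r| <= c) -> `|T g| <= 1 * c.
 by move=> sg gc; rewrite mul1r; apply: ulim_norm_le => j; exact: bd.
have T1 : T (fun=> 1) = 0.
 rewrite -[RHS]ulim_cst; congr ulim; apply/funext => j; have [[_ h _] _] := FP j; rewrite -[RHS]h.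
 by congr mu; apply/funext => s; rewrite mulr1.
have harm : ulim (fun j => j.+1%:R^-1 : R) = 0 by apply: ulim_oo; exact: cvg_harmonic.
have bharm : bds (fun j => j.+1%:R^-1 : R).
 exists 1 => j; rewrite ger0_norm ?invr_ge0 // invf_le1 ?ltr0n // ler1n //.
(* The Euler-Lagrange equation in the limit. Minimality of [nu] along $F_j+tg$ holds up to the error
   $1/(j+1)$; after the ultralimit a quadratic polynomial in $t$ without constant term is
   nonnegative, so its linear coefficient vanishes. *)
have Tnu1 g : smooth K g -> mu g = 0 -> T (fun s => lapM g s + nu * g s) = 0.
 move=> sg g0; set h := fun s => lapM g s + nu * g s.
 have sh : smooth K h := sm_add (sm_lap sg) (sm_scale nu sg).
 have Q j t : 0 <= j.+1%:R^-1 + (- (2 * t) * mu (fun s => F j s * h s) + t ^+ 2 * (E g - nu * L g)).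
  have [[_ F0 LF] EF] := FP j; have stg := sm_scale t sg; have sG := sm_add (sF j) stg.
  have G0 : mu (fun s => F j s + t * g s) = 0 by rewrite (muD (sF j) stg) F0 (muZ _ sg) g0 mulr0 addr0.
  have := low _ sG G0.
  have -> : L (fun s => F j s + t * g s) = L (F j) + 2 * t * mu (fun s => F j s * g s) + t ^+ 2 * L g.
   rewrite /L -(mu_quad t (sm_mul (sF j) (sF j)) (sm_mul (sF j) sg) (sm_mul sg sg)).
   by congr mu; apply/funext => s; ring.
  have -> : E (fun s => F j s + t * g s) = E (F j) + 2 * t * mu (fun s => ipM (F j) g s) + t ^+ 2 * E g.
   rewrite /E -(mu_quad t (sm_ip (sF j) (sF j)) (sm_ip (sF j) sg) (sm_ip sg sg)).
   congr mu; apply/funext => s; rewrite (ipMDl _ s (sF j) stg) (ipMZl _ _ s sg).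
   by rewrite (ipMC K (F j) _) (ipMC K g (fun t0 => _)) !(ipMDl _ s (sF j) stg) !(ipMZl _ _ s sg) (ipMC K g (F j)); ring.
  rewrite LF.
  have -> : mu (fun s => F j s * h s) = - mu (fun s => ipM (F j) g s) + nu * mu (fun s => F j s * g s).
   rewrite -(msym (sF j) sg) -(muZ _ (sm_mul (sF j) sg)).
   rewrite -(muD (sm_mul (sF j) (sm_lap sg)) (sm_scale nu (sm_mul (sF j) sg))).
   by congr mu; apply/funext => s; rewrite /h; ring.
  move: (mu (fun s => ipM _ _ s)) (mu (fun s => F j s * g s)) (L g) (E g) (E (F j)) (j.+1%:R^-1) EF => a b c d e k1 He h1.
  by lra.
 have z : forall t, 0 <= t * (- 2 * T h) + t ^+ 2 * (E g - nu * L g).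
  move=> t; have b1 := bdsF _ sh; have b2 := bdsM (bds_cst (- (2 * t))) b1; have b3 := bdsD b2 (bds_cst (t ^+ 2 * (E g - nu * L g))).
  have := ulim_le (bds_cst 0) (bdsD bharm b3) (fun j => Q j t).
  rewrite ulim_cst (ulimD bharm b3) (ulimD b2 (bds_cst _)) ulim_cst (ulimZ _ b1) harm -/(T h).
  by move: (T h) (t ^+ 2 * _) => a b; lra.
 by have := quadratic_zero z; move: (T h) => a; lra.
(* The restriction to mean 0 is lifted by subtracting the mean of [g], since [T] vanishes on
   constants. *)
have Tnu g : smooth K g -> T (fun s => lapM g s + nu * g s) = 0.
 move=> sg; have sc := sm_cst K (- mu g); have sg' := sm_add sg sc.
 have g0 : mu (fun s => g s + - mu g) = 0.
  rewrite (muD sg sc) (_ : (fun=> - mu g) = (fun s : M => - mu g * 1)); last by apply/funext => s; rewrite mulr1.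
  by rewrite (muZ _ (sm_cst K 1)) mu1 mulr1 subrr.
 have s1 := sm_add (sm_lap sg) (sm_scale nu sg).
 have := Tnu1 _ sg' g0.
 rewrite (_ : (fun s => _) = (fun s => (lapM g s + nu * g s) + (- (nu * mu g)) * 1)); last first.
  by apply/funext => s; rewrite (lapMD s sg sc) lapM_cst; ring.
 by rewrite (TD _ _ s1 (sm_scale (- (nu * mu g)) (sm_cst K 1))) (TZ _ _ (sm_cst K 1)) T1 mulr0 addr0.
have [G sG TG] := represent TD TZ TB Tnu.
have G0 : exists p, G p != 0.
 apply: contrapT => nG; have Gz s : G s = 0 by apply: contrapT => /eqP ne; apply: nG; exists s.
 have Tz g : smooth K g -> T g = 0.
  by move=> sg; rewrite TG // -[RHS]mu0; congr mu; apply/funext => s; rewrite Gz mulr0.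
 (* The energy $1+E(F_j)$ is at most $2+\nu$, so the error term of [rellich] stays below one half
    while the left-hand side is 1. If [T] were zero, the finitely many functionals would tend to 0,
    which is absurd. *)
 pose e := (2 * (2 + nu))^-1; have e0 : 0 < e by rewrite invr_gt0; lra.
 have [I [psi [sp H]]] := rellich e0.
 have b1 i : bds (fun j => mu (fun s => F j s * psi i s)) by exact: bdsF.
 have b2 i : bds (fun j => mu (fun s => F j s * psi i s) ^+ 2) by exact: bdsM.
 have [b3 eS] := ulim_sum (index_enum I) b2.
 have : ulim (fun=> 2^-1 : R) <= ulim (fun j => \sum_i mu (fun s => F j s * psi i s) ^+ 2).
  apply: ulim_le b3 _ => [|j]; first exact: bds_cst.
  have := H _ (sF j); have [[_ _ LF] EF] := FP j.
  rewrite (_ : (fun s => 1 * _) = (fun s => F j s * F j s)); last by apply/funext => s; rewrite mul1r.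
  rewrite (muD (sm_mul (sF j) (sF j)) (sm_ip (sF j) (sF j))) -/(L (F j)) -/(E (F j)) LF.
  have EF2 : E (F j) <= nu + 1.
   by apply: le_trans (ltW EF) _; rewrite lerD2l invf_le1 ?ltr0n // ler1n.
  have : e * (1 + E (F j)) <= 2^-1.
   apply: (@le_trans _ _ (e * (2 + nu))); first by rewrite ler_wpM2l ?(ltW e0) //; move: EF2; move: (E _) => a; lra.
   by rewrite /e invfM -mulrA mulVf ?mulr1 // gt_eqF //; lra.
  by move: (e * _) (\sum_i _) => a b; lra.
 rewrite ulim_cst eS big1 => [|i _]; first by rewrite leNgt invr_gt0 ltr0n.
 by have := ulimM (b1 i) (b1 i); rewrite -/(T (psi i)) Tz // mul0r => <-; congr ulim.
(* [G] is so far only the density of [T]; Green's formula moves the Laplacian onto it and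
   faithfulness gives the equation pointwise. *)
have lG s : lapM G s + nu * G s = 0.
 move: s; apply: (mean_eq (sm_add (sm_lap sG) (sm_scale nu sG)) (sm_cst K 0)) => g sg.
 have <- : T (fun s => lapM g s + nu * g s) = mu (fun s => g s * 0).
  by rewrite Tnu // -[LHS]mu0; congr mu; apply/funext => z; rewrite mulr0.
 rewrite TG; last exact: sm_add (sm_lap sg) (sm_scale nu sg).
 have s1 := sm_mul sg (sm_lap sG); have s2 := sm_mul sG (sm_lap sg); have s3 := sm_scale nu (sm_mul sg sG).
 have e1 : mu (fun s => g s * lapM G s + nu * (g s * G s)) = mu (fun s => G s * lapM g s + nu * (g s * G s)).
  have e0 : mu (fun s => g s * lapM G s) = mu (fun s => G s * lapM g s).
 apply: etrans (msym sg sG) (etrans _ (esym (msym sG sg))); congr (- mu _); apply/funext => z; exact: ipMC.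
 exact: etrans (muD s1 s3) (etrans (congr1 (fun t => t + mu (fun s => nu * (g s * G s))) e0) (esym (muD s2 s3))).
 by apply: etrans _ (etrans e1 _); congr mu; apply/funext => z; ring.
(* For [nu] zero, [G] would be harmonic, hence constant, and of mean 0 because [T] vanishes on
   constants, against [G0]. *)
have [nz|nnz] := eqVneq nu 0.
 have i0 : mu (fun s => ipM G G s) = 0.
  apply: oppr_inj; rewrite -(msym sG sG) oppr0 -[RHS]mu0; congr mu; apply/funext => s.
  by have := lG s; rewrite nz mul0r addr0 => ->; rewrite mulr0.
 have cG := gradient0_cst _ _ sG (mean_pos hM hK hC mmu (sm_ip sG sG) (fun s => ipM_ge0 _ _ s) i0).
 have [p Gp] := G0; have := TG _ (sm_cst K 1); rewrite T1.
 rewrite (_ : (fun s => _) = (fun s => G p * 1)); last by apply/funext => s; rewrite mul1r mulr1; exact: cG.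
 by rewrite (muZ _ (sm_cst K 1)) mu1 mulr1 => /esym/eqP; rewrite (negbTE Gp).
(* [box] is half the Laplacian, which accounts for the factor 2 throughout. *)
have : l <= nu / 2.
 apply: hl; last by rewrite mulf_neq0 // invr_neq0.
 by exists G; split=> // s; rewrite /box -/(lapM G s); have := lG s; move: (lapM G s) (G s) => a b; lra.
by move: nul; lra.
Qed.

(** * Integral estimates *)

Hypothesis n2 : (2 <= n)%N.

Lemma anti_part (H P : 'M[R]_m) : P = 2^-1 *: (H + J *m H *m J^T) -> J *m P *m J^T = P ->
 J *m (H - P) *m J^T = (-1) *: (H - P).
Proof.
move=> e JP; rewrite mulmxBr mulmxBl JP; move: e; move: (J *m H *m J^T) => B e.
by apply/matrixP => i j; have := congr1 (fun A : 'M[R]_m => A i j) e; rewrite !mxE; lra.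
Qed.

Lemma bochner_comb (t a b c k l i p e q T N : R) : 2 * e <= c + k -> 2 * a + 2 * p + (c + k) = l - 2 * i ->
 0 <= a - 2 * t * b + q - 2 * 0 * T + 0 ^+ 2 * N -> 0 <= (2^-1 * l - i - p - e) - 2 * t * b + q.
Proof. by move=> h1 h2; rewrite mulr0 mul0r expr2 !mul0r; move: h1 h2; move: (2 * t * b) => z; lra. Qed.

Lemma quad_flip (v : 'rV[R]_m) (A B : 'M[R]_m) : A^T = A -> B^T = B ->
 (v *m A *m (2 *: (v *m A *m B))^T) 0 0 = 2 * (v *m A *m B *m A *m v^T) 0 0.
Proof. by move=> AT BT; rewrite linearZ /= -scalemxAr [LHS]mxE !trmx_mul AT BT !mulmxA. Qed.

(* [P] is the value of the J-invariant part of the Hessian on the gradient; it cancels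
in [integral_bound]. *)
Lemma hessian_bounds f r : smooth K f -> exists P : R,
 (forall t, 0 <= (2^-1 * lapM (ipM f f) r - ipM f (lapM f) r - ppM f f r - ipM f f r)
  - 2 * t * (2^-1 * ipM f (ipM f f) r - P) + t ^+ 2 * ipM f f r ^+ 2 / 2) /\
 (forall t, 0 <= (ppM f f r - lapM f r ^+ 2 / m%:R) - 2 * t * (P - lapM f r * ipM f f r / m%:R)
  + t ^+ 2 * ipM f f r ^+ 2 * (2^-1 - m%:R^-1)).
Proof.
move=> sf; set x := crd r r; have d := chart_at_dom K r; have Ux : U r x := U_crd d.
have sl : smooth_on (U r) (loc r f) by exact: sf.
pose th := grad (loc r f); have ct : clsd (U r) th by exact: (clsd_grad (oU r) sl).
pose H := Hm (g r) th x; pose P := Pm J th x; pose G := ig r x.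
have gp := fun v => @gmx_pos _ _ _ K r x v Ux.
have etaE y : U r y -> loc r (ipM f f) y = nrm2 (g r) th y.
 by move=> Uy; have [e dy] := coordVK Uy; rewrite /loc_fun /= (ipM_patch sf sf dy) e.
have eta_r : ipM f f r = (th x *m G *m (th x)^T) 0 0 by [].
have lapE : laplacian (g r) (nrm2 (g r) th) x = lapM (ipM f f) r.
 by apply: esym; exact: (@laplacian_ext (U r) _ _ r x (oU r) Ux etaE).
have dvE : \sum_a shp (g r) th x 0 a * partial a (divg (g r) (shp (g r) th)) x = ipM f (lapM f) r.
 rewrite /gradM mxE; apply: eq_bigr => a _; rewrite [(grad _ _)^T a 0]mxE [grad _ _ 0 a]mxE; congr (_ * _).
 apply: (partial_ext a (oU r) Ux) => y Uy; have [e dy] := coordVK Uy.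
 by rewrite -(laplacianE (oU r) (@sgx r) (@gTx r) (@ugx r) sl Uy) [RHS]/loc_fun /= (lapM_patch sf dy) e.
have PT : P^T = P := PmT J ct Ux.
have HT : H^T = H := HmT (oU r) (@gTx r) ct Ux.
have JJT : J *m J^T = 1%:M by rewrite JmxT mulmxN JmxJ opprK.
have JP : J *m P *m J^T = P by rewrite /P (JPm JmxT JmxJ) -mulmxA JJT mulmx1.
have PH : P = 2^-1 *: (H + J *m H *m J^T).
 exact: (PmH JmxT JmxJ (oU r) (@sgx r) (@gTx r) (@ugx r) (fun y Uy => gmx_hermitian Uy) (fun y a b c Uy => omega_closed a b c Uy) th Ux).
have JN := anti_part PH JP.
have NT : (H - P)^T = H - P by rewrite linearB /= HT PT.
have Bo := @kahler_bochner R m J (U r) (g r) JmxT JmxJ (oU r) (@sgx r) (@gTx r) (@ugx r)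
 (fun y Uy => gmx_hermitian Uy) (fun y a b c Uy => omega_closed a b c Uy) _ x ct Ux.
have Ri := ricci_real (gmx_sym Ux) (gmx_hermitian Ux) gp (shp (g r) th x) (hRic (p := r)).
have gE : gi (g r x) (shp (g r) th x) (shp (g r) th x) = ipM f f r.
 by rewrite /gi /shp trmx_mul (igT (@gTx r) Ux) !mulmxA mulmxKV ?ugx.
have hE : (th x *m G *m H *m G *m (th x)^T) 0 0 = 2^-1 * ipM f (ipM f f) r.
 have -> : ipM f (ipM f f) r = (th x *m G *m (grad (loc r (ipM f f)) x)^T) 0 0 by [].
 have gr : grad (loc r (ipM f f)) x = grad (nrm2 (g r) th) x.
  by apply/rowP => a; rewrite [LHS]mxE [RHS]mxE; exact: (partial_ext a (oU r) Ux etaE).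
 rewrite (etrans gr (grad_nrm2 (oU r) (@sgx r) (@gTx r) (@ugx r) ct Ux)) -/H.
 by rewrite (quad_flip _ (igT (@gTx r) Ux) HT) mulrA mulVf ?mul1r ?pnatr_eq0.
have tE : \tr (P *m G) = lapM f r by rewrite /laplaceM (laplacian_Pm sl Ux).
have m0 : m%:R != 0 :> R by rewrite pnatr_eq0 addn_eq0 andbb -lt0n (leq_trans _ n2).
have NP : (th x *m G *m (H - P) *m G *m (th x)^T) 0 0 = 2^-1 * ipM f (ipM f f) r - (th x *m G *m P *m G *m (th x)^T) 0 0.
 by rewrite -hE mulmxBr !mulmxBl [LHS]mxE; congr (_ + _); rewrite mxE.
exists ((th x *m G *m P *m G *m (th x)^T) 0 0); split=> t.
 (* The anti-invariant part is trace-free against the metric, so the pairing is taken with [u] equal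
    to 0. *)
 have e1 : (-1) * (-1) = 1 :> R by rewrite mulrNN mulr1.
 have := typed_pairing (gmx_sym Ux) (gmx_hermitian Ux) gp t 0 e1 NT JN eta_r; rewrite NP.
 have pE : ppM f f r = \tr (P *m G *m (P *m G)) by [].
 move: Bo; cbv zeta; rewrite lapE dvE -/H -/P -/G -pE.
 move: Ri; rewrite gE.
 by move=> R1 B1; exact: (bochner_comb R1 B1).
have e1 : 1 * 1 = 1 :> R by rewrite mulr1.
have JP1 : J *m P *m J^T = 1 *: P by rewrite scale1r.
(* For the invariant part [u] is the optimal value: subtracting this multiple of the metric removes
   the trace of $P-tT$. *)
have := typed_pairing (gmx_sym Ux) (gmx_hermitian Ux) gp t ((lapM f r - t * ipM f f r) / m%:R) e1 PT JP1 eta_r; rewrite tE.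
have -> : \tr (P *m G *m (P *m G)) = ppM f f r by [].
move: (ppM f f r) (lapM f r) (ipM f f r) (_ 0 0) (m%:R : R) m0 => a b c k M0 M1.
have -> : a - 2 * t * k + t ^+ 2 * c ^+ 2 / 2 - 2 * ((b - t * c) / M0) * (b - t * ((1 + 1) / 2) * c) + ((b - t * c) / M0) ^+ 2 * M0
 = a - b ^+ 2 / M0 - 2 * t * (k - b * c / M0) + t ^+ 2 * c ^+ 2 * (2^-1 - M0^-1) by field.
by [].
Qed.

Lemma mean_lin (I : Type) (l : seq I) (c : I -> R) (F : I -> M -> R) : (forall i, smooth K (F i)) ->
 smooth K (fun s => \sum_(i <- l) c i * F i s) /\ mu (fun s => \sum_(i <- l) c i * F i s) = \sum_(i <- l) c i * mu (F i).
Proof.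
move=> sF; elim: l => [|i l [s1 e1]].
 rewrite big_nil (_ : (fun s => _) = (fun=> 0)); first by split; [exact: sm_cst|exact: mu0].
 by apply/funext => s; rewrite big_nil.
have E : (fun s => \sum_(k <- i :: l) c k * F k s) = (fun s => c i * F i s + \sum_(k <- l) c k * F k s).
 by apply/funext => s; rewrite big_cons.
have s2 := sm_scale (c i) (sF i).
rewrite E big_cons; split; first exact: sm_add.
by rewrite (muD s2 s1) (muZ _ (sF i)) e1.
Qed.

Lemma ipM_inv f h s : smooth K f -> f s != 0 -> ipM (fun t => (f t)^-1) h s = - (f s)^-1 ^+ 2 * ipM f h s.
Proof.
move=> sf fs; have d := chart_at_dom K s; have Ux := U_crd d; apply: ipM_chain => a.
rewrite -(loc_crd f d); apply: (@partial_comp1 _ _ (fun t => t^-1)).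
 by apply: is_derive_invr; rewrite coordK.
by apply: (smooth_derivable _ Ux); exact: sf.
Qed.

Lemma integral_bound f (y z tau sigma c Q D A B : R) : smooth K f -> (forall r, 0 < f r) -> 0 <= y -> 0 <= z ->
 4 * y * tau = c -> 4 * z * n%:R / (n%:R - 1) * sigma = c ->
 mu (fun s => lapM f s * lapM f s) = Q -> mu (ipM f f) = D ->
 mu (fun s => (f s)^-1 * ipM f f s * lapM f s) = A ->
 mu (fun s => (f s)^-1 * ipM f f s * ((f s)^-1 * ipM f f s)) = B ->
 0 <= y * (Q - 2 * D) + z * Q - c / 2 * (B - A * (n%:R + 1) / n%:R) + (y * tau ^+ 2 + z * sigma ^+ 2) * B.
Proof.
move=> sf f0 y0 z0 cy cz QE DE AE BE; pose w s := (f s)^-1.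
have nR : 2 <= n%:R :> R by rewrite (ler_nat R 2 n).
have fn s : f s != 0 by rewrite gt_eqF.
have sw : smooth K w by exact: sm_inv.
have sE := sm_ip sf sf; have sL := sm_lap sf; have swe := sm_mul sw sE.
(* With [P] gone, the pointwise inequality is a linear combination of eight smooth functions; the
   means of all of them are computed below in terms of [Q], [D], [A] and [B]. *)
pose F i := nth (fun=> 0) [:: lapM (ipM f f); ipM f (lapM f); ppM f f; ipM f f; (fun s => lapM f s * lapM f s);
 (fun s => w s * ipM f (ipM f f) s); (fun s => w s * ipM f f s * lapM f s); (fun s => w s * ipM f f s * (w s * ipM f f s))] i.
have sF i : smooth K (F i).
 move: i; case; first exact: (sm_lap sE).
 case; first exact: (sm_ip sf sL).
 case; first exact: (sm_pp sf sf).
 case; first exact: sE.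
 case; first exact: (sm_mul sL sL).
 case; first exact: (sm_mul sw (sm_ip sf sE)).
 case; first exact: (sm_mul swe sL).
 case; first exact: (sm_mul swe swe).
 by move=> i; rewrite /F /= nth_nil; exact: sm_cst.
(* Since $|P|^2$ has mean $Q/2$ and the trace part removed from it has mean $Q/m$, the weight is
   normalized by $Z(\frac12-\frac1m)=z$. *)
pose Z := 2 * z * n%:R / (n%:R - 1); pose ni : R := m%:R^-1.
have Z0 : 0 <= Z by apply: divr_ge0; [apply: mulr_ge0; [apply: mulr_ge0|]; lra|lra].
have n0 : n%:R != 0 :> R by rewrite gt_eqF //; lra.
have n1 : n%:R - 1 != 0 :> R by rewrite gt_eqF //; lra.
have niE : ni = (2 * n%:R)^-1 by rewrite /ni natrD; congr (_^-1); ring.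
have Zs : 2 * Z * sigma = c by rewrite -cz /Z; field.
have Zz : Z * (2^-1 - ni) = z by rewrite niE /Z; field; rewrite n0.
have key (a1 a2 a3 a4 a5 a6 a7 P : R) : 0 <= (2^-1 * a1 - a2 - a3 - a4) - 2 * (tau * a7) * (2^-1 * a6 - P) + (tau * a7) ^+ 2 * a4 ^+ 2 / 2 ->
 0 <= (a3 - a5 ^+ 2 * ni) - 2 * (sigma * a7) * (P - a5 * a4 * ni) + (sigma * a7) ^+ 2 * a4 ^+ 2 * (2^-1 - ni) ->
 0 <= y * a1 + (- (2 * y) * a2 + ((Z - 2 * y) * a3 + (- (2 * y) * a4 + (- (Z * ni) * (a5 * a5) + (- (c / 2) * (a7 * a6)
  + (c * ni * (a7 * a4 * a5) + ((y * tau ^+ 2 + z * sigma ^+ 2) * (a7 * a4 * (a7 * a4)) + 0))))))).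
 move=> h1 h2; have := addr_ge0 (mulr_ge0 (mulr_ge0 (ler0n R 2) y0) h1) (mulr_ge0 Z0 h2).
 have d1 : 4 * y * tau - c = 0 by rewrite cy subrr.
 have d2 : 2 * Z * sigma - c = 0 by rewrite Zs subrr.
 have d3 : z - Z * (2^-1 - ni) = 0 by rewrite Zz subrr.
 have d4 : (4 * y * tau - c) * (a7 * (2^-1 * a6 - P)) + (2 * Z * sigma - c) * (a7 * (P - a5 * a4 * ni)) + (z - Z * (2^-1 - ni)) * (sigma ^+ 2 * (a7 * a4) ^+ 2) = 0.
  by rewrite d1 d2 d3 !mul0r !addr0.
 move=> h; apply: (le_trans h); rewrite -[leLHS]addr0 -[X in _ + X <= _]d4 le_eqVlt; apply/orP; left; apply/eqP; by field.
pose k i := nth 0 [:: y; - (2 * y); Z - 2 * y; - (2 * y); - (Z * ni); - (c / 2); c * ni; y * tau ^+ 2 + z * sigma ^+ 2] i.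
have pos s : 0 <= \sum_(i <- iota 0 8) k i * F i s.
 have [P0 [h1 h2]] := hessian_bounds s sf.
 by rewrite /k /F /= !big_cons big_nil; apply: (key _ _ _ _ _ _ _ P0); [exact: h1|exact: h2].
have M1 : mu (lapM (ipM f f)) = 0 by exact: mul.
have M2 : mu (ipM f (lapM f)) = - Q.
 by rewrite -QE (msym sL sf) opprK; congr mu; apply/funext => s; exact: ipMC.
have M3 : mu (ppM f f) = 2^-1 * Q by rewrite (mean_pp sf sf) QE.
have M6 : mu (fun s => w s * ipM f (ipM f f) s) = B - A.
 have s1 := sm_mul sw (sm_ip sf sE); have s2 := sm_scale (-1) (sm_mul swe swe).
 have -> : A = - mu (fun s => w s * ipM f (ipM f f) s + -1 * (w s * ipM f f s * (w s * ipM f f s))).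
  rewrite -AE (msym swe sf); congr (- _); congr mu; apply/funext => s.
  rewrite (ipMM f s sw sE) (ipM_inv f sf (fn s)) (ipMC K (ipM f f) f) -/(w s).
  by move: (ipM f (ipM f f) s) (ipM f f s) (w s) => a b e; ring.
 by rewrite (muD s1 s2) (muZ _ (sm_mul swe swe)) BE; ring.
have E4 : mu (F 4) = Q by [].
have E7 : mu (F 7) = B by [].
have := mup (mean_lin (iota 0 8) k sF).1 pos; rewrite (mean_lin (iota 0 8) k sF).2 [iota 0 8]/= !big_cons big_nil.
rewrite (M1 : mu (F 0) = _) (M2 : mu (F 1) = _) (M3 : mu (F 2) = _) (DE : mu (F 3) = _) E4 (M6 : mu (F 5) = _).
rewrite (AE : mu (F 6) = _) E7 /k /= -[X in _ + X * Q]Zz.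
rewrite -[A * (n%:R + 1) / n%:R](_ : A + 2 * ni * A = _); last by rewrite niE; field.
by clearbody ni; move: (y * tau ^+ 2 + z * sigma ^+ 2) => u; lra.
Qed.

(** With $h$ equal to $f$ minus its mean, expand $0\le\int(\Delta f+2l\,h)^2$ and insert $2l\int
    h^2\le\int|df|^2$ from [gap]. *)
Lemma gradient_integral l f : (forall nu, eigenvalue_box K nu -> nu != 0 -> l <= nu) -> 0 <= l -> smooth K f ->
 2 * l * mu (ipM f f) <= mu (fun s => lapM f s * lapM f s).
Proof.
move=> hl l0 sf; have sc := sm_cst K (- mu f); pose h s := f s + - mu f.
have sh : smooth K h by exact: sm_add.
have h0 : mu h = 0.
 rewrite /h (muD sf sc) (_ : (fun=> - mu f) = (fun s : M => - mu f * 1)); last by apply/funext => s; rewrite mulr1.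
 by rewrite (muZ _ (sm_cst K 1)) mu1 mulr1 subrr.
have lh s : lapM h s = lapM f s by rewrite (lapMD s sf sc) lapM_cst addr0.
have ih : ipM h h = ipM f f.
 apply/funext => s; rewrite (ipMDl h s sf sc) ipM_cst addr0 ipMC (ipMDl f s sf sc) ipM_cst addr0 //.
have := gap hl sh h0; rewrite ih => g1.
have e1 : mu (fun s => h s * lapM f s) = - mu (ipM f f).
 apply: etrans _ (etrans (msym sh sh) (congr1 (fun t => - mu t) ih)).
 by apply: (congr1 mu); apply/funext => s; rewrite lh.
have s1 := sm_mul sh sh; have s2 := sm_mul sh (sm_lap sf); have s3 := sm_mul (sm_lap sf) (sm_lap sf).
have p0 : 0 <= mu (fun s => lapM f s * lapM f s + (2 * (2 * l) * (h s * lapM f s) + (2 * l) ^+ 2 * (h s * h s))).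
 apply: mup => [|s]; first exact: (sm_add s3 (sm_add (sm_scale _ s2) (sm_scale _ s1))).
 rewrite [leRHS](_ : _ = (lapM f s + 2 * l * h s) ^+ 2) ?sqr_ge0 //; ring.
move: p0; rewrite (muD s3 (sm_add (sm_scale _ s2) (sm_scale _ s1))) (muD (sm_scale _ s2) (sm_scale _ s1)) !(muZ _ s2) !(muZ _ s1) e1.
have : 2 * l * (2 * l * mu (fun s => h s * h s)) <= 2 * l * mu (ipM f f) by rewrite ler_wpM2l // mulr_ge0.
by move: (mu (fun s => h s * h s)) (mu (ipM f f)) (mu _) => a b c; lra.
Qed.

Lemma powR_grad u (a : R) h s : smooth K u -> (forall r, 0 < u r) -> ipM (fun t => u t `^ a) h s = a * u s `^ (a - 1) * ipM u h s.
Proof.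
move=> su u0; have d := chart_at_dom K s; have Ux := U_crd d; apply: ipM_chain => i.
rewrite -(loc_crd u d); apply: (@partial_comp1 _ _ (fun t => t `^ a)).
 by apply: is_derive_powR; exact: u0.
by apply: (smooth_derivable _ Ux); exact: su.
Qed.

Lemma powR_lap u (a : R) s : smooth K u -> (forall r, 0 < u r) ->
 lapM (fun t => u t `^ a) s = a * u s `^ (a - 1) * lapM u s + a * (a - 1) * u s `^ (a - 1 - 1) * ipM u u s.
Proof.
move=> su u0; have d := chart_at_dom K s; have sp b := sm_powR b su u0.
rewrite (lapM_chain su (sp a) (sm_scale a (sp (a - 1)))) => [|i x Ux].
 by rewrite (ipMZl _ _ s (sp (a - 1))) (powR_grad _ _ _ su u0) !mulrA.
have [e dx] := coordVK Ux.
apply: (@partial_comp1 _ _ (fun t => t `^ a)); first by apply: is_derive_powR; exact: u0.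
by apply: (smooth_derivable _ Ux); exact: su.
Qed.

Lemma powR_pred (t a : R) : 0 < t -> t `^ (a - 1) = t `^ a / t.
Proof. by move=> t0; rewrite powRD ?(lt0r_neq0 t0) ?implybT // powR_inv1 // ltW. Qed.

Let mu_lin3 a b c f1 f2 f3 : smooth K f1 -> smooth K f2 -> smooth K f3 ->
 mu (fun s => a * f1 s + b * f2 s + c * f3 s) = a * mu f1 + b * mu f2 + c * mu f3.
Proof.
move=> s1 s2 s3; have t1 := sm_scale a s1; have t2 := sm_scale b s2; have t3 := sm_scale c s3.
by rewrite (muD (sm_add t1 t2) t3) (muD t1 t2) (muZ _ s1) (muZ _ s2) (muZ _ s3).
Qed.

(** The equation for [u] becomes $\Delta f=(1-\alpha^{-1})|df|^2/f+2\lambda\alpha f-2\alpha h$ with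
    $h=u^{q+\alpha-1}$. Multiplying by $\Delta f$ leaves the integral of $h\,\Delta f$ as the only
    one not among [Q], [D], [A], [B]; Green's formula and [p2] eliminate it. *)
Lemma integral_identity u (q lam al Q D A B : R) : smooth K u -> (forall r, 0 < u r) -> al != 0 ->
 (forall s, lapM u s = 2 * lam * u s - 2 * u s `^ q) -> forall f, f = (fun s => u s `^ al) ->
 mu (fun s => lapM f s * lapM f s) = Q -> mu (ipM f f) = D ->
 mu (fun s => (f s)^-1 * ipM f f s * lapM f s) = A ->
 mu (fun s => (f s)^-1 * ipM f f s * ((f s)^-1 * ipM f f s)) = B ->
 Q + al^-1 * q * A + (al^-1 * (q - 1) + 1) * (al^-1 - 1) * B = 2 * (q - 1) * lam * D.
Proof.
move=> su u0 al0 ueq f fE QE DE AE BE; have sp b := sm_powR b su u0; pose h s := u s `^ (q + al - 1).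
have sf : smooth K f by rewrite fE; exact: sp.
have sh : smooth K h by exact: sp.
have fs s : f s = u s `^ al by rewrite fE.
have f0 s : 0 < f s by rewrite fs; exact: powR_gt0.
have sw : smooth K (fun s => (f s)^-1) by apply: sm_inv => // s; rewrite gt_eqF.
have sE := sm_ip sf sf; have sL := sm_lap sf; have swe := sm_mul sw sE.
have gF g s : ipM f g s = al * (f s / u s) * ipM u g s.
 by rewrite [in LHS]fE (powR_grad _ _ _ su u0) powR_pred // -fs.
have iE s : ipM u f s = al * (f s / u s) * ipM u u s by rewrite ipMC gF.
have eE s : ipM f f s = al ^+ 2 * (f s / u s) ^+ 2 * ipM u u s by rewrite gF iE; ring.
have lE s : lapM f s = al * (f s / u s) * (2 * lam * u s - 2 * u s `^ q) + al * (al - 1) * (f s / u s / u s) * ipM u u s.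
 by rewrite [in LHS]fE (powR_lap _ _ su u0) ueq !powR_pred // -fs.
have hE s : h s = u s `^ q * f s / u s.
 by rewrite /h powR_pred // powRD -?fs ?(gt_eqF (u0 s)) ?implybT.
have gE s : ipM h f s = (q + al - 1) * (u s `^ q * f s / u s / u s) * (al * (f s / u s) * ipM u u s).
 by rewrite (powR_grad _ _ _ su u0) iE powR_pred // -/(h s) hE.
pose be := al^-1; pose S := be * (q - 1) + 1.
have p1 s : lapM f s * lapM f s = (1 - be) * ((f s)^-1 * ipM f f s * lapM f s) + (2 * lam * al) * (f s * lapM f s) + (- (2 * al)) * (h s * lapM f s).
 rewrite {1}lE eE hE; have := f0 s; have := u0 s; move: (lapM f s) (ipM u u s) (u s `^ q) (f s) (u s) => a b c v w /lt0r_neq0 wn /lt0r_neq0 vn.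
 by rewrite /be; field; rewrite vn wn al0.
(* The gradient of [h] is $S\,(h/f)\nabla f$, and the equation expresses $2\alpha h$ through
   $|df|^2/f$, [f] and the Laplacian of [f] once more. *)
have p2 s : 2 * al * ipM h f s = S * (1 - be) * ((f s)^-1 * ipM f f s * ((f s)^-1 * ipM f f s)) + S * (2 * lam * al) * ipM f f s + (- S) * ((f s)^-1 * ipM f f s * lapM f s).
 rewrite gE lE eE; have := f0 s; have := u0 s; move: (ipM u u s) (u s `^ q) (f s) (u s) => b c v w /lt0r_neq0 wn /lt0r_neq0 vn.
 by rewrite /S /be; field; rewrite vn wn al0.
have h1 : Q = (1 - be) * A + (2 * lam * al) * - D + (- (2 * al)) * mu (fun s => h s * lapM f s).
 rewrite -{1}QE -AE -DE -(msym sf sf) -(mu_lin3 _ _ _ (sm_mul swe sL) (sm_mul sf sL) (sm_mul sh sL)).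
 by congr mu; apply/funext => s; exact: p1.
have h2 : 2 * al * mu (ipM h f) = S * (1 - be) * B + S * (2 * lam * al) * D + (- S) * A.
 rewrite -(muZ _ (sm_ip sh sf)) -AE -DE -BE -(mu_lin3 _ _ _ (sm_mul swe swe) sE (sm_mul swe sL)).
 by congr mu; apply/funext => s; exact: p2.
move: h1 h2; rewrite (msym sh sf) -/be -/S; move: (mu _) => v h1 h2.
have ab : be * al = 1 by rewrite mulVf.
have d : (be * al - 1) * (2 * lam * (q - 1) * D) = 0 by rewrite ab subrr mul0r.
by move: h1 h2 d; rewrite /S; clearbody be; lra.
Qed.

End LogDensity.

(** * Algebra of the weights *)

Section Constants.
Context {R : realType}.
Implicit Types N q k : R.

(** The interval is $|k+1-a|\le a\sqrt{1-b}$ with $ab=2$; squaring gives $(k+1)^2\le2ak$, which also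
    forces $k>0$. The bound on [q] is what makes $b\le1$. *)
Lemma weight_range (n : nat) q k : (2 <= n)%N -> 1 < q -> q < (n%:R + 1) / (n%:R - 1) -> k_lower n q <= k <= k_upper n q ->
 0 < k /\ q * (n%:R - 1) * (k + 1) ^+ 2 <= 4 * (n%:R + 1) * k.
Proof.
move=> n2; have : 2 <= n%:R :> R by rewrite (ler_nat R 2 n).
rewrite /k_lower /k_upper; move: (n%:R : R) => N N2 q1 q2.
have N0 : 0 < N - 1 by lra.
have q0 : 0 < q * (N - 1) by apply: mulr_gt0 => //; lra.
set a := 2 * (N + 1) / (q * (N - 1)); set b := (N - 1) * q / (N + 1); set S := Num.sqrt _.
have b1 : b <= 1.
 by rewrite /b ler_pdivrMr ?mul1r; [move: q2; rewrite ltr_pdivlMr // mulrC => /ltW|lra].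
have S2 : S ^+ 2 = 1 - b by rewrite sqr_sqrtr // subr_ge0.
have S0 : 0 <= S by exact: sqrtr_ge0.
have a0 : 0 < a by apply: divr_gt0 => //; lra.
have ab : a * b = 2 by rewrite /a /b; field; rewrite !gt_eqF //; lra.
have aq : a * (q * (N - 1)) = 2 * (N + 1) by rewrite /a divfK // gt_eqF.
move=> /andP[h1 h2].
have h : (k + 1) ^+ 2 <= 2 * a * k.
 have p1 : 0 <= a * S - (a - (k + 1)) by lra.
 have p2 : 0 <= a * S + (a - (k + 1)) by lra.
 have e1 : a ^+ 2 * S ^+ 2 = a ^+ 2 - 2 * a.
  rewrite S2 (_ : a ^+ 2 * (1 - b) = a ^+ 2 - a * (a * b)); last by ring.
  by rewrite ab; ring.
 by have := mulr_ge0 p1 p2; move: e1; lra.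
have k0 : 0 < k.
 rewrite ltNge; apply/negP => k0; have : 2 * a * k <= 0 by rewrite mulr_ge0_le0 // mulr_ge0 // ltW.
 move=> h3; have h4 : (k + 1) ^+ 2 <= 0 by exact: le_trans h h3.
 have /eqP : (k + 1) ^+ 2 == 0 by rewrite eq_le h4 sqr_ge0.
 move/eqP; rewrite sqrf_eq0 addrC => /eqP e; move: h; have -> : k = -1 by lra.
 by rewrite addNr expr0n /=; move: a0; lra.
split=> //; have := ler_wpM2l (ltW q0) h.
have -> : q * (N - 1) * (2 * a * k) = 2 * (a * (q * (N - 1))) * k by ring.
rewrite aq.
by have -> : 2 * (2 * (N + 1)) * k = 4 * (N + 1) * k by ring.
Qed.

(** The three integral relations are combined with the weights [X], [y], [z] of sum 1. The value of
    [c] cancels [A], the exponent [al] then cancels [B], the weights remove [Q], and only multiples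
    of [D] survive. *)
Lemma final_algebra N q k l lam Q D A B : 2 <= N -> 1 < q -> q < 2 * (N + 1) -> 0 < k ->
 q * (N - 1) * (k + 1) ^+ 2 <= 4 * (N + 1) * k ->
 forall al y z c, al = 1 - q / (2 * (N + 1)) -> c = 2 * N * al^-1 * q / (N + 1) ->
 y = q * N * (k * N + N - 1) / ((4 * N ^+ 2 + 4 * N + q) * k) -> z = y * (N - 1) * k / N ->
 Q + al^-1 * q * A + (al^-1 * (q - 1) + 1) * (al^-1 - 1) * B = 2 * (q - 1) * lam * D ->
 0 <= y * (Q - 2 * D) + z * Q - c / 2 * (B - A * (N + 1) / N)
  + (y * (c / (4 * y)) ^+ 2 + z * (c * (N - 1) / (4 * z * N)) ^+ 2) * B ->
 2 * l * D <= Q ->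
 ((1 - (N + (N - 1) * k) * (k * N + N - 1) * q / ((4 * N ^+ 2 + 4 * N + q) * k)) * l
  + q * N * (k * N + N - 1) / ((4 * N ^+ 2 + 4 * N + q) * k)) * D <= (q - 1) * lam * D.
Proof.
move=> N2 q1 q2 k0 kr al y z c alE cE yE zE I1 I2 I3.
have N0 : 0 < N by lra.
have N1 : 0 < N - 1 by lra.
have kN : 0 < k * N by exact: mulr_gt0.
have T0 : 0 < k * N + N - 1 by lra.
have E0 : 0 < 4 * N ^+ 2 + 4 * N + q by have := sqr_ge0 N; lra.
have Ek : 0 < (4 * N ^+ 2 + 4 * N + q) * k by exact: mulr_gt0.
have y0 : 0 < y by rewrite yE; apply: divr_gt0 => //; apply: mulr_gt0 => //; apply: mulr_gt0 => //; lra.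
have z0 : 0 < z by rewrite zE; apply: divr_gt0 => //; apply: mulr_gt0 => //; exact: mulr_gt0.
have nz (x : R) : 0 < x -> x != 0 by move=> x0; rewrite gt_eqF.
have Nn := nz _ N0; have N1n := nz _ N1; have kn := nz _ k0; have Tn := nz _ T0; have En := nz _ E0; have yn := nz _ y0; have zn := nz _ z0.
have Np : N + 1 != 0 by apply: nz; lra.
have qn : q != 0 by apply: nz; lra.
have Dn : 2 * (N + 1) - q != 0 by apply: nz; lra.
pose X := 1 - (N + (N - 1) * k) * (k * N + N - 1) * q / ((4 * N ^+ 2 + 4 * N + q) * k).
have xyz : X + y + z = 1 by rewrite /X zE yE; field; rewrite Nn kn En.
(* Here the range of [k] enters: up to the positive factors $N$ and the common denominator, [X] is
   the difference of the two sides of [kr]. *)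
have X0 : 0 <= X.
 rewrite /X subr_ge0 ler_pdivrMr // mul1r -subr_ge0.
 have -> : (4 * N ^+ 2 + 4 * N + q) * k - (N + (N - 1) * k) * (k * N + N - 1) * q
  = N * (4 * (N + 1) * k - q * (N - 1) * (k + 1) ^+ 2) by ring.
 by apply: mulr_ge0; [exact: ltW|rewrite subr_ge0].
have be : al^-1 = 2 * (N + 1) / (2 * (N + 1) - q) by rewrite alE; field; rewrite Np Dn.
(* The ratio $z/y$ and the size of [y] are such that this sum depends on [k] only through [c], and
   [c] is free of [k]. *)
have kap : y * (c / (4 * y)) ^+ 2 + z * (c * (N - 1) / (4 * z * N)) ^+ 2 = c ^+ 2 / 16 * ((4 * N ^+ 2 + 4 * N + q) / (q * N ^+ 2)).
 transitivity (c ^+ 2 / 16 * ((k * N + N - 1) / (y * N * k))).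
  by rewrite zE; field; rewrite Nn kn N1n yn.
 by congr (_ * _); rewrite yE; field; rewrite Nn kn En qn Tn.
(* The exponent $1-q/(2(N+1))$ is designed for this cancellation. *)
have B0 : c / 2 - (y * (c / (4 * y)) ^+ 2 + z * (c * (N - 1) / (4 * z * N)) ^+ 2) + (al^-1 * (q - 1) + 1) * (al^-1 - 1) = 0.
 by rewrite kap cE be; field; rewrite Nn Np qn Dn.
have A0 : c / 2 * (A * (N + 1) / N) = al^-1 * q * A by rewrite cE; move: (al^-1) => ai; field; rewrite Nn Np.
rewrite -/X -yE.
have XQ : X * (2 * l * D) <= X * Q by exact: ler_wpM2l.
have e1 : X * Q + y * Q + z * Q = Q by rewrite -!mulrDl xyz mul1r.
have e2 : (c / 2 - (y * (c / (4 * y)) ^+ 2 + z * (c * (N - 1) / (4 * z * N)) ^+ 2) + (al^-1 * (q - 1) + 1) * (al^-1 - 1)) * B = 0 by rewrite B0 mul0r.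
move: I1 I2 XQ e1 e2; rewrite [c / 2 * (B - _)]mulrBr A0.
move: (y * (c / (4 * y)) ^+ 2 + _) ((al^-1 * (q - 1) + 1) * (al^-1 - 1)) (al^-1 * q * A) (c / 2) => u1 u2 u3 u4 I1 I2 XQ e1 e2.
rewrite -(ler_pM2l (ltr0n R 2)).
have -> : 2 * ((X * l + y) * D) = X * (2 * l * D) + 2 * (y * D) by ring.
by move: I1 I2 XQ e1 e2; move: (X * (2 * l * D)) (X * Q) => v1 v2; lra.
Qed.

End Constants.

Theorem theoremB (R : realType) (n : nat) (hn : (2 <= n)%N)
  (M : topologicalType) (hM_hausdorff : hausdorff_space M)
  (hM_compact : compact [set: M]) (hM_connected : connected [set: M])
  (K : kahler R n M) (hRic : ricci_ge_omega K)
  (q : R) (hq1 : 1 < q) (hq2 : q < (n%:R + 1) / (n%:R - 1))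
  (lambda1 : R) (hlambda1 : first_eigenvalue K lambda1)
  (k : R) (hk : k_lower n q <= k <= k_upper n q)
  (C : R) (hC : 1 / C = invCS n q lambda1 k)
  (lambda : R) (hlambda0 : 0 < lambda) (hlambda : lambda < 1 / (2 * C))
  (u : M -> R) (hu_smooth : smooth K u) (hu_pos : forall p, 0 < u p)
 (hu : forall p, - box K u p + lambda * u p = u p `^ q) :
  exists c : R, 0 < c /\ forall p, u p = c.
Proof.
have [[r0 _]|nM] := pselect (exists r : M, True); last by exists 1; split=> // p; case: nM; exists p.
have [mu mmu] := @exists_mean R n M K hM_compact r0.
have [l0 _ lmin] := hlambda1.
have nR : 2 <= n%:R :> R by rewrite (ler_nat R 2 n).
have [k0 kr] := weight_range hn hq1 hq2 hk.
have q2 : q < 2 * (n%:R + 1).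
 apply: lt_le_trans hq2 _; rewrite ler_pdivrMr; last by lra.
 have : 0 <= (n%:R + 1) * (2 * (n%:R - 1) - 1) :> R by apply: mulr_ge0; lra.
 by move: (n%:R : R) => N; lra.
pose al := 1 - q / (2 * (n%:R + 1)).
have al0 : 0 < al by rewrite subr_gt0 ltr_pdivrMr ?mul1r //; lra.
have ueq s : laplaceM K u s = 2 * lambda * u s - 2 * u s `^ q.
 by have := hu s; rewrite /box -/(laplaceM K u s); move: (laplaceM K u s) (u s) (u s `^ q) => a b c; lra.
pose f s := u s `^ al.
have sf : smooth K f by exact: sm_powR.
have f0 s : 0 < f s by exact: powR_gt0.
pose y := q * n%:R * (k * n%:R + n%:R - 1) / ((4 * n%:R ^+ 2 + 4 * n%:R + q) * k).
pose z := y * (n%:R - 1) * k / n%:R.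
pose c := 2 * n%:R * al^-1 * q / (n%:R + 1).
have kn : 0 < k * n%:R by apply: mulr_gt0 => //; lra.
have n2' : 0 <= n%:R ^+ 2 :> R by exact: sqr_ge0.
have y0 : 0 < y.
 apply: divr_gt0; last by apply: mulr_gt0 => //; lra.
 by apply: mulr_gt0; [apply: mulr_gt0|]; lra.
have z0 : 0 < z by apply: divr_gt0; [apply: mulr_gt0 => //; apply: mulr_gt0 => //|]; lra.
have I1 := integral_identity hM_hausdorff hM_compact hM_connected mmu hRic hu_smooth hu_pos (lt0r_neq0 al0) ueq
 (erefl f) erefl erefl erefl erefl.
have I2 := @integral_bound R n M K hM_hausdorff hM_compact hM_connected mu mmu hRic hn f y z (c / (4 * y)) (c * (n%:R - 1) / (4 * z * n%:R)) c
 _ _ _ _ sf f0 (ltW y0) (ltW z0) _ _ erefl erefl erefl erefl.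
have I3 := gradient_integral hM_hausdorff hM_compact hM_connected mmu hRic r0
 (l := lambda1) (f := f) _ (ltW l0) sf.
have yn : y != 0 by rewrite gt_eqF.
have zn : z != 0 by rewrite gt_eqF.
have nn : n%:R != 0 :> R by rewrite gt_eqF //; lra.
have n1 : n%:R - 1 != 0 :> R by rewrite gt_eqF //; lra.
have Fin := final_algebra nR hq1 q2 k0 kr (erefl al) (erefl c) (erefl y) (erefl z) I1 (I2 _ _) (I3 lmin).
have {}Fin := Fin ltac:(by field) ltac:(by field; rewrite zn nn n1).
have D0 : mu (gradM K f f) = 0.
 apply/eqP; rewrite eq_le; apply/andP; split; last first.
  by have [_ _ H _ _] := mmu; apply: H => [|s]; [exact: sm_ip|exact: ipM_ge0].
 have q1 : 0 < q - 1 by lra.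
 (* The rearrangement is valid for every [C], inverses of 0 being 0 by convention. *)
 have := hlambda; rewrite (_ : 1 / (2 * C) = 2^-1 * (1 / C)); last by rewrite !mul1r invfM.
 rewrite hC /invCS; move: Fin; set W := (_ * lambda1 + _) => Fin.
 have -> : 2^-1 * (2 / (q - 1) * W) = W / (q - 1) by field; rewrite gt_eqF.
 rewrite ltr_pdivlMr // -subr_gt0 => h.
 have : (W - lambda * (q - 1)) * mu (gradM K f f) <= 0.
  by rewrite mulrBl subr_le0 [lambda * _]mulrC.
 by rewrite pmulr_rle0.
have e0 := mean_pos hM_hausdorff hM_compact hM_connected mmu (sm_ip sf sf) (fun s => ipM_ge0 K f s) D0.
(* So far only $f=u^\alpha$ is known to have zero gradient; as $\alpha$ and the powers of [u] are
   nonzero, the gradient of [u] vanishes too. *)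
exists (u r0); split=> // s; apply: (gradient0_cst hM_connected _ _ hu_smooth) => t.
have E1 : gradM K f f t = al * u t `^ (al - 1) * gradM K u f t := powR_grad al f t hu_smooth hu_pos.
have E2 : gradM K f u t = al * u t `^ (al - 1) * gradM K u u t := powR_grad al u t hu_smooth hu_pos.
have p1 : al * u t `^ (al - 1) != 0 by rewrite mulf_neq0 ?(lt0r_neq0 al0) // lt0r_neq0 // powR_gt0.
have := e0 t; rewrite E1 ipMC E2 => /eqP; rewrite mulf_eq0 (negbTE p1) /= mulf_eq0 (negbTE p1) /=.
by move/eqP.
Qed.
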